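(* Let $m\ge0$ be an integer and suppose that $\lambda=\lambda(x,y)$ satisfies the positive $m$-condition. Then $\mathcal{V}_{\boldsymbol\Gamma}(\Omega)\cap\mathcal{X}^m_{\boldsymbol\Gamma}(\Omega)$ is dense in $\mathcal{X}^m_{\boldsymbol\Gamma}(\Omega)$.
   Context: $\Omega=(0,L_1)\times(0,L_2)$ with $L_1,L_2>0$; ${\boldsymbol\Gamma}=\{x=0\}\cup\{y=0\}$ (the corresponding two sides of $\Omega$); $\theta|_{\boldsymbol\Gamma}=0$ means $\theta|_{x=0}=\theta|_{y=0}=0$; $\partial^\alpha=\partial_x^{\alpha_1}\partial_y^{\alpha_2}$. Positive $m$-condition: there are positive constants $c_0,c_1$ with $c_0\le\lambda(x,y)\le c_1$ in $\Omega$, and moreover $\nabla\lambda\in L^\infty(\Omega)$ if $m=0,1$, and $\lambda\in H^{\max(3,m)}(\Omega)$ if $m\ge2$. Write $T\theta=\lambda\theta_x+\theta_y$. Then $$\mathcal{X}^m_{\boldsymbol\Gamma}(\Omega)=\{\theta\in H^m(\Omega):\ T\theta\in H^m(\Omega),\ \partial^\alpha\theta|_{\boldsymbol\Gamma}=0\ \ \forall\,|\alpha|\le m\},$$ with the natural norm $(\|\theta\|^2_{H^m}+\|T\theta\|^2_{H^m})^{1/2}$, and $$\mathcal{V}_{\boldsymbol\Gamma}(\Omega)=\{\theta\in\mathcal{C}^\infty(\overline\Omega):\ \theta\text{ vanishes in a neighborhood of }{\boldsymbol\Gamma}\}.$$ The traces of order-$m$ derivatives make sense: for such $\theta$ and $|\alpha|=m$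 one has $\partial^\alpha\theta, T\partial^\alpha\theta\in L^2(\Omega)$, and any $\psi\in L^2(\Omega)$ with $T\psi\in L^2(\Omega)$ belongs to $\mathcal{C}([0,L_1];H^{-1}_y(0,L_2))$ and to $\mathcal{C}([0,L_2];H^{-1}_x(0,L_1))$, hence has traces in $H^{-1}$ on each side of $\Omega$. *)

(* Defs.v *)
From HB Require Import structures.
From mathcomp Require Import all_boot all_order all_algebra.
From mathcomp Require Import all_classical all_reals all_analysis.

Set Implicit Arguments.
Unset Strict Implicit.
Unset Printing Implicit Defensive.

Import Order.TTheory GRing.Theory Num.Theory.
Import numFieldNormedType.Exports.

Local Open Scope classical_set_scope.
Local Open Scope ring_scope.

Section Plane.
Context {R : realType}.
Implicit Types (f : R * R -> R) (n a b : nat).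

Definition leb2 :
    {measure set (measurableTypeR R * measurableTypeR R) -> \bar R} :=
  (@lebesgue_measure R \x @lebesgue_measure R)%E.

Definition dx f : R * R -> R := fun z => 'D_(1, 0) f z.
Definition dy f : R * R -> R := fun z => 'D_(0, 1) f z.

Definition Dxy a b f : R * R -> R := iter a dx (iter b dy f).

Fixpoint Ck n f : Prop :=
  match n with
  | 0 => continuous f
  | n'.+1 => (forall z, derivable f z (1, 0) /\ derivable f z (0, 1)) /\
             Ck n' (dx f) /\ Ck n' (dy f)
  end.

Definition smooth2 f : Prop := forall n, Ck n f.

Definition test2 (Om : set (R * R)) f : Prop :=
  smooth2 f /\
  exists K : set (R * R),
    [/\ compact K, K `<=` Om & forall z, ~ K z -> f z = 0].

End Plane.

(* Elements of L^p(Om) are represented by functions on the whole plane, only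
   their restriction to Om being relevant. *)
Section Sobolev.
Context {R : realType}.
Variable Om : set (R * R).
Implicit Types (u v : R * R -> R) (m a b : nat).

Definition inLp (p : \bar R) u : Prop := (u \_ Om) \in Lfun leb2 p.

Definition L2norm u : R := fine ('N[leb2]_2%:E [EFin \o (u \_ Om)]).

Definition is_wderiv a b u v : Prop :=
  inLp 2%:E v /\
  forall phi, test2 Om phi ->
    \int[leb2]_(z in Om) (u z * Dxy a b phi z) =
    (-1) ^+ (a + b) * \int[leb2]_(z in Om) (v z * phi z).

(* A representative of the weak derivative (unique almost everywhere on Om),
   and a junk value if there is no square-integrable weak derivative. *)
Definition wderiv a b u : R * R -> R := xget (fun=> 0) (is_wderiv a b u).

Definition inHm m u : Prop :=
  inLp 2%:E u /\
  forall a b, (a + b <= m)%N -> exists v, is_wderiv a b u v.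

Definition Hmnorm m u : R :=
  Num.sqrt (\sum_(a < m.+1) \sum_(b < m.+1 | (a + b <= m)%N)
              L2norm (wderiv a b u) ^+ 2).

(* f = lam * u_x + u_y in the sense of distributions; for u merely in L^2 the
   product lam * u_x is the distribution phi |-> - \int u * (lam * phi)_x,
   where (lam * phi)_x = lam * phi_x + lam_x * phi. *)
Definition is_transport (lam u f : R * R -> R) : Prop :=
  inLp 2%:E f /\
  forall phi, test2 Om phi ->
    \int[leb2]_(z in Om) (f z * phi z) =
    - \int[leb2]_(z in Om)
        (u z * (lam z * dx phi z + wderiv 1 0 lam z * phi z + dy phi z)).

Definition transport (lam u : R * R -> R) : R * R -> R :=
  xget (fun=> 0) (is_transport lam u).

End Sobolev.

(* H^{-1}(0, L), as the space of the distributions on (0, L) that are bounded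
   for the H^1 norm.  A distribution is a function (R -> R) -> R, only its
   values at test functions being relevant. *)
Section Hminus1.
Context {R : realType}.
Implicit Types (L : R) (eta zeta : R -> R) (g : (R -> R) -> R).

Definition test1 L eta : Prop :=
  (forall n x, derivable (derive1n n eta) x 1) /\
  exists K : set R,
    [/\ compact K, K `<=` `]0, L[ & forall x, ~ K x -> eta x = 0].

Definition H1norm L eta : R :=
  Num.sqrt (\int[lebesgue_measure]_(x in `]0, L[)
              (eta x ^+ 2 + (derive1 eta x) ^+ 2)).

Definition inHminus1 L g : Prop :=
  (forall (c : R) eta zeta, test1 L eta -> test1 L zeta ->
     g (fun x => c * eta x + zeta x) = c * g eta + g zeta) /\
  exists C : R, forall eta, test1 L eta -> `|g eta| <= C * H1norm L eta.

(* G belongs to C([0, L]; H^{-1}(0, L')) *)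
Definition continuous_Hminus1 L L' (G : R -> (R -> R) -> R) : Prop :=
  (forall t, t \in `[0, L] -> inHminus1 L' (G t)) /\
  forall t, t \in `[0, L] -> forall e : R, 0 < e ->
    \forall s \near t, s \in `[0, L] ->
      forall eta, test1 L' eta -> `|G s eta - G t eta| <= e * H1norm L' eta.

(* The trace at t = 0 of psi(t, s), (t, s) in (0, L) x (0, L'), is the value
   g at 0 of the representative of psi in C([0, L]; H^{-1}(0, L')). *)
Definition is_trace0 L L' (psi : R -> R -> R) g : Prop :=
  exists G : R -> (R -> R) -> R,
    [/\ continuous_Hminus1 L L' G,
        {ae @lebesgue_measure R, forall t, t \in `]0, L[ ->
           forall eta, test1 L' eta ->
             G t eta = \int[lebesgue_measure]_(s in `]0, L'[)
                         (psi t s * eta s)} &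
        forall eta, test1 L' eta -> G 0 eta = g eta].

End Hminus1.

Section Rectangle.
Context {R : realType}.
Variables L1 L2 : R.
Implicit Types (theta psi lam : R * R -> R) (m : nat).

Definition Omega : set (R * R) := `]0, L1[ `*` `]0, L2[.

Definition Gamma : set (R * R) :=
  ([set 0] `*` `[0, L2]) `|` (`[0, L1] `*` [set 0]).

Definition trace_Gamma_eq0 psi : Prop :=
  is_trace0 L1 L2 (fun x y => psi (x, y)) (fun=> 0) /\
  is_trace0 L2 L1 (fun y x => psi (x, y)) (fun=> 0).

Definition positive_condition m lam : Prop :=
  [/\ measurable_fun Omega lam,
      exists c0 c1 : R, [/\ 0 < c0, 0 < c1 &
        {ae leb2, forall z, Omega z -> c0 <= lam z <= c1}] &
      if (m <= 1)%N then
        (exists v, is_wderiv Omega 1 0 lam v /\ inLp Omega +oo%E v) /\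
        (exists v, is_wderiv Omega 0 1 lam v /\ inLp Omega +oo%E v)
      else inHm Omega (maxn 3 m) lam].

Definition XGamma m lam theta : Prop :=
  [/\ inHm Omega m theta,
      exists f, is_transport Omega lam theta f /\ inHm Omega m f &
      forall a b, (a + b <= m)%N -> trace_Gamma_eq0 (wderiv Omega a b theta)].

Definition Xnorm m lam theta : R :=
  Num.sqrt (Hmnorm Omega m theta ^+ 2 +
            Hmnorm Omega m (transport Omega lam theta) ^+ 2).

(* C^infty of the closed rectangle is the set of the restrictions of the smooth
   functions on the plane. *)
Definition VGamma theta : Prop :=
  (exists2 Theta, smooth2 Theta & {in closure Omega, theta =1 Theta}) /\
  (exists U : set (R * R), [/\ open U, Gamma `<=` U &
     forall z, U z -> closure Omega z -> theta z = 0]).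

End Rectangle.

(* Main.v *)
Require Import Defs.
From HB Require Import structures.
From mathcomp Require Import all_boot all_order all_algebra.
From mathcomp Require Import all_classical all_reals all_analysis.
From mathcomp Require Import measurable_realfun ess_sup_inf ring lra.
Set Implicit Arguments.
Unset Strict Implicit.
Unset Printing Implicit Defensive.
Import Order.TTheory GRing.Theory Num.Theory.
Import numFieldNormedType.Exports.
Local Open Scope classical_set_scope.
Local Open Scope ring_scope.

(* The kernel rho_e of the mollification is supported in the square (e, 2e)^2, so
   that theta_n = rho_{e_n} * theta only involves the values of theta in Omega, is
   smooth on the plane, and vanishes within distance e_n of Gamma.  As the traces
   of the derivatives of theta vanish, integration by parts against rho_e(z - .)
   has no boundary term: the derivatives of order at most m of theta_n are the
   mollified derivatives, and T d^alpha theta_n - rho_{e_n} * (T d^alpha theta) is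
   a Friedrichs commutator, bounded in L^2 because lambda is Lipschitz.  Since
   T d^alpha theta and d^alpha (T theta) differ by products of derivatives of
   lambda and theta, which are controlled by H^{max(2,k)} . H^k in H^k, the
   sequence theta_n is bounded in X^m.  It converges to theta weakly, and the
   theta_n lie in a linear subspace, which therefore contains elements close to
   theta: strong convergence of theta_n is not needed. *)

(** * Square-integrable functions *)

(** Derivatives of order [m] have traces only in $H^{-1}$ of a side, where they are paired with
    smooth functions compactly supported in the open side. Two obstacles to the integration by parts
    result. The coefficient is only Lipschitz, so it is itself mollified before it enters a trace
    pairing. And a kernel whose support meets the corner of [Gamma] is seen by neither trace: the
    corner is removed by a cutoff whose gradient has size [1/e] on a square of area of order [e^2],
    hence stays bounded in L^2, while the mass of the square-integrable factor on that square tends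
    to zero. The commutator evaluates the coefficient pointwise, so [lam] is replaced by a Lipschitz
    representative. For [m >= 2] the gradient of [lam] lies in H^(max(2,m-1)), which makes it
    bounded and a multiplier of H^k for every [k < m], the orders in which it occurs. The jet of all
    derivatives of [theta] and [T theta] is viewed in a finite power of L^2, where density becomes a
    statement about weak limits. *)

Section L2.
Context d (T : measurableType d) (R : realType).
Variables (mu : {measure set T -> \bar R}) (D : set T).
Implicit Types f g h : T -> R.

Definition Itg f := mu.-integrable D (EFin \o f).

Definition sqint f := measurable_fun D f /\ Itg (fun x => f x ^+ 2).

(** Kept squared, since Cauchy-Schwarz, Young-type bounds and sums over derivatives are then
    polynomial inequalities. *)
Definition sqn f : R := \int[mu]_(x in D) (f x ^+ 2).

Lemma sqn_ge0 f : 0 <= sqn f.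
Proof. by apply: Rintegral_ge0 => x _; exact: sqr_ge0. Qed.

Hypothesis mD : measurable D.

Local Notation I f := (\int[mu]_(x in D) f x).

Lemma Itg_meas f : Itg f -> measurable_fun D f.
Proof. by move=> /measurable_int /measurable_EFinP. Qed.

Lemma Itg_le f g : measurable_fun D f -> (forall x, D x -> `|f x| <= g x) ->
  Itg g -> Itg f.
Proof.
move=> mf fg; apply: le_integrable => //; first exact/measurable_EFinP.
by move=> x Dx /=; rewrite lee_fin (le_trans (fg x Dx))// ler_norm.
Qed.

Lemma Itg_eq f g : (forall x, D x -> f x = g x) -> Itg f -> Itg g.
Proof.
by move=> fg; apply: eq_integrable => // x /set_mem Dx /=; rewrite fg.
Qed.

Lemma ItgD f g : Itg f -> Itg g -> Itg (fun x => f x + g x).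
Proof. by move=> If Ig; have := integrableD mD If Ig. Qed.

Lemma ItgZ c f : Itg f -> Itg (fun x => c * f x).
Proof. by move=> If; have := integrableZl mD c If. Qed.

Lemma ItgN f : Itg f -> Itg (fun x => - f x).
Proof. by move=> /(ItgZ (-1)); apply: Itg_eq => x _; rewrite mulN1r. Qed.

Lemma ItgB f g : Itg f -> Itg g -> Itg (fun x => f x - g x).
Proof. by move=> If /ItgN; exact: ItgD. Qed.

Lemma Itg_norm f : Itg f -> Itg (fun x => `|f x|).
Proof. by move=> /(integrable_norm). Qed.

Lemma Itg0 : Itg (fun=> 0).
Proof. exact: integrable0. Qed.

Lemma eq_I f g : (forall x, D x -> f x = g x) -> I f = I g.
Proof. by move=> fg; apply: eq_Rintegral => x /set_mem; exact: fg. Qed.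

Lemma I0 : \int[mu]_(x in D) (0 : R) = 0.
Proof. by rewrite Rintegral_cst// mul0r. Qed.

Lemma ID f g : Itg f -> Itg g ->
  \int[mu]_(x in D) (f x + g x) = I f + I g.
Proof. exact: RintegralD. Qed.

Lemma IZ c f : Itg f -> \int[mu]_(x in D) (c * f x) = c * I f.
Proof. exact: RintegralZl. Qed.

Lemma IN f : Itg f -> \int[mu]_(x in D) (- f x) = - I f.
Proof.
move=> If; rewrite -[RHS]mulN1r -IZ//.
by apply: eq_I => x _; rewrite mulN1r.
Qed.

Lemma IB f g : Itg f -> Itg g ->
  \int[mu]_(x in D) (f x - g x) = I f - I g.
Proof. exact: RintegralB. Qed.

Lemma le_I f g : Itg f -> Itg g -> (forall x, D x -> f x <= g x) ->
  I f <= I g.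
Proof. exact: le_Rintegral. Qed.

Lemma norm_I f : Itg f -> `|I f| <= \int[mu]_(x in D) `|f x|.
Proof. exact: le_normr_Rintegral. Qed.

Lemma norm_I_le f g : Itg f -> Itg g -> (forall x, D x -> `|f x| <= g x) ->
  `|I f| <= I g.
Proof.
move=> If Ig fg; apply: le_trans (norm_I If) _.
by apply: le_I => //; exact: Itg_norm.
Qed.

Lemma ae_eq_I f g : measurable_fun D f -> measurable_fun D g ->
  {ae mu, forall x, D x -> f x = g x} -> I f = I g.
Proof.
move=> mf mg fg; rewrite /Rintegral; congr fine.
apply: ae_eq_integral => //; [exact/measurable_EFinP|exact/measurable_EFinP|].
by apply: filterS fg => x + Dx => /(_ Dx) ->.
Qed.

Lemma ae_Itg f g : measurable_fun D g ->
  {ae mu, forall x, D x -> f x = g x} -> Itg f -> Itg g.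
Proof.
move=> mg fg If.
have mf := Itg_meas If.
move: If => /integrableP[_ foo]; apply/integrableP; split.
  exact/measurable_EFinP.
rewrite (le_lt_trans _ foo)// le_eqVlt; apply/orP; left; apply/eqP.
apply: ae_eq_integral => //; [| |].
- by apply: measurableT_comp => //; exact/measurable_EFinP.
- by apply: measurableT_comp => //; exact/measurable_EFinP.
by apply: filterS fg => x + Dx => /(_ Dx) /= ->.
Qed.

Lemma ae_le_Itg f g : measurable_fun D f -> Itg g ->
  {ae mu, forall x, D x -> `|f x| <= g x} -> Itg f.
Proof.
move=> mf Ig fg; have mg := Itg_meas Ig.
(* The clamp of [f] between [- |g|] and [|g|] is dominated everywhere, so [Itg_le] applies to it,
   and it equals [f] almost everywhere. *)
apply: (@ae_Itg (fun x => Num.max (- `|g x|) (Num.min (f x) `|g x|))) => //.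
  apply: filterS fg => x + Dx => /(_ Dx) h.
  have {}h : `|f x| <= `|g x| by rewrite (le_trans h)// ler_norm.
  move: h; rewrite ler_norml => /andP[h1 h2].
  by rewrite (min_idPl _)// (max_idPr _).
apply: Itg_le (Itg_norm Ig) => [|x Dx].
  apply: measurable_maxr; first by apply: measurable_funN; exact: measurableT_comp.
  by apply: measurable_minr => //; exact: measurableT_comp.
rewrite ler_norml; apply/andP; split; first by rewrite le_max lexx.
by rewrite ge_max ge_min lexx orbT andbT (le_trans _ (normr_ge0 _))// oppr_le0.
Qed.

Lemma ae_le_I f g : Itg f -> Itg g ->
  {ae mu, forall x, D x -> f x <= g x} -> I f <= I g.
Proof.
move=> If Ig fg.
have mf := Itg_meas If; have mg := Itg_meas Ig.
(* The maximum is above [f] everywhere and equals [g] almost everywhere. *)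
have mm : measurable_fun D (fun x => Num.max (f x) (g x)).
  exact: measurable_maxr.
have h : {ae mu, forall x, D x -> g x = Num.max (f x) (g x)}.
  by apply: filterS fg => x + Dx => /(_ Dx) h; rewrite (max_idPr _).
rewrite (ae_eq_I mg mm h); apply: le_I => //; first exact: ae_Itg h Ig.
by move=> x _; rewrite le_max lexx.
Qed.

Lemma Itg_I0 f : Itg f -> (forall x, D x -> 0 <= f x) -> I f = 0 ->
  {ae mu, forall x, D x -> f x = 0}.
Proof.
move=> If f0 If0.
have h : (\int[mu]_(x in D) `|(EFin \o f) x| = 0)%E.
  rewrite -[RHS]/(0%:E) -If0 /Rintegral fineK; last exact: integrable_fin_num.
  by apply: eq_integral => x /set_mem Dx /=; rewrite ger0_norm// f0.
have mf := measurable_int _ If.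
have := @ae_eq_integral_abs _ _ _ mu _ mD _ mf.
move=> [+ _] => /(_ h).
by apply: filterS => x + Dx => /(_ Dx) /= [].
Qed.

Lemma Rdct (f_ : nat -> T -> R) f g :
  (forall n, measurable_fun D (f_ n)) -> measurable_fun D f -> Itg g ->
  (forall n x, D x -> `|f_ n x| <= g x) ->
  {ae mu, forall x, D x -> f_ n x @[n --> \oo] --> f x} ->
  I (f_ n) @[n --> \oo] --> I f.
Proof.
move=> mf_ mf Ig fg ff.
have [] := @dominated_convergence _ _ _ mu D mD (fun n => EFin \o f_ n)
  (EFin \o f) (EFin \o g).
- by move=> n; exact/measurable_EFinP.
- exact/measurable_EFinP.
- apply: filterS ff => x + Dx => /(_ Dx) h.
  by apply: cvg_EFin; [exact: nearW|exact: h].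
- exact: Ig.
- by apply: aeW => x n Dx /=; rewrite lee_fin fg.
move=> If _ h; apply: fine_cvg.
rewrite /Rintegral fineK//; exact: integrable_fin_num.
Qed.

Lemma sqintM f g : sqint f -> sqint g -> Itg (fun x => f x * g x).
Proof.
move=> [mf f2] [mg g2]; apply: Itg_le (ItgD f2 g2).
  exact: measurable_funM.
move=> x _; rewrite ler_norml; apply/andP; split; nra.
Qed.

Lemma sqintZ c f : sqint f -> sqint (fun x => c * f x).
Proof.
move=> [mf f2]; split; first exact: measurable_funM.
by apply: Itg_eq (ItgZ (c ^+ 2) f2) => x _; rewrite exprMn.
Qed.

Lemma sqintD f g : sqint f -> sqint g -> sqint (fun x => f x + g x).
Proof.
move=> lf lg; split; first by apply: measurable_funD; [case: lf|case: lg].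
have := ItgD (ItgD lf.2 lg.2) (ItgZ 2 (sqintM lf lg)).
by apply: Itg_eq => x _; ring.
Qed.

Lemma sqintN f : sqint f -> sqint (fun x => - f x).
Proof.
by move=> [mf f2]; split; [exact: measurable_funN|apply: Itg_eq f2 => x _; rewrite sqrrN].
Qed.

Lemma sqintB f g : sqint f -> sqint g -> sqint (fun x => f x - g x).
Proof. by move=> lf /sqintN; exact: sqintD. Qed.

Lemma sqint0 : sqint (fun=> 0).
Proof. by split => //; apply: Itg_eq Itg0 => x _; rewrite expr0n. Qed.

Lemma sqint_ae f g : measurable_fun D g ->
  {ae mu, forall x, D x -> f x = g x} -> sqint f -> sqint g.
Proof.
move=> mg fg [mf f2]; split => //; apply: ae_Itg f2; first exact: measurable_funX.
by apply: filterS fg => x + Dx => /(_ Dx) ->.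
Qed.

Lemma sqint_eq f g : (forall x, D x -> f x = g x) -> sqint f -> sqint g.
Proof.
move=> fg [mf f2]; split; last by apply: Itg_eq f2 => x Dx; rewrite fg.
by apply: eq_measurable_fun mf => x /set_mem Dx; exact: fg.
Qed.

Lemma ae_sqint_bndM M f g : measurable_fun D f ->
  {ae mu, forall x, D x -> `|f x| <= M} -> sqint g ->
  sqint (fun x => f x * g x) /\ sqn (fun x => f x * g x) <= M ^+ 2 * sqn g.
Proof.
move=> mf fM [mg g2].
have h : {ae mu, forall x, D x -> (f x * g x) ^+ 2 <= M ^+ 2 * g x ^+ 2}.
  apply: filterS fM => x + Dx => /(_ Dx) fx; rewrite exprMn.
  apply: ler_wpM2r; first exact: sqr_ge0.
  by rewrite -[_ ^+ 2 in leLHS]real_normK ?num_real// lerXn2r// nnegrE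
    (le_trans _ fx).
have l : sqint (fun x => f x * g x).
  split; first exact: measurable_funM.
  apply: ae_le_Itg (ItgZ (M ^+ 2) g2) _.
    by apply: measurable_funX; exact: measurable_funM.
  by apply: filterS h => x + Dx => /(_ Dx); rewrite ger0_norm// sqr_ge0.
split => //; rewrite /sqn -IZ//; apply: ae_le_I => //; first by case: l.
exact: ItgZ.
Qed.

Lemma sqint_bndM M f g : measurable_fun D f ->
  (forall x, D x -> `|f x| <= M) -> sqint g ->
  sqint (fun x => f x * g x) /\ sqn (fun x => f x * g x) <= M ^+ 2 * sqn g.
Proof. by move=> mf fM; apply: ae_sqint_bndM => //; exact: aeW. Qed.

Lemma sqnZ c f : sqint f -> sqn (fun x => c * f x) = c ^+ 2 * sqn f.
Proof.
by move=> [_ f2]; rewrite /sqn -IZ//; apply: eq_I => x _; rewrite exprMn.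
Qed.

Lemma sqn_eq f g : (forall x, D x -> f x = g x) -> sqn f = sqn g.
Proof. by move=> fg; apply: eq_I => x Dx; rewrite fg. Qed.

Lemma sqn_ae f g : measurable_fun D f -> measurable_fun D g ->
  {ae mu, forall x, D x -> f x = g x} -> sqn f = sqn g.
Proof.
move=> mf mg fg; apply: ae_eq_I; [exact: measurable_funX|exact: measurable_funX|].
by apply: filterS fg => x + Dx => /(_ Dx) ->.
Qed.

Lemma sqnD f g : sqint f -> sqint g ->
  sqn (fun x => f x + g x) = sqn f + 2 * \int[mu]_(x in D) (f x * g x) + sqn g.
Proof.
move=> lf lg; have fg := sqintM lf lg.
rewrite /sqn -IZ// -ID; [|by case: lf|exact: ItgZ].
rewrite -ID; [|apply: ItgD; [by case: lf|exact: ItgZ]|by case: lg].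
by apply: eq_I => x _; ring.
Qed.

Lemma sqnD_le f g : sqint f -> sqint g ->
  sqn (fun x => f x + g x) <= 2 * (sqn f + sqn g).
Proof.
move=> lf lg; rewrite /sqn -ID; [|by case: lf|by case: lg].
rewrite -IZ; last by apply: ItgD; [case: lf|case: lg].
apply: le_I; first by case: (sqintD lf lg).
  by apply: ItgZ; apply: ItgD; [case: lf|case: lg].
move=> x _; rewrite -subr_ge0 (_ : _ - _ = (f x - g x) ^+ 2) ?sqr_ge0//.
by ring.
Qed.

(** The integral of [(f + t g)^2] is nonnegative for every real [t]; it is evaluated at the
    minimizing [t]. *)
Lemma cauchy_schwarz f g : sqint f -> sqint g ->
  (\int[mu]_(x in D) (f x * g x)) ^+ 2 <= sqn f * sqn g.
Proof.
move=> lf lg.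
set a := sqn f; set b := \int[mu]_(x in D) _; set c := sqn g.
have h t : 0 <= a + 2 * t * b + t ^+ 2 * c.
  have := sqn_ge0 (fun x => f x + t * g x).
  rewrite sqnD//; last exact: sqintZ.
  rewrite sqnZ// (_ : \int[mu]_(x in D) _ = t * b).
    by rewrite -/a -/c mulrA.
  rewrite -IZ; last exact: sqintM.
  by apply: eq_I => x _; rewrite mulrCA.
have a0 : 0 <= a := sqn_ge0 f; have c0 : 0 <= c := sqn_ge0 g.
have [c00|cn0] := eqVneq c 0.
  rewrite c00 mulr0.
  have [->|bn0] := eqVneq b 0; first by rewrite expr0n.
  (* Without quadratic term the polynomial is affine of slope [2 b]; this [t] gives it the value
     -1. *)
  have := h (- (a + 1) / (2 * b)).
  have -> : a + 2 * (- (a + 1) / (2 * b)) * b + (- (a + 1) / (2 * b)) ^+ 2 * c = -1.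
    by rewrite c00; field.
  by rewrite lerNr oppr0 ler10.
have := h (- b / c).
have -> : a + 2 * (- b / c) * b + (- b / c) ^+ 2 * c = (a * c - b ^+ 2) / c by field.
rewrite pmulr_lge0 ?invr_gt0 ?lt_neqAle 1?eq_sym ?cn0//.
by rewrite subr_ge0.
Qed.

Lemma cauchy_schwarz_le f g A B : sqint f -> sqint g -> 0 <= A -> 0 <= B ->
  sqn f <= A ^+ 2 -> sqn g <= B ^+ 2 ->
  `|\int[mu]_(x in D) (f x * g x)| <= A * B.
Proof.
move=> lf lg A0 B0 fA gB; have := cauchy_schwarz lf lg.
set b := \int[mu]_(x in D) _ => h.
have : `|b| ^+ 2 <= (A * B) ^+ 2.
  rewrite real_normK ?num_real// exprMn (le_trans h)//.
  by apply: ler_pM => //; exact: sqn_ge0.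
by rewrite ler_sqr ?nnegrE ?mulr_ge0.
Qed.

Lemma sqn0_ae f : sqint f -> sqn f = 0 -> {ae mu, forall x, D x -> f x = 0}.
Proof.
move=> [mf f2] f0.
have := Itg_I0 f2 (fun x _ => sqr_ge0 _) f0.
by apply: filterS => x + Dx => /(_ Dx) /eqP; rewrite sqrf_eq0 => /eqP.
Qed.

Hypothesis fD : (mu D < +oo)%E.

Lemma Itg_bnd M f : measurable_fun D f -> (forall x, D x -> `|f x| <= M) -> Itg f.
Proof.
move=> mf fM; apply: measurable_bounded_integrable => //.
exists M; split; first exact: num_real.
by move=> y My x Dx; apply: le_trans (fM x Dx) _; exact: ltW.
Qed.

Lemma Itg_cst (c : R) : Itg (fun=> c).
Proof. exact: (@Itg_bnd `|c|). Qed.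

Lemma sqint_bnd M f : measurable_fun D f -> (forall x, D x -> `|f x| <= M) -> sqint f.
Proof.
move=> mf fM; split => //; apply: (@Itg_bnd (M ^+ 2)); first exact: measurable_funX.
move=> x Dx; have h := fM x Dx; rewrite normrX.
by rewrite ler_sqr ?nnegrE// (le_trans _ h).
Qed.

Lemma sqint_Itg1 f : sqint f -> Itg f.
Proof.
move=> lf; have l1 : sqint (fun=> 1) by apply: (@sqint_bnd 1) => // x _; rewrite normr1.
by have := sqintM lf l1; apply: Itg_eq => x _; rewrite mulr1.
Qed.

End L2.

(** * Smooth functions *)

Section Smooth1.
Context {R : realType}.
Implicit Types (a b f g : R -> R).

(** Level 0 demands nothing: continuity of each derivative comes from its derivability one level up,
    and the notion of interest is the intersection [smooth1]. *)
Fixpoint Cn n f : Prop :=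
  if n is n'.+1 then (forall x : R, derivable f x 1) /\ Cn n' (derive1 f) else True.

Definition smooth1 f := forall n, Cn n f.

Lemma smooth1_der f (x : R) : smooth1 f -> derivable f x 1.
Proof. by move=> /(_ 1%N) []. Qed.

Lemma smooth1_d1 f : smooth1 f -> smooth1 (derive1 f).
Proof. by move=> sf n; have [] := sf n.+1. Qed.

Lemma smooth1_is f (x : R) : smooth1 f -> is_derive x 1 f ((derive1 f) x).
Proof. by move=> sf; rewrite derive1E; apply: derivableP; exact: smooth1_der. Qed.

Lemma derivable_cont f (x : R) : derivable f x 1 -> {for x, continuous f}.
Proof. by move=> /derivable1_diffP /differentiable_continuous. Qed.

Lemma smooth1_cont f : smooth1 f -> continuous f.
Proof. by move=> sf x; apply: derivable_cont; exact: smooth1_der. Qed.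

Lemma smooth1_derive1n f : smooth1 f ->
  forall n (x : R), derivable (derive1n n f) x 1.
Proof.
move=> sf n; elim: n f sf => [|n IH] f sf x; first by rewrite derive1n0; exact: smooth1_der.
by rewrite derive1Sn; apply: IH; exact: smooth1_d1.
Qed.

Lemma derive1n_smooth1 f : (forall n (x : R), derivable (derive1n n f) x 1) -> smooth1 f.
Proof.
move=> df n; elim: n f df => [//|n IH] f df /=; split.
  by move=> x; have := df 0%N x; rewrite derive1n0.
by apply: IH => k x; have := df k.+1 x; rewrite derive1Sn.
Qed.

Lemma is_derive1_eq f df : (forall x : R, is_derive x 1 f (df x)) -> (derive1 f) = df.
Proof. by move=> h; apply/funext => x; rewrite derive1E; apply: derive_val. Qed.

Lemma Cn_step f df n : (forall x : R, is_derive x 1 f (df x)) -> Cn n df -> Cn n.+1 f.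
Proof.
move=> h c; split; last by rewrite (is_derive1_eq h).
by move=> x; apply: ex_derive.
Qed.

Lemma CnD n f g : Cn n f -> Cn n g -> Cn n (fun x => f x + g x).
Proof.
elim: n f g => [//|n IH] f g [df cf] [dg cg].
apply: (@Cn_step _ (fun x => (derive1 f) x + (derive1 g) x)); last exact: IH.
by move=> x; apply: is_deriveD; rewrite derive1E; exact: derivableP.
Qed.

Lemma smooth1M f g : smooth1 f -> smooth1 g -> smooth1 (fun x => f x * g x).
Proof.
move=> sf sg n; elim: n f g sf sg => [//|n IH] f g sf sg.
apply: (@Cn_step _ (fun x => f x * (derive1 g) x + g x * (derive1 f) x)).
  by move=> x; apply: is_deriveM; exact: smooth1_is.
by apply: CnD; apply: IH => //; exact: smooth1_d1.
Qed.

Lemma smooth1D f g : smooth1 f -> smooth1 g -> smooth1 (fun x => f x + g x).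
Proof. by move=> sf sg n; exact: CnD. Qed.

Lemma smooth1_cst (c : R) : smooth1 (fun=> c).
Proof.
move=> n; elim: n c => [//|n IH] c; apply: (@Cn_step _ (fun=> 0)) => // x.
Qed.

Lemma smooth1N f : smooth1 f -> smooth1 (fun x => - f x).
Proof.
move=> sf; have := smooth1M (smooth1_cst (-1)) sf.
by congr smooth1; apply/funext => x; rewrite mulN1r.
Qed.

Lemma is_derive_affine f (c k x : R) df : is_derive (c + k * x) 1 f df ->
  is_derive x 1 (fun x => f (c + k * x)) (k * df).
Proof.
move=> h.
have h2 : is_derive x 1 (fun x => c + k * x) k.
  by apply: is_derive_eq; rewrite add0r mul1r; exact: mulr1.
have := @is_derive1_comp _ f (fun x => c + k * x) x df k h h2.
by rewrite mulrC.
Qed.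

Lemma smooth1_affine f (c k : R) : smooth1 f -> smooth1 (fun x => f (c + k * x)).
Proof.
move=> sf n; elim: n f sf => [//|n IH] f sf.
apply: (@Cn_step _ (fun x => k * (derive1 f) (c + k * x))).
  by move=> x; apply: is_derive_affine; exact: smooth1_is.
have -> : (fun x => k * (derive1 f) (c + k * x)) =
          (fun x => k * (derive1 f) x) \o (fun x => c + k * x) by [].
have sk : smooth1 (fun x => k * (derive1 f) x).
  by apply: smooth1M; [exact: smooth1_cst|exact: smooth1_d1].
exact: IH.
Qed.

Lemma smooth1V f : (forall x, f x != 0) -> smooth1 f -> smooth1 (fun x => (f x)^-1).
Proof.
move=> f0 sf.
suff h n : Cn n (fun x => (f x)^-1) by [].
elim: n {-2}n (leqnn n) => [|n IH] m; first by rewrite leqn0 => /eqP ->.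
case: m => [//|m]; rewrite ltnS => mn.
apply: (@Cn_step _ (fun x => - (f x ^- 2) * (derive1 f) x)).
  by move=> x; apply: is_deriveV; [exact: f0|exact: smooth1_is].
(* The inverse is so far known to be regular only up to order [n], so [smooth1M] does not apply and
   products are treated at bounded order. *)
suff M k g1 g2 : (k <= n)%N -> (forall j, (j <= k)%N -> Cn j g1) ->
    (forall j, (j <= k)%N -> Cn j g2) -> Cn k (fun x => g1 x * g2 x).
  have c1 : forall j, (j <= m)%N -> Cn j (fun x => - (derive1 f) x * (f x)^-1).
    move=> j jm; apply: M => //; first exact: leq_trans mn.
      by move=> i _; apply: (smooth1N (smooth1_d1 sf)).
    by move=> i ij; apply: IH; apply: leq_trans mn; apply: leq_trans jm.
  have := M m _ _ mn c1 (fun j jm => IH j (leq_trans jm mn)).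
  by congr Cn; apply/funext => x; rewrite -exprVn expr2; ring.
elim: k g1 g2 => [//|k IHk] g1 g2 kn c1 c2.
have d1 (x : R) : is_derive x 1 g1 ((derive1 g1) x).
  by rewrite derive1E; apply: derivableP; case: (c1 1%N isT).
have d2 (x : R) : is_derive x 1 g2 ((derive1 g2) x).
  by rewrite derive1E; apply: derivableP; case: (c2 1%N isT).
suff hD : Cn k (fun x => g1 x * derive1 g2 x + g2 x * derive1 g1 x).
  by apply: Cn_step hD => x; apply: is_deriveM.
by apply: CnD; apply: IHk; do ?[exact: ltnW | move=> j jk];
  [exact/c1/leqW | have [] := c2 j.+1 jk | exact/c2/leqW | have [] := c1 j.+1 jk].
Qed.

Lemma smooth1_MVT f x y : smooth1 f ->
  exists c, f y - f x = (derive1 f) c * (y - x).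
Proof.
move=> sf.
have cw u v : {within `[u, v], continuous f}.
  by apply: continuous_subspaceT; exact: smooth1_cont.
have [xy|yx] := leP x y.
  by have [c _ h] := MVT_segment xy (fun z _ => smooth1_is z sf) (cw _ _); exists c.
have [c _ h] := MVT_segment (ltW yx) (fun z _ => smooth1_is z sf) (cw _ _).
by exists c; rewrite -opprB h; ring.
Qed.

Lemma smooth1_lip f M : smooth1 f -> (forall x, `|(derive1 f) x| <= M) ->
  forall x y, `|f x - f y| <= M * `|x - y|.
Proof.
move=> sf fM x y; have [c ->] := smooth1_MVT y x sf.
by rewrite normrM ler_wpM2r.
Qed.

Lemma smooth1_bnd f (u v : R) : smooth1 f ->
  (forall x, x < u \/ v < x -> f x = 0) -> exists M, forall x, `|f x| <= M.
Proof.
move=> sf f0.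
have [uv|vu] := leP u v; last first.
  exists 0 => x; rewrite f0 ?normr0//.
  by have [?|?] := ltP x u; [left|right; exact: lt_le_trans vu _].
have cw g : continuous g -> {within `[u, v], continuous g}.
  exact: continuous_subspaceT.
have cn : continuous (fun x => `|f x|).
  by move=> x; apply: cvg_norm; exact: smooth1_cont.
have [c _ h] := EVT_max uv (cw _ cn).
exists `|f c| => x.
have [xu|ux] := ltP x u; first by rewrite f0 ?normr0//; left.
have [vx|xv] := ltP v x; first by rewrite f0 ?normr0//; right.
by apply: h; rewrite in_itv/= ux.
Qed.

Lemma derive1_0 f (P : set R) : open P -> (forall x, P x -> f x = 0) ->
  forall x, P x -> (derive1 f) x = 0.
Proof.
move=> oP f0 x Px.
rewrite derive1E -(@near_eq_derive _ _ _ (cst 0) f x 1) ?derive_cst//.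
have : \forall y \near x, P y by apply: open_nbhs_nbhs.
by apply: filterS => y Py; rewrite f0.
Qed.

End Smooth1.

(** * A smooth step and the one-dimensional mollifier *)

Section Step.
Context {R : realType}.
Implicit Types (p : {poly R}) (x : R).

(** The family is stable under differentiation: with [t = 1/x], the derivative of [p(t) exp(-t)] is
    [t^2 (p - p')(t) exp(-t)]. One induction on the order then makes all members smooth. *)
Definition flat p x : R := if 0 < x then p.[x^-1] * expR (- x^-1) else 0.

(** Serves at the origin, where the two formulas defining [flat] meet and the difference quotient is
    estimated directly. *)
Lemma is_derive_quad (V : normedModType R) (f : V -> R) (a v : V) (l C : R) :
  (forall h : R, `|f (h *: v + a) - f a - h * l| <= C * h ^+ 2) ->
  is_derive a v f l.
Proof.
move=> fC.
have C0 : 0 <= C by have := fC 1; rewrite expr1n mulr1; apply: le_trans.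
have cv : h^-1 *: ((f \o shift a) (h *: v) - f a) @[h --> 0^'] --> (l : R^o).
  apply/cvgrPdist_le => e e0.
  near=> h; have hn0 : h != 0 by near: h; exact: nbhs_dnbhs_neq.
  have -> : l - h^-1 *: ((f \o shift a) (h *: v) - f a) =
           - (h^-1 * (f (h *: v + a) - f a - h * l)).
    rewrite -[_ *: _]/(h^-1 * (f (h *: v + a) - f a)).
    by move: (f _) (f a) => u w; field.
  rewrite normrN normrM normfV ler_pdivrMl ?normr_gt0//.
  apply: le_trans (fC h) _.
  rewrite -real_normK ?num_real// expr2 mulrA [leRHS]mulrC.
  rewrite ler_wpM2r//.
  have : `|h| <= e / (C + 1).
    near: h; apply: dnbhs0_le; by rewrite divr_gt0// ltr_wpDl.
  rewrite ler_pdivlMr ?ltr_wpDl//; apply: le_trans.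
  by rewrite mulrC ler_wpM2l// lerDl.
apply: DeriveDef; first by apply/cvg_ex; exists l.
exact: cvg_lim cv.
Unshelve. all: by end_near. Qed.

(** From [t^(i+2) <= (i+2)! exp(t)] at [t = 1/x]: the two extra powers of [t] leave the factor
    [x^2], which forces the derivative at the origin to be zero. *)
Lemma flat_bound p : exists C : R, forall x, `|flat p x| <= C * x ^+ 2.
Proof.
exists (\sum_(i < size p) `|p`_i| * (i.+2)`!%:R) => x.
rewrite /flat; case: ifPn => [x0|_]; last first.
  rewrite normr0 mulr_ge0 ?sqr_ge0// sumr_ge0// => i _; exact: mulr_ge0.
rewrite normrM (ger0_norm (expR_ge0 _)) horner_coef.
apply: le_trans (ler_wpM2r (expR_ge0 _) (ler_norm_sum _ _ _)) _.
rewrite !mulr_suml; apply: ler_sum => i _.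
rewrite normrM -!mulrA; apply: ler_wpM2l => //.
rewrite normrX ger0_norm ?invr_ge0 ?(ltW x0)// expRN.
have e0 : 0 < expR x^-1 by exact: expR_gt0.
rewrite ler_pdivrMr//.
have x20 : 0 < x ^+ 2 by exact: exprn_gt0.
have f0 : 0 < (i.+2)`!%:R :> R by rewrite ltr0n fact_gt0.
have t0 : 0 <= x^-1 by rewrite invr_ge0 ltW.
have h : (x^-1) ^+ i.+2 <= (i.+2)`!%:R * expR x^-1.
  have := expR_ge1Dxn i.+1 t0 => h.
  rewrite mulrC -ler_pdivrMr//; apply: le_trans h; lra.
have -> : (x^-1) ^+ i = (x^-1) ^+ i.+2 * x ^+ 2.
  by rewrite -addn2 exprD -mulrA -exprMn mulVf ?gt_eqF// expr1n mulr1.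
by rewrite [leRHS]mulrAC ler_pM2r.
Qed.

Lemma is_derive_flat p x : is_derive x 1 (flat p) (flat ('X^2 * (p - p^`())) x).
Proof.
have [x0|x0|->] := ltgtP x 0.
- apply: (@near_eq_is_derive _ _ _ (cst 0)).
    near=> y; rewrite /flat ltNge (_ : y <= 0)//.
    by apply/ltW; near: y; exact: lt_nbhsl.
  by rewrite /flat ltNge ltW//=; exact: is_derive_cst.
- apply: (@near_eq_is_derive _ _ _ (fun y : R => p.[y^-1] * expR (- y^-1))).
    by near=> y; rewrite /flat ifT//; near: y; exact: lt_nbhsr.
  have xn0 : x != 0 by rewrite gt_eqF.
  have d1 : is_derive x 1 (fun y : R => y^-1) (- x ^- 2).
    by apply: is_derive_eq; [apply: is_deriveV|rewrite /= -[RHS]mulr1].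
  have d2 : is_derive x 1 (fun y : R => p.[y^-1]) (p^`().[x^-1] * - x ^- 2).
    exact: (@is_derive1_comp _ (horner p) (fun y : R => y^-1)).
  have d3 : is_derive x 1 (fun y : R => expR (- y^-1)) (expR (- x^-1) * x ^- 2).
    rewrite -[x ^- 2]opprK.
    exact: (@is_derive1_comp _ expR (fun y : R => - y^-1)).
  rewrite /flat x0; have d4 := is_deriveM d2 d3; apply: (@is_derive_eq _ _ _ _ _ _ _ _ d4).
  rewrite !(hornerE, hornerM, hornerXn) exprVn /=.
  by rewrite -![_ *: _]/(_ * _); ring.
- have [C hC] := flat_bound p.
  rewrite {2}/flat ltxx; apply: (@is_derive_quad _ _ _ _ _ C) => h.
  rewrite mulr0 addr0 subr0 {2}/flat ltxx subr0.
  by have := hC h; rewrite -[h *: 1]/(h * 1) mulr1.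
Unshelve. all: by end_near. Qed.


Lemma smooth1_flat p : smooth1 (flat p).
Proof.
move=> n; elim: n p => [//|n IH] p.
by apply: (@Cn_step _ _ (flat ('X^2 * (p - p^`())))) => // x; exact: is_derive_flat.
Qed.

(** The usual quotient of flat functions, with its transition placed on [[1, 2]]: the derivative is
    then supported away from the origin on the positive side, which produces the one-sided mollifier
    supported in [[e, 2e]]. *)
Definition step x : R := flat 1 (x - 1) / (flat 1 (x - 1) + flat 1 (2 - x)).

Lemma flat1_gt0 x : 0 < x -> 0 < flat 1 x.
Proof. by move=> x0; rewrite /flat x0 hornerC mul1r expR_gt0. Qed.

Lemma flat1_0 x : x <= 0 -> flat 1 x = 0.
Proof. by move=> x0; rewrite /flat ltNge x0. Qed.

Lemma flat1_ge0 x : 0 <= flat 1 x.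
Proof. by have [/flat1_0->//|/flat1_gt0/ltW] := leP x 0. Qed.

Lemma step_den x : 0 < flat 1 (x - 1) + flat 1 (2 - x).
Proof.
have [x1|x1] := leP x 1.
  by apply: ltr_wpDl; [exact: flat1_ge0|apply: flat1_gt0; lra].
by apply: ltr_pwDl; [apply: flat1_gt0; lra|exact: flat1_ge0].
Qed.

Lemma smooth1_step : smooth1 step.
Proof.
have s1 : smooth1 (fun x => flat 1 (x - 1)).
  have := @smooth1_affine _ _ (-1) 1 (smooth1_flat 1).
  by congr smooth1; apply/funext => x; congr flat; ring.
have s2 : smooth1 (fun x => flat 1 (2 - x)).
  have := @smooth1_affine _ _ 2 (-1) (smooth1_flat 1).
  by congr smooth1; apply/funext => x; congr flat; ring.
apply: smooth1M => //; apply: smooth1V; last exact: smooth1D.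
by move=> x; rewrite gt_eqF// step_den.
Qed.

Lemma step0 x : x <= 1 -> step x = 0.
Proof. by move=> x1; rewrite /step flat1_0 ?mul0r// subr_le0. Qed.

Lemma step1 x : 2 <= x -> step x = 1.
Proof.
move=> x2; have := step_den x; rewrite /step (@flat1_0 (2 - x)) ?subr_le0//.
by rewrite addr0 => h; rewrite divff// gt_eqF.
Qed.

Lemma step_ge0 x : 0 <= step x.
Proof. by rewrite /step divr_ge0 ?flat1_ge0// ltW// step_den. Qed.

Lemma step_le1 x : step x <= 1.
Proof. by rewrite /step ler_pdivrMr ?step_den// mul1r lerDl flat1_ge0. Qed.

(** Neither sign nor mass is prescribed, so that the class is stable under differentiation. *)
Definition ckern (e : R) (a : R -> R) :=
  smooth1 a /\ forall x, x < e \/ 2 * e < x -> a x = 0.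

Lemma ckern_d1 e a : ckern e a -> ckern e (derive1 a).
Proof.
move=> [sa a0]; split; first exact: smooth1_d1.
move=> x [xe|ex].
  by apply: (@derive1_0 _ a `]-oo, e[) => [|y|] //=;
    rewrite ?in_itv//= => ye; apply: a0; left.
by apply: (@derive1_0 _ a `]2 * e, +oo[) => [|y|] //=;
  rewrite ?in_itv/= ?andbT//= => ye; apply: a0; right.
Qed.

Lemma ckern_bnd e a : ckern e a -> exists M, forall x, `|a x| <= M.
Proof. by move=> [sa a0]; apply: smooth1_bnd sa a0. Qed.

Lemma ckern_step : ckern 1 (derive1 step).
Proof.
split; first exact: smooth1_d1 smooth1_step.
move=> x [xe|ex].
  apply: (@derive1_0 _ step `]-oo, 1[) => [|y|] //=; rewrite ?in_itv//= => ye.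
  by apply: step0; exact: ltW.
rewrite mulr1 in ex.
(* Beyond 2 the function [step] is the constant 1; subtracting 1 lets [derive1_0] apply. *)
have -> : derive1 step = derive1 (fun x => step x + (-1)).
  apply/esym/is_derive1_eq => y; have := smooth1_is y smooth1_step => h.
  have h2 : is_derive y 1 (fun=> -1 : R) 0 by exact: is_derive_cst.
  by have := is_deriveD h h2; rewrite addr0.
apply: (@derive1_0 _ _ `]2, +oo[) => [|y|] //=; rewrite ?in_itv/= ?andbT//= => ye.
by rewrite step1 ?subrr// ltW.
Qed.

(** Being the derivative of [step] at scale [e], it has integral one by the fundamental theorem of
    calculus. It is also the derivative of the boundary cutoff [cut e], which is how the mollifier
    bounds reappear in the trace estimates. *)
Definition mol (e x : R) : R := e^-1 * derive1 step (e^-1 * x).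

Lemma is_derive_scale f (k x : R) : smooth1 f ->
  is_derive x 1 (fun x => f (k * x)) (k * derive1 f (k * x)).
Proof.
move=> sf.
have := @is_derive_affine _ f 0 k x _ (smooth1_is (0 + k * x) sf).
by rewrite add0r; under eq_fun do rewrite add0r.
Qed.

Lemma smooth1_scale f (k : R) : smooth1 f -> smooth1 (fun x => f (k * x)).
Proof.
by move=> /(smooth1_affine 0 k); congr smooth1; apply/funext => x; rewrite add0r.
Qed.

Lemma ckern_mol e : 0 < e -> ckern e (mol e).
Proof.
move=> e0; have [sa a0] := ckern_step; split.
  apply: smooth1M; first exact: smooth1_cst.
  exact: smooth1_scale.
move=> x h; rewrite /mol a0 ?mulr0//; move: h => [h|h]; [left|right].
  by rewrite ltr_pdivrMl ?mulr1.
by rewrite ltr_pdivlMl// mulr1 mulrC.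
Qed.

Lemma mol_bnd : exists M : R, 0 < M /\ forall e, 0 < e -> forall x,
  `|mol e x| <= M / e /\ `|derive1 (mol e) x| <= M / e ^+ 2.
Proof.
have [M1 h1] := ckern_bnd ckern_step.
have [M2 h2] := ckern_bnd (ckern_d1 ckern_step).
exists (1 + `|M1| + `|M2|); split.
  by rewrite ltr_wpDr// ltr_wpDr.
move=> e e0 x; split.
  rewrite /mol normrM mulrC (@ger0_norm _ e^-1) ?invr_ge0 ?(ltW e0)//.
  apply: ler_wpM2r; first by rewrite invr_ge0 ltW.
  apply: le_trans (h1 _) _; apply: le_trans (ler_norm _) _.
  by rewrite -addrA addrCA lerDl addr_ge0.
have -> : derive1 (mol e) = fun x => e^-1 * (e^-1 * derive1 (derive1 step) (e^-1 * x)).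
  apply: is_derive1_eq => y.
  have h := @is_derive_scale (derive1 step) e^-1 y (smooth1_d1 smooth1_step).
  exact: is_deriveZ.
rewrite mulrA normrM -invfM -expr2 mulrC.
rewrite (@ger0_norm _ (e ^+ 2)^-1) ?invr_ge0 ?sqr_ge0//.
apply: ler_wpM2r; first by rewrite invr_ge0 sqr_ge0.
apply: le_trans (h2 _) _; apply: le_trans (ler_norm _) _.
by rewrite lerDr addr_ge0.
Qed.

End Step.

(** * Partial derivatives on the plane *)

Section Calculus2.
Context {R : realType}.
Implicit Types (f g : R * R -> R) (z : R * R).

Let sliceE f z (h : R) : (f \o shift z) (h *: (1, 0)) =
  ((fun t => f (t, z.2)) \o shift z.1) (h *: 1).
Proof.
case: z => x y /=; congr f.
by rewrite -[h *: (1, 0)]/(h * 1, h * 0) mulr0 -[LHS]/(h * 1 + x, 0 + y) add0r.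
Qed.

Let sliceE2 f z (h : R) : (f \o shift z) (h *: (0, 1)) =
  ((fun t => f (z.1, t)) \o shift z.2) (h *: 1).
Proof.
case: z => x y /=; congr f.
by rewrite -[h *: (0, 1)]/(h * 0, h * 1) mulr0 -[LHS]/(0 + x, h * 1 + y) add0r.
Qed.

Let qE f z : (fun h : R => h^-1 *: ((f \o shift z) (h *: (1, 0)) - f z)) =
  (fun h => h^-1 *: (((fun t => f (t, z.2)) \o shift z.1) (h *: 1) - f (z.1, z.2))).
Proof. by apply/funext => h; rewrite sliceE; case: z. Qed.

Let qE2 f z : (fun h : R => h^-1 *: ((f \o shift z) (h *: (0, 1)) - f z)) =
  (fun h => h^-1 *: (((fun t => f (z.1, t)) \o shift z.2) (h *: 1) - f (z.1, z.2))).
Proof. by apply/funext => h; rewrite sliceE2; case: z. Qed.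

Lemma derivable_x f z : derivable f z (1, 0) =
  derivable (fun t => f (t, z.2)) z.1 1.
Proof. by rewrite /derivable qE. Qed.

Lemma dxE f z : dx f z = derive1 (fun t => f (t, z.2)) z.1.
Proof. by rewrite derive1E /dx /derive qE. Qed.

Lemma derivable_y f z : derivable f z (0, 1) =
  derivable (fun t => f (z.1, t)) z.2 1.
Proof. by rewrite /derivable qE2. Qed.

Lemma dyE f z : dy f z = derive1 (fun t => f (z.1, t)) z.2.
Proof. by rewrite derive1E /dy /derive qE2. Qed.

(** Unlike an equation on [dx f], this includes derivability, so it composes with the rules for one
    variable. *)
Definition isdx f df := forall z, is_derive z.1 1 (fun t => f (t, z.2)) (df z : R).
Definition isdy f df := forall z, is_derive z.2 1 (fun t => f (z.1, t)) (df z : R).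

Lemma isdxE f df : isdx f df -> dx f = df.
Proof.
by move=> h; apply/funext => z; rewrite dxE derive1E; have := h z => ?; apply: derive_val.
Qed.

Lemma isdyE f df : isdy f df -> dy f = df.
Proof.
by move=> h; apply/funext => z; rewrite dyE derive1E; have := h z => ?; apply: derive_val.
Qed.

Lemma Ck_step n f df1 df2 : isdx f df1 -> isdy f df2 -> Ck n df1 -> Ck n df2 ->
  Ck n.+1 f.
Proof.
move=> h1 h2 c1 c2; split; last by rewrite (isdxE h1) (isdyE h2).
move=> z; rewrite derivable_x derivable_y.
by have := h1 z; have := h2 z => ? ?; split; apply: ex_derive.
Qed.

Lemma smooth2_dx f : smooth2 f -> smooth2 (dx f).
Proof. by move=> sf n; have [_ []] := sf n.+1. Qed.

Lemma smooth2_dy f : smooth2 f -> smooth2 (dy f).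
Proof. by move=> sf n; have [_ []] := sf n.+1. Qed.

Lemma smooth2_Dxy f a b : smooth2 f -> smooth2 (Dxy a b f).
Proof.
move=> sf; rewrite /Dxy; have sb : smooth2 (iter b dy f).
  by elim: b => [//|b IH] /=; exact: smooth2_dy.
by elim: a => [//|a IH] /=; exact: smooth2_dx.
Qed.

Lemma smooth2_cont f : smooth2 f -> continuous f.
Proof. by move=> sf; exact: (sf 0%N). Qed.

Let der_isdx f z : derivable f z (1, 0) ->
  is_derive z.1 1 (fun t => f (t, z.2)) (dx f z).
Proof. by rewrite derivable_x dxE derive1E => /derivableP. Qed.

Let der_isdy f z : derivable f z (0, 1) ->
  is_derive z.2 1 (fun t => f (z.1, t)) (dy f z).
Proof. by rewrite derivable_y dyE derive1E => /derivableP. Qed.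

Lemma smooth2_isdx f : smooth2 f -> isdx f (dx f).
Proof. by move=> sf z; have [+ _] := sf 1%N => /(_ z)[/der_isdx]. Qed.

Lemma smooth2_isdy f : smooth2 f -> isdy f (dy f).
Proof. by move=> sf z; have [+ _] := sf 1%N => /(_ z)[_ /der_isdy]. Qed.

Lemma isdxD f g df dg : isdx f df -> isdx g dg ->
  isdx (fun z => f z + g z) (fun z => df z + dg z).
Proof. by move=> h1 h2 z; apply: is_deriveD. Qed.

Lemma isdyD f g df dg : isdy f df -> isdy g dg ->
  isdy (fun z => f z + g z) (fun z => df z + dg z).
Proof. by move=> h1 h2 z; apply: is_deriveD. Qed.

Lemma isdxM f g df dg : isdx f df -> isdx g dg ->
  isdx (fun z => f z * g z) (fun z => f z * dg z + g z * df z).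
Proof.
move=> h1 h2 [x y].
exact: (@is_deriveM _ _ (fun t => f (t, y)) (fun t => g (t, y)) x 1 _ _ (h1 (x, y)) (h2 (x, y))).
Qed.

Lemma isdyM f g df dg : isdy f df -> isdy g dg ->
  isdy (fun z => f z * g z) (fun z => f z * dg z + g z * df z).
Proof.
move=> h1 h2 [x y].
exact: (@is_deriveM _ _ (fun t => f (x, t)) (fun t => g (x, t)) y 1 _ _ (h1 (x, y)) (h2 (x, y))).
Qed.

Lemma CkD n f g : Ck n f -> Ck n g -> Ck n (fun z => f z + g z).
Proof.
elim: n f g => [|n IH] f g /=; first by move=> cf cg z; apply: cvgD; [exact: cf|exact: cg].
move=> [df [f1 f2]] [dg [g1 g2]].
have fx : isdx f (dx f) by move=> z; case: (df z) => /der_isdx.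
have fy : isdy f (dy f) by move=> z; case: (df z) => _ /der_isdy.
have gx : isdx g (dx g) by move=> z; case: (dg z) => /der_isdx.
have gy : isdy g (dy g) by move=> z; case: (dg z) => _ /der_isdy.
apply: (Ck_step (isdxD fx gx) (isdyD fy gy)); exact: IH.
Qed.

Lemma smooth2D f g : smooth2 f -> smooth2 g -> smooth2 (fun z => f z + g z).
Proof. by move=> sf sg n; exact: CkD. Qed.

Lemma smooth2M f g : smooth2 f -> smooth2 g -> smooth2 (fun z => f z * g z).
Proof.
move=> sf sg n; elim: n f g sf sg => [|n IH] f g sf sg.
  by move=> z; apply: cvgM; apply: smooth2_cont.
have Mx := isdxM (smooth2_isdx sf) (smooth2_isdx sg).
have My := isdyM (smooth2_isdy sf) (smooth2_isdy sg).
apply: (Ck_step Mx My).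
  apply: CkD; [exact: IH sf (smooth2_dx sg)|exact: IH sg (smooth2_dx sf)].
apply: CkD; [exact: IH sf (smooth2_dy sg)|exact: IH sg (smooth2_dy sf)].
Qed.

Lemma smooth2_cst (c : R) : smooth2 (fun=> c).
Proof.
move=> n; elim: n c => [|n IH] c; first by move=> z; exact: cvg_cst.
by apply: (@Ck_step _ _ (fun=> 0) (fun=> 0)) => // z; exact: is_derive_cst.
Qed.

Lemma smooth2Z (c : R) f : smooth2 f -> smooth2 (fun z => c * f z).
Proof. by apply: smooth2M; exact: smooth2_cst. Qed.

Lemma dxD f g z : smooth2 f -> smooth2 g ->
  dx (fun z => f z + g z) z = dx f z + dx g z.
Proof. by move=> sf sg; rewrite (isdxE (isdxD (smooth2_isdx sf) (smooth2_isdx sg))). Qed.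

Lemma dyD f g z : smooth2 f -> smooth2 g ->
  dy (fun z => f z + g z) z = dy f z + dy g z.
Proof. by move=> sf sg; rewrite (isdyE (isdyD (smooth2_isdy sf) (smooth2_isdy sg))). Qed.

Lemma dxM f g z : smooth2 f -> smooth2 g ->
  dx (fun z => f z * g z) z = f z * dx g z + g z * dx f z.
Proof. by move=> sf sg; rewrite (isdxE (isdxM (smooth2_isdx sf) (smooth2_isdx sg))). Qed.

Lemma dyM f g z : smooth2 f -> smooth2 g ->
  dy (fun z => f z * g z) z = f z * dy g z + g z * dy f z.
Proof. by move=> sf sg; rewrite (isdyE (isdyM (smooth2_isdy sf) (smooth2_isdy sg))). Qed.

Lemma isdx_tensor (a b : R -> R) : smooth1 a ->
  isdx (fun z => a z.1 * b z.2) (fun z => derive1 a z.1 * b z.2).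
Proof.
move=> sa [x y] /=; have h := smooth1_is x sa.
have h2 : is_derive x 1 (fun=> b y) 0 by exact: is_derive_cst.
have := @is_deriveM _ _ a (fun=> b y) x 1 _ _ h h2.
by rewrite scaler0 add0r (_ : b y *: _ = derive1 a x * b y)//; exact: mulrC.
Qed.

Lemma isdy_tensor (a b : R -> R) : smooth1 b ->
  isdy (fun z => a z.1 * b z.2) (fun z => a z.1 * derive1 b z.2).
Proof.
move=> sb [x y] /=; have h := smooth1_is y sb.
have h2 : is_derive y 1 (fun=> a x) 0 by exact: is_derive_cst.
have := @is_deriveM _ _ (fun=> a x) b y 1 _ _ h2 h.
by rewrite scaler0 addr0 -[_ *: _]/(a x * _).
Qed.

Lemma cont_fst (a : R -> R) : continuous a -> continuous (fun z : R * R => a z.1).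
Proof. by move=> ca z; apply: continuous_comp; [exact: cvg_fst|exact: ca]. Qed.

Lemma cont_snd (a : R -> R) : continuous a -> continuous (fun z : R * R => a z.2).
Proof. by move=> ca z; apply: continuous_comp; [exact: cvg_snd|exact: ca]. Qed.

Lemma smooth2_tensor (a b : R -> R) : smooth1 a -> smooth1 b ->
  smooth2 (fun z => a z.1 * b z.2).
Proof.
move=> sa sb n; elim: n a b sa sb => [|n IH] a b sa sb.
  move=> z; apply: cvgM; first exact: (cont_fst (smooth1_cont sa)).
  exact: (cont_snd (smooth1_cont sb)).
apply: (Ck_step (isdx_tensor b sa) (isdy_tensor a sb)); apply: IH => //; exact: smooth1_d1.
Qed.

Lemma smooth2_slicex f y : smooth2 f -> smooth1 (fun x => f (x, y)).
Proof.
move=> sf n; elim: n f sf => [//|n IH] f sf.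
apply: (@Cn_step _ _ (fun x => dx f (x, y))).
  by move=> x; exact: (smooth2_isdx sf (x, y)).
exact: IH (smooth2_dx sf).
Qed.

Lemma smooth2_slicey f x : smooth2 f -> smooth1 (fun y => f (x, y)).
Proof.
move=> sf n; elim: n f sf => [//|n IH] f sf.
apply: (@Cn_step _ _ (fun y => dy f (x, y))).
  by move=> y; exact: (smooth2_isdy sf (x, y)).
exact: IH (smooth2_dy sf).
Qed.

Lemma near_dx0 f (P : set (R * R)) z : open P -> (forall w, P w -> f w = 0) ->
  P z -> dx f z = 0.
Proof.
move=> oP f0 Pz.
rewrite /dx -(@near_eq_derive _ _ _ (cst 0) f z (1, 0)) ?derive_cst//.
have : \forall y \near z, P y by apply: open_nbhs_nbhs.
by apply: filterS => y Py; rewrite f0.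
Qed.

Lemma near_dy0 f (P : set (R * R)) z : open P -> (forall w, P w -> f w = 0) ->
  P z -> dy f z = 0.
Proof.
move=> oP f0 Pz.
rewrite /dy -(@near_eq_derive _ _ _ (cst 0) f z (0, 1)) ?derive_cst//.
have : \forall y \near z, P y by apply: open_nbhs_nbhs.
by apply: filterS => y Py; rewrite f0.
Qed.

(* The second difference quotients of f at (x, y) equal both
   d_x d_y f and d_y d_x f at nearby points. *)
Lemma schwarz f : smooth2 f -> dx (dy f) = dy (dx f).
Proof.
move=> sf; apply/funext => -[x y]; apply/eqP; rewrite -subr_eq0 -normr_le0.
apply/ler_addgt0Pr => e e0; rewrite add0r.
have cw (g : R -> R) u v : smooth1 g -> {within `[u, v], continuous g}.
  by move=> sg; apply: continuous_subspaceT; exact: smooth1_cont.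
have isder (g : R -> R) (u v : R) : is_derive u 1 g v -> derivable g u 1.
  by case.
have sxy : smooth2 (dx (dy f)) by exact/smooth2_dx/smooth2_dy.
have syx : smooth2 (dy (dx f)) by exact/smooth2_dy/smooth2_dx.
have /cvgrPdist_le/(_ (e / 2)) := @smooth2_cont _ sxy (x, y).
have e2 : 0 < e / 2 by rewrite divr_gt0.
move=> /(_ e2) [[A1 A2] /= [/nbhs_ballP[d1 /= d10 h1] /nbhs_ballP[d2 /= d20 h2]] hA].
have /cvgrPdist_le/(_ _ e2) := @smooth2_cont _ syx (x, y).
move=> [[A3 A4] /= [/nbhs_ballP[d3 /= d30 h3] /nbhs_ballP[d4 /= d40 h4]] hA'].
pose d := Num.min (Num.min d1 d2) (Num.min d3 d4) / 2.
have d0 : 0 < d by rewrite divr_gt0// !lt_min d10 d20 d30 d40.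
have [dd1 dd2 dd3 dd4] : [/\ d < d1, d < d2, d < d3 & d < d4].
  have dd : d < Num.min (Num.min d1 d2) (Num.min d3 d4).
    by rewrite gtr_pMr ?invf_lt1 ?ltr1n// !lt_min d10 d20 d30 d40.
  by move: dd; rewrite !lt_min => /andP[/andP[? ?] /andP[? ?]].
have bl (u d' : R) c : u < c < u + d -> d < d' -> ball u d' c.
  by move=> /andP[uc cu] dd'; rewrite /ball/= distrC ltr_norml; apply/andP; split; lra.
have xd : x < x + d by rewrite ltrDl.
have yd : y < y + d by rewrite ltrDl.
pose D := f (x + d, y + d) - f (x, y + d) - (f (x + d, y) - f (x, y)).
have [c1 [c2 [hc1 hc2 E1]]] : exists c1 c2, [/\ x < c1 < x + d, y < c2 < y + d &
    D = dx (dy f) (c1, c2) * (d * d)].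
  have sg : forall t : R, is_derive t 1 (fun t => f (x + d, t) - f (x, t))
      (dy f (x + d, t) - dy f (x, t)).
    by move=> t; apply: is_deriveB; [exact: (smooth2_isdy sf (x + d, t))|
      exact: (smooth2_isdy sf (x, t))].
  have [c2 + E] := MVT yd (fun t _ => sg t)
    (derivable_within_continuous (fun t _ => isder _ _ _ (sg t))).
  rewrite in_itv/= => hc2.
  have [c1 + E'] := @MVT _ (fun t => dy f (t, c2)) (fun t => dx (dy f) (t, c2)) _ _ xd
    (fun t _ => smooth2_isdx (smooth2_dy sf) (t, c2))
    (cw _ _ _ (smooth2_slicex c2 (smooth2_dy sf))).
  rewrite in_itv/= => hc1; exists c1, c2; split; [exact: hc1|exact: hc2|].
  by move: E E' => /= E E'; rewrite /D E E'; ring.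
have [c3 [c4 [hc3 hc4 E2]]] : exists k1 k2, [/\ x < k1 < x + d, y < k2 < y + d &
    D = dy (dx f) (k1, k2) * (d * d)].
  have sg : forall t : R, is_derive t 1 (fun t => f (t, y + d) - f (t, y))
      (dx f (t, y + d) - dx f (t, y)).
    by move=> t; apply: is_deriveB; [exact: (smooth2_isdx sf (t, y + d))|
      exact: (smooth2_isdx sf (t, y))].
  have [k1 + E] := MVT xd (fun t _ => sg t)
    (derivable_within_continuous (fun t _ => isder _ _ _ (sg t))).
  rewrite in_itv/= => hk1.
  have [k2 + E'] := @MVT _ (fun t => dx f (k1, t)) (fun t => dy (dx f) (k1, t)) _ _ yd
    (fun t _ => smooth2_isdy (smooth2_dx sf) (k1, t))
    (cw _ _ _ (smooth2_slicey k1 (smooth2_dx sf))).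
  rewrite in_itv/= => hk2; exists k1, k2; split; [exact: hk1|exact: hk2|].
  have -> : D = f (x + d, y + d) - f (x + d, y) - (f (x, y + d) - f (x, y)).
    by rewrite /D; ring.
  by move: E E' => /= E E'; rewrite E E'; ring.
have E3 : dx (dy f) (c1, c2) = dy (dx f) (c3, c4).
  have dd0 : d * d != 0 by rewrite mulf_neq0// gt_eqF.
  by move: E1; rewrite E2 => /(mulIf dd0) ->.
have n1 : `|dx (dy f) (x, y) - dx (dy f) (c1, c2)| <= e / 2.
  by apply: (hA (c1, c2)); split; [apply: h1; exact: bl|apply: h2; exact: bl].
have n2 : `|dy (dx f) (x, y) - dy (dx f) (c3, c4)| <= e / 2.
  by apply: (hA' (c3, c4)); split; [apply: h3; exact: bl|apply: h4; exact: bl].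
move: n1 n2; rewrite E3; move: (dx (dy f) _) (dy (dx f) (x, y)) (dy (dx f) _).
by move=> A B C; rewrite !ler_norml => /andP[? ?] /andP[? ?]; apply/andP; split; lra.
Qed.

Lemma dx_dyn b f : smooth2 f -> dx (iter b dy f) = iter b dy (dx f).
Proof.
elim: b f => [//|b IH] f sf; rewrite !iterSr IH; last exact: smooth2_dy.
by rewrite schwarz.
Qed.

Lemma DxySl a b f : Dxy a.+1 b f = dx (Dxy a b f).
Proof. by []. Qed.

Lemma DxySr a b f : Dxy a b.+1 f = Dxy a b (dy f).
Proof. by rewrite /Dxy iterSr. Qed.

(** [Dxy] applies the [y]-derivatives first, so an [x]-derivative on the inside has to cross all of
    them by Schwarz's theorem. *)
Lemma Dxy_dx a b f : smooth2 f -> Dxy a b (dx f) = dx (Dxy a b f).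
Proof. by move=> sf; rewrite /Dxy -dx_dyn// -iterSr. Qed.

End Calculus2.

(** * Mollification *)

Section FubiniRect.
Context d1 d2 (T1 : measurableType d1) (T2 : measurableType d2) (R : realType).
Variable m1 : {sigma_finite_measure set T1 -> \bar R}.
Variable m2 : {sigma_finite_measure set T2 -> \bar R}.
Variables (A : set T1) (B : set T2).
Hypotheses (mA : measurable A) (mB : measurable B).
Implicit Types F : T1 * T2 -> R.

Let mAB : measurable (A `*` B). Proof. exact: measurableX. Qed.

Let restrL F x : A x -> (fun y => ((EFin \o F) \_ (A `*` B)) (x, y)) =
  (EFin \o (fun y => F (x, y))) \_ B.
Proof.
move=> Ax; apply/funext => y; rewrite /patch/=; congr (if _ then _ else _).
by apply/idP/idP; rewrite !inE/=; [case|].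
Qed.

Let restrL0 F x : ~ A x -> (fun y => ((EFin \o F) \_ (A `*` B)) (x, y)) =
  (fun=> 0%E).
Proof.
move=> Ax; apply/funext => y; rewrite /patch/= ifF//; apply/negbTE/negP.
by rewrite inE/= => -[].
Qed.

Let Fint F : Itg (m1 \x m2)%E (A `*` B) F ->
  (m1 \x m2)%E.-integrable setT ((EFin \o F) \_ (A `*` B)).
Proof. by move=> h; apply/(integrable_mkcond _ mAB). Qed.

Lemma fubini_ae F : Itg (m1 \x m2)%E (A `*` B) F ->
  {ae m1, forall x, A x -> Itg m2 B (fun y => F (x, y))}.
Proof.
move=> /Fint/ae_integrable1; apply: filterS => x + Ax.
by rewrite restrL// => h; apply/(integrable_mkcond _ mB).
Qed.

Let GE F x : fubini_F m2 ((EFin \o F) \_ (A `*` B)) x =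
  ((fun x => \int[m2]_(y in B) (F (x, y))%:E)%E \_ A) x.
Proof.
rewrite /fubini_F /patch; case: ifPn; rewrite ?inE ?notin_setE => Ax.
  by rewrite restrL// -integral_mkcond.
by rewrite restrL0// integral0.
Qed.

Let GI F : Itg (m1 \x m2)%E (A `*` B) F ->
  m1.-integrable A (fun x => \int[m2]_(y in B) (F (x, y))%:E)%E.
Proof.
move=> /Fint h; have := integrable_fubini_F h.
by rewrite (funext (GE F)) => /(integrable_mkcond _ mA).
Qed.

Lemma fubini_Itg F : Itg (m1 \x m2)%E (A `*` B) F ->
  Itg m1 A (fun x => \int[m2]_(y in B) F (x, y)).
Proof.
move=> /GI h; apply: le_integrable (h) => //.
  apply/measurable_EFinP; apply: measurableT_comp => //.
  exact: measurable_int h.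
(* Where the inner integral is infinite its real value is the default 0, which is dominated all the
   same. *)
move=> x Ax /=; rewrite /Rintegral.
by case: (\int[m2]_(y in B) _)%E => [r||] //=; rewrite ?normr0 ?leey.
Qed.

Lemma fubini_I F : Itg (m1 \x m2)%E (A `*` B) F ->
  \int[(m1 \x m2)%E]_(z in A `*` B) F z =
  \int[m1]_(x in A) \int[m2]_(y in B) F (x, y).
Proof.
move=> IF; rewrite /Rintegral; congr fine.
rewrite integral_mkcond -(integral12_prod_meas1 (Fint IF)).
rewrite (funext (GE F)) -integral_mkcond.
(* The inner integral is finite only for almost every [x]; elsewhere its real version is 0, so the
   extended and the real iterated integrals are compared almost everywhere. *)
have h := GI IF; have h2 := fubini_Itg IF.
apply: ae_eq_integral => //; [exact: measurable_int h|exact: measurable_int h2|].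
have := integrable_ae mA h; apply: filterS => x + Ax => /(_ Ax) /=.
by move=> hf; rewrite fineK.
Qed.

Let restrR F y : B y -> (fun x => ((EFin \o F) \_ (A `*` B)) (x, y)) =
  (EFin \o (fun x => F (x, y))) \_ A.
Proof.
move=> By; apply/funext => x; rewrite /patch/=; congr (if _ then _ else _).
by apply/idP/idP; rewrite !inE/=; [case|].
Qed.

Let restrR0 F y : ~ B y -> (fun x => ((EFin \o F) \_ (A `*` B)) (x, y)) =
  (fun=> 0%E).
Proof.
move=> By; apply/funext => x; rewrite /patch/= ifF//; apply/negbTE/negP.
by rewrite inE/= => -[].
Qed.

Lemma fubini_ae2 F : Itg (m1 \x m2)%E (A `*` B) F ->
  {ae m2, forall y, B y -> Itg m1 A (fun x => F (x, y))}.
Proof.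
move=> /Fint/ae_integrable2; apply: filterS => x + Ax.
by rewrite restrR// => h; apply/(integrable_mkcond _ mA).
Qed.

Let GE2 F y : fubini_G m1 ((EFin \o F) \_ (A `*` B)) y =
  ((fun y => \int[m1]_(x in A) (F (x, y))%:E)%E \_ B) y.
Proof.
rewrite /fubini_G /patch; case: ifPn; rewrite ?inE ?notin_setE => Ay.
  by rewrite restrR// -integral_mkcond.
by rewrite restrR0// integral0.
Qed.

Let GI2 F : Itg (m1 \x m2)%E (A `*` B) F ->
  m2.-integrable B (fun y => \int[m1]_(x in A) (F (x, y))%:E)%E.
Proof.
move=> /Fint h; have mG := measurable_fubini_G h; have mF := measurable_int _ h.
suff : m2.-integrable setT (fubini_G m1 ((EFin \o F) \_ (A `*` B))).
  by rewrite (funext (GE2 F)) => /(integrable_mkcond _ mB).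
have hh : (\int[m2]_y \int[m1]_x `|((EFin \o F) \_ (A `*` B)) (x, y)| < +oo)%E.
  by apply/integrable21ltyP.
apply/integrableP; split; first exact: mG.
apply: le_lt_trans hh.
apply: ge0_le_integral => //; first exact: measurableT_comp.
  apply: (measurable_fun_fubini_tonelli_G (abse \o ((EFin \o F) \_ (A `*` B)))).
    exact: measurableT_comp.
  by move=> z; exact: abse_ge0.
move=> y _; apply: le_abse_integral => //.
exact: (measurable_fun_pair1 y mF).
Qed.

Lemma fubini_Itg2 F : Itg (m1 \x m2)%E (A `*` B) F ->
  Itg m2 B (fun y => \int[m1]_(x in A) F (x, y)).
Proof.
move=> /GI2 h; apply: le_integrable (h) => //.
  apply/measurable_EFinP; apply: measurableT_comp => //.
  exact: measurable_int h.
move=> x Ax /=; rewrite /Rintegral.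
by case: (\int[m1]_(y in A) _)%E => [r||] //=; rewrite ?normr0 ?leey.
Qed.

Lemma fubini_I2 F : Itg (m1 \x m2)%E (A `*` B) F ->
  \int[(m1 \x m2)%E]_(z in A `*` B) F z =
  \int[m2]_(y in B) \int[m1]_(x in A) F (x, y).
Proof.
move=> IF; rewrite /Rintegral; congr fine.
rewrite integral_mkcond -(integral21_prod_meas1 (Fint IF)).
rewrite (funext (GE2 F)) -integral_mkcond.
have h := GI2 IF; have h2 := fubini_Itg2 IF.
apply: ae_eq_integral => //; [exact: measurable_int h|exact: measurable_int h2|].
have := integrable_ae mB h; apply: filterS => x + Ax => /(_ Ax) /=.
by move=> hf; rewrite fineK.
Qed.

(** Produces the integrability that the previous lemmas presuppose: the absolute value may be
    integrated in either order, and here the slices along [A] come first. *)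
Lemma tonelli_Itg F (g : T2 -> R) : measurable_fun (A `*` B) F ->
  (forall y, B y -> Itg m1 A (fun x => F (x, y)) /\
     \int[m1]_(x in A) `|F (x, y)| <= g y) ->
  Itg m2 B g -> Itg (m1 \x m2)%E (A `*` B) F.
Proof.
move=> mF hF Ig; apply/(integrable_mkcond _ mAB).
have mF' : measurable_fun setT ((EFin \o F) \_ (A `*` B)).
  by apply: (measurable_restrictT _ mAB).1; apply/measurable_EFinP.
apply/integrable21ltyP => //.
have mN : measurable_fun setT
    (fun y => \int[m1]_x `|((EFin \o F) \_ (A `*` B)) (x, y)|)%E.
  apply: (measurable_fun_fubini_tonelli_G (abse \o ((EFin \o F) \_ (A `*` B)))).
    exact: measurableT_comp.
  by move=> z; exact: abse_ge0.
have : (\int[m2]_(y in B) (g y)%:E < +oo)%E by exact: integrable_lty.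
apply: le_lt_trans; rewrite [leRHS]integral_mkcond.
have mg : measurable_fun setT ((EFin \o g) \_ B).
  by apply: (measurable_restrictT _ mB).1; exact: measurable_int Ig.
have key y : (\int[m1]_x `|((EFin \o F) \_ (A `*` B)) (x, y)| <=
             ((EFin \o g) \_ B) y)%E.
  rewrite [leRHS]/patch; case: ifPn; rewrite ?inE ?notin_setE => By.
    have [IF Fg] := hF y By.
    have E x : (`|((EFin \o F) \_ (A `*` B)) (x, y)| =
        ((EFin \o (fun x => `|F (x, y)|%R)) \_ A) x)%E.
      have := restrR F By => /(congr1 (fun f => f x)) ->.
      by rewrite /patch; case: ifPn => _; rewrite ?abse0.
    under eq_integral do rewrite E; rewrite -integral_mkcond.
    rewrite -[leLHS]fineK; last by apply: integrable_fin_num => //; exact: Itg_norm IF.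
    by rewrite lee_fin.
  have E x : (`|((EFin \o F) \_ (A `*` B)) (x, y)| = 0)%E.
    by have := restrR0 F By => /(congr1 (fun f => f x)) ->; rewrite abse0.
  by under eq_integral do rewrite E; rewrite integral0.
by apply: ge0_le_integral => // y _; exact: integral_ge0.
Qed.

End FubiniRect.

(** * Convolution over the rectangle with smooth kernels *)

Section Plane2.
Context {R : realType}.
Notation RR := (measurableTypeR R * measurableTypeR R)%type.
Implicit Types (f g u : R * R -> R) (a b : R -> R).

(** An open set is the countable union of the squares with rational centre and radius that it
    contains. This ties the product topology, in which continuity is expressed, to the product
    sigma-algebra. *)
Lemma open2_meas (U : set (R * R)) : open U -> measurable (U : set RR).
Proof.
move=> oU.
pose B (q : rat * rat * rat) : set RR :=
  if pselect (ball ((ratr q.1.1 : R), (ratr q.1.2 : R)) (ratr q.2 : R) `<=` U)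
  then ball (ratr q.1.1 : R) (ratr q.2 : R) `*` ball (ratr q.1.2 : R) (ratr q.2 : R)
  else set0.
have -> : (U : set RR) = \bigcup_q B q.
  rewrite eqEsubset; split=> [[x y] Uxy|z [q _]]; last first.
    by rewrite /B; case: pselect => // h [h1 h2]; apply: h.
  have /nbhs_ballP[e /= e0 he] : nbhs (x, y) U by exact: open_nbhs_nbhs.
  have e3 : 0 < e / 3 by rewrite divr_gt0.
  (* A rational radius [p < e / 3] and a rational centre within [p] of the point: the square
     contains the point and stays in the ball of radius [e]. *)
  have [p] := rat_in_itvoo e3; rewrite in_itv/= => /andP[p0 pe].
  have hp (t : R) : t - ratr p < t by rewrite ltrBlDr ltrDl.
  have [q1] := rat_in_itvoo (hp x).
  rewrite in_itv/= => /andP[q1x xq1].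
  have [q2] := rat_in_itvoo (hp y).
  rewrite in_itv/= => /andP[q2y yq2].
  exists ((q1, q2), p) => //; rewrite /B; case: pselect => [h|nh].
    by split; rewrite /ball/= ltr_norml; apply/andP; split; lra.
  case: nh => -[s t] [/= hs ht]; apply: he; split; rewrite /ball/=.
    by move: hs; rewrite /ball/= !ltr_norml => /andP[? ?]; apply/andP; split; lra.
  by move: ht; rewrite /ball/= !ltr_norml => /andP[? ?]; apply/andP; split; lra.
apply: countable_bigcupT_measurable => // q; rewrite /B; case: pselect => [h|h]; last exact: measurable0.
by apply: measurableX; exact: measurable_ball.
Qed.

Lemma cont2_meas f (D : set RR) : measurable D -> continuous f ->
  measurable_fun D (f : RR -> R).
Proof.
move=> mD /continuousP cf; apply: measurable_funS measurableT (@subsetT _ D) _.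
apply: (measurability _ (RGenOpens.measurableE R)).
move=> _ [_ [x [y ->] <-]]; rewrite setTI; apply: open2_meas.
exact/cf/interval_open.
Qed.

Lemma Itg_contcc (a : R -> R) (x y : R) : continuous a ->
  Itg lebesgue_measure `[x, y] a.
Proof.
move=> ca; apply: continuous_compact_integrable; first exact: segment_compact.
exact: continuous_subspaceT.
Qed.

Lemma Itg_cont (a : R -> R) (x y : R) : continuous a ->
  Itg lebesgue_measure `]x, y[ a.
Proof.
move=> /(@Itg_contcc _ x y); apply: integrableS => //; exact: subset_itv_oo_cc.
Qed.

Lemma FTC_smooth (F : R -> R) (x y : R) : x <= y -> smooth1 F ->
  \int[lebesgue_measure]_(t in `]x, y[) derive1 F t = F y - F x.
Proof.
rewrite le_eqVlt => /predU1P[->|xy] sF.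
  by rewrite set_itvoo0 Rintegral_set0 subrr.
have cF' : continuous (derive1 F) by exact: smooth1_cont (smooth1_d1 sF).
have Icc := Itg_contcc x y cF'.
rewrite Rintegral_itv_bndo_bndc; last exact: Itg_cont.
rewrite Rintegral_itv_obnd_cbnd; last first.
  by apply: integrableS Icc => //; exact: subset_itv_oc_cc.
have -> : F y - F x = fine ((F y)%:E - (F x)%:E) by [].
rewrite /Rintegral (@continuous_FTC2 _ (derive1 F) F x y) //.
  exact: continuous_subspaceT.
split => [z _||]; first exact: smooth1_der.
  by apply: cvg_at_right_filter; exact: smooth1_cont.
by apply: cvg_at_left_filter; exact: smooth1_cont.
Qed.

Variables (L1 L2 : R).

Notation Om := (Omega L1 L2).
Notation I2 f := (\int[leb2]_(z in Om) f z).

Lemma Om_meas : measurable (Om : set RR).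
Proof. exact: measurableX. Qed.

Lemma leb2_rect (A B : set R) : measurable A -> measurable B ->
  leb2 (A `*` B) = (lebesgue_measure A * lebesgue_measure B)%E.
Proof. by move=> mA mB; exact: product_measure1E. Qed.

Lemma Om_fin : (leb2 Om < +oo)%E.
Proof.
rewrite leb2_rect// !lebesgue_measure_itv/=.
by do 2 case: ifP => _; rewrite ?mul0e ?mule0// -EFinD -?EFinM ltry.
Qed.

Let Omr x y : Om (x, y) -> 0 < x < L1 /\ 0 < y < L2.
Proof. by move=> [] /=; rewrite !in_itv. Qed.

Lemma Itg_smooth f : continuous f -> (exists M, forall z, Om z -> `|f z| <= M) ->
  Itg leb2 Om f.
Proof.
move=> cf [M fM]; apply: (Itg_bnd Om_meas Om_fin _ fM).
by apply: cont2_meas => //; exact: Om_meas.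
Qed.

Lemma cont2_bnd f : continuous f -> exists M, forall z, Om z -> `|f z| <= M.
Proof.
move=> cf.
have cK : compact (`[0, L1] `*` `[0, L2] : set (R * R)).
  by apply: compact_setX; exact: segment_compact.
have cn : {within (`[0, L1] `*` `[0, L2] : set (R * R)), continuous f}.
  exact: continuous_subspaceT.
have /compact_bounded := continuous_compact cn cK.
move=> [M [Mr hM]]; exists (M + 1) => -[x y] /Omr[/andP[x0 xL] /andP[y0 yL]].
apply: (hM (M + 1)); first by rewrite ltrDl.
by exists (x, y) => //; split; rewrite /= in_itv/= !ltW.
Qed.

Lemma Itg_cont2 f : continuous f -> Itg leb2 Om f.
Proof. by move=> cf; apply: Itg_smooth => //; exact: cont2_bnd. Qed.

Lemma sqint_cont2 f : continuous f -> sqint leb2 Om f.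
Proof.
move=> cf; have [M hM] := cont2_bnd cf.
apply: (sqint_bnd Om_meas Om_fin _ hM).
by apply: cont2_meas => //; exact: Om_meas.
Qed.

Lemma sqint_contM f u : continuous f -> sqint leb2 Om u ->
  sqint leb2 Om (fun z => f z * u z).
Proof.
move=> cf su; have [M hM] := cont2_bnd cf.
have [] // := sqint_bndM Om_meas _ hM su.
by apply: cont2_meas => //; exact: Om_meas.
Qed.

Definition kern2 a b (z w : R * R) : R := a (z.1 - w.1) * b (z.2 - w.2).

(** Two arbitrary kernels, so that a derivative of a convolution is again a convolution. Integrating
    over the rectangle amounts to extending [u] by zero. *)
Definition conv u a b (z : R * R) : R := I2 (fun w => u w * kern2 a b z w).

Lemma smooth1_refl (x : R) a : smooth1 a -> smooth1 (fun t => a (x - t)).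
Proof.
by move=> /(smooth1_affine x (-1)); congr smooth1; apply/funext => t; rewrite mulN1r.
Qed.

Lemma smooth2_kern2 a b z : smooth1 a -> smooth1 b -> smooth2 (kern2 a b z).
Proof.
move=> sa sb; exact: (smooth2_tensor (smooth1_refl z.1 sa) (smooth1_refl z.2 sb)).
Qed.

Let derive1_refl (x t : R) a : smooth1 a ->
  derive1 (fun t => a (x - t)) t = - derive1 a (x - t).
Proof.
move=> sa; have h := @is_derive_affine _ a x (-1) t _ (smooth1_is (x + -1 * t) sa).
have e : (fun t => a (x + -1 * t)) = (fun t => a (x - t)).
  by apply/funext => s; rewrite mulN1r.
by move: h; rewrite e !mulN1r => h; rewrite derive1E; apply: derive_val.
Qed.

Lemma dx_kern2 a b z w : smooth1 a -> dx (kern2 a b z) w = - kern2 (derive1 a) b z w.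
Proof.
move=> sa; have := isdxE (isdx_tensor (fun t => b (z.2 - t)) (smooth1_refl z.1 sa)).
by move=> /(congr1 (fun f => f w)) /= ->; rewrite derive1_refl// mulNr.
Qed.

Lemma dy_kern2 a b z w : smooth1 b -> dy (kern2 a b z) w = - kern2 a (derive1 b) z w.
Proof.
move=> sb; have := isdyE (isdy_tensor (fun t => a (z.1 - t)) (smooth1_refl z.2 sb)).
by move=> /(congr1 (fun f => f w)) /= ->; rewrite derive1_refl// mulrN.
Qed.

Lemma Itg_kern2 u e a b z : Itg leb2 Om u -> ckern e a -> ckern e b ->
  Itg leb2 Om (fun w => u w * kern2 a b z w).
Proof.
move=> Iu ka kb; have [M hM] := ckern_bnd ka; have [N hN] := ckern_bnd kb.
have cK : continuous (kern2 a b z).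
  by apply: smooth2_cont; apply: smooth2_kern2; [case: ka|case: kb].
have mO := Om_meas.
apply: (Itg_le mO (g := fun w => (M * N) * `|u w|)).
- apply: measurable_funM; first exact: Itg_meas Iu.
  exact: cont2_meas.
- move=> w _; rewrite normrM mulrC; apply: ler_wpM2r => //.
  by rewrite /kern2 normrM; apply: ler_pM.
- by apply: ItgZ => //; exact: Itg_norm.
Qed.

Lemma is_derive_I u (k k' : R -> RR -> R) (M x : R) : Itg leb2 Om u ->
  (forall s, measurable_fun Om (k s)) ->
  (forall s w, `|k s w| <= M) -> (forall s w, `|k' s w| <= M) ->
  (forall (s : R) w, is_derive s 1 (k^~ w) (k' s w)) ->
  is_derive x 1 (fun s => I2 (fun w => u w * k s w)) (I2 (fun w => u w * k' x w)).
Proof.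
move=> Iu mk kM kM' dk; have mO := Om_meas.
pose F (s : R) (w : RR) := u w * k s w.
pose G (w : RR) := M * `|u w|.
have dF (s : R) (w : RR) : is_derive s 1 (F^~ w) (u w * k' s w).
  have h2 : is_derive s 1 (fun=> u w) 0 by exact: is_derive_cst.
  have := @is_deriveM _ _ (fun=> u w) (k^~ w) s 1 _ _ h2 (dk s w).
  by rewrite scaler0 addr0.
have IG : Itg leb2 Om G by apply: (ItgZ mO); exact: Itg_norm.
have xI : `]x - 1, x + 1[%classic x by rewrite /= in_itv/= ltrBlDr !ltrDl ltr01.
have IF s : `]x - 1, x + 1[%classic s -> leb2.-integrable Om (EFin \o F s).
  move=> _; apply: (Itg_le mO _ _ IG).
    by apply: measurable_funM; [exact: Itg_meas Iu|exact: mk].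
  by move=> w _; rewrite normrM mulrC; apply: ler_wpM2r.
have dd s w : (`]x - 1, x + 1[%classic : set R) s -> Om w -> derivable (F^~ w) s 1.
  by move=> _ _; have := dF s w => ?; apply: ex_derive.
have M0 : 0 <= M by rewrite (le_trans _ (kM 0 (0, 0))).
have G0 w : 0 <= G w by rewrite /G !mulr_ge0.
have p1 s w : partial1of2 F s w = u w * k' s w.
  by rewrite partial1of2E; have := dF s w => ?; apply: derive_val.
have GF s w : `]x - 1, x + 1[%classic s -> Om w -> `|partial1of2 F s w| <= G w.
  by move=> _ _; rewrite p1 normrM mulrC; apply: ler_wpM2r.
have h1 := derivable_under_integral mO xI IF dd G0 IG GF.
have h2 := differentiation_under_integral mO xI IF dd G0 IG GF.
apply: DeriveDef; first exact: h1.
rewrite -derive1E; apply: etrans h2 _.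
by apply: eq_Rintegral => w _; rewrite p1.
Qed.

Lemma kern2_bnd e a b : ckern e a -> ckern e b ->
  exists M, forall z w, `|kern2 a b z w| <= M.
Proof.
move=> ka kb; have [M hM] := ckern_bnd ka; have [N hN] := ckern_bnd kb.
by exists (M * N) => z w; rewrite /kern2 normrM; apply: ler_pM.
Qed.

Let is_derive_transl a (x c : R) : smooth1 a ->
  is_derive x 1 (fun s => a (s - c)) (derive1 a (x - c)).
Proof.
move=> sa; have := @is_derive_affine _ a (- c) 1 x _ (smooth1_is (- c + 1 * x) sa).
have e1 : (fun t => a (- c + 1 * t)) = (fun t => a (t - c)).
  by apply/funext => t; rewrite mul1r addrC.
by rewrite e1 !mul1r addrC.
Qed.

Let meas_kern2 a b z : smooth1 a -> smooth1 b -> measurable_fun Om (kern2 a b z).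
Proof.
move=> sa sb; apply: cont2_meas; first exact: Om_meas.
by apply: smooth2_cont; apply: smooth2_kern2.
Qed.

Lemma isdx_conv u e a b : Itg leb2 Om u -> ckern e a -> ckern e b ->
  isdx (conv u a b) (conv u (derive1 a) b).
Proof.
move=> Iu ka kb [x y] /=.
have [M hM] := kern2_bnd ka kb; have [N hN] := kern2_bnd (ckern_d1 ka) kb.
have [sa _] := ka; have [sb _] := kb.
apply: (@is_derive_I u (fun s w => kern2 a b (s, y) w)
  (fun s w => kern2 (derive1 a) b (s, y) w) (Num.max M N)) => //.
- by move=> s; exact: meas_kern2.
- by move=> s w; rewrite le_max hM.
- by move=> s w; rewrite le_max hN orbT.
move=> s w; have h2 : is_derive s 1 (fun=> b (y - w.2)) 0 by exact: is_derive_cst.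
have := @is_deriveM _ _ _ _ s 1 _ _ (is_derive_transl s w.1 sa) h2.
by rewrite scaler0 add0r (_ : _ *: _ = kern2 (derive1 a) b (s, y) w)//; exact: mulrC.
Qed.

Lemma isdy_conv u e a b : Itg leb2 Om u -> ckern e a -> ckern e b ->
  isdy (conv u a b) (conv u a (derive1 b)).
Proof.
move=> Iu ka kb [x y] /=.
have [M hM] := kern2_bnd ka kb; have [N hN] := kern2_bnd ka (ckern_d1 kb).
have [sa _] := ka; have [sb _] := kb.
apply: (@is_derive_I u (fun s w => kern2 a b (x, s) w)
  (fun s w => kern2 a (derive1 b) (x, s) w) (Num.max M N)) => //.
- by move=> s; exact: meas_kern2.
- by move=> s w; rewrite le_max hM.
- by move=> s w; rewrite le_max hN orbT.
move=> s w; have h2 : is_derive s 1 (fun=> a (x - w.1)) 0 by exact: is_derive_cst.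
have := @is_deriveM _ _ _ _ s 1 _ _ h2 (is_derive_transl s w.2 sb).
by rewrite scaler0 addr0.
Qed.

Lemma cont_lip2 f (C : R) : (forall z w, `|f z - f w| <= C * (`|z.1 - w.1| + `|z.2 - w.2|)) ->
  continuous f.
Proof.
move=> fC [x y]; apply/cvgrPdist_le => e e0.
have C0 : 0 <= C.
  have := fC (1, 0) (0, 0); rewrite /= subr0 subrr normr0 addr0 normr1 mulr1.
  exact: le_trans.
have d0 : 0 < e / (2 * (C + 1)) by rewrite divr_gt0// mulr_gt0// ltr_wpDl.
have /cvgrPdist_le/(_ _ d0) hx : (z : R * R).1 @[z --> (x, y)] --> x by exact: cvg_fst.
have /cvgrPdist_le/(_ _ d0) hy : (z : R * R).2 @[z --> (x, y)] --> y by exact: cvg_snd.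
near=> z.
apply: le_trans (fC _ _) _.
have z1 : `|x - z.1| <= e / (2 * (C + 1)) by near: z; exact: hx.
have z2 : `|y - z.2| <= e / (2 * (C + 1)) by near: z; exact: hy.
have C1 : 0 < C + 1 by rewrite ltr_wpDl.
have -> : e = (C + 1) * (e / (2 * (C + 1)) + e / (2 * (C + 1))).
  by field; rewrite gt_eqF.
apply: ler_pM; [exact: C0|exact: addr_ge0|by rewrite lerDl|exact: lerD].
Unshelve. all: by end_near. Qed.

Lemma cont_conv u e a b : Itg leb2 Om u -> ckern e a -> ckern e b ->
  continuous (conv u a b).
Proof.
move=> Iu ka kb; have mO := Om_meas.
have [M hM] := ckern_bnd ka; have [N hN] := ckern_bnd kb.
have [M' hM'] := ckern_bnd (ckern_d1 ka); have [N' hN'] := ckern_bnd (ckern_d1 kb).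
have [sa _] := ka; have [sb _] := kb.
have M0 : 0 <= M by rewrite (le_trans _ (hM 0)).
have N0 : 0 <= N by rewrite (le_trans _ (hN 0)).
have M'0 : 0 <= M' by rewrite (le_trans _ (hM' 0)).
have N'0 : 0 <= N' by rewrite (le_trans _ (hN' 0)).
pose K := M' * N + M * N'.
apply: (@cont_lip2 _ (K * I2 (fun w => `|u w|))) => z w.
rewrite /conv -IB//; [|exact: (Itg_kern2 z Iu ka kb)|exact: (Itg_kern2 w Iu ka kb)].
set d := _ + _; rewrite mulrAC -IZ//; last exact: Itg_norm.
apply: norm_I_le => //.
- apply: ItgB => //; [exact: (Itg_kern2 z Iu ka kb)|exact: (Itg_kern2 w Iu ka kb)].
- by apply: ItgZ => //; exact: Itg_norm.
move=> v _; rewrite -mulrBr normrM mulrC; apply: ler_wpM2r => //.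
rewrite /kern2.
have -> : a (z.1 - v.1) * b (z.2 - v.2) - a (w.1 - v.1) * b (w.2 - v.2) =
  (a (z.1 - v.1) - a (w.1 - v.1)) * b (z.2 - v.2) +
  a (w.1 - v.1) * (b (z.2 - v.2) - b (w.2 - v.2)) by ring.
have ha : `|a (z.1 - v.1) - a (w.1 - v.1)| <= M' * `|z.1 - w.1|.
  by apply: le_trans (smooth1_lip sa hM' _ _) _; rewrite opprB addrA subrK.
have hb : `|b (z.2 - v.2) - b (w.2 - v.2)| <= N' * `|z.2 - w.2|.
  by apply: le_trans (smooth1_lip sb hN' _ _) _; rewrite opprB addrA subrK.
apply: le_trans (ler_normD _ _) _; rewrite !normrM.
have h1 : `|a (z.1 - v.1) - a (w.1 - v.1)| * `|b (z.2 - v.2)| <= (M' * `|z.1 - w.1|) * N.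
  exact: ler_pM.
have h2 : `|a (w.1 - v.1)| * `|b (z.2 - v.2) - b (w.2 - v.2)| <= M * (N' * `|z.2 - w.2|).
  exact: ler_pM.
apply: le_trans (lerD h1 h2) _.
rewrite /K /d mulrDl !mulrDr.
have -> : M' * `|z.1 - w.1| * N = M' * N * `|z.1 - w.1| by ring.
have -> : M * (N' * `|z.2 - w.2|) = M * N' * `|z.2 - w.2| by ring.
have p1 : 0 <= M' * N * `|z.2 - w.2| by rewrite !mulr_ge0.
have p2 : 0 <= M * N' * `|z.1 - w.1| by rewrite !mulr_ge0.
by rewrite lerD// ?lerDl ?lerDr.
Qed.

Lemma smooth2_conv u e a b : Itg leb2 Om u -> ckern e a -> ckern e b ->
  smooth2 (conv u a b).
Proof.
move=> Iu ka kb n; elim: n a b ka kb => [|n IH] a b ka kb.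
  exact: cont_conv Iu ka kb.
apply: (Ck_step (isdx_conv Iu ka kb) (isdy_conv Iu ka kb)).
  exact: IH (ckern_d1 ka) kb.
exact: IH ka (ckern_d1 kb).
Qed.

(* Only the values of u below and to the left of z enter conv u a b z. *)
Lemma conv0 u e a b z : ckern e a -> ckern e b -> z.1 < e \/ z.2 < e ->
  conv u a b z = 0.
Proof.
move=> [_ a0] [_ b0] h; rewrite /conv -[RHS](I0 leb2 Om_meas); apply: eq_I.
move=> [s t] /Omr[/andP[s0 _] /andP[t0 _]]; rewrite /kern2 /=.
case: h => h; first by rewrite a0 ?mul0r ?mulr0//; left; lra.
by rewrite b0 ?mulr0//; left; lra.
Qed.

End Plane2.

Section MeasProj.
Context d1 d2 (T1 : measurableType d1) (T2 : measurableType d2) (R : realType).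
Variables (A : set T1) (B : set T2).

Lemma meas_fstX (a : T1 -> R) : measurable A -> measurable B -> measurable_fun A a ->
  measurable_fun (A `*` B) (fun z => a z.1).
Proof.
move=> mA mB ma; apply: (@measurable_comp _ _ _ _ _ _ A a (A `*` B) fst) => //.
  by move=> _ [z [z1 z2] <-].
by apply: measurable_funTS; exact: measurable_fst.
Qed.

Lemma meas_sndX (b : T2 -> R) : measurable A -> measurable B -> measurable_fun B b ->
  measurable_fun (A `*` B) (fun z => b z.2).
Proof.
move=> mA mB mb; apply: (@measurable_comp _ _ _ _ _ _ B b (A `*` B) snd) => //.
  by move=> _ [z [z1 z2] <-].
by apply: measurable_funTS; exact: measurable_snd.
Qed.

End MeasProj.

Lemma leb2_sigma_finite (R : realType) : sigma_finite setT (@leb2 R).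
Proof.
have /sigma_finiteP[F [TF ndF Foo]] := sigma_finiteT (@lebesgue_measure R).
exists (fun n => F n `*` F n).
  rewrite -setXTT {1 2}TF predeqE => -[x y]; split.
    move=> [/= [n _ Fnx] [k _ Gky]]; exists (maxn n k) => //; split.
    - by move: x Fnx; exact/subsetPset/ndF/leq_maxl.
    - by move: y Gky; exact/subsetPset/ndF/leq_maxr.
  by move=> [n _ []/= ? ?]; split; exists n.
move=> k; have [? ?] := Foo k.
split; first exact: measurableX.
by rewrite leb2_rect// lte_mul_pinfty// ge0_fin_numE.
Qed.

(* leb2 as a plain function, the key for its sigma-finite instance *)
Definition leb2f (R : realType) :
  set (measurableTypeR R * measurableTypeR R) -> \bar R := @leb2 R.
HB.instance Definition _ (R : realType) := Measure.copy (@leb2f R) (@leb2 R).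
HB.instance Definition _ (R : realType) :=
  Measure_isSigmaFinite.Build _ (measurableTypeR R * measurableTypeR R)%type R
    (@leb2f R) (@leb2_sigma_finite R).

(** * Uniform L^2 bounds for integral operators of mollifier type *)

Section Young.
Context {R : realType}.
Notation RR := (measurableTypeR R * measurableTypeR R)%type.
Implicit Types (f g u : R * R -> R) (a b : R -> R).

Definition leb2s : {sigma_finite_measure set RR -> \bar R} := @leb2f R.

Variables (L1 L2 : R).
Notation Om := (Omega L1 L2).
Notation I2 f := (\int[leb2]_(z in Om) f z).

Lemma I_prodX (A B : set (measurableTypeR R)) a b : measurable A -> measurable B ->
  Itg lebesgue_measure A a -> Itg lebesgue_measure B b ->
  Itg leb2 (A `*` B) (fun z => a z.1 * b z.2) /\
  \int[leb2]_(z in A `*` B) (a z.1 * b z.2) =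
  \int[lebesgue_measure]_(x in A) a x * \int[lebesgue_measure]_(x in B) b x.
Proof.
move=> mA mB Ia Ib.
have h : Itg leb2 (A `*` B) (fun z => a z.1 * b z.2).
  apply: (@tonelli_Itg _ _ _ _ _ (@lebesgue_measure R) (@lebesgue_measure R) _ _
    mA mB _ (fun y => (\int[lebesgue_measure]_(x in A) `|a x|) * `|b y|)).
  - by apply: measurable_funM; [apply: meas_fstX|apply: meas_sndX] => //;
      [exact: Itg_meas Ia|exact: Itg_meas Ib].
  - move=> y _ /=; split.
      by apply: (Itg_eq mA) (ItgZ mA (b y) Ia) => x _; exact: mulrC.
    rewrite -RintegralZr//; last exact: Itg_norm.
    by rewrite le_eqVlt; apply/orP; left; apply/eqP; apply: eq_Rintegral => x _; rewrite normrM.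
  - by apply: ItgZ => //; exact: Itg_norm.
split => //; rewrite (fubini_I mA mB h) /=.
rewrite -RintegralZr//; apply: eq_Rintegral => x _.
by rewrite RintegralZl.
Qed.

Lemma I_prod a b : Itg lebesgue_measure `]0, L1[ a -> Itg lebesgue_measure `]0, L2[ b ->
  Itg leb2 Om (fun z => a z.1 * b z.2) /\
  I2 (fun z => a z.1 * b z.2) = \int[lebesgue_measure]_(x in `]0, L1[) a x *
                                \int[lebesgue_measure]_(x in `]0, L2[) b x.
Proof. by apply: I_prodX; exact: measurable_itv. Qed.

(** A common majorant, up to constants, of the mollifying kernels and of their first derivatives. As
    a multiple of an indicator it is stable under squaring, and it is symmetric in its two
    points. *)
Definition box (e : R) (c : R) (p : RR * RR) : R :=
  if (`|p.1.1 - p.2.1| <= 2 * e) && (`|p.1.2 - p.2.2| <= 2 * e) then c else 0.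

Lemma boxE e c p : box e c p =
  c * \1_[set p : RR * RR | `|p.1.1 - p.2.1| <= 2 * e /\ `|p.1.2 - p.2.2| <= 2 * e] p.
Proof.
rewrite /box indicE; case: ifPn => h.
  by rewrite mem_set ?mulr1//; apply/andP.
by rewrite memNset ?mulr0//= => /andP; rewrite (negbTE h).
Qed.

Lemma meas_box e c : measurable_fun setT (box e c).
Proof.
have m1 : measurable_fun setT (fun p : RR * RR => p.1.1 - p.2.1).
  apply: measurable_funB; first exact: measurableT_comp measurable_fst measurable_fst.
  exact: measurableT_comp measurable_fst measurable_snd.
have m2 : measurable_fun setT (fun p : RR * RR => p.1.2 - p.2.2).
  apply: measurable_funB; first exact: measurableT_comp measurable_snd measurable_fst.
  exact: measurableT_comp measurable_snd measurable_snd.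
have ms (k : RR * RR -> R) : measurable_fun setT k ->
    measurable [set p | `|k p| <= 2 * e].
  move=> mk.
  have := @measurable_fun_le _ _ _ setT (fun p => `|k p|) (cst (2 * e)) measurableT
    (measurableT_comp (@normr_measurable R setT) mk) (measurable_cst _).
  by rewrite setTI.
rewrite (funext (boxE e c)); apply: measurable_funM => //.
apply: measurable_indic; exact: measurableI (ms _ m1) (ms _ m2).
Qed.

Lemma box_sqr e c p : box e c p ^+ 2 = box e (c ^+ 2) p.
Proof. by rewrite /box; case: ifP => //; rewrite expr0n. Qed.

Lemma box_sym e c z w : box e c (z, w) = box e c (w, z).
Proof. by rewrite /box /= distrC (distrC z.2). Qed.

Lemma box_ge0 e c p : 0 <= c -> 0 <= box e c p.
Proof. by rewrite /box; case: ifP. Qed.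

Lemma Itg_box e c z : Itg leb2 Om (fun w => box e c (z, w)).
Proof.
apply: (@Itg_bnd _ _ _ _ _ (Om_meas _ _) (Om_fin _ _) `|c|).
  apply: measurable_funTS; apply: measurableT_comp (meas_box e c) _.
  exact: pair1_measurable.
by move=> w _; rewrite /box; case: ifP; rewrite ?normr0.
Qed.

(** A square of side [4 e] has area [16 e^2], which the height [e ^- 2] compensates at every
    scale. *)
Lemma I_box e z : 0 < e -> I2 (fun w => box e (e ^- 2) (z, w)) <= 16.
Proof.
move=> e0.
pose B : set RR := `[z.1 - 2 * e, z.1 + 2 * e] `*` `[z.2 - 2 * e, z.2 + 2 * e].
have mB : measurable B by exact: measurableX.
have lt2 (t : R) : t - 2 * e < t + 2 * e by lra.
have BE : leb2 B = (16 * e ^+ 2)%:E.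
  rewrite leb2_rect// !lebesgue_measure_itv/= !lte_fin !lt2 -!EFinD -EFinM.
  by congr EFin; ring.
have E w : box e (e ^- 2) (z, w) = e ^- 2 * \1_B w.
  rewrite boxE; congr (_ * _); rewrite !indicE; congr (_%:R); congr nat_of_bool.
  apply/idP/idP; rewrite !inE /B /= !in_itv /= !ler_norml.
    by move=> [/andP[? ?] /andP[? ?]]; split; apply/andP; split; lra.
  by move=> [/andP[? ?] /andP[? ?]]; split; apply/andP; split; lra.
under eq_Rintegral do rewrite E.
have I1 : Itg leb2 Om (\1_B : RR -> R).
  apply: (@Itg_bnd _ _ _ _ _ (Om_meas _ _) (Om_fin _ _) 1).
    by apply: measurable_funTS; exact: measurable_indic.
  by move=> w _; rewrite indicE; case: (w \in B); rewrite ?normr1 ?normr0.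
rewrite RintegralZl//; last exact: Om_meas.
have : I2 (fun w => \1_B w) <= 16 * e ^+ 2.
  rewrite /Rintegral integral_indic//; last exact: Om_meas.
  have -> : 16 * e ^+ 2 = fine (leb2 B) by rewrite BE.
  apply: fine_le.
  - rewrite ge0_fin_numE// (@le_lt_trans _ _ (leb2 B))//; last by rewrite BE ltry.
    by apply: le_measure; rewrite ?inE//; apply: measurableI => //; exact: Om_meas.
  - by rewrite BE.
  - by apply: le_measure; rewrite ?inE//; apply: measurableI => //; exact: Om_meas.
have e2 : 0 < e ^- 2 by rewrite invr_gt0 exprn_gt0.
move=> h; apply: le_trans (ler_wpM2l (ltW e2) h) _.
by rewrite mulrCA mulVf ?mulr1// expf_neq0// gt_eqF.
Qed.

(* Schur test for the kernel e^-2 1_{|z - w|_oo <= 2 e}. *)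
Lemma young e (C : R) u D : 0 < e -> 0 <= C -> sqint leb2 Om u ->
  measurable_fun Om (D : RR -> R) ->
  (forall z, Om z -> `|D z| <= C * I2 (fun w => box e (e ^- 2) (z, w) * `|u w|)) ->
  sqint leb2 Om D /\ sqn leb2 Om D <= (16 * C) ^+ 2 * sqn leb2 Om u.
Proof.
move=> e0 C0 su mD hD.
have mO := Om_meas L1 L2.
have e2 : 0 <= e ^- 2 by rewrite invr_ge0 sqr_ge0.
have [mu Iu2] := su.
pose F (p : RR * RR) := box e (e ^- 2) p * u p.2 ^+ 2.
have IF : Itg (leb2s \x leb2s)%E (Om `*` Om) F.
  apply: (tonelli_Itg mO mO (g := fun w => 16 * u w ^+ 2)).
  - apply: measurable_funM; first (apply: measurable_funTS; exact: meas_box).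
    by apply: measurable_funX; exact: meas_sndX.
  - move=> w _; rewrite /F /=; split.
      apply: (Itg_eq mO) (ItgZ mO (u w ^+ 2) (Itg_box e (e ^- 2) w)) => z _.
      by rewrite box_sym mulrC.
    have E z : `|box e (e ^- 2) (z, w) * u w ^+ 2| = u w ^+ 2 * box e (e ^- 2) (w, z).
      by rewrite normrM !ger0_norm ?sqr_ge0 ?box_ge0// mulrC box_sym.
    under eq_Rintegral do rewrite E.
    rewrite (IZ mO)//; last exact: Itg_box.
    by rewrite mulrC; apply: ler_wpM2r; [exact: sqr_ge0|exact: I_box].
  - exact: ItgZ.
pose H z := I2 (fun w => F (z, w)).
have IH : Itg leb2 Om H := fubini_Itg mO mO IF.
have DH z : Om z -> D z ^+ 2 <= 16 * C ^+ 2 * H z.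
  move=> Omz.
  (* The kernel [e ^- 2] is split into two factors [e^-1], one of which stays with [|u|] in
     Cauchy-Schwarz. *)
  have sb1 : sqint leb2 Om (fun w => box e e^-1 (z, w)).
    split; first exact: Itg_meas (Itg_box _ _ _).
    by apply: (Itg_eq mO) (Itg_box e (e^-1 ^+ 2) z) => w _; rewrite box_sqr.
  have mb : measurable_fun Om (fun w => box e e^-1 (z, w)) by case: sb1.
  have sb2 : sqint leb2 Om (fun w => box e e^-1 (z, w) * `|u w|).
    have hb : forall w, Om w -> `|box e e^-1 (z, w)| <= e^-1.
      have ei : 0 <= e^-1 by rewrite invr_ge0 ltW.
      by move=> w _; rewrite /box; case: ifP => _; rewrite ?normr0 ?ger0_norm.
    have su' : sqint leb2 Om (fun w => `|u w|).
      split; first exact: (measurableT_comp (@normr_measurable R setT) mu).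
      by apply: (Itg_eq mO) Iu2 => w _; rewrite real_normK ?num_real.
    have [h _] := sqint_bndM mO mb hb su'; exact: h.
  have CS := cauchy_schwarz mO sb1 sb2.
  have E1 : \int[leb2]_(w in Om) (box e e^-1 (z, w) * (box e e^-1 (z, w) * `|u w|)) =
            I2 (fun w => box e (e ^- 2) (z, w) * `|u w|).
    by apply: eq_Rintegral => w _; rewrite mulrA -expr2 box_sqr exprVn.
  have E2 : sqn leb2 Om (fun w => box e e^-1 (z, w)) = I2 (fun w => box e (e ^- 2) (z, w)).
    by apply: eq_Rintegral => w _; rewrite box_sqr exprVn.
  have E3 : sqn leb2 Om (fun w => box e e^-1 (z, w) * `|u w|) = H z.
    apply: eq_Rintegral => w _; rewrite exprMn box_sqr exprVn.
    by rewrite real_normK ?num_real.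
  rewrite E1 E2 E3 in CS.
  have H0 : 0 <= H z by rewrite -E3; exact: sqn_ge0.
  rewrite -real_normK ?num_real//.
  apply: le_trans (_ : (C * I2 (fun w => box e (e ^- 2) (z, w) * `|u w|)) ^+ 2 <= _).
    rewrite ler_sqr ?nnegrE//; first exact: hD.
    by rewrite mulr_ge0// Rintegral_ge0// => w _; rewrite mulr_ge0// box_ge0.
  rewrite exprMn (_ : 16 * C ^+ 2 * H z = C ^+ 2 * (16 * H z)); last by ring.
  apply: ler_wpM2l; first exact: sqr_ge0.
  by apply: le_trans CS _; apply: ler_wpM2r => //; exact: I_box.
(* Here the kernel is integrated in its first point, which brings the second factor 16 of
   [(16 * C) ^+ 2]. *)
have HL : I2 H <= 16 * sqn leb2 Om u.
  rewrite /H -[X in X <= _](fubini_I mO mO IF) (fubini_I2 mO mO IF).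
  rewrite /sqn -IZ//; apply: le_I => //; first exact: fubini_Itg2 IF.
    exact: ItgZ.
  move=> w _; rewrite /F /=.
  have E z : box e (e ^- 2) (z, w) * u w ^+ 2 = u w ^+ 2 * box e (e ^- 2) (w, z).
    by rewrite mulrC box_sym.
  under eq_Rintegral do rewrite E.
  rewrite (IZ mO)//; last exact: Itg_box.
  by rewrite mulrC; apply: ler_wpM2r; [exact: sqr_ge0|exact: I_box].
have ID2 : Itg leb2 Om (fun z => D z ^+ 2).
  apply: (Itg_le mO _ _ (ItgZ mO (16 * C ^+ 2) IH)); first exact: measurable_funX.
  by move=> z Omz; rewrite ger0_norm ?sqr_ge0//; exact: DH.
split => //; rewrite /sqn.
apply: le_trans (le_I mO ID2 (ItgZ mO (16 * C ^+ 2) IH) DH) _.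
rewrite IZ//.
apply: le_trans (ler_wpM2l _ HL) _; first by rewrite mulr_ge0// sqr_ge0.
by rewrite -/(sqn leb2 Om u) le_eqVlt; apply/orP; left; apply/eqP; ring.
Qed.

End Young.

(** * Mollified indicators on the line *)

Section MolLebesgue.
Context {R : realType}.
Notation RR := (measurableTypeR R * measurableTypeR R)%type.
Notation mu := (@lebesgue_measure R).

Definition en (n : nat) : R := n.+1%:R^-1.

Lemma en_gt0 n : 0 < en n. Proof. by rewrite invr_gt0. Qed.

Lemma en_cvg : en n @[n --> \oo] --> (0 : R).
Proof. exact: cvg_harmonic. Qed.

(** The kernel lives on one side of [s]; the symmetric interval is chosen because it is a ball
    around [s], as Lebesgue differentiation requires. *)
Lemma mol_I1 (e s : R) : 0 < e ->
  \int[mu]_(t in `]s - 3 * e, s + 3 * e[) mol e (t - s) = 1.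
Proof.
move=> e0.
have sS : smooth1 (fun t => step (- (e^-1 * s) + e^-1 * t)).
  exact: smooth1_affine smooth1_step.
have le3 : s - 3 * e <= s + 3 * e by lra.
have := FTC_smooth le3 sS.
have -> : derive1 (fun t => step (- (e^-1 * s) + e^-1 * t)) = fun t => mol e (t - s).
  apply: is_derive1_eq => t.
  have := @is_derive_affine _ step (- (e^-1 * s)) e^-1 t _ (smooth1_is _ smooth1_step).
  by rewrite /mol mulrBr addrC.
move=> ->; rewrite step1 ?step0 ?subr0//.
  rewrite (_ : _ + _ = -3); first lra.
  by field; rewrite gt_eqF.
rewrite (_ : _ + _ = 3); first lra.
by field; rewrite gt_eqF.
Qed.

Lemma mol_out (e x : R) : 0 < e -> 2 * e < `|x| -> mol e x = 0.
Proof.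
move=> e0 h; have [_] := ckern_mol e0; apply.
by move: h; rewrite ltr_normr => /orP[h|h]; [right|left]; lra.
Qed.

(** Height [M / e] times length [6 e]. The constant, uniform in the scale and in [s], is the
    dominating one in [wk_rect]. *)
Lemma mol_indic_bnd : exists K : R, forall (L e s : R) (A : set R), 0 < e -> measurable A ->
  `|\int[mu]_(t in `]0, L[) (mol e (t - s) * \1_A t)| <= K.
Proof.
have [M [M0 hM]] := @mol_bnd R.
exists (6 * M) => L e s A e0 mA.
pose B := `]s - 3 * e, s + 3 * e[%classic.
have mB : measurable (B : set (measurableTypeR R)) by exact: measurable_itv.
have mL : measurable (`]0, L[%classic : set (measurableTypeR R)) by exact: measurable_itv.
have mm : measurable_fun setT (fun t : measurableTypeR R => mol e (t - s)).
  apply: continuous_measurable_fun; apply: smooth1_cont.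
  have [sm _] := ckern_mol e0; have := smooth1_affine (- s) 1 sm.
  by congr smooth1; apply/funext => t; rewrite mul1r addrC.
have I1 : Itg mu setT (fun t => M / e * \1_B t).
  apply: ItgZ => //; exact: integrable_indic_itv.
have Me : 0 < M / e by rewrite divr_gt0.
have hb t : `|mol e (t - s) * \1_A t| <= M / e * \1_B t.
  rewrite normrM; have [/set_mem tB|tB] := boolP (t \in B).
    have -> : \1_B t = 1 :> R by rewrite indicE mem_set.
    apply: ler_pM => //.
      by have [] := hM _ e0 (t - s).
    by rewrite indicE; case: (t \in A); rewrite ?normr1 ?normr0.
  rewrite mol_out ?normr0 ?mul0r//; first by rewrite mulr_ge0// ltW.
  move: tB; rewrite notin_setE /B /= in_itv/= => h; rewrite ltNge; apply/negP => h2; apply: h.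
  by move: h2; rewrite ler_norml => /andP[? ?]; apply/andP; split; lra.
have mf : measurable_fun setT (fun t : measurableTypeR R => mol e (t - s) * \1_A t).
  by apply: measurable_funM => //; exact: measurable_indic.
have If : Itg mu setT (fun t => mol e (t - s) * \1_A t).
  by apply: Itg_le I1.
have IS (f : R -> R) : Itg mu setT f -> Itg mu `]0, L[ f by move=> h; exact: integrableS h.
apply: le_trans (norm_I_le mL (IS _ If) (IS _ I1) (fun t _ => hb t)) _.
apply: (@le_trans _ _ (\int[mu]_t (M / e * \1_B t))).
  rewrite [leLHS]Rintegral_mkcond; apply: le_I => //.
    by rewrite /Itg -restrict_EFin; apply/(integrable_mkcond _ mL); exact: IS.
  move=> t _; rewrite /patch; case: ifP => // _.
  by rewrite mulr_ge0 ?(ltW Me)// indicE.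
rewrite IZ//; last exact: integrable_indic_itv.
have le3 : s - 3 * e < s + 3 * e by lra.
have muB : mu B = (6 * e)%:E.
  by rewrite /B lebesgue_measure_itv/= lte_fin le3 -EFinD; congr EFin; ring.
have -> : \int[mu]_t \1_B t = 6 * e.
  by rewrite /Rintegral integral_indic// setIT [X in fine X](_ : _ = mu B)// muB.
by rewrite le_eqVlt; apply/orP; left; apply/eqP; field; rewrite gt_eqF.
Qed.

(** At a Lebesgue point: the kernel having mass one, the error is at most [M / e] times the integral
    of [|f s - f t|] over the ball of radius [3 e], that is [6 M] times the mean oscillation. *)
Lemma mol_indic_cvg (L : R) (A : set R) : measurable A ->
  {ae mu, forall s, `]0, L[%classic s ->
    \int[mu]_(t in `]0, L[) (mol (en n) (t - s) * \1_A t) @[n --> \oo] --> (\1_A s : R)}.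
Proof.
move=> mA.
have [M [M0 hM]] := @mol_bnd R.
(* Absorbing the interval into the set turns the integral over []0, L[] into one over a ball around
   [s]. *)
pose A' := A `&` `]0, L[%classic.
have mL : measurable (`]0, L[%classic : set (measurableTypeR R)) by exact: measurable_itv.
have mA' : measurable (A' : set (measurableTypeR R)) by exact: measurableI.
pose f : R -> R := \1_A'.
have ld := lebesgue_differentiation (locally_integrable_indic (@openT R) mA').
apply: (@filterS _ _ (ae_filter_ringOfSetsType mu) _ _ _ ld) => s /cvge_at_rightP/(_ (fun n => 3 * en n)) hs sL.
have {}hs : davg f s (3 * en n) @[n --> \oo] --> 0%E.
  apply: hs; split; first by move=> n; rewrite mulr_gt0// en_gt0.
  rewrite -(mulr0 (3 : R)); apply: cvgM; [exact: cvg_cst|exact: en_cvg].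
have fs : f s = \1_A s.
  by rewrite /f !indicE; congr (_%:R); congr nat_of_bool; apply/idP/idP; rewrite !inE; [case|].
rewrite -fs.
have key n : `|f s - \int[mu]_(t in `]0, L[) (mol (en n) (t - s) * \1_A t)| <=
    6 * M * fine (davg f s (3 * en n)).
  set e := en n; have e0 : 0 < e := en_gt0 n.
  pose B := `]s - 3 * e, s + 3 * e[%classic.
  have BE : ball s (3 * e) = B by rewrite /B ball_itv.
  have mB : measurable (B : set (measurableTypeR R)) by exact: measurable_itv.
  have le3 : s - 3 * e < s + 3 * e by lra.
  have cm : continuous (fun t : R => mol e (t - s)).
    apply: smooth1_cont.
    have [sm _] := ckern_mol e0; have := smooth1_affine (- s) 1 sm.
    by congr smooth1; apply/funext => t; rewrite mul1r addrC.
  have mm : measurable_fun setT (fun t : measurableTypeR R => mol e (t - s)).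
    exact: continuous_measurable_fun.
  have mfun : measurable_fun setT (f : measurableTypeR R -> R) by exact: measurable_indic.
  have Bf : (mu B < +oo)%E by rewrite /B lebesgue_measure_itv/= lte_fin le3 -EFinD ltry.
  have E1 : \int[mu]_(t in `]0, L[) (mol e (t - s) * \1_A t) =
            \int[mu]_(t in B) (mol e (t - s) * f t).
    rewrite [LHS]Rintegral_mkcond [RHS]Rintegral_mkcond; apply: eq_Rintegral => t _.
    have fE : f t = if t \in `]0, L[%classic then \1_A t else 0.
      by rewrite /f /A' !indicE in_setI; case: (t \in A); case: (t \in `]0, L[%classic).
    rewrite /patch fE.
    have [tB|/negP tB] := boolP (t \in B); first by case: ifP; rewrite ?mulr0.
    suff -> : mol e (t - s) = 0 by rewrite mul0r; case: ifP.
    apply: mol_out => //; rewrite ltNge; apply/negP => h2; apply: tB.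
    rewrite inE /B /= in_itv /=.
    by move: h2; rewrite ler_norml => /andP[? ?]; apply/andP; split; lra.
  have Im : Itg mu B (fun t => mol e (t - s)) by exact: Itg_cont.
  have Imf : Itg mu B (fun t => mol e (t - s) * f t).
    apply: (Itg_le mB _ _ (Itg_norm Im)).
      by apply: measurable_funTS; exact: measurable_funM.
    move=> t _; rewrite normrM -[leRHS]mulr1; apply: ler_wpM2l => //.
    by rewrite /f indicE; case: (t \in _); rewrite ?normr1 ?normr0.
  have Id : Itg mu B (fun t => f s - f t).
    apply: (Itg_bnd mB Bf (M := 1)).
      by apply: measurable_funB => //; exact: measurable_funTS.
    move=> t _; rewrite /f !indicE.
    by case: (s \in _); case: (t \in _); rewrite ?subrr ?subr0 ?sub0r ?normrN ?normr1 ?normr0.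
  have E2 : f s - \int[mu]_(t in B) (mol e (t - s) * f t) =
      \int[mu]_(t in B) (f s * mol e (t - s) - mol e (t - s) * f t).
    by rewrite IB//; [rewrite IZ// mol_I1// mulr1|exact: ItgZ].
  rewrite E1 E2.
  have hb t : B t -> `|f s * mol e (t - s) - mol e (t - s) * f t| <= M / e * `|f s - f t|.
    move=> _; rewrite mulrC -mulrBr normrM; apply: ler_wpM2r => //.
    by have [] := hM _ e0 (t - s).
  have I2 : Itg mu B (fun t => M / e * `|f s - f t|) by apply: ItgZ => //; exact: Itg_norm.
  apply: le_trans (norm_I_le mB _ I2 hb) _; first by apply: ItgB => //; exact: ItgZ.
  rewrite IZ//; last exact: Itg_norm.
  have Ef : fine (davg f s (3 * e)) = (6 * e)^-1 * \int[mu]_(t in B) `|f s - f t|.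
    rewrite /davg /iavg BE [X in (X^-1 * _)%E](_ : _ = (6 * e)%:E); last first.
      by rewrite /B lebesgue_measure_itv/= lte_fin le3 -EFinD; congr EFin; ring.
    have -> : (\int[mu]_(y in B) `|((center (f s) \o f) y)%:E|)%E =
              (\int[mu]_(t in B) `|f s - f t|)%:E.
      rewrite /Rintegral fineK; last by apply: integrable_fin_num => //; exact: (Itg_norm Id).
      by apply: eq_integral => t _ /=; rewrite distrC.
    by rewrite inver gt_eqF ?mulr_gt0// -EFinM.
  rewrite Ef le_eqVlt; apply/orP; left; apply/eqP; field.
  by rewrite gt_eqF.
apply/cvgrPdist_le => d d0.
have /fine_cvgP[_ /cvgrPdist_le] := hs.
have d1 : 0 < d / (6 * M) by rewrite divr_gt0// mulr_gt0.
move=> /(_ _ d1); apply: filterS => n; rewrite sub0r normrN => h.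
apply: le_trans (key n) _.
have M6 : 0 < 6 * M by rewrite mulr_gt0.
rewrite mulrC -ler_pdivlMr//; apply: le_trans h; exact: ler_norm.
Qed.

End MolLebesgue.

Section Mollify.
Context {R : realType}.
Notation RR := (measurableTypeR R * measurableTypeR R)%type.
Implicit Types (f g u : R * R -> R) (a b : R -> R).
Variables (L1 L2 : R).
Notation Om := (Omega L1 L2).
Notation I2 f := (\int[leb2]_(z in Om) f z).

Let mO : measurable (Om : set RR) := Om_meas L1 L2.
Let fO := Om_fin L1 L2.

Definition mo (e : R) u := conv L1 L2 u (mol e) (mol e).

Lemma kern2_out (e : R) a b z w c : ckern e a -> ckern e b ->
  kern2 a b z w != 0 -> box e c (z, w) = c.
Proof.
move=> [_ a0] [_ b0] h; rewrite /box /= ifT//; apply/andP.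
have aux k s : (forall x : R, x < e \/ 2 * e < x -> k x = 0) -> k s != 0 -> `|s| <= 2 * e.
  move=> k0 ks; have e0 : 0 <= e.
    by rewrite leNgt; apply/negP => e0; case/eqP: ks; apply: k0;
      case: (ltP s e) => se; [left|right; lra].
  rewrite ler_norml; apply/andP; split; rewrite leNgt; apply/negP => hs;
    case/eqP: ks; apply: k0; [left; lra|by right].
move: h; rewrite /kern2 mulf_eq0 negb_or => /andP[ha hb].
by split; [apply: aux a0 ha|apply: aux b0 hb].
Qed.

(** [K] is the square of the one-dimensional bound, one factor per variable. Each differentiation
    costs [1 / e], which the commutator estimate has to regain. *)
Lemma kern_box : exists K : R, 0 < K /\ forall e : R, 0 < e -> forall z w,
  [/\ `|kern2 (mol e) (mol e) z w| <= K * box e (e ^- 2) (z, w),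
      `|kern2 (derive1 (mol e)) (mol e) z w| <= K / e * box e (e ^- 2) (z, w) &
      `|kern2 (mol e) (derive1 (mol e)) z w| <= K / e * box e (e ^- 2) (z, w)].
Proof.
have [M [M0 hM]] := @mol_bnd R.
exists (M ^+ 2); split; first exact: exprn_gt0.
move=> e e0 z w; have k1 := ckern_mol e0; have k2 := ckern_d1 k1.
have e2 : 0 <= e ^- 2 by rewrite invr_ge0 sqr_ge0.
have aux a b c : ckern e a -> ckern e b -> 0 <= c ->
    (`|kern2 a b z w| <= c * e ^- 2) -> `|kern2 a b z w| <= c * box e (e ^- 2) (z, w).
  move=> ka kb c0 h; have [->|n0] := eqVneq (kern2 a b z w) 0.
    by rewrite normr0 mulr_ge0// box_ge0.
  by rewrite (kern2_out _ ka kb n0).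
have en0 : e != 0 by rewrite gt_eqF.
have [h1 _] := hM _ e0 (z.1 - w.1); have [h2 _] := hM _ e0 (z.2 - w.2).
have [_ h3] := hM _ e0 (z.1 - w.1); have [_ h4] := hM _ e0 (z.2 - w.2).
have M20 : 0 <= M ^+ 2 by exact: sqr_ge0.
have Me0 : 0 <= M ^+ 2 / e by rewrite divr_ge0// ltW.
split.
- apply: aux => //; rewrite /kern2 normrM.
  have -> : M ^+ 2 * e ^- 2 = M / e * (M / e) by field.
  exact: (ler_pM (normr_ge0 _) (normr_ge0 _) h1 h2).
- apply: aux => //; rewrite /kern2 normrM.
  have -> : M ^+ 2 / e * e ^- 2 = M / e ^+ 2 * (M / e) by field.
  exact: (ler_pM (normr_ge0 _) (normr_ge0 _) h3 h2).
- apply: aux => //; rewrite /kern2 normrM.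
  have -> : M ^+ 2 / e * e ^- 2 = M / e * (M / e ^+ 2) by field.
  exact: (ler_pM (normr_ge0 _) (normr_ge0 _) h1 h4).
Qed.

Lemma Itg_boxM (e c : R) z u : Itg leb2 Om u ->
  Itg leb2 Om (fun w => box e c (z, w) * `|u w|).
Proof.
move=> Iu; apply: (Itg_le mO _ _ (ItgZ mO `|c| (Itg_norm Iu))).
  apply: measurable_funM; first exact: Itg_meas (Itg_box _ _ _ _ _).
  exact: (measurableT_comp (@normr_measurable R setT) (Itg_meas Iu)).
move=> w _; rewrite normrM normr_id; apply: ler_wpM2r => //.
by rewrite /box; case: ifP; rewrite ?normr0.
Qed.

Lemma conv_box (e C : R) u a b z : ckern e a -> ckern e b -> Itg leb2 Om u ->
  (forall w, `|kern2 a b z w| <= C * box e (e ^- 2) (z, w)) ->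
  `|conv L1 L2 u a b z| <= C * I2 (fun w => box e (e ^- 2) (z, w) * `|u w|).
Proof.
move=> ka kb Iu hk; rewrite -IZ//; last exact: Itg_boxM.
apply: (norm_I_le mO (Itg_kern2 z Iu ka kb)).
  by apply: ItgZ => //; exact: Itg_boxM.
move=> w _; rewrite normrM mulrC mulrA; apply: ler_wpM2r => //.
Qed.

Lemma meas_conv u e a b : Itg leb2 Om u -> ckern e a -> ckern e b ->
  measurable_fun Om (conv L1 L2 u a b).
Proof. by move=> Iu ka kb; apply: cont2_meas => //; exact: cont_conv Iu ka kb. Qed.

Lemma mo_young : exists K : R, 0 < K /\ forall e u, 0 < e -> sqint leb2 Om u ->
  sqint leb2 Om (mo e u) /\ sqn leb2 Om (mo e u) <= K ^+ 2 * sqn leb2 Om u.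
Proof.
have [K [K0 hK]] := kern_box; exists (16 * K); split; first by rewrite mulr_gt0.
move=> e u e0 su; have Iu := sqint_Itg1 mO fO su; have k1 := ckern_mol e0.
apply: (young e0 (ltW K0) su (meas_conv Iu k1 k1)) => z _.
by apply: conv_box => // w; have [] := hK _ e0 z w.
Qed.

(** Fubini moves the convolution onto [g], where it acts as its adjoint; the bound on [g] makes the
    double integrand integrable. *)
Lemma conv_swap u e a b g M : Itg leb2 Om u -> ckern e a -> ckern e b ->
  measurable_fun Om (g : RR -> R) -> (forall z, Om z -> `|g z| <= M) ->
  I2 (fun z => conv L1 L2 u a b z * g z) =
  I2 (fun w => u w * I2 (fun z => kern2 a b z w * g z)).
Proof.
move=> Iu ka kb mg gM; have [N hN] := kern2_bnd ka kb.
have Ig := Itg_bnd mO fO mg gM.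
have [sa _] := ka; have [sb _] := kb.
pose F (p : RR * RR) := u p.2 * kern2 a b p.1 p.2 * g p.1.
have mk : measurable_fun setT (fun p : RR * RR => kern2 a b p.1 p.2).
  rewrite /kern2; apply: measurable_funM.
    apply: (measurableT_comp (continuous_measurable_fun (smooth1_cont sa))).
    apply: measurable_funB; first exact: measurableT_comp measurable_fst measurable_fst.
    exact: measurableT_comp measurable_fst measurable_snd.
  apply: (measurableT_comp (continuous_measurable_fun (smooth1_cont sb))).
  apply: measurable_funB; first exact: measurableT_comp measurable_snd measurable_fst.
  exact: measurableT_comp measurable_snd measurable_snd.
have Ikg w : Itg leb2 Om (fun z => kern2 a b z w * g z).
  apply: (Itg_bnd mO fO (M := N * M)).
    apply: measurable_funM => //; apply: measurable_funTS.
    exact: (measurable_fun_pair1 w mk).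
  by move=> z Omz; rewrite normrM; apply: ler_pM => //; exact: gM.
have NM w z : Om z -> `|kern2 a b z w * g z| <= N * M.
  by move=> Omz; rewrite normrM; apply: ler_pM => //; exact: gM.
have IF : Itg (leb2s \x leb2s)%E (Om `*` Om) F.
  apply: (tonelli_Itg mO mO (g := fun w => (N * M * fine (leb2 Om)) * `|u w|)).
  - apply: measurable_funM; last exact: meas_fstX.
    apply: measurable_funM; last exact: measurable_funTS.
    by apply: meas_sndX => //; exact: Itg_meas Iu.
  - move=> w _; rewrite /F /=.
    have E z : u w * kern2 a b z w * g z = u w * (kern2 a b z w * g z) by rewrite mulrA.
    split; first by apply: (Itg_eq mO) (ItgZ mO (u w) (Ikg w)) => z _; rewrite E.
    have -> : \int[leb2s]_(x in Om) `|u w * kern2 a b x w * g x| =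
              `|u w| * I2 (fun z => `|kern2 a b z w * g z|).
      rewrite -IZ//; last exact: Itg_norm.
      by apply: eq_Rintegral => z _; rewrite E normrM.
    rewrite mulrC; apply: ler_wpM2r => //.
    rewrite -(Rintegral_cst _ mO); apply: le_I => //; first exact: Itg_norm.
      exact: Itg_cst.
    exact: NM.
  - by apply: ItgZ => //; exact: Itg_norm.
have := fubini_I2 mO mO IF; rewrite (fubini_I mO mO IF) /F /= => h.
transitivity (\int[leb2s]_(x in Om) \int[leb2s]_(y in Om) (u y * kern2 a b x y * g x)).
  apply: eq_Rintegral => z _; rewrite /conv -RintegralZr//.
  exact: (Itg_kern2 z Iu ka kb).
rewrite h; apply: eq_Rintegral => w _; rewrite -IZ//.
by apply: eq_Rintegral => z _; rewrite mulrA.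
Qed.

(** The functions [g] against which mollifications converge weakly. Fixing [g] and quantifying over
    [u] allows this class to be enlarged from indicators to all of L^2. *)
Definition wk g := forall u, sqint leb2 Om u ->
  I2 (fun z => mo (en n) u z * g z) @[n --> \oo] --> I2 (fun z => u z * g z).

Lemma ae_fst (P : R -> Prop) : {ae @lebesgue_measure R, forall x, P x} ->
  {ae @leb2 R, forall z, P z.1}.
Proof.
move=> [N [mN N0 hN]]; exists (N `*` setT); split; first exact: measurableX.
  by rewrite leb2_rect// N0 mul0e.
by move=> z /= h; split => //; apply: hN.
Qed.

Lemma ae_snd (P : R -> Prop) : {ae @lebesgue_measure R, forall x, P x} ->
  {ae @leb2 R, forall z, P z.2}.
Proof.
move=> [N [mN N0 hN]]; exists (setT `*` N); split; first exact: measurableX.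
  by rewrite leb2_rect// N0 mule0.
by move=> z /= h; split => //; apply: hN.
Qed.

(** The kernel and the indicator both factor. After transposition onto the indicator the claim is
    the one-dimensional convergence almost everywhere on each axis, with dominated convergence
    against [|u|]. *)
Lemma wk_rect (A B : set R) : measurable A -> measurable B -> wk (\1_(A `*` B)).
Proof.
move=> mA mB u su; have Iu := sqint_Itg1 mO fO su.
have [K hK] := @mol_indic_bnd R.
pose al L (A : set R) n (s : R) :=
  \int[lebesgue_measure]_(t in `]0, L[) (mol (en n) (t - s) * \1_A t).
have E (z : RR) : \1_(A `*` B) z = \1_A z.1 * \1_B z.2 :> R.
  by rewrite !indicE -natrM mulnb; congr (_%:R); congr nat_of_bool;
    apply/idP/andP; rewrite !inE.
have mAB : measurable_fun Om (\1_(A `*` B) : RR -> R).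
  by apply: measurable_funTS; apply: measurable_indic; exact: measurableX.
have bAB z : Om z -> `|\1_(A `*` B) z : R| <= 1.
  by move=> _; rewrite indicE; case: (_ \in _); rewrite ?normr1 ?normr0.
have ck n := ckern_mol (@en_gt0 R n).
have mL L : measurable (`]0, L[%classic : set (measurableTypeR R)) by exact: measurable_itv.
have Imol L (C : set R) n s : measurable C ->
    Itg lebesgue_measure `]0, L[ (fun t => mol (en n) (t - s) * \1_C t).
  move=> mC; apply: (Itg_le (mL L) _ _ (Itg_norm (Itg_cont 0 L (a := fun t => mol (en n) (t - s)) _))).
  - apply: measurable_funM; last by apply: measurable_funTS; exact: measurable_indic.
    apply: measurable_funTS; apply: continuous_measurable_fun.
    apply: smooth1_cont; have [sm _] := ck n; have := smooth1_affine (- s) 1 sm.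
    by congr smooth1; apply/funext => t; rewrite mul1r addrC.
  - move=> t _; rewrite normrM -[leRHS]mulr1; apply: ler_wpM2l => //.
    by rewrite indicE; case: (t \in C); rewrite ?normr1 ?normr0.
  apply: smooth1_cont; have [sm _] := ck n; have := smooth1_affine (- s) 1 sm.
  by congr smooth1; apply/funext => t; rewrite mul1r addrC.
have EI n : I2 (fun z => mo (en n) u z * \1_(A `*` B) z) =
            I2 (fun w => u w * (al L1 A n w.1 * al L2 B n w.2)).
  rewrite /mo (conv_swap Iu (ck n) (ck n) mAB bAB); apply: eq_Rintegral => w _.
  congr (_ * _); have [_ <-] := I_prod (Imol L1 A n w.1 mA) (Imol L2 B n w.2 mB).
  by apply: eq_Rintegral => z _; rewrite E /kern2 mulrACA.
rewrite (funext EI).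
have ball1 n w : `|al L1 A n w.1 * al L2 B n w.2| <= K * K.
  by rewrite normrM; apply: ler_pM => //; apply: hK => //; exact: en_gt0.
have mF n : measurable_fun Om (fun w => u w * (al L1 A n w.1 * al L2 B n w.2)).
  apply: measurable_funM; first exact: Itg_meas Iu.
  (* Measurability of the one-dimensional averages in their base point comes from Fubini on the
     square of side [L]. *)
  have mal (L : R) (C : set R) : measurable C ->
      measurable_fun (`]0, L[%classic : set (measurableTypeR R)) (al L C n).
    move=> mC.
    have mm : measurable_fun setT (fun p : RR => mol (en n) (p.1 - p.2)).
      apply: (measurableT_comp (f := mol (en n))).
        by apply: continuous_measurable_fun; apply: smooth1_cont; case: (ck n).
      by apply: measurable_funB; [exact: measurable_fst|exact: measurable_snd].
    have [M [M0 hM]] := @mol_bnd R.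
    pose G (p : RR) := mol (en n) (p.1 - p.2) * \1_C p.1.
    have mG : measurable_fun setT G.
      have mC1 : measurable_fun setT (\1_C : measurableTypeR R -> R).
        exact: measurable_indic.
      by apply: measurable_funM => //; exact: (measurableT_comp mC1 measurable_fst).
    pose SQ : set RR := `]0, L[ `*` `]0, L[.
    have mX : measurable SQ by exact: measurableX.
    have fX : (@leb2 R SQ < +oo)%E.
      rewrite /SQ leb2_rect// !lebesgue_measure_itv/=.
      by case: ifP => _; rewrite ?mul0e -?EFinD -?EFinM ltry.
    have IG : Itg (@leb2 R) SQ G.
      apply: (Itg_bnd mX fX (M := M / en n)); first exact: measurable_funTS.
      move=> p _; rewrite /G normrM -[leRHS]mulr1; apply: ler_pM => //.
        by have [] := hM _ (@en_gt0 R n) (p.1 - p.2).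
      by rewrite indicE; case: (_ \in C); rewrite ?normr1 ?normr0.
    exact: Itg_meas (fubini_Itg2 (mL L) (mL L) IG).
  by apply: measurable_funM; [apply: meas_fstX|apply: meas_sndX] => //; exact: mal.
apply: (Rdct mO (g := fun w => K * K * `|u w|)) => //.
- by apply: measurable_funM; [exact: Itg_meas Iu|].
- by apply: ItgZ => //; exact: Itg_norm.
- by move=> n w _; rewrite normrM mulrC; apply: ler_wpM2r.
have h1 := ae_fst (mol_indic_cvg L1 mA).
have h2 := ae_snd (mol_indic_cvg L2 mB).
have Fae := ae_filter_ringOfSetsType (@leb2 R).
apply: (@filterS2 _ _ Fae _ _ _ _ h1 h2) => w c1 c2 [/= w1 w2]; rewrite E.
apply: cvgM; first exact: cvg_cst.
by apply: cvgM; [exact: c1|exact: c2].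
Qed.

End Mollify.

(** * Weak convergence of mollifications *)

Section WeakConvergence.
Context {R : realType}.
Notation RR := (measurableTypeR R * measurableTypeR R)%type.
Implicit Types (f g u : R * R -> R).
Variables (L1 L2 : R).
Notation Om := (Omega L1 L2).
Notation I2 f := (\int[leb2]_(z in Om) f z).
Notation sq := (sqint leb2 Om).
Notation wk := (wk L1 L2).

Let mO : measurable (Om : set RR) := Om_meas L1 L2.
Let fO := Om_fin L1 L2.

(** [cauchy_schwarz_le] takes its bounds as squares; this crude one spares a square root. *)
Lemma sqn_le_sqr u : sqn leb2 Om u <= (1 + sqn leb2 Om u) ^+ 2.
Proof.
have h : 0 <= sqn leb2 Om u by exact: sqn_ge0.
by move: (sqn _ _ _) h => x x0; nra.
Qed.

Lemma sq_mo n u : sq u -> sq (mo L1 L2 (en n) u).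
Proof. by move=> su; have [K [_ /(_ (en n) u (en_gt0 n) su) []]] := @mo_young R L1 L2. Qed.

Lemma wkD f g : sq f -> sq g -> wk f -> wk g -> wk (fun z => f z + g z).
Proof.
move=> sf sg wf wg u su.
have E v : sq v -> I2 (fun z => v z * (f z + g z)) = I2 (fun z => v z * f z) + I2 (fun z => v z * g z).
  move=> sv; rewrite -(ID mO (sqintM mO sv sf) (sqintM mO sv sg)).
  by apply: eq_Rintegral => z _; rewrite mulrDr.
rewrite E// (funext (fun n => E _ (sq_mo n su))).
exact: cvgD (wf u su) (wg u su).
Qed.

Lemma wkZ c f : sq f -> wk f -> wk (fun z => c * f z).
Proof.
move=> sf wf u su.
have E v : sq v -> I2 (fun z => v z * (c * f z)) = c * I2 (fun z => v z * f z).
  move=> sv; rewrite -(IZ mO c (sqintM mO sv sf)).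
  by apply: eq_Rintegral => z _; rewrite mulrCA.
rewrite E// (funext (fun n => E _ (sq_mo n su))).
exact: cvgM (cvg_cst _) (wf u su).
Qed.

(** The operators [mo (en n)] are bounded on L^2 uniformly in [n], so the class of admissible [g] is
    closed in L^2. *)
Lemma wk_lim g : sq g ->
  (forall d : R, 0 < d -> exists g', [/\ sq g', wk g' & sqn leb2 Om (fun z => g z - g' z) <= d ^+ 2]) ->
  wk g.
Proof.
move=> sg hg u su.
have [K [K0 hK]] := @mo_young R L1 L2.
pose U := 1 + sqn leb2 Om u.
have u0 : 0 <= sqn leb2 Om u by exact: sqn_ge0.
have U0 : 0 < U by rewrite /U; lra.
apply/cvgrPdist_le => e e0.
(* Makes the errors [U * d] for [u] and [K * U * d] for its mollification add up to [e / 2]. *)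
pose d := e / (2 * (K * U + U)).
have den : 0 < K * U + U by rewrite addr_gt0// mulr_gt0.
have d0 : 0 < d by rewrite divr_gt0// mulr_gt0.
have [g' [sg' wg' gg']] := hg d d0.
have sd : sq (fun z => g z - g' z) by exact: sqintB.
have e2 : 0 < e / 2 by rewrite divr_gt0.
have /cvgrPdist_le/(_ _ e2) := wg' u su; apply: filterS => n hn.
have sm := sq_mo n su.
have [_ hm] := hK (en n) u (en_gt0 n) su.
have E v : sq v -> I2 (fun z => v z * g z) =
    I2 (fun z => v z * g' z) + I2 (fun z => v z * (g z - g' z)).
  move=> sv; rewrite -(ID mO (sqintM mO sv sg') (sqintM mO sv sd)).
  by apply: eq_Rintegral => z _; rewrite -mulrDr addrC subrK.
rewrite (E u)// (E (mo L1 L2 (en n) u))//.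
have h1 : `|I2 (fun z => u z * (g z - g' z))| <= U * d.
  by apply: (cauchy_schwarz_le mO su sd (ltW U0) (ltW d0) _ gg'); exact: sqn_le_sqr.
have h2 : `|I2 (fun z => mo L1 L2 (en n) u z * (g z - g' z))| <= (K * U) * d.
  apply: (cauchy_schwarz_le mO sm sd (mulr_ge0 (ltW K0) (ltW U0)) (ltW d0) _ gg').
  apply: le_trans hm _; rewrite exprMn; apply: ler_wpM2l; first exact: sqr_ge0.
  exact: sqn_le_sqr.
have Ed : e = e / 2 + U * d + (K * U) * d by rewrite /d; field; rewrite gt_eqF.
move: hn h1 h2; set x := I2 (fun z => u z * g' z); set y := I2 (fun z => u z * (g z - g' z)).
set x' := I2 (fun z => mo L1 L2 (en n) u z * g' z).
set y' := I2 (fun z => mo L1 L2 (en n) u z * (g z - g' z)) => hn h1 h2.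
have -> : x + y - (x' + y') = (x - x') + y - y' by ring.
apply: le_trans (ler_normB _ _) _; rewrite [leRHS]Ed.
apply: lerD h2; apply: le_trans (ler_normD _ _) _; exact: lerD.
Qed.

Lemma sq_indic (E : set RR) : measurable E -> sq (\1_E).
Proof.
move=> mE; apply: (sqint_bnd mO fO (M := 1)).
  by apply: measurable_funTS; exact: measurable_indic.
by move=> z _; rewrite indicE; case: (_ \in _); rewrite ?normr1 ?normr0.
Qed.

(** Dynkin's theorem: rectangles form a pi-system generating the product sigma-algebra, and the
    admissible sets form a lambda-system, increasing unions being covered by the closedness in
    L^2. *)
Lemma wk_indic (E : set RR) : measurable E -> wk (\1_E).
Proof.
move=> mE.
suff : measurable `<=` [set E : set RR | measurable E /\ wk (\1_E)] by move=> /(_ E mE) [].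
rewrite [X in X `<=` _]measurable_prod_measurableType.
set C := [set A1 `*` A2 | A1 in measurable & A2 in measurable].
have CI : setI_closed C.
  move=> X Y [X1 mX1 [X2 mX2 <-{X}]] [Y1 mY1 [Y2 mY2 <-{Y}]].
  exists (X1 `&` Y1); first exact: measurableI.
  by exists (X2 `&` Y2); [exact: measurableI|rewrite setXI].
have CB : C `<=` [set E : set RR | measurable E /\ wk (\1_E)].
  move=> X [X1 mX1 [X2 mX2 <-{X}]]; split; first exact: measurableX.
  exact: wk_rect.
have CT : C setT by exists setT => //; exists setT => //; rewrite setXTT.
suff ls : lambda_system setT [set E : set RR | measurable E /\ wk (\1_E)].
  exact: lambda_system_subset ls CB _.
split => //; first exact: CB.
  move=> X Y XY [mX wX] [mY wY]; split; first exact: measurableD.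
  have -> : \1_(X `\` Y) = (fun z => \1_X z + (-1) * \1_Y z) :> (RR -> R).
    apply/funext => z; rewrite !indicE mulN1r.
    have [/set_mem zY|zY] := boolP (z \in Y).
      have zX : z \in X by rewrite inE; exact: XY.
      have zXY : (z \in X `\` Y) = false by apply/negbTE; rewrite notin_setE => -[_].
      by rewrite zXY zX subrr.
    rewrite subr0; congr (_%:R); congr nat_of_bool; apply/idP/idP; rewrite !inE; first by case.
    by move=> zX; split => //; rewrite -notin_setE.
  by apply: wkD => //; [exact: sq_indic|apply: sqintZ => //; exact: sq_indic|
    apply: wkZ => //; exact: sq_indic].
move=> F ndF hF; split; first by apply: bigcupT_measurable => n; have [] := hF n.
have mF n : measurable (F n) by have [] := hF n.
have mU : measurable (\bigcup_n F n) by exact: bigcupT_measurable.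
apply: wk_lim; first exact: sq_indic.
move=> d d0.
have cv : sqn leb2 Om (fun z => \1_(\bigcup_n F n) z - \1_(F n) z) @[n --> \oo] --> (0 : R).
  rewrite -[X in _ --> X](I0 leb2 mO); apply: (Rdct mO (g := fun=> 1)).
  - move=> n; apply: measurable_funX; apply: measurable_funB;
      by apply: measurable_funTS; exact: measurable_indic.
  - exact: measurable_cst.
  - exact: Itg_cst.
  - move=> n z _; rewrite !indicE.
    by do 2 case: (z \in _); rewrite ?subrr ?subr0 ?sub0r ?sqrrN ?expr0n ?expr1n ?normr0 ?normr1.
  apply: aeW => z _.
  have [/set_mem [k _ Fk]|zU] := boolP (z \in \bigcup_n F n).
    apply: cvg_near_cst; exists k => // n /= kn.
    rewrite !indicE !mem_set ?subrr ?expr0n//; last by exists k.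
    by move: z Fk; exact/subsetPset/ndF.
  apply: cvg_near_cst; apply: nearW => n; rewrite !indicE (negbTE zU).
  rewrite memNset ?subrr ?expr0n// => Fn; move: zU; rewrite notin_setE; apply; by exists n.
have d2 : 0 < d ^+ 2 by exact: exprn_gt0.
have /cvgrPdist_le/(_ _ d2) [N _ hN] := cv.
exists (\1_(F N)); split; [exact: sq_indic|by have [] := hF N|].
by have := hN N (leqnn N); rewrite /= sub0r normrN; apply: le_trans; exact: ler_norm.
Qed.

Import HBNNSimple.

Lemma wk_nnsfun (g : {nnsfun RR >-> R}) : sq (fun z => g z) /\ wk (fun z => g z).
Proof.
have mE (y : R) : measurable (g @^-1` [set y]) by exact: measurable_sfunP.
have E : (fun z => g z) = fun z => \sum_(y <- finmap.enum_fset (fset_set (range g))) (y * \1_(g @^-1` [set y]) z).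
  by apply/funext => z; rewrite fimfunE fsbig_finite.
rewrite E; elim: (finmap.enum_fset (fset_set (range g))) => [|y s [IHs IH]].
  have E0 : (fun z : RR => \sum_(y <- [::]) (y * \1_(g @^-1` [set y]) z)) = fun=> 0.
    by apply/funext => z; rewrite big_nil.
  rewrite E0; split; first exact: sqint0.
  move=> u su; have I00 v : I2 (fun z => v z * 0) = 0.
    by rewrite -[RHS](I0 leb2 mO); apply: eq_Rintegral => z _; rewrite mulr0.
  by rewrite I00 (funext (fun n => I00 _)); exact: cvg_cst.
have E1 : (fun z : RR => \sum_(y <- y :: s) (y * \1_(g @^-1` [set y]) z)) =
    fun z => y * \1_(g @^-1` [set y]) z + \sum_(y <- s) (y * \1_(g @^-1` [set y]) z).
  by apply/funext => z; rewrite big_cons.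
have si := sq_indic (mE y); have wi := wk_indic (mE y).
rewrite E1; split; first exact: (sqintD mO (sqintZ mO y si) IHs).
by apply: (wkD (sqintZ mO y si) IHs _ IH); exact: wkZ.
Qed.

Let wk_ge0 g : sq g -> (forall z, Om z -> 0 <= g z) -> wk g.
Proof.
move=> sg g0; apply: wk_lim => // d d0.
have [mg g2] := sg.
have mG : measurable_fun Om (EFin \o g) by exact/measurable_EFinP.
have G0 z : Om z -> (0 <= (EFin \o g) z)%E by move=> Oz; rewrite lee_fin g0.
pose a n : RR -> R := nnsfun_approx mO mG n.
have ca z : Om z -> a n z @[n --> \oo] --> g z.
  by move=> Oz; have /fine_cvgP[_ h] := cvg_nnsfun_approx mO mG G0 Oz; exact: h.
have ale n z : Om z -> a n z <= g z.
  move=> Oz; have /cvg_lim <- // := ca z Oz.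
  apply: (@nondecreasing_cvgn_le _ (fun n => a n z)); last by apply/cvg_ex; exists (g z); exact: ca.
  by move=> k l kl; have /lefP := nd_nnsfun_approx mO mG kl; apply.
have a0 n z : 0 <= a n z by exact: fun_ge0.
have cv : sqn leb2 Om (fun z => g z - a n z) @[n --> \oo] --> (0 : R).
  rewrite -[X in _ --> X](I0 leb2 mO); apply: (Rdct mO (g := fun z => g z ^+ 2)) => //.
  - move=> n; apply: measurable_funX; apply: measurable_funB => //.
    by apply: measurable_funTS; exact: measurable_funPT.
  - move=> n z Oz; rewrite ger0_norm ?sqr_ge0// ler_sqr ?nnegrE ?subr_ge0 ?g0 ?ale//.
    by rewrite gerBl.
  apply: aeW => z Oz; have h : g z - a n z @[n --> \oo] --> (0 : R).
    by rewrite -(subrr (g z)); apply: cvgB; [exact: cvg_cst|exact: ca].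
  by rewrite -(mulr0 (0 : R)); exact: cvgM.
have d2 : 0 < d ^+ 2 by exact: exprn_gt0.
have /cvgrPdist_le/(_ _ d2) [N _ hN] := cv.
have [sa wa] := wk_nnsfun (nnsfun_approx mO mG N).
exists (a N); split => //.
by have := hN N (leqnn N); rewrite /= sub0r normrN; apply: le_trans; exact: ler_norm.
Qed.

(** The positive and negative parts of [g] are L^2 limits of simple functions, hence admissible by
    [wk_lim]. *)
Theorem weak_cvg g : sq g -> wk g.
Proof.
move=> sg; have [mg g2] := sg.
pose p z := Num.max (g z) 0; pose q z := Num.max (- g z) 0.
have mp : measurable_fun Om (p : RR -> R) by exact: measurable_maxr.
have mq : measurable_fun Om (q : RR -> R) by apply: measurable_maxr => //; exact: measurable_funN.
have le_sq (f : RR -> R) : measurable_fun Om f -> (forall z, `|f z| <= `|g z|) -> sq f.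
  move=> mf fg; split => //; apply: (Itg_le mO _ _ g2); first exact: measurable_funX.
  by move=> z _; rewrite normrX -[leRHS]real_normK ?num_real// ler_sqr ?nnegrE.
have sp : sq p.
  apply: le_sq => // z; rewrite /p; have [h|h] := leP (g z) 0; rewrite ?normr0//.
have sq' : sq q.
  apply: le_sq => // z; rewrite /q; have [h|h] := leP (- g z) 0; rewrite ?normr0 ?normrN//.
have -> : g = fun z => p z + (-1) * q z.
  apply/funext => z; rewrite /p /q; have [h|h] := leP (g z) 0.
    by rewrite (max_idPl _) ?oppr_ge0// mulN1r opprK add0r.
  by rewrite (max_idPr _) ?oppr_le0 ?ltW// mulr0 addr0.
have wp : wk p by apply: wk_ge0 => // z _; rewrite /p le_max lexx orbT.
have wq : wk q by apply: wk_ge0 => // z _; rewrite /q le_max lexx orbT.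
by apply: wkD => //; [exact: sqintZ|exact: wkZ].
Qed.

End WeakConvergence.

(** * Weak derivatives *)

Section WeakDerivatives.
Context {R : realType}.
Notation RR := (measurableTypeR R * measurableTypeR R)%type.
Implicit Types (f g u v phi : R * R -> R).
Variables (L1 L2 : R).
Notation Om := (Omega L1 L2).
Notation I2 f := (\int[leb2]_(z in Om) f z).
Notation sq := (sqint leb2 Om).
Notation test := (test2 Om).
Notation mo := (mo L1 L2).

Let mO : measurable (Om : set RR) := Om_meas L1 L2.
Let fO := Om_fin L1 L2.

Lemma OmE x y : Om (x, y) <-> 0 < x < L1 /\ 0 < y < L2.
Proof. by rewrite /Omega /= !in_itv. Qed.

(** A quantitative form of compact support: the margin [d] is compared with the reach [2 e] of the
    mollifier. *)
Definition marg (d : R) phi := forall z, phi z != 0 ->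
  d <= z.1 <= L1 - d /\ d <= z.2 <= L2 - d.

Let compact_rect (a b c d : R) : compact ([set z : R * R | a <= z.1 <= b /\ c <= z.2 <= d]).
Proof.
have -> : [set z : R * R | a <= z.1 <= b /\ c <= z.2 <= d] = `[a, b] `*` `[c, d].
  by apply/seteqP; split => [[x y]|[x y]] /=; rewrite !in_itv.
by apply: compact_setX; exact: segment_compact.
Qed.

Lemma test2P phi : test phi <-> smooth2 phi /\ exists2 d : R, 0 < d & marg d phi.
Proof.
split=> [[sphi [K [cK KO phi0]]]|[sphi [d d0 hd]]]; split => //.
  have [[z Kz]|K0] := pselect (K !=set0); last first.
    exists 1 => // z /eqP; rewrite phi0// => Kz; apply: K0; by exists z.
  have KN : K !=set0 by exists z.
  have cw (k : R * R -> R) : continuous k -> {within K, continuous k}.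
    exact: continuous_subspaceT.
  have c1 : continuous (fst : R * R -> R) by move=> p; exact: cvg_fst.
  have c2 : continuous (snd : R * R -> R) by move=> p; exact: cvg_snd.
  have [a1 /set_mem/KO + h1] := compact_EVT_min KN cK (cw _ c1).
  have [a2 /set_mem/KO + h2] := compact_EVT_max KN cK (cw _ c1).
  have [a3 /set_mem/KO + h3] := compact_EVT_min KN cK (cw _ c2).
  have [a4 /set_mem/KO + h4] := compact_EVT_max KN cK (cw _ c2).
  case: a1 a2 a3 a4 h1 h2 h3 h4 => [a1 b1] [a2 b2] [b3 a3] [b4 a4] /= h1 h2 h3 h4.
  move=> /OmE[_ /andP[a40 a4L]] /OmE[_ /andP[a30 a3L]] /OmE[/andP[a20 a2L] _] /OmE[/andP[a10 a1L] _].
  exists (Num.min (Num.min a1 (L1 - a2)) (Num.min a3 (L2 - a4))).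
    by rewrite !lt_min a10 a30 !subr_gt0 a2L a4L.
  move=> w w0; have Kw : w \in K.
    by rewrite inE; apply: contrapT => /phi0 h; rewrite h eqxx in w0.
  have := h1 w Kw; have := h2 w Kw; have := h3 w Kw; have := h4 w Kw.
  set m := Num.min _ _.
  have : m <= a1 /\ m <= L1 - a2 by rewrite /m !ge_min !lexx !orbT.
  have : m <= a3 /\ m <= L2 - a4 by rewrite /m !ge_min !lexx !orbT.
  move=> [? ?] [? ?] ? ? ? ?; split; apply/andP; split; lra.
exists [set z : R * R | d <= z.1 <= L1 - d /\ d <= z.2 <= L2 - d]; split.
- exact: compact_rect.
- move=> [x y] /= [/andP[? ?] /andP[? ?]]; apply/OmE.
  by split; apply/andP; split; lra.
- by move=> z /= nz; apply/eqP; apply: contra_notT nz => /hd.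
Qed.

Let dxy_marg d phi : smooth2 phi -> marg d phi -> marg d (dx phi) /\ marg d (dy phi).
Proof.
move=> sphi hd.
pose K := [set z : R * R | d <= z.1 <= L1 - d /\ d <= z.2 <= L2 - d].
have oK : open (~` K).
  apply: closed_openC; apply: compact_closed; [exact: norm_hausdorff|exact: compact_rect].
have k0 z : (~` K) z -> phi z = 0.
  by move=> nz; apply/eqP; apply: contra_notT nz => /hd.
by split=> z; apply: contra_neqP => nz; [exact: near_dx0 oK k0 nz|exact: near_dy0 oK k0 nz].
Qed.

Lemma test_dx phi : test phi -> test (dx phi).
Proof.
move=> /test2P[sp [d d0 hd]]; apply/test2P; split; first exact: smooth2_dx.
by exists d => //; case: (dxy_marg sp hd).
Qed.

Lemma test_dy phi : test phi -> test (dy phi).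
Proof.
move=> /test2P[sp [d d0 hd]]; apply/test2P; split; first exact: smooth2_dy.
by exists d => //; case: (dxy_marg sp hd).
Qed.

Definition dd (i : bool) f := if i then dy f else dx f.

Lemma test_dd i phi : test phi -> test (dd i phi).
Proof. by case: i; [exact: test_dy|exact: test_dx]. Qed.

Lemma smooth2_dd i f : smooth2 f -> smooth2 (dd i f).
Proof. by case: i; [exact: smooth2_dy|exact: smooth2_dx]. Qed.

Lemma ddM i f g z : smooth2 f -> smooth2 g ->
  dd i (fun z => f z * g z) z = f z * dd i g z + g z * dd i f z.
Proof. by case: i; [exact: dyM|exact: dxM]. Qed.

Lemma ddC i j f : smooth2 f -> dd i (dd j f) = dd j (dd i f).
Proof.
move=> /schwarz h; rewrite /dd; case: i; case: j; [reflexivity|exact: esym h|exact: h|reflexivity].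
Qed.

Lemma test_smooth phi : test phi -> smooth2 phi. Proof. by case. Qed.

Lemma test_cont phi : test phi -> continuous phi.
Proof. by move=> /test_smooth/smooth2_cont. Qed.

Lemma test_sq phi : test phi -> sq phi.
Proof. by move=> /test_cont/sqint_cont2. Qed.

Lemma testM f phi : smooth2 f -> test phi -> test (fun z => f z * phi z).
Proof.
move=> sf /test2P[sp [d d0 hd]]; apply/test2P; split; first exact: smooth2M.
by exists d => // z; rewrite mulf_eq0 negb_or => /andP[_ /hd].
Qed.

Lemma testD phi psi : test phi -> test psi -> test (fun z => phi z + psi z).
Proof.
move=> /test2P[sp [d d0 hd]] /test2P[sq [e e0 he]]; apply/test2P; split.
  exact: smooth2D.
exists (Num.min d e); first by rewrite lt_min d0.
have [m1 m2] : Num.min d e <= d /\ Num.min d e <= e by rewrite !ge_min !lexx orbT.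
move=> z h; have {h} : (phi z != 0) || (psi z != 0).
  by apply: contraNT h; rewrite negb_or !negbK => /andP[/eqP-> /eqP->]; rewrite addr0.
move: m1 m2; set m := Num.min d e => m1 m2.
by move=> /orP[/hd|/he] [/andP[? ?] /andP[? ?]]; split; apply/andP; split; lra.
Qed.

Lemma testZ (c : R) phi : test phi -> test (fun z => c * phi z).
Proof. by apply: testM; exact: smooth2_cst. Qed.

(** As a function of its second point the kernel lives in [z - [e, 2e]^2], which is compact in the
    rectangle as soon as both coordinates of [z] exceed [2 e]. *)
Lemma test_kern2 (e : R) a b z : ckern e a -> ckern e b -> 0 < e ->
  2 * e < z.1 < L1 -> 2 * e < z.2 < L2 -> test (kern2 a b z).
Proof.
move=> ka kb e0 /andP[z1 z1L] /andP[z2 z2L]; apply/test2P; split.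
  by apply: smooth2_kern2; [case: ka|case: kb].
pose d := Num.min e (Num.min (z.1 - 2 * e) (z.2 - 2 * e)).
have [d1 d2 d3] : [/\ d <= e, d <= z.1 - 2 * e & d <= z.2 - 2 * e].
  by rewrite /d !ge_min !lexx !orbT.
exists d; first by rewrite /d !lt_min e0 !subr_gt0 z1.
move=> w; rewrite /kern2 mulf_eq0 negb_or => /andP[ha hb].
have aux (k : R -> R) (s : R) : (forall x : R, x < e \/ 2 * e < x -> k x = 0) ->
    k s != 0 -> e <= s <= 2 * e.
  move=> k0 ks; rewrite !leNgt; apply/andP.
  by split; apply/negP => h; case/eqP: ks; apply: k0; [left|right].
have /andP[? ?] := aux _ _ ka.2 ha; have /andP[? ?] := aux _ _ kb.2 hb.
by split; apply/andP; split; lra.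
Qed.

Hypotheses (hL1 : 0 < L1) (hL2 : 0 < L2).

Lemma I_dx0 F : smooth2 F -> (forall y, 0 < y < L2 -> F (0, y) = F (L1, y)) ->
  I2 (dx F) = 0.
Proof.
move=> sF F0; have IF : Itg leb2 Om (dx F) by apply: Itg_cont2; exact: smooth2_cont (smooth2_dx sF).
have mI (L : R) : measurable (`]0, L[%classic : set (measurableTypeR R)) by exact: measurable_itv.
apply: etrans (fubini_I2 (mI L1) (mI L2) IF) _.
rewrite -[RHS](I0 (@lebesgue_measure R) (mI L2)); apply: eq_I => y; rewrite /= in_itv/= => hy.
have := FTC_smooth (ltW hL1) (smooth2_slicex y sF); rewrite F0// subrr => E.
apply: etrans E; apply: eq_Rintegral => x _.
by have := smooth2_isdx sF (x, y) => /= h; rewrite derive1E; apply/esym/derive_val.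
Qed.

Lemma I_dy0 F : smooth2 F -> (forall x, 0 < x < L1 -> F (x, 0) = F (x, L2)) ->
  I2 (dy F) = 0.
Proof.
move=> sF F0; have IF : Itg leb2 Om (dy F) by apply: Itg_cont2; exact: smooth2_cont (smooth2_dy sF).
have mI (L : R) : measurable (`]0, L[%classic : set (measurableTypeR R)) by exact: measurable_itv.
apply: etrans (fubini_I (mI L1) (mI L2) IF) _.
rewrite -[RHS](I0 (@lebesgue_measure R) (mI L1)); apply: eq_I => x; rewrite /= in_itv/= => hx.
have := FTC_smooth (ltW hL2) (smooth2_slicey x sF); rewrite F0// subrr => E.
apply: etrans E; apply: eq_Rintegral => y _.
by have := smooth2_isdy sF (x, y) => /= h; rewrite derive1E; apply/esym/derive_val.
Qed.

Lemma test_bdry phi z : test phi -> (z.1 <= 0 \/ L1 <= z.1) \/ (z.2 <= 0 \/ L2 <= z.2) ->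
  phi z = 0.
Proof.
move=> /test2P[sp [d d0 hd]] h; apply/eqP/negPn/negP => /hd [/andP[? ?] /andP[? ?]].
by case: h => [[]|[]] ?; lra.
Qed.

(* weak derivatives of order one in the direction x (i = false) or y (i = true) *)
Definition wd (i : bool) u v := sq v /\
  forall phi, test phi -> I2 (fun z => u z * dd i phi z) = - I2 (fun z => v z * phi z).

Lemma sq_smooth f : smooth2 f -> sq f.
Proof. by move=> /smooth2_cont/sqint_cont2. Qed.

Let wdx_smooth f : smooth2 f -> wd false f (dx f).
Proof.
move=> sf; split=> [|phi tp]; first exact: sq_smooth (smooth2_dx sf).
have sp := test_smooth tp; have sd := smooth2_dx sf; have sdp := smooth2_dx sp.
have : I2 (dx (fun z => f z * phi z)) = 0.
  apply: I_dx0 => [|y _]; first exact: smooth2M.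
  have b0 : phi (0, y) = 0 by apply: (test_bdry tp); left; left.
  have b1 : phi (L1, y) = 0 by apply: (test_bdry tp); left; right.
  by rewrite b0 b1 !mulr0.
under eq_Rintegral do rewrite dxM//.
rewrite (ID mO (sqintM mO (sq_smooth sf) (sq_smooth sdp)) (sqintM mO (sq_smooth sp) (sq_smooth sd))).
by move/eqP; rewrite addr_eq0 => /eqP ->; congr (- _); apply: eq_Rintegral => z _; rewrite mulrC.
Qed.

Let wdy_smooth f : smooth2 f -> wd true f (dy f).
Proof.
move=> sf; split=> [|phi tp]; first exact: sq_smooth (smooth2_dy sf).
have sp := test_smooth tp; have sd := smooth2_dy sf; have sdp := smooth2_dy sp.
have : I2 (dy (fun z => f z * phi z)) = 0.
  apply: I_dy0 => [|x _]; first exact: smooth2M.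
  have b0 : phi (x, 0) = 0 by apply: (test_bdry tp); right; left.
  have b1 : phi (x, L2) = 0 by apply: (test_bdry tp); right; right.
  by rewrite b0 b1 !mulr0.
under eq_Rintegral do rewrite dyM//.
rewrite (ID mO (sqintM mO (sq_smooth sf) (sq_smooth sdp)) (sqintM mO (sq_smooth sp) (sq_smooth sd))).
by move/eqP; rewrite addr_eq0 => /eqP ->; congr (- _); apply: eq_Rintegral => z _; rewrite mulrC.
Qed.

Lemma wd_smooth i f : smooth2 f -> wd i f (dd i f).
Proof. by case: i; [exact: wdy_smooth|exact: wdx_smooth]. Qed.

Lemma smooth2_mo e u : 0 < e -> sq u -> smooth2 (mo e u).
Proof.
by move=> e0 su; apply: (smooth2_conv (sqint_Itg1 mO fO su) (ckern_mol e0) (ckern_mol e0)).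
Qed.

Lemma dd_moE i e u z : 0 < e -> sq u ->
  dd i (mo e u) z = - I2 (fun w => u w * dd i (kern2 (mol e) (mol e) z) w).
Proof.
move=> e0 su; have k := ckern_mol e0; have Iu := sqint_Itg1 mO fO su.
case: i => /=.
  have Ik := Itg_kern2 z Iu k (ckern_d1 k).
  rewrite (isdyE (isdy_conv Iu k k)) -[LHS]opprK; congr (- _); rewrite /conv -IN//.
  by apply: eq_Rintegral => w _; rewrite dy_kern2 ?mulrN//; case: k.
have Ik := Itg_kern2 z Iu (ckern_d1 k) k.
rewrite (isdxE (isdx_conv Iu k k)) -[LHS]opprK; congr (- _); rewrite /conv -IN//.
by apply: eq_Rintegral => w _; rewrite dx_kern2 ?mulrN//; case: k.
Qed.

(** At such [z] the kernel is a test function and the definition of the weak derivative applies at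
    once. Up to [Gamma] the same identity is a matter of traces, see [mo_dd]. *)
Lemma dd_mo i e u v z : 0 < e -> sq u -> wd i u v ->
  2 * e < z.1 < L1 -> 2 * e < z.2 < L2 -> dd i (mo e u) z = mo e v z.
Proof.
move=> e0 su [sv uv] h1 h2; rewrite dd_moE// uv ?opprK//.
exact: (test_kern2 (ckern_mol e0) (ckern_mol e0) e0 h1 h2).
Qed.

(** Only the sides of [Gamma] are cut off: the mollifier looks to the left and below, so it meets no
    obstruction near the other two sides. *)
Definition qd (d : R) (z : R * R) : R := if (d < z.1) && (d < z.2) then 1 else 0.

Lemma meas_qd d : measurable_fun Om (qd d : RR -> R).
Proof.
have -> : qd d = \1_(`]d, +oo[%classic `*` `]d, +oo[%classic) :> (RR -> R).
  apply/funext => -[x y]; rewrite /qd indicE /=; case: ifPn => h.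
    by rewrite mem_set//= !in_itv/= !andbT; apply/andP.
  by rewrite memNset//= !in_itv/= !andbT => /andP; rewrite (negbTE h).
by apply: measurable_funTS; apply: measurable_indic; apply: measurableX.
Qed.

Lemma qd_bnd d z : `|qd d z| <= 1.
Proof. by rewrite /qd; case: ifP; rewrite ?normr1 ?normr0. Qed.

Lemma sq_qd d u : sq u -> sq (fun z => qd d z * u z).
Proof.
move=> su; have [//] := sqint_bndM mO (meas_qd d) (fun z _ => qd_bnd d z) su.
Qed.

Lemma en_lt (d : R) : 0 < d -> \forall n \near \oo, en n < d.
Proof. by move=> d0; apply: (cvgr_lt 0) => //; exact: en_cvg. Qed.

Lemma cv_qd F : Itg leb2 Om F -> I2 (fun z => qd (en n) z * F z) @[n --> \oo] --> I2 F.
Proof.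
move=> IF; have mF := Itg_meas IF.
apply: (Rdct mO (g := fun z => `|F z|)) => //.
- by move=> n; apply: measurable_funM => //; exact: meas_qd.
- exact: Itg_norm.
- by move=> n z _; rewrite normrM -[leRHS]mul1r; apply: ler_wpM2r => //; exact: qd_bnd.
apply: aeW => -[x y] /OmE[/andP[x0 _] /andP[y0 _]]; apply: cvg_near_cst.
have hx := en_lt x0; have hy := en_lt y0.
by near=> n; rewrite /qd /= ifT ?mul1r//; apply/andP; split; near: n.
Unshelve. all: by end_near. Qed.

Lemma lim_norm_le (x : nat -> R) (l K : R) : x n @[n --> \oo] --> l ->
  (\forall n \near \oo, `|x n| <= K) -> `|l| <= K.
Proof.
move=> xl xK; have xl' : `|x n| @[n --> \oo] --> `|l| by exact: cvg_norm.
by rewrite -(cvg_lim (@Rhausdorff R) xl'); apply: limr_le => //; apply/cvg_ex; exists `|l|.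
Qed.

Lemma cvg_near_eq (x y : nat -> R) (l : R) : (\forall n \near \oo, x n = y n) ->
  y n @[n --> \oo] --> l -> x n @[n --> \oo] --> l.
Proof.
move=> E /cvgrPdist_le h; apply/cvgrPdist_le => e e0.
by apply: filterS2 E (h e e0) => n -> .
Qed.

(** Where both coordinates exceed [d], mollifications of [v] at small scales are integrals of [v]
    against test functions, hence zero. Their weak limit [v], tested with its own restriction
    [qd d * v], vanishes there as well. *)
Lemma test_orth v : sq v -> (forall phi, test phi -> I2 (fun z => v z * phi z) = 0) ->
  {ae leb2, forall z, Om z -> v z = 0}.
Proof.
move=> sv v0.
have key d : 0 < d -> I2 (fun z => qd d z * v z ^+ 2) = 0.
  move=> d0; have sg := sq_qd d sv.
  have := weak_cvg sg sv.
  have -> : (fun z => v z * (qd d z * v z)) = (fun z => qd d z * v z ^+ 2).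
    by apply/funext => z; rewrite mulrCA expr2.
  move=> h; apply/eqP; rewrite -normr_le0; apply: (lim_norm_le h).
  have d2 : 0 < d / 2 by rewrite divr_gt0.
  apply: filterS (en_lt d2) => n hn; rewrite normr_le0; apply/eqP.
  rewrite -[RHS](I0 leb2 mO); apply: eq_I => -[x y] /OmE[/andP[x0 xL] /andP[y0 yL]].
  rewrite /qd /=; case: ifP => [/andP[dx dy]|_]; last by rewrite mul0r mulr0.
  rewrite (_ : mo (en n) v (x, y) = 0) ?mul0r//; apply: v0.
  apply: (@test_kern2 (en n)) => //; try exact: ckern_mol (en_gt0 n).
  - exact: en_gt0.
  - by rewrite /= xL andbT; lra.
  - by rewrite /= yL andbT; lra.
apply: (sqn0_ae mO sv).
have h := cv_qd sv.2; rewrite (funext (fun n => key _ (en_gt0 n))) in h.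
have h0 : (fun _ : nat => 0 : R) @ \oo --> (0 : R) by exact: cvg_cst.
exact: (cvg_unique (@Rhausdorff R) h h0).
Qed.

Lemma test_orth2 u v : sq u -> sq v ->
  (forall phi, test phi -> I2 (fun z => u z * phi z) = I2 (fun z => v z * phi z)) ->
  {ae leb2, forall z, Om z -> u z = v z}.
Proof.
move=> su sv uv; have := @test_orth (fun z => u z - v z) (sqintB mO su sv).
move=> h; have Fae := ae_filter_ringOfSetsType (@leb2 R).
apply: (@filterS _ _ Fae _ _ _ (h _)); first by move=> z + Oz => /(_ Oz) /eqP; rewrite subr_eq0 => /eqP.
move=> phi tp; have sp := test_sq tp.
have := uv phi tp => E; rewrite -[RHS](subrr (I2 (fun z => v z * phi z))) -{1}E.
rewrite -(IB mO (sqintM mO su sp) (sqintM mO sv sp)).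
by apply: eq_Rintegral => z _; rewrite mulrBl.
Qed.

(* By mollification of [a]. *)
Lemma wd_leibniz i a ax u ux phi : sq a -> sq u -> wd i a ax -> wd i u ux -> test phi ->
  I2 (fun z => a z * u z * dd i phi z) =
  - I2 (fun z => (ax z * u z + a z * ux z) * phi z).
Proof.
move=> sa su [sax hax] [sux hux] tp.
have tdp := test_dd i tp.
have s1 : sq (fun z => dd i phi z * u z) by exact: sqint_contM (test_cont tdp) su.
have s2 : sq (fun z => phi z * u z) by exact: sqint_contM (test_cont tp) su.
have s3 : sq (fun z => phi z * ux z) by exact: sqint_contM (test_cont tp) sux.
have c1 := weak_cvg s1 sa; have c2 := weak_cvg s2 sax; have c3 := weak_cvg s3 sa.
have [_ [d d0 hd]] := (test2P phi).1 tp.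
have d2 : 0 < d / 2 by rewrite divr_gt0.
(* [mo (en n) a * phi] is a test function for [u], and on the support of [phi], further than
   [2 * en n] from [Gamma], the derivative of the mollified [a] is the mollified [ax]. *)
have E : \forall n \near \oo, I2 (fun z => mo (en n) a z * (dd i phi z * u z)) =
    - (I2 (fun z => mo (en n) ax z * (phi z * u z)) + I2 (fun z => mo (en n) a z * (phi z * ux z))).
  apply: filterS (en_lt d2) => n hn.
  have sm := smooth2_mo (en_gt0 n) sa; have tm := testM sm tp.
  have smq := sq_mo n sa; have smx := sq_mo n sax.
  have := hux _ tm; under eq_Rintegral do rewrite (ddM i _ sm (test_smooth tp)) mulrDr.
  have e1 : forall z, Om z -> u z * (phi z * dd i (mo (en n) a) z) = mo (en n) ax z * (phi z * u z).
    move=> [x y] /OmE[/andP[x0 xL] /andP[y0 yL]].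
    have [p0|pn0] := eqVneq (phi (x, y)) 0; first by rewrite p0 !mul0r !mulr0.
    have [/= /andP[? ?] /andP[? ?]] := hd _ pn0.
    rewrite (dd_mo (v := ax) (en_gt0 n)) //=; first by rewrite mulrCA mulrA mulrC.
      by rewrite xL andbT; lra.
    by rewrite yL andbT; lra.
  have i1 : Itg leb2 Om (fun z => u z * (mo (en n) a z * dd i phi z)).
    by apply: (Itg_eq mO) (sqintM mO smq s1) => z _; ring.
  have i2 : Itg leb2 Om (fun z => u z * (phi z * dd i (mo (en n) a) z)).
    by apply: (Itg_eq mO) (sqintM mO smx s2) => z Oz; rewrite e1.
  rewrite (ID mO i1 i2) (eq_I leb2 e1) => h.
  apply/eqP; rewrite -subr_eq0 opprK addrA; apply/eqP.
  have -> : I2 (fun z => mo (en n) a z * (dd i phi z * u z)) =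
            I2 (fun z => u z * (mo (en n) a z * dd i phi z)).
    by apply: eq_Rintegral => z _; rewrite mulrA [RHS]mulrC.
  rewrite h addrC; apply/eqP; rewrite subr_eq0; apply/eqP.
  by apply: eq_Rintegral => z _; ring.
have h1 := cvgN (cvgD c2 c3).
have h2 : I2 (fun z => mo (en n) a z * (dd i phi z * u z)) @[n --> \oo] -->
   - (I2 (fun z => ax z * (phi z * u z)) + I2 (fun z => a z * (phi z * ux z))).
  by apply: (cvg_near_eq E); exact: h1.
have := cvg_unique (@Rhausdorff R) c1 h2.
rewrite -(ID mO (sqintM mO sax s2) (sqintM mO sa s3)).
have -> : I2 (fun z => a z * u z * dd i phi z) = I2 (fun z => a z * (dd i phi z * u z)).
  by apply: eq_Rintegral => z _; rewrite -mulrA [u z * _]mulrC.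
by move=> ->; congr (- _); apply: eq_Rintegral => z _; ring.
Qed.

End WeakDerivatives.

(** * Multipliers in Sobolev spaces *)

Lemma sum4_le (R : realType) (p q r s t : R) : s <= t -> r <= t -> q <= t -> p <= t ->
  p + r + (q + s) <= 4 * t.
Proof. lra. Qed.

Section Sobolev.
Context {R : realType}.
Notation RR := (measurableTypeR R * measurableTypeR R)%type.
Notation mu := (@lebesgue_measure R).
Implicit Types (f g u v phi : R * R -> R).
Variables (L1 L2 : R).
Hypotheses (hL1 : 0 < L1) (hL2 : 0 < L2).
Notation Om := (Omega L1 L2).
Notation I2 f := (\int[leb2]_(z in Om) f z).
Notation sq := (sqint leb2 Om).
Notation sn := (sqn leb2 Om).
Notation mo := (mo L1 L2).
Notation wd := (wd L1 L2).

Let mO : measurable (Om : set RR) := Om_meas L1 L2.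
Let fO := Om_fin L1 L2.

Let mI (p q : R) : measurable (`]p, q[%classic : set (measurableTypeR R)).
Proof. exact: measurable_itv. Qed.

(** [a x - a s] is bounded by the L^1 norm of the derivative, to which Cauchy-Schwarz applies; the
    inequality [a(x)^2 <= 2 a(s)^2 + 2 (a(x) - a(s))^2] is then averaged over [s]. *)
Lemma sup1 (a : R -> R) (p q x : R) : p < x < q -> smooth1 a ->
  a x ^+ 2 <= 2 / (q - p) * (\int[mu]_(s in `]p, q[) (a s ^+ 2)) +
              2 * (q - p) * (\int[mu]_(s in `]p, q[) (derive1 a s ^+ 2)).
Proof.
move=> /andP[px xq] sa.
have pq : p < q by exact: lt_trans xq.
have qp0 : 0 < q - p by rewrite subr_gt0.
have sa' := smooth1_d1 sa.
have mpq := mI p q.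
have If (f : R -> R) : continuous f -> Itg mu `]p, q[ f by exact: Itg_cont.
have c2 (f : R -> R) : continuous f -> continuous (fun s => f s ^+ 2).
  by move=> cf s; apply: cvgM; exact: cf.
have cn (f : R -> R) : continuous f -> continuous (fun s => `|f s|).
  by move=> cf s; apply: cvg_norm; exact: cf.
have ca := smooth1_cont sa; have ca' := smooth1_cont sa'.
set B := \int[mu]_(s in `]p, q[) (derive1 a s ^+ 2).
have lebpq : fine (mu `]p, q[%classic) = q - p.
  by rewrite lebesgue_measure_itv/= lte_fin pq -EFinD.
have sqf (f : R -> R) : continuous f -> sqint mu `]p, q[ f.
  move=> cf; split; first exact: Itg_meas (If _ cf).
  exact: If (c2 _ cf).
pose N := \int[mu]_(s in `]p, q[) `|derive1 a s|.
have hN : N ^+ 2 <= (q - p) * B.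
  have c1 : continuous (fun _ : R => 1 : R) by move=> s; exact: cvg_cst.
  have := cauchy_schwarz mpq (sqf _ (cn _ ca')) (sqf _ c1).
  have -> : \int[mu]_(s in `]p, q[) (`|derive1 a s| * 1) = N.
    by apply: eq_Rintegral => s _; rewrite mulr1.
  have -> : sqn mu `]p, q[ (fun=> 1 : R) = q - p.
    rewrite /sqn; under eq_Rintegral do rewrite expr1n.
    by rewrite (Rintegral_cst _ mpq) mul1r.
  have -> : sqn mu `]p, q[ (fun s => `|derive1 a s|) = B.
    by apply: eq_Rintegral => s _; rewrite real_normK ?num_real.
  by rewrite mulrC.
have hd s t : p < s -> s <= t -> t < q -> `|a t - a s| <= N.
  move=> ps st tq.
  rewrite -(FTC_smooth st sa).
  have Ist : Itg mu `]s, t[ (derive1 a) by exact: Itg_cont.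
  apply: le_trans (norm_I (mI s t) Ist) _.
  rewrite /N /Rintegral; apply: fine_le.
  - by apply: integrable_fin_num => //; exact: Itg_norm Ist.
  - by apply: integrable_fin_num => //; exact: If (cn _ ca').
  apply: ge0_subset_integral => //.
    by apply/measurable_EFinP; exact: Itg_meas (If _ (cn _ ca')).
  by apply: subset_itv; rewrite bnd_simp ltW.
have key s : `]p, q[%classic s -> a x ^+ 2 <= 2 * a s ^+ 2 + 2 * ((q - p) * B).
  rewrite /= in_itv/= => /andP[ps sq0].
  have h : `|a x - a s| <= N.
    have [xs|sx] := leP x s; first by rewrite distrC; exact: hd.
    by apply: hd => //; exact: ltW.
  have h2 : (a x - a s) ^+ 2 <= (q - p) * B.
    apply: le_trans hN; rewrite -[leLHS]real_normK ?num_real// ler_sqr ?nnegrE//.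
    by rewrite /N; apply: Rintegral_ge0 => ? _.
  have -> : a x = a s + (a x - a s) by rewrite addrC subrK.
  apply: le_trans (_ : 2 * (a s ^+ 2 + (a x - a s) ^+ 2) <= _).
    rewrite -subr_ge0 (_ : _ - _ = (a s - (a x - a s)) ^+ 2) ?sqr_ge0//; ring.
  by rewrite mulrDr lerD2l ler_wpM2l.
have c3 : continuous (fun s => 2 * a s ^+ 2 + 2 * ((q - p) * B)).
  by move=> s; apply: cvgD; [apply: cvgM; [exact: cvg_cst|exact: c2]|exact: cvg_cst].
have Ic (c : R) : Itg mu `]p, q[ (fun=> c) by apply: If => s; exact: cvg_cst.
have := le_I mpq (Ic _) (If _ c3) key.
rewrite (Rintegral_cst _ mpq) (ID mpq (ItgZ mpq 2 (If _ (c2 _ ca))) (Ic _)).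
rewrite (IZ mpq _ (If _ (c2 _ ca))) (Rintegral_cst _ mpq) lebpq => h.
rewrite -(ler_pM2r qp0); apply: le_trans h _.
rewrite le_eqVlt; apply/orP; left; apply/eqP; field; exact: lt0r_neq0.
Qed.

(** Serves both directions and every interval []d, L[] with [d < L / 2], whose length lies between
    [L / 2] and [L]: it dominates the constants [2 / (L - d)] and [2 (L - d)] of [sup1]. *)
Definition supcst : R := 4 / L1 + 4 / L2 + 2 * L1 + 2 * L2.

Local Notation S := supcst.

Lemma supcst_gt0 : 0 < S.
Proof. by rewrite /supcst !addr_gt0// ?divr_gt0// mulr_gt0. Qed.

Definition d0 : R := Num.min L1 L2 / 2.

Lemma d0_gt0 : 0 < d0. Proof. by rewrite /d0 divr_gt0// lt_min hL1. Qed.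

Let dL d : d < d0 -> d < L1 / 2 /\ d < L2 / 2.
Proof.
rewrite /d0 => h; split; apply: lt_le_trans h _; rewrite ler_pM2r ?invr_gt0//.
  by rewrite ge_min lexx.
by rewrite ge_min lexx orbT.
Qed.

Let sup1S L (a : R -> R) (d x : R) : 0 < L -> 4 / L <= S -> 2 * L <= S -> 0 < d < L / 2 ->
  d < x < L -> smooth1 a ->
  a x ^+ 2 <= S * \int[mu]_(s in `]d, L[) (a s ^+ 2 + derive1 a s ^+ 2).
Proof.
move=> L0 s1 s2 /andP[d0 dL'] xdL sa; apply: le_trans (sup1 xdL sa) _.
have c2 (f : R -> R) : continuous f -> Itg mu `]d, L[ (fun s => f s ^+ 2).
  by move=> cf; apply: Itg_cont => s; apply: cvgM; exact: cf.
have i1 := c2 _ (smooth1_cont sa); have i2 := c2 _ (smooth1_cont (smooth1_d1 sa)).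
rewrite (ID (mI d L) i1 i2) [leRHS]mulrDr; apply: lerD; apply: ler_wpM2r;
  try (by apply: Rintegral_ge0 => s _; exact: sqr_ge0).
  apply: le_trans s1.
  have -> : 4 / L = 2 / (L / 2) by field; exact: lt0r_neq0.
  by rewrite ler_pM2l// lef_pV2 ?posrE; lra.
by apply: le_trans s2; lra.
Qed.

Let SL1 : 4 / L1 <= S /\ 2 * L1 <= S.
Proof.
have h1 : 0 < 4 / L1 by rewrite divr_gt0. have h2 : 0 < 4 / L2 by rewrite divr_gt0.
by rewrite /supcst; move: (4 / L1) (4 / L2) h1 h2 => a b h1 h2; split; move: hL1 hL2; lra.
Qed.

Let SL2 : 4 / L2 <= S /\ 2 * L2 <= S.
Proof.
have h1 : 0 < 4 / L1 by rewrite divr_gt0. have h2 : 0 < 4 / L2 by rewrite divr_gt0.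
by rewrite /supcst; move: (4 / L1) (4 / L2) h1 h2 => a b h1 h2; split; move: hL1 hL2; lra.
Qed.

Let AX (d : R) f g (y : R) := \int[mu]_(s in `]d, L1[) (f (s, y) ^+ 2 + g (s, y) ^+ 2).
Let AY (d : R) f g (x : R) := \int[mu]_(s in `]d, L2[) (f (x, s) ^+ 2 + g (x, s) ^+ 2).

Let supX d f x y : 0 < d < d0 -> smooth2 f -> d < x < L1 ->
  f (x, y) ^+ 2 <= S * AX d f (dx f) y.
Proof.
move=> /andP[dp /dL[d1 d2]] sf hx; have [s1 s2] := SL1.
have := sup1S hL1 s1 s2 _ hx (smooth2_slicex y sf); rewrite dp d1 => /(_ isT) h.
rewrite (_ : AX d f (dx f) y = \int[mu]_(s in `]d, L1[) (f (s, y) ^+ 2 +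
  derive1 (fun t => f (t, y)) s ^+ 2)); first exact: h.
by apply: eq_Rintegral => s _; rewrite dxE.
Qed.

Let supY d f x y : 0 < d < d0 -> smooth2 f -> d < y < L2 ->
  f (x, y) ^+ 2 <= S * AY d f (dy f) x.
Proof.
move=> /andP[dp /dL[d1 d2]] sf hy; have [s1 s2] := SL2.
have := sup1S hL2 s1 s2 _ hy (smooth2_slicey x sf); rewrite dp d2 => /(_ isT) h.
rewrite (_ : AY d f (dy f) x = \int[mu]_(s in `]d, L2[) (f (x, s) ^+ 2 +
  derive1 (fun t => f (x, t)) s ^+ 2)); first exact: h.
by apply: eq_Rintegral => s _; rewrite dyE.
Qed.

(** The region in which, for [2 e < d], differentiation commutes with mollification whatever the
    traces. It extends up to the right and upper sides. *)
Definition inner (d : R) : set RR := `]d, L1[%classic `*` `]d, L2[%classic.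

Local Notation Q := inner.

Lemma meas_inner d : measurable (Q d : set RR). Proof. exact: measurableX. Qed.

Lemma inner_sub d : 0 < d -> Q d `<=` Om.
Proof.
move=> dp [x y] [/=]; rewrite !in_itv/= => /andP[? ?] /andP[? ?].
by apply/OmE; split; apply/andP; split => //; lra.
Qed.

Let sq2 f g : continuous f -> continuous g ->
  continuous (fun z : R * R => f z ^+ 2 + g z ^+ 2).
Proof. by move=> cf cg z; apply: cvgD; apply: cvgM; [exact: cf|exact: cf|exact: cg|exact: cg]. Qed.

Let IQ d f g : 0 < d -> continuous f -> continuous g ->
  Itg leb2 (Q d) (fun z => f z ^+ 2 + g z ^+ 2).
Proof.
by move=> dp cf cg; apply: (integrableS mO (meas_inner d) (inner_sub dp)); apply: Itg_cont2; exact: sq2.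
Qed.

Let IAX d f g : 0 < d -> continuous f -> continuous g -> Itg mu `]d, L2[ (AX d f g) /\
  \int[mu]_(y in `]d, L2[) AX d f g y = \int[leb2]_(z in Q d) (f z ^+ 2 + g z ^+ 2).
Proof.
move=> dp cf cg; have I := IQ dp cf cg; split; first exact: (fubini_Itg2 (mI d L1) (mI d L2) I).
by apply/esym; apply: (fubini_I2 (mI d L1) (mI d L2) I).
Qed.

Let IAY d f g : 0 < d -> continuous f -> continuous g -> Itg mu `]d, L1[ (AY d f g) /\
  \int[mu]_(x in `]d, L1[) AY d f g x = \int[leb2]_(z in Q d) (f z ^+ 2 + g z ^+ 2).
Proof.
move=> dp cf cg; have I := IQ dp cf cg; split; first exact: (fubini_Itg (mI d L1) (mI d L2) I).
by apply/esym; apply: (fubini_I (mI d L1) (mI d L2) I).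
Qed.

Lemma subset_I (A : set RR) f : measurable A -> A `<=` Om -> Itg leb2 Om f -> (forall z, Om z -> 0 <= f z) ->
  \int[leb2]_(z in A) f z <= I2 f.
Proof.
move=> mA AO If f0; rewrite /Rintegral; apply: fine_le.
- by apply: integrable_fin_num => //; exact: integrableS If.
- exact: integrable_fin_num.
apply: ge0_subset_integral => //.
by apply/measurable_EFinP; exact: Itg_meas If.
Qed.

(* on Q d the derivative of mo e a is mo e applied to the weak derivative *)
Lemma inner_mo d e i a b : 0 < e -> 2 * e < d -> sq a -> wd i a b ->
  \int[leb2]_(z in Q d) (mo e a z ^+ 2 + dd i (mo e a) z ^+ 2) <= sn (mo e a) + sn (mo e b).
Proof.
move=> e0 ed sa ab; have dp : 0 < d by lra. have sb := ab.1.
have sma : sq (mo e a) := sq_smooth L1 L2 (smooth2_mo e0 sa).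
have smb : sq (mo e b) := sq_smooth L1 L2 (smooth2_mo e0 sb).
have E : \int[leb2]_(z in Q d) (mo e a z ^+ 2 + dd i (mo e a) z ^+ 2) =
         \int[leb2]_(z in Q d) (mo e a z ^+ 2 + mo e b z ^+ 2).
  apply: eq_I => -[x y] [/=]; rewrite !in_itv/= => /andP[x1 x2] /andP[y1 y2].
  congr (_ + _ ^+ 2); apply: (dd_mo e0 sa ab) => /=.
    by rewrite x2 andbT; lra.
  by rewrite y2 andbT; lra.
rewrite E /sqn -(ID mO sma.2 smb.2); apply: subset_I; [exact: meas_inner|exact: inner_sub| |].
  by apply: ItgD => //; [exact: sma.2|exact: smb.2].
by move=> z _; rewrite addr_ge0// sqr_ge0.
Qed.

(** Sobolev's inequality in [x] bounds [f^2] by a function of [y] alone, the one in [y] bounds [g^2]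
    by a function of [x] alone; the product of the two bounds integrates to the product of their
    integrals. Each factor thus spends a single derivative. *)
Lemma inner_prod d f g : 0 < d < d0 -> smooth2 f -> smooth2 g ->
  \int[leb2]_(z in Q d) ((f z * g z) ^+ 2) <=
  S ^+ 2 * ((\int[leb2]_(z in Q d) (f z ^+ 2 + dx f z ^+ 2)) *
            (\int[leb2]_(z in Q d) (g z ^+ 2 + dy g z ^+ 2))).
Proof.
move=> dd0 sf sg; have /andP[dp _] := dd0.
have [cf cg] := (smooth2_cont sf, smooth2_cont sg).
have [cfx cgy] := (smooth2_cont (smooth2_dx sf), smooth2_cont (smooth2_dy sg)).
have [iX eX] := IAX dp cf cfx; have [iY eY] := IAY dp cg cgy.
have [iP eP] := I_prodX (mI d L1) (mI d L2) iY iX.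
rewrite -eX -eY [X in _ <= _ * X]mulrC -eP -(IZ (meas_inner d) _ iP).
apply: (le_I (meas_inner d)).
- apply: (integrableS mO (meas_inner d) (inner_sub dp)); apply: Itg_cont2 => z.
  by apply: cvgM; apply: cvgM; [exact: cf|exact: cg|exact: cf|exact: cg].
- exact: (ItgZ (meas_inner d)).
move=> [x y] [/=]; rewrite !in_itv/= => hx hy.
have h1 := supX y dd0 sf hx; have h2 := supY x dd0 sg hy.
rewrite exprMn /= mulrC.
apply: le_trans (ler_pM (sqr_ge0 _) (sqr_ge0 _) h2 h1) _.
by rewrite le_eqVlt; apply/orP; left; apply/eqP; ring.
Qed.


(** Sobolev's inequality is applied in [x] and then in [y], so the only second derivative involved
    is the mixed one. It concerns smooth functions, hence the formulation on mollifications,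
    uniformly in the scale. *)
Lemma mo_sup : exists C : R, 0 <= C /\ forall a ax ay axy (A : R),
  sq a -> wd false a ax -> wd true a ay -> wd true ax axy ->
  sn a <= A -> sn ax <= A -> sn ay <= A -> sn axy <= A ->
  forall d e z, 0 < d < d0 -> 0 < e -> 2 * e < d -> Q d z -> mo e a z ^+ 2 <= C * A.
Proof.
have [K [K0 hK]] := mo_young L1 L2.
exists (S ^+ 2 * (4 * K ^+ 2)); split.
  by apply: mulr_ge0; [exact: sqr_ge0|apply: mulr_ge0 => //; exact: sqr_ge0].
move=> a ax ay axy A sa ax_ ay_ axy_ nA nax nay naxy d e [x y] dd0 e0 ed [/=].
rewrite !in_itv/= => hx hy.
have /andP[dp _] := dd0.
have sax := ax_.1; have say := ay_.1; have saxy := axy_.1.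
pose f := mo e a; pose g := mo e ax.
have sf : smooth2 f by exact: smooth2_mo.
have sg : smooth2 g by exact: smooth2_mo.
have cf := smooth2_cont sf; have cg := smooth2_cont sg.
have cfy := smooth2_cont (smooth2_dy sf); have cgy := smooth2_cont (smooth2_dy sg).
(* The [x]-derivative is rewritten as the mollification of [ax], so that the inequality in [y] meets
   the weak derivative [axy]. *)
have EX : AX d f (dx f) y = AX d f g y.
  apply: eq_Rintegral => s; rewrite inE/= in_itv/= => /andP[s1 s2].
  congr (_ + _ ^+ 2); apply: (dd_mo (i := false) e0 sa ax_) => /=.
    by rewrite s2 andbT; lra.
  by case/andP: hy => h1 h2; rewrite h2 andbT; lra.
apply: le_trans (supX y dd0 sf hx) _; rewrite EX expr2 -!mulrA.
apply: ler_wpM2l; first exact: (ltW supcst_gt0).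
have [i1 e1] := IAY dp cf cfy; have [i2 e2] := IAY dp cg cgy.
have csl (u : R * R -> R) : smooth2 u -> continuous (fun s => u (s, y) ^+ 2).
  by move=> su s; apply: cvgM; exact: (smooth1_cont (smooth2_slicex y su)).
have hF s : f (s, y) ^+ 2 <= S * AY d f (dy f) s by exact: supY.
have hG s : g (s, y) ^+ 2 <= S * AY d g (dy g) s by exact: supY.
move: (AY d f (dy f)) (AY d g (dy g)) hF hG i1 i2 e1 e2 => F G hF hG i1 i2 e1 e2.
have iFG := ItgD (mI d L1) i1 i2.
apply: le_trans (_ : \int[mu]_(s in `]d, L1[) (S * (F s + G s)) <= _).
  apply: (le_I (mI d L1) _ (ItgZ (mI d L1) S iFG)).
    by apply: (ItgD (mI d L1)); apply: Itg_cont; exact: csl.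
  by move=> s _; rewrite mulrDr; exact: lerD.
rewrite (IZ (mI d L1) S iFG) (ID (mI d L1) i1 i2) e1 e2.
apply: ler_wpM2l; first exact: (ltW supcst_gt0).
have h1 := inner_mo e0 ed sa ay_; have h2 := inner_mo e0 ed sax axy_.
have b u : sq u -> sn u <= A -> sn (mo e u) <= K ^+ 2 * A.
  by move=> su uA; have [_ h] := hK _ _ e0 su; apply: le_trans h _; rewrite ler_wpM2l ?sqr_ge0.
apply: le_trans (lerD h1 h2) _.
have := b _ sa nA; have := b _ sax nax; have := b _ say nay; have := b _ saxy naxy.
rewrite -/f -/g; move: (sn f) (sn g) (sn (mo e ay)) (sn (mo e axy)) => p q r s.
by rewrite [K * (K * A)]mulrA -[K * K]expr2; exact: sum4_le.
Qed.

(** A uniform bound passes to the weak limit. With [g] the sign of [a] on the set where [|a| > M],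
    the limit gives an integral of [a g] at most that of [M |g|], while [a g >= M |g|] pointwise;
    equality almost everywhere rules out [|a| > M]. *)
Lemma ae_bound a (M : R) : sq a -> 0 <= M ->
  (forall d, 0 < d < d0 -> \forall n \near \oo, forall z, Q d z -> `|mo (en n) a z| <= M) ->
  {ae leb2, forall z, Om z -> `|a z| <= M}.
Proof.
move=> sa M0 hM.
pose h (t : R) : R := if M < t then 1 else if t < - M then - 1 else 0.
have mh : measurable_fun setT h.
  by apply: measurable_fun_ifT => //; [exact: measurable_fun_ltr|
     apply: measurable_fun_ifT => //; exact: measurable_fun_ltr].
pose g z := h (a z).
have mg : measurable_fun Om (g : RR -> R) by exact: (measurableT_comp mh sa.1).
have g1 z : `|g z| <= 1.
  by rewrite /g /h; case: ifP => _; [|case: ifP => _]; rewrite ?normrN ?normr1 ?normr0.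
have sg : sq g by apply: (sqint_bnd mO fO (M := 1)) => // z _.
have sgn : sq (fun z => `|g z|).
  by apply: (sqint_bnd mO fO (M := 1)) => [|z _]; [exact: measurableT_comp|rewrite normr_id].
have Ig := sqint_Itg1 mO fO sgn.
have sqg d : sq (fun z => qd d z * g z) by exact: sq_qd.
have step1 d : 0 < d < d0 -> `|I2 (fun z => a z * (qd d z * g z))| <= M * I2 (fun z => `|g z|).
  move=> dd0; have /andP[dp _] := dd0.
  apply: (lim_norm_le (weak_cvg (sqg d) sa)).
  have hd2 : 0 < d / 2 by rewrite divr_gt0.
  apply: filterS2 (en_lt hd2) (hM _ dd0) => n _ hn.
  have sm := sq_mo n sa.
  rewrite -(IZ mO _ Ig); apply: (norm_I_le mO) => //; first exact: (sqintM mO).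
    exact: (ItgZ mO).
  move=> z Oz; rewrite !normrM; have [Qz|Qz] := pselect (Q d z).
    apply: ler_pM => //; first exact: hn.
    by rewrite -[leRHS]mul1r ler_wpM2r// qd_bnd.
  rewrite (_ : qd d z = 0); first by rewrite normr0 mul0r mulr0 mulr_ge0.
  rewrite /qd; case: ifP => // /andP[h1 h2]; case: Qz; case: z Oz h1 h2 => x y /OmE /= [/andP[_ xL] /andP[_ yL]] h1 h2.
  by split; rewrite /= in_itv/= ?h1 ?h2.
have Iag := sqintM mO sa sg.
have step2 : `|I2 (fun z => a z * g z)| <= M * I2 (fun z => `|g z|).
  apply: (lim_norm_le (cv_qd Iag)).
  apply: filterS (en_lt d0_gt0) => n hn.
  apply: le_trans (step1 (en n) _); last by rewrite en_gt0.
  rewrite le_eqVlt; apply/orP; left; apply/eqP; congr `|_|.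
  by apply: eq_I => z _; rewrite mulrCA.
have E z : `|(a z * g z)| = a z * g z /\ M * `|g z| <= a z * g z /\ (a z * g z = M * `|g z| -> `|a z| <= M).
  rewrite /g /h; case: ifP => [h1|h1]; [|case: ifP => h2].
  - rewrite normr1 !mulr1; split; first by rewrite ger0_norm// (le_trans M0)// ltW.
    by split; [exact: ltW|move=> ->; rewrite ger0_norm].
  - rewrite normrN normr1 mulr1 mulrN1; split; first by rewrite ger0_norm// oppr_ge0; move: M0 h2; lra.
    split; first by move: h2; lra.
    by move=> E; rewrite -normrN E ger0_norm.
  - rewrite normr0 !mulr0 normr0; split => //; split => // _; rewrite ler_norml.
    by rewrite !leNgt h1 h2.
have mgi : Itg leb2 Om (fun z => M * `|g z|) by exact: (ItgZ mO).
pose D z := a z * g z - M * `|g z|.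
have ID0 : I2 D = 0.
  apply/eqP; rewrite eq_le (IB mO Iag mgi) (IZ mO _ Ig); apply/andP; split.
    by rewrite subr_le0 (le_trans (ler_norm _)).
  by rewrite subr_ge0 -(IZ mO _ Ig); apply: le_I => // z _; have [_ []] := E z.
have ItD : Itg leb2 Om D by exact: (ItgB mO).
have D0 z : Om z -> 0 <= D z by move=> _; rewrite subr_ge0; have [_ []] := E z.
have := Itg_I0 mO ItD D0 ID0; apply: filterS => z + Oz => /(_ Oz) /subr0_eq.
by have [_ [_]] := E z.
Qed.

End Sobolev.

(** * Square integrability by duality and products of H^1 functions *)

Section Truncation.
Context d (T : measurableType d) (R : realType) (mu : {measure set T -> \bar R}).
Variable (D : set T).
Hypothesis mD : measurable D.
Hypothesis fD : (mu D < +oo)%E.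

(** Values beyond [N] go to 0 and not to [N], which gives [t * trunc N t = (trunc N t)^2], the
    identity behind [dual_sq]. *)
Definition trunc (N : nat) (t : R) : R := if `|t| <= N%:R then t else 0.

Lemma meas_trunc N f : measurable_fun D f -> measurable_fun D (fun x => trunc N (f x)).
Proof.
move=> mf; apply: measurableT_comp mf.
apply: measurable_fun_ifT => //; apply: measurable_fun_ler => //.
Qed.

Lemma trunc_bnd N t : `|trunc N t| <= N%:R.
Proof. by rewrite /trunc; case: ifP => // _; rewrite normr0. Qed.

Lemma sqint_trunc (K : R) f : measurable_fun D f ->
  (forall N, sqn mu D (fun x => trunc N (f x)) <= K) -> sqint mu D f /\ sqn mu D f <= K.
Proof.
move=> mf hK.
pose g N x : \bar R := (trunc N (f x) ^+ 2)%:E.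
have mg N : measurable_fun D (g N).
  by apply/measurable_EFinP; apply: measurable_funX; exact: meas_trunc.
have g0 N x : D x -> (0 <= g N x)%E by move=> _; rewrite lee_fin sqr_ge0.
have gm x : D x -> {homo g^~ x : n m / (n <= m)%N >-> (n <= m)%E}.
  move=> _ n m nm; rewrite lee_fin /trunc; case: ifP => h1; last by rewrite expr0n sqr_ge0.
  by rewrite (le_trans h1) ?ler_nat.
have glim x : limn (g^~ x) = (f x ^+ 2)%:E.
  apply/cvg_lim => //; apply: cvg_near_cst.
  near=> n; rewrite /g /trunc ifT//.
  near: n; exists (Num.truncn `|f x|).+1 => // n /= h.
  apply: le_trans (_ : (Num.truncn `|f x|).+1%:R <= _); last by rewrite ler_nat.
  by apply: ltW; exact: truncnS_gt.
have hle N : (\int[mu]_(x in D) g N x <= K%:E)%E.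
  have [_ i] : sqint mu D (fun x => trunc N (f x)).
    by apply: (sqint_bnd mD fD (M := N%:R)) => [|x _]; [exact: meas_trunc|exact: trunc_bnd].
  rewrite -(fineK (integrable_fin_num mD i)) lee_fin; exact: hK.
have hc := @cvg_monotone_convergence _ _ _ mu _ mD _ mg g0 gm.
have E : (fun x => limn (g^~ x)) = (fun x => (f x ^+ 2)%:E) by apply/funext.
rewrite E in hc.
have hf : (\int[mu]_(x in D) (f x ^+ 2)%:E <= K%:E)%E.
  rewrite -(cvg_lim _ hc)//; apply: lime_le; first by apply/cvg_ex; eexists; exact: hc.
  by near=> n; exact: hle.
have i2 : Itg mu D (fun x => f x ^+ 2).
  apply/integrableP; split; first by apply/measurable_EFinP; exact: measurable_funX.
  apply: le_lt_trans (ltry K); apply: le_trans hf.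
  by rewrite le_eqVlt; apply/orP; left; apply/eqP; apply: eq_integral => x _ /=; rewrite ger0_norm ?sqr_ge0.
split => //; rewrite /sqn /Rintegral -lee_fin fineK//; exact: integrable_fin_num.
Unshelve. all: by end_near. Qed.

End Truncation.

Lemma lim_sqr_le (R : realType) (x : nat -> R) (l K : R) : x n @[n --> \oo] --> l ->
  (\forall n \near \oo, x n ^+ 2 <= K) -> l ^+ 2 <= K.
Proof.
move=> xl xK; have h : x n ^+ 2 @[n --> \oo] --> l ^+ 2 by apply: cvgM.
by rewrite -(cvg_lim (@Rhausdorff R) h); apply: limr_le => //; apply/cvg_ex; exists (l ^+ 2).
Qed.

Section Products.
Context {R : realType}.
Notation RR := (measurableTypeR R * measurableTypeR R)%type.
Notation mu := (@lebesgue_measure R).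
Implicit Types (f g u v phi : R * R -> R).
Variables (L1 L2 : R).
Hypotheses (hL1 : 0 < L1) (hL2 : 0 < L2).
Notation Om := (Omega L1 L2).
Notation I2 f := (\int[leb2]_(z in Om) f z).
Notation sq := (sqint leb2 Om).
Notation sn := (sqn leb2 Om).
Notation mo := (mo L1 L2).
Notation wd := (wd L1 L2).
Notation Q := (inner L1 L2).
Notation S := (supcst L1 L2).

Let mO : measurable (Om : set RR) := Om_meas L1 L2.
Let fO := Om_fin L1 L2.

(** Testing [F] with its own truncation [g] gives [sn g ^+ 2 <= K * sn g], hence the bound for [g],
    and monotone convergence removes the truncation. It serves for products that are known only to
    be integrable. *)
Lemma dual_sq F (K : R) : 0 <= K -> Itg leb2 Om F ->
  (forall d, 0 < d < d0 L1 L2 -> forall g (M : R), measurable_fun Om (g : RR -> R) -> (forall z, `|g z| <= M) ->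
    I2 (fun z => F z * (qd d z * g z)) ^+ 2 <= K * sn g) ->
  sq F /\ sn F <= K.
Proof.
move=> K0 IF h; have mF := Itg_meas IF.
apply: (sqint_trunc mO fO mF) => N.
pose g z := trunc N (F z).
have mg : measurable_fun Om (g : RR -> R) by exact: meas_trunc.
have gN z : `|g z| <= N%:R by exact: trunc_bnd.
have sg : sq g by apply: (sqint_bnd mO fO (M := N%:R)).
have E z : F z * g z = g z ^+ 2.
  by rewrite /g /trunc; case: ifP => _; rewrite ?mulr0 ?expr0n ?expr2.
have Ig : Itg leb2 Om (fun z => F z * g z).
  by apply: (Itg_eq mO _ sg.2) => z _; rewrite E.
have Eg : I2 (fun z => F z * g z) = sn g by apply: eq_I => z _; rewrite E.
have le2 : sn g ^+ 2 <= K * sn g.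
  rewrite -Eg; apply: (lim_sqr_le (cv_qd Ig)); apply: filterS (en_lt (d0_gt0 hL1 hL2)) => n hn.
  have -> : I2 (fun z => qd (en n) z * (F z * g z)) = I2 (fun z => F z * (qd (en n) z * g z)).
    by apply: eq_I => z _; rewrite mulrCA.
  by rewrite Eg; apply: h mg gN; rewrite en_gt0 hn.
have [g0|] := ltP 0 (sn g); first by rewrite -(ler_pM2r g0) -expr2.
by move=> /le_trans; apply.
Qed.

Lemma I_qd F d : 0 < d -> I2 (fun z => qd d z * F z) = \int[leb2]_(z in Q d) F z.
Proof.
move=> dp; have -> : Q d = Om `&` Q d :> set RR.
  by apply/seteqP; split => z; [move=> h; split => //; exact: inner_sub h|case].
rewrite /Rintegral [in RHS]integral_mkcondr; congr fine; apply: eq_integral => -[x y] /set_mem.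
move=> /OmE[/andP[_ xL] /andP[_ yL]]; rewrite restrict_EFin /= /qd /patch; congr (_%:E).
case: ifPn => /= [/andP[h1 h2]|h].
  by rewrite mem_set ?mul1r//; split; rewrite /= in_itv/= ?h1 ?h2.
rewrite memNset ?mul0r// => -[/=]; rewrite !in_itv/= => /andP[h1 _] /andP[h2 _].
by rewrite h1 h2 in h.
Qed.

(** [inner_prod] for the mollified factors, with the L^2 bounds of [mo_young], controls the product
    tested against bounded functions; [dual_sq] turns this into square integrability. The power
    [K ^+ 4] comes from one factor [K ^+ 2] per function. *)
Lemma H1H1 : exists C : R, 0 <= C /\ forall a ax u uy (A B : R), sq a -> sq u ->
  wd false a ax -> wd true u uy -> sn a <= A -> sn ax <= A -> sn u <= B -> sn uy <= B ->
  sq (fun z => a z * u z) /\ sn (fun z => a z * u z) <= C * (A * B).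
Proof.
have [K [K0 hK]] := mo_young L1 L2.
have C0 : 0 <= S ^+ 2 * (4 * K ^+ 4).
  by apply: mulr_ge0; [exact: sqr_ge0|apply: mulr_ge0 => //; apply: exprn_ge0; exact: ltW].
exists (S ^+ 2 * (4 * K ^+ 4)); split => //.
move=> a ax u uy A B sa su ax_ uy_ aA axA uB uyB.
have A0 : 0 <= A by apply: le_trans aA; exact: sqn_ge0.
have B0 : 0 <= B by apply: le_trans uB; exact: sqn_ge0.
set C := S ^+ 2 * _.
apply: dual_sq => [||d dd0 g M mg gM]; [exact: (mulr_ge0 C0 (mulr_ge0 A0 B0))|exact: (sqintM mO)|].
have /andP[dp _] := dd0.
have M0 : 0 <= M by apply: le_trans (gM (0, 0)).
pose G z := qd d z * g z.
have mG : measurable_fun Om (G : RR -> R) by apply: measurable_funM => //; exact: meas_qd.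
have GM z : `|G z| <= M.
  by rewrite normrM -[leRHS]mul1r; apply: ler_pM => //; exact: qd_bnd.
have sg : sq g by apply: (sqint_bnd mO fO (M := M)).
have bs v : sq v -> sq (fun z => v z * G z).
  move=> sv; have [h _] := sqint_bndM mO mG (fun z _ => GM z) sv.
  by apply: (sqint_eq mO _ h) => z _; rewrite mulrC.
have sm n v : sq v -> smooth2 (mo (en n) v) by move=> sv; apply: smooth2_mo => //; exact: en_gt0.
have b n v w V : sq v -> sq w -> sn v <= V -> sn w <= V ->
    sn (mo (en n) v) + sn (mo (en n) w) <= 2 * K ^+ 2 * V.
  move=> sv sw vV wV.
  have [_ h1] := hK _ _ (en_gt0 n) sv; have [_ h2] := hK _ _ (en_gt0 n) sw.
  rewrite -mulrA mulr_natl mulr2n; apply: lerD; [apply: le_trans h1 _|apply: le_trans h2 _];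
  by apply: ler_wpM2l => //; exact: sqr_ge0.
have hd2 : 0 < d / 2 by rewrite divr_gt0.
(* Two independent scales: the limits are taken one after the other, because weak convergence of
   both factors says nothing about their product. *)
have key n k : en n < d / 2 -> en k < d / 2 ->
  I2 (fun z => mo (en n) a z * mo (en k) u z * G z) ^+ 2 <= C * (A * B) * sn g.
  move=> hn hk; set f := mo (en n) a; set h := mo (en k) u.
  have sf := sm n a sa; have sh := sm k u su.
  have cfh : continuous (fun z => f z * h z).
    by move=> z; apply: cvgM; [exact: (smooth2_cont sf)|exact: (smooth2_cont sh)].
  have sfh : sq (fun z => f z * h z) by exact: sqint_cont2.
  have sqfh : sq (fun z => qd d z * (f z * h z)) by exact: sq_qd.
  have -> : I2 (fun z => f z * h z * G z) = I2 (fun z => qd d z * (f z * h z) * g z).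
    by apply: eq_I => z _; rewrite /G mulrA [_ * qd d z]mulrC.
  apply: le_trans (cauchy_schwarz mO sqfh sg) _.
  apply: ler_wpM2r; first exact: sqn_ge0.
  have -> : sn (fun z => qd d z * (f z * h z)) = \int[leb2]_(z in Q d) ((f z * h z) ^+ 2).
    rewrite -(I_qd (fun z => (f z * h z) ^+ 2) dp); apply: eq_I => z _.
    by rewrite exprMn /qd; case: ifP => _; rewrite ?expr1n ?expr0n.
  apply: le_trans (inner_prod hL1 hL2 dd0 sf sh) _.
  rewrite /C -mulrA; apply: ler_wpM2l; first exact: sqr_ge0.
  have -> : 4 * K ^+ 4 * (A * B) = (2 * K ^+ 2 * A) * (2 * K ^+ 2 * B) by ring.
  have P (v w : R * R -> R) : 0 <= \int[leb2]_(z in Q d) (v z ^+ 2 + w z ^+ 2).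
    by apply: Rintegral_ge0 => z _; rewrite addr_ge0// sqr_ge0.
  have e2 j : en j < d / 2 -> 2 * en j < d :> R by move: (en j) => x; lra.
  apply: ler_pM.
  - exact: P.
  - exact: P.
  - apply: le_trans (inner_mo (i := false) (en_gt0 n) (e2 _ hn) sa ax_) _.
    by apply: b => //; exact: ax_.1.
  - apply: le_trans (inner_mo (i := true) (en_gt0 k) (e2 _ hk) su uy_) _.
    by apply: b => //; exact: uy_.1.
have A3 (p q r : R) : p * q * r = q * (p * r) by ring.
have key2 n : en n < d / 2 ->
    I2 (fun z => mo (en n) a z * u z * G z) ^+ 2 <= C * (A * B) * sn g.
  move=> hn.
  have sfG : sq (fun z => mo (en n) a z * G z) by apply: bs; exact: (sq_mo n sa).
  have c : I2 (fun z => mo (en n) a z * mo (en k) u z * G z) @[k --> \oo] -->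
           I2 (fun z => mo (en n) a z * u z * G z).
    have E v : I2 (fun z => mo (en n) a z * v z * G z) = I2 (fun z => v z * (mo (en n) a z * G z)).
      by apply: eq_I => z _; exact: A3.
    rewrite E; under eq_fun do rewrite E; exact: (weak_cvg sfG su).
  apply: (lim_sqr_le c).
  by apply: filterS (en_lt hd2) => k hk; exact: key.
have suG : sq (fun z => u z * G z) by exact: bs.
have c : I2 (fun z => mo (en n) a z * u z * G z) @[n --> \oo] --> I2 (fun z => a z * u z * G z).
  have E v : I2 (fun z => v z * u z * G z) = I2 (fun z => v z * (u z * G z)).
    by apply: eq_I => z _; rewrite mulrA.
  rewrite E; under eq_fun do rewrite E; exact: (weak_cvg suG sa).
apply: (lim_sqr_le c).
by apply: filterS (en_lt hd2) => k hk; exact: key2.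
Qed.

End Products.

(** * Sobolev spaces by iterated weak derivatives *)

Section Spaces.
Context {R : realType}.
Notation RR := (measurableTypeR R * measurableTypeR R)%type.
Implicit Types (f g u v phi : R * R -> R) (a b k : nat).
Variables (L1 L2 : R).
Notation Om := (Omega L1 L2).
Notation I2 f := (\int[leb2]_(z in Om) f z).
Notation sq := (sqint leb2 Om).
Notation sn := (sqn leb2 Om).
Notation wd := (wd L1 L2).
Notation test := (test2 Om).

Let mO : measurable (Om : set RR) := Om_meas L1 L2.
Let Fae := ae_filter_ringOfSetsType (@leb2 R).

Let Lnorm_int u : (\int[leb2]_z (`|(EFin \o (u \_ Om)) z| `^ 2) = \int[leb2]_(z in Om) (u z ^+ 2)%:E)%E.
Proof.
rewrite [RHS]integral_mkcond; apply: eq_integral => z _; rewrite /= /patch.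
case: ifP => _ /=; first by rewrite powR_mulrn// real_normK ?num_real.
by change ((`|0 : R| `^ 2)%:E = 0%E); rewrite normr0 powR0// pnatr_eq0.
Qed.

Lemma inLpP u : inLp Om 2%:E u <-> sq u.
Proof.
split=> [uL|[mu iu]].
  have mu : measurable_fun Om (u : RR -> R).
    by apply/(measurable_restrictT _ mO); move: uL; rewrite /inLp inE => /andP[+ _]; rewrite inE.
  split => //; have := Lfun2_integrable_sqr uL.
  have -> : (EFin \o (fun z => (u \_ Om) z ^+ 2)) = (EFin \o (fun z => u z ^+ 2)) \_ Om.
    by apply/funext => z; rewrite /= /patch; case: ifP => // _; rewrite expr0n.
  by move/(integrable_mkcond _ mO).
rewrite /inLp inE; apply/andP; split; first by rewrite inE; apply/(measurable_restrictT _ mO).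
rewrite inE /= /finite_norm unlock Lnorm_int.
rewrite -(fineK (integrable_fin_num mO iu)) poweR_EFin; exact: ltry.
Qed.

Lemma L2norm_sqr u : sq u -> L2norm Om u ^+ 2 = sn u.
Proof.
move=> [mu iu]; rewrite /L2norm unlock Lnorm_int -(fineK (integrable_fin_num mO iu)) poweR_EFin.
rewrite -/(Rintegral leb2 Om (fun z => u z ^+ 2)) -/(sqn leb2 Om u) /=.
by rewrite powR12_sqrt ?sqr_sqrtr// sqn_ge0.
Qed.

Lemma inLp_pinfty u : inLp Om +oo%E u -> measurable_fun Om (u : RR -> R) /\
  exists2 M : R, 0 <= M & {ae leb2, forall z, Om z -> `|u z| <= M}.
Proof.
move=> uL; split.
  by apply/(measurable_restrictT _ mO); move: uL; rewrite /inLp inE => /andP[+ _]; rewrite inE.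
move: uL; rewrite /inLp inE => /andP[_]; rewrite inE /= /finite_norm unlock.
case: ifPn => [_ h|].
  have [M0 hM0] : exists M : R, (ess_sup leb2 (abse \o (EFin \o (u \_ Om))) <= M%:E)%E.
    move: h; case: (ess_sup _ _) => [r _|//|_]; first by exists r.
    by exists 0; rewrite leNye.
  exists (Num.max 0 M0); first by rewrite le_max lexx.
  move/ess_supP : hM0; apply: filterS => z /= + Oz.
  by rewrite patchE mem_set// lee_fin => h1; rewrite le_max h1 orbT.
(* The convention for a space of measure zero, where the norm is 0 by definition and every bound
   holds almost everywhere. *)
rewrite -leNgt measure_le0 => /eqP h _; exists 0 => //.
by apply: (negligibleS (@subsetT _ _)); exists setT; split.
Qed.

Lemma wd_ae i u v w : measurable_fun Om (w : RR -> R) ->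
  {ae leb2, forall z, Om z -> v z = w z} -> wd i u v -> wd i u w.
Proof.
move=> mw vw [sv h]; have sw := sqint_ae mO mw vw sv; split => // phi tp.
rewrite h//; congr (- _); apply: (ae_eq_I mO).
- exact: Itg_meas (sqintM mO sv (test_sq tp)).
- exact: Itg_meas (sqintM mO sw (test_sq tp)).
by apply: (@filterS _ _ Fae _ _ _ vw) => z + Oz => /(_ Oz) ->.
Qed.

Lemma wd_ael i u v w : sq u -> sq w ->
  {ae leb2, forall z, Om z -> u z = w z} -> wd i u v -> wd i w v.
Proof.
move=> su sw uw [sv h]; split => // phi tp; rewrite -h//; apply: (ae_eq_I mO).
- exact: Itg_meas (sqintM mO sw (test_sq (test_dd i tp))).
- exact: Itg_meas (sqintM mO su (test_sq (test_dd i tp))).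
by apply: (@filterS _ _ Fae _ _ _ uw) => z + Oz => /(_ Oz) ->.
Qed.

Lemma wd_uniq i u v w : wd i u v -> wd i u w -> {ae leb2, forall z, Om z -> v z = w z}.
Proof.
move=> [sv h1] [sw h2]; apply: test_orth2 => // phi tp.
by apply: oppr_inj; rewrite -h1// -h2.
Qed.

Lemma wdD i u u' v v' : sq u -> sq u' -> wd i u v -> wd i u' v' ->
  wd i (fun z => u z + u' z) (fun z => v z + v' z).
Proof.
move=> su su' [sv h] [sv' h']; split; first exact: (sqintD mO).
move=> phi tp; have sp := test_sq tp; have sdp := test_sq (test_dd i tp).
have E (p q r : R * R -> R) : sq p -> sq q -> sq r ->
    I2 (fun z => (p z + q z) * r z) = I2 (fun z => p z * r z) + I2 (fun z => q z * r z).
  move=> sp' sq' sr; rewrite -(ID mO (sqintM mO sp' sr) (sqintM mO sq' sr)).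
  by apply: eq_I => z _; rewrite mulrDl.
by rewrite !E// h// h'// opprD.
Qed.

Lemma wdZ i (c : R) u v : sq u -> wd i u v -> wd i (fun z => c * u z) (fun z => c * v z).
Proof.
move=> su [sv h]; split; first exact: (sqintZ mO).
move=> phi tp; have sp := test_sq tp; have sdp := test_sq (test_dd i tp).
have E (p r : R * R -> R) : sq p -> sq r ->
    I2 (fun z => c * p z * r z) = c * I2 (fun z => p z * r z).
  move=> sp' sr; rewrite -(IZ mO _ (sqintM mO sp' sr)).
  by apply: eq_I => z _; rewrite mulrA.
by rewrite !E// h// mulrN.
Qed.

(* the ball of squared radius [C], up to a constant, of the Sobolev space H^k *)
Fixpoint Hs k (C : R) u : Prop := [/\ sq u, sn u <= C &
  if k is k'.+1 then forall i, exists v, wd i u v /\ Hs k' C v else True].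

Lemma Hs_sq k C u : Hs k C u -> sq u. Proof. by case: k => [|k] []. Qed.

Lemma Hs_sn k C u : Hs k C u -> sn u <= C. Proof. by case: k => [|k] []. Qed.

Lemma Hs_ge0 k C u : Hs k C u -> 0 <= C.
Proof. by move=> /Hs_sn; apply: le_trans; exact: sqn_ge0. Qed.

Lemma Hs_le k C C' u : C <= C' -> Hs k C u -> Hs k C' u.
Proof.
move=> CC'; elim: k u => [|k IH] u [su uC H]; split => //; try exact: le_trans uC CC'.
by move=> i; have [v [wv hv]] := H i; exists v; split => //; exact: IH.
Qed.

Lemma Hs_pred k C u : Hs k.+1 C u -> Hs k C u.
Proof.
elim: k u => [|k IH] u [su uC H]; split => //.
by move=> i; have [v [wv hv]] := H i; exists v; split => //; exact: IH.
Qed.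

Lemma Hs_leq j k C u : (j <= k)%N -> Hs k C u -> Hs j C u.
Proof.
elim: k => [|k IH]; first by rewrite leqn0 => /eqP ->.
by rewrite leq_eqVlt ltnS => /predU1P[->//|/IH h /Hs_pred].
Qed.

Lemma Hs_ae k C u v : measurable_fun Om (v : RR -> R) ->
  {ae leb2, forall z, Om z -> u z = v z} -> Hs k C u -> Hs k C v.
Proof.
move=> mv uv; have h : Hs 0 C u -> Hs 0 C v.
  move=> [su uC _]; split => //; first exact: sqint_ae uv su.
  by rewrite -(sqn_ae mO su.1 mv uv).
case: k => [|k] // [su uC H]; have [sv vC _] : Hs 0 C v by exact: h.
split => // i; have [w [wv hw]] := H i; exists w; split => //.
exact: wd_ael wv.
Qed.

(** [Hs] only asserts the existence of some weak derivative; by uniqueness almost everywhere it can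
    be exchanged for any other. *)
Lemma Hs_wd k C i u v : Hs k.+1 C u -> wd i u v -> Hs k C v.
Proof.
move=> [_ _ /(_ i) [w [uw hw]]] uv; apply: Hs_ae hw; first exact: uv.1.1.
exact: wd_uniq uw uv.
Qed.

Lemma HsD k C C' u v : Hs k C u -> Hs k C' v -> Hs k (2 * (C + C')) (fun z => u z + v z).
Proof.
elim: k u v => [|k IH] u v [su uC Hu] [sv vC' Hv]; split; try exact: (sqintD mO).
- by apply: le_trans (sqnD_le mO su sv) _; rewrite ler_pM2l// lerD.
- by [].
- by apply: le_trans (sqnD_le mO su sv) _; rewrite ler_pM2l// lerD.
move=> i; have [p [up hp]] := Hu i; have [q [vq hq]] := Hv i.
exists (fun z => p z + q z); split; [exact: wdD|exact: IH].
Qed.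

Lemma HsZ k C (c : R) u : Hs k C u -> Hs k (c ^+ 2 * C) (fun z => c * u z).
Proof.
elim: k u => [|k IH] u [su uC Hu]; split; try exact: (sqintZ mO).
- by rewrite (sqnZ mO)// ler_wpM2l// sqr_ge0.
- by [].
- by rewrite (sqnZ mO)// ler_wpM2l// sqr_ge0.
move=> i; have [p [up hp]] := Hu i.
exists (fun z => c * p z); split; [exact: wdZ|exact: IH].
Qed.

Lemma HsB k C C' u v : Hs k C u -> Hs k C' v -> Hs k (2 * (C + C')) (fun z => u z - v z).
Proof.
move=> hu /(HsZ (-1)); rewrite sqrrN expr1n mul1r => hv.
rewrite (_ : (fun z => u z - v z) = (fun z => u z + -1 * v z)); first exact: HsD.
by apply/funext => z; rewrite mulN1r.
Qed.

Lemma is_wderiv00 u : sq u -> is_wderiv Om 0 0 u u.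
Proof. by move=> su; split => [|phi _]; [exact/inLpP|rewrite mul1r]. Qed.

Lemma is_wderiv_ae a b u v w : sq u -> is_wderiv Om a b u v -> is_wderiv Om a b u w ->
  {ae leb2, forall z, Om z -> v z = w z}.
Proof.
move=> su [/inLpP sv h1] [/inLpP sw h2]; apply: test_orth2 => // phi tp.
by have := h1 _ tp; rewrite h2// => /mulfI -> //; rewrite signr_eq0.
Qed.

Lemma is_wderiv_dx a b u v w : is_wderiv Om a b u v -> wd false v w -> is_wderiv Om a.+1 b u w.
Proof.
move=> [sv h] [sw vw]; split => [|phi tp]; first exact/inLpP.
have e := vw _ tp; rewrite DxySl -(Dxy_dx _ _ (test_smooth tp)) (h _ (test_dx tp)).
by rewrite e addSn exprS mulN1r mulrN mulNr.
Qed.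

Lemma is_wderiv_dy a b u v w : is_wderiv Om a b u v -> wd true v w -> is_wderiv Om a b.+1 u w.
Proof.
move=> [sv h] [sw vw]; split => [|phi tp]; first exact/inLpP.
have e := vw _ tp; rewrite DxySr (h _ (test_dy tp)).
by rewrite e addnS exprS mulN1r mulrN mulNr.
Qed.

Lemma wd_is_wderiv_dx a b u v w : is_wderiv Om a b u v -> is_wderiv Om a.+1 b u w -> wd false v w.
Proof.
move=> [sv h] [sw vw]; split => [|phi tp]; first exact/inLpP.
have := vw _ tp; rewrite DxySl -(Dxy_dx _ _ (test_smooth tp)) (h _ (test_dx tp)).
by rewrite addSn exprS mulN1r mulNr -mulrN => /mulfI -> //; rewrite signr_eq0.
Qed.

Lemma wd_is_wderiv_dy a b u v w : is_wderiv Om a b u v -> is_wderiv Om a b.+1 u w -> wd true v w.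
Proof.
move=> [sv h] [sw vw]; split => [|phi tp]; first exact/inLpP.
have := vw _ tp; rewrite DxySr (h _ (test_dy tp)).
by rewrite addnS exprS mulN1r mulNr -mulrN => /mulfI -> //; rewrite signr_eq0.
Qed.

Lemma is_wderiv10 u v : sq u -> is_wderiv Om 1 0 u v <-> wd false u v.
Proof.
move=> su; split; first exact: wd_is_wderiv_dx (is_wderiv00 su).
exact: is_wderiv_dx (is_wderiv00 su).
Qed.

Lemma is_wderiv01 u v : sq u -> is_wderiv Om 0 1 u v <-> wd true u v.
Proof.
move=> su; split; first exact: wd_is_wderiv_dy (is_wderiv00 su).
exact: is_wderiv_dy (is_wderiv00 su).
Qed.

Lemma Hs_is_wderiv k C u a b : Hs k C u -> (a + b <= k)%N ->
  exists v, is_wderiv Om a b u v /\ Hs (k - (a + b)) C v.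
Proof.
move=> hu; elim: a => [|a IH].
  elim: b => [|b IH] hb; first by exists u; split; [exact: is_wderiv00 (Hs_sq hu)|rewrite subn0].
  have [v [uv hv]] := IH (ltnW hb); rewrite !add0n in hb hv *.
  move: hv; rewrite -(subnSK hb) => /= -[_ _ /(_ true)[w [vw hw]]].
  by exists w; split => //; exact: is_wderiv_dy vw.
move=> hb; have [v [uv hv]] := IH (ltnW hb); rewrite !addSn in hb *.
move: hv; rewrite -(subnSK hb) => /= -[_ _ /(_ false)[w [vw hw]]].
by exists w; split => //; exact: is_wderiv_dx vw.
Qed.

(** The multi-index definition provides each derivative separately. They fit into the iterated form
    because the derivative of index [(a+1, b)] is a weak [x]-derivative of the one of index
    [(a, b)], and likewise in [y]. The constant sums all the squared norms. *)
Lemma inHm_Hs m u : inHm Om m u -> exists C, Hs m C u.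
Proof.
move=> [/inLpP su hm].
pose V a b := xget (fun=> 0) (is_wderiv Om a b u).
have VE a b : (a + b <= m)%N -> is_wderiv Om a b u (V a b).
  by move=> /hm [v uv]; exact: (xgetPex _ (ex_intro _ v uv)).
pose C := \sum_(a < m.+1) \sum_(b < m.+1) sn (V a b).
have VC a b : (a + b <= m)%N -> sn (V a b) <= C.
  move=> ab; have a1 : (a < m.+1)%N by rewrite ltnS (leq_trans _ ab)// leq_addr.
  have b1 : (b < m.+1)%N by rewrite ltnS (leq_trans _ ab)// leq_addl.
  rewrite /C (bigD1 (Ordinal a1))//= (bigD1 (Ordinal b1))//= -addrA lerDl.
  apply: addr_ge0; first by apply: sumr_ge0 => j _; exact: sqn_ge0.
  by apply: sumr_ge0 => j _; apply: sumr_ge0 => ? _; exact: sqn_ge0.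
have key k : forall a b, (a + b + k <= m)%N -> Hs k C (V a b).
  elim: k => [|k IH] a b h.
    rewrite addn0 in h; split => //; [|exact: VC].
    by have [/inLpP] := VE _ _ h.
  have h0 : (a + b <= m)%N by apply: leq_trans h; exact: leq_addr.
  split; [by have [/inLpP] := VE _ _ h0|exact: VC|].
  case; [exists (V a b.+1)|exists (V a.+1 b)]; split.
  - apply: (wd_is_wderiv_dy (VE _ _ h0)); apply: VE; apply: leq_trans h.
    by rewrite !addnS ltnS leq_addr.
  - by apply: IH; rewrite addnS addSnnS.
  - apply: (wd_is_wderiv_dx (VE _ _ h0)); apply: VE; apply: leq_trans h.
    by rewrite addnS addSn ltnS leq_addr.
  - by apply: IH; rewrite addSn addSnnS.
(* [V 0 0] is a selected derivative of order zero, equal to [u] only almost everywhere. *)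
exists C; apply: (Hs_ae su.1 _ (key m 0 0 _)) => //.
exact: (is_wderiv_ae su (VE 0 0 _) (is_wderiv00 su)).
Qed.

End Spaces.

(** * Products in H^k and the gradient of the coefficient *)

Section Multipliers.
Context {R : realType}.
Notation RR := (measurableTypeR R * measurableTypeR R)%type.
Implicit Types (f g u v phi : R * R -> R) (k : nat).
Variables (L1 L2 : R).
Hypotheses (hL1 : 0 < L1) (hL2 : 0 < L2).
Notation Om := (Omega L1 L2).
Notation I2 f := (\int[leb2]_(z in Om) f z).
Notation sq := (sqint leb2 Om).
Notation sn := (sqn leb2 Om).
Notation wd := (wd L1 L2).
Notation Hs := (Hs L1 L2).
Notation test := (test2 Om).

Let mO : measurable (Om : set RR) := Om_meas L1 L2.

Lemma wdM i (a ai u ui : RR -> R) : sq a -> sq u -> wd i a ai -> wd i u ui ->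
  sq (fun z => ai z * u z) -> sq (fun z => a z * ui z) ->
  wd i (fun z => a z * u z) (fun z => ai z * u z + a z * ui z).
Proof.
move=> sa su aai uui s1 s2; split; first exact: (sqintD mO).
by move=> phi tp; exact: wd_leibniz.
Qed.

(** The uniform bound of [mo_sup] on the mollifications passes to their weak limit by [ae_bound]. *)
Lemma Hs2_bounded : exists K : R, 0 <= K /\ forall A a, Hs 2 A a ->
  {ae leb2, forall z, Om z -> `|a z| <= Num.sqrt (K * A)}.
Proof.
have [K [K0 hK]] := mo_sup hL1 hL2; exists K; split => // A a ha.
have A0 := Hs_ge0 ha.
case: (ha) => sa aA H; have [ax [aax [sax nax Hx]]] := H false.
have [ay [aay [say nay _]]] := H true.
have [axy [axaxy [saxy naxy _]]] := Hx true.
apply: (ae_bound hL1 hL2 sa (sqrtr_ge0 _)) => d dd0.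
have hd2 : 0 < d / 2 by case/andP: dd0 => d0 _; rewrite divr_gt0.
apply: filterS (en_lt hd2) => n hn z Qz.
rewrite -sqrtr_sqr; apply: ler_wsqrtr.
have h2 : 2 * en n < d by move: (en n) hn => x; lra.
exact (hK a ax ay axy A sa aax aay axaxy aA nax nay naxy d _ z dd0 (en_gt0 n) h2 Qz).
Qed.

Lemma bounded_mul (a : RR -> R) (M : R) : measurable_fun Om a ->
  {ae leb2, forall z, Om z -> `|a z| <= M} -> forall C u, Hs 0 C u ->
  Hs 0 (M ^+ 2 * C) (fun z => a z * u z).
Proof.
move=> ma aM C u [su uC _]; have [s h] := ae_sqint_bndM mO ma aM su.
by split => //; apply: le_trans h _; rewrite ler_wpM2l// sqr_ge0.
Qed.

(** Induction on [k] by the Leibniz rule, starting from bounded times L^2. Order 1 is special, since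
    the derivative of [a] is then only in H^1 and may be unbounded; the maximum with 2 keeps [a]
    itself bounded throughout. *)
Lemma Hs_mul k : exists K : R, 0 <= K /\ forall A C a u, Hs (maxn 2 k) A a -> Hs k C u ->
  Hs k (K * A * C) (fun z => a z * u z).
Proof.
have [K0 [K00 hK0]] := Hs2_bounded.
have P0 A C a u : Hs 2 A a -> Hs 0 C u -> Hs 0 (K0 * A * C) (fun z => a z * u z).
  move=> ha hu; have := bounded_mul (Hs_sq ha).1 (hK0 _ _ ha) hu.
  by rewrite sqr_sqrtr// mulr_ge0// (Hs_ge0 ha).
(* Common to all orders: the Leibniz rule reduces order [j + 1] to two products of order [j]. The
   factor 4 is that of [HsD] applied to two equal bounds. *)
have step j K A C a u : (forall i ai ui, wd i a ai -> wd i u ui -> Hs j A ai -> Hs j C ui ->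
      Hs j K (fun z => ai z * u z) /\ Hs j K (fun z => a z * ui z)) ->
    Hs 2 A a -> Hs j.+1 A a -> Hs j.+1 C u ->
    Hs j.+1 (K0 * A * C + 4 * K) (fun z => a z * u z).
  move=> H ha2 ha hu.
  have [s n _] := P0 _ _ _ _ ha2 (Hs_leq (leq0n j.+1) hu).
  have p0 : 0 <= K0 * A * C by rewrite !mulr_ge0 ?(Hs_ge0 ha) ?(Hs_ge0 hu).
  have K'0 : 0 <= K.
    case: (ha) => _ _ /(_ true)[ai [wa hai]]; case: (hu) => _ _ /(_ true)[ui [wu hui]].
    by have [/Hs_ge0] := H _ _ _ wa wu hai hui.
  split => //; first by apply: le_trans n _; rewrite lerDl mulr_ge0.
  move=> i; case: (ha) => sa _ /(_ i)[ai [wa hai]]; case: (hu) => su _ /(_ i)[ui [wu hui]].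
  have [h1 h2] := H _ _ _ wa wu hai hui.
  exists (fun z => ai z * u z + a z * ui z); split.
    exact: (wdM sa su wa wu (Hs_sq h1) (Hs_sq h2)).
  apply: Hs_le (HsD h1 h2).
  by rewrite (_ : 2 * (K + K) = 4 * K) ?lerDr//; ring.
elim: k => [|k [K [hK0' IH]]].
  by exists K0; split => // A C a u; exact: P0.
case: k => [|k] in IH *.
  (* At order 1 the product of [ai] and [u] is one of two H^1 functions. *)
  have [K1 [K10 hK1]] := H1H1 hL1 hL2.
  exists (K0 + 4 * (K0 + K1)); split; first by rewrite addr_ge0// mulr_ge0// addr_ge0.
  move=> A C a u ha hu.
  have A0 := Hs_ge0 ha; have C0 := Hs_ge0 hu.
  have -> : (K0 + 4 * (K0 + K1)) * A * C = K0 * A * C + 4 * ((K0 + K1) * A * C) by ring.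
  apply: (step _ _ _ _ _ _ _ ha (Hs_pred ha) hu) => i ai ui wa wu hai hui; split.
    have hai1 : Hs 1 A ai := Hs_wd ha wa.
    case: (hai1) => sai _ /(_ false)[aix [wx [_ nx _]]].
    case: (hu) => su _ /(_ true)[uy [wy [_ ny _]]].
    have [s n] := hK1 _ _ _ _ A C sai su wx wy (Hs_sn hai1) nx (Hs_sn hu) ny.
    by split => //; apply: le_trans n _; rewrite mulrA ler_wpM2r// ler_wpM2r// lerDr.
  apply: Hs_le (P0 _ _ _ _ ha hui).
  by rewrite ler_wpM2r// ler_wpM2r// lerDl.
exists (K0 + 4 * K); split; first by apply: addr_ge0 => //; exact: mulr_ge0.
move=> A C a u; rewrite (maxn_idPr _)// => ha hu.
have -> : (K0 + 4 * K) * A * C = K0 * A * C + 4 * (K * A * C) by ring.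
have ll : (maxn 2 k.+1 <= k.+2)%N by rewrite geq_max /= leqnSn.
apply: (step _ _ _ _ _ _ _ (Hs_leq _ ha) ha hu) => // i ai ui wa wu hai hui; split; last first.
  exact: (IH _ _ _ _ (Hs_leq ll ha) hui).
(* From order 2 on [u] is regular enough to be the multiplier, and it exchanges roles with [ai],
   which has lost a derivative. *)
rewrite (_ : (fun z => ai z * u z) = (fun z => u z * ai z)); last by apply/funext => z; rewrite mulrC.
rewrite -mulrA [A * C]mulrC mulrA.
exact: (IH _ _ _ _ (Hs_leq ll hu) hai).
Qed.

Definition mult k (K : R) a := forall C u, Hs k C u -> Hs k (K * C) (fun z => a z * u z).

(** What is needed of the gradient: it is bounded, and it is a multiplier of H^k for [k < m]. For
    [m <= 1] only [k = 0] occurs and boundedness suffices. For [m >= 2] the gradient has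
    [max(3, m) - 1] derivatives, at least [max(2, k)] for every [k < m], and [Hs_mul] applies. *)
Lemma positive_mult m lam : positive_condition L1 L2 m lam -> sq lam /\
  exists lamd : bool -> R * R -> R, (forall i, wd i lam (lamd i)) /\
  exists2 M : R, 0 <= M & (forall i, {ae leb2, forall z, Om z -> `|lamd i z| <= M}) /\
  forall k, (k < m)%N -> exists2 K : R, 0 <= K & forall i, mult k K (lamd i).
Proof.
move=> [mlam [c0 [c1 [c00 c10 hc]]] hm].
have slam : sq lam.
  have s1 : sq (fun=> 1) by apply: (sqint_bnd mO (Om_fin L1 L2) (M := 1)) => // z _; rewrite normr1.
  have hb : {ae leb2, forall z, Om z -> `|lam z| <= c1}.
    have Fae := ae_filter_ringOfSetsType (@leb2 R).
    apply: (@filterS _ _ Fae _ _ _ hc) => z + Oz => /(_ Oz)/andP[h1 h2].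
    by rewrite ger0_norm// (le_trans (ltW c00)).
  have [s _] := ae_sqint_bndM mO mlam hb s1.
  by apply: (sqint_eq mO _ s) => z _; rewrite mulr1.
split => //; move: hm; case: leqP => hm.
  move=> [[vx [/(is_wderiv10 _ slam) wx /inLp_pinfty[mx [Mx Mx0 hx]]]]
          [vy [/(is_wderiv01 _ slam) wy /inLp_pinfty[my [My My0 hy]]]]].
  pose M := Num.max Mx My.
  exists (fun i => if i then vy else vx); split; first by case.
  have hM i : {ae leb2, forall z, Om z -> `|(if i then vy else vx) z| <= M}.
    have Fae := ae_filter_ringOfSetsType (@leb2 R).
    case: i; [apply: (@filterS _ _ Fae _ _ _ hy)|apply: (@filterS _ _ Fae _ _ _ hx)] => z + Oz => /(_ Oz) h;
    by rewrite /M le_max h ?orbT.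
  exists M; first by rewrite le_max Mx0.
  split => // k km; have -> : k = 0 by apply/eqP; rewrite -leqn0 -ltnS (leq_trans km).
  exists (M ^+ 2) => [|i C u hu]; first exact: sqr_ge0.
  by apply: bounded_mul hu => //; case: i.
move=> /inHm_Hs [C hC].
have [lamd hl] : exists lamd : bool -> R * R -> R, forall i, wd i lam (lamd i) /\ Hs (maxn 3 m).-1 C (lamd i).
  have : Hs (maxn 3 m).-1.+1 C lam by rewrite prednK// (leq_trans _ (leq_maxl 3 m)).
  by move=> [_ _ H]; case: (H true) (H false) => [p hp] [q hq]; exists (fun i => if i then p else q); case.
have mm k : (k < m)%N -> (maxn 2 k <= (maxn 3 m).-1)%N.
  clear; case: m => [|n]//; rewrite ltnS maxnSS /= => kn.
  by rewrite geq_max leq_maxl (leq_trans kn)// leq_maxr.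
have C0 := Hs_ge0 hC.
exists lamd; split; first by move=> i; have [] := hl i.
have [K [K0 hK]] := Hs2_bounded.
exists (Num.sqrt (K * C)); first exact: sqrtr_ge0.
split => [i|k km].
  by apply: hK; apply: Hs_leq (hl i).2; exact: (mm 0 (ltnW hm)).
have [K1 [K10 hK1]] := Hs_mul k.
exists (K1 * C) => [|i D u hu]; first exact: mulr_ge0.
by apply: hK1 => //; apply: Hs_leq (hl i).2; exact: mm.
Qed.

End Multipliers.

(** * Lipschitz coefficients and transport *)

Lemma smooth1_lip_itv (R : realType) (f : R -> R) (p q M x y : R) : smooth1 f ->
  (forall c, p < c < q -> `|derive1 f c| <= M) -> p < x < q -> p < y < q ->
  `|f x - f y| <= M * `|x - y|.
Proof.
move=> sf fM; wlog xy : x y / x <= y.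
  move=> H hx hy; have [xy|/ltW yx] := leP x y; first exact: H.
  by rewrite distrC [`|x - y|]distrC; exact: H.
move=> /andP[px _] /andP[_ yq].
have cf : {within `[x, y], continuous f} by apply: continuous_subspaceT; exact: smooth1_cont.
have [c + e] := MVT_segment xy (fun z _ => smooth1_is z sf) cf.
rewrite in_itv/= => /andP[cx cy].
have {}cx : p < c by exact: lt_le_trans px cx.
have {}cy : c < q by exact: le_lt_trans cy yq.
by rewrite distrC [`|x - y|]distrC e normrM ler_wpM2r// fM// cx.
Qed.

Lemma half_small (R : realType) (k r eps : R) : 0 <= k -> 0 < r -> r <= eps / (4 * (k + 1)) ->
  2 * k * r <= eps / 2.
Proof.
move=> k0 r0; rewrite ler_pdivlMr; last by rewrite mulr_gt0// ltr_wpDl.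
by have := mulr_ge0 (ltW r0) k0; lra.
Qed.

Lemma double_mul (R : realType) (k r : R) : 2 * k * r = k * (r + r).
Proof. ring. Qed.

Lemma itv_in (R : realType) (x r d L s : R) : x - r < s < x + r -> r <= x - d -> r <= L - x ->
  d < s < L.
Proof. by move=> /andP[? ?] ? ?; apply/andP; split; lra. Qed.

Section Lipschitz.
Context {R : realType}.
Notation RR := (measurableTypeR R * measurableTypeR R)%type.
Implicit Types (f g u v phi : R * R -> R) (k : nat).
Variables (L1 L2 : R).
Hypotheses (hL1 : 0 < L1) (hL2 : 0 < L2).
Notation Om := (Omega L1 L2).
Notation I2 f := (\int[leb2]_(z in Om) f z).
Notation sq := (sqint leb2 Om).
Notation sn := (sqn leb2 Om).
Notation wd := (wd L1 L2).
Notation mo := (mo L1 L2).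
Notation test := (test2 Om).

Let mO : measurable (Om : set RR) := Om_meas L1 L2.
Let fO := Om_fin L1 L2.
Let Fae := ae_filter_ringOfSetsType (@leb2 R).

Lemma mo_bounded : exists K : R, 0 < K /\ forall e u (M : R), 0 < e -> 0 <= M -> sq u ->
  {ae leb2, forall z, Om z -> `|u z| <= M} -> forall z, `|mo e u z| <= K * M.
Proof.
have [K [K0 hK]] := @kern_box R; exists (K * 16); split; first by rewrite mulr_gt0.
move=> e u M e0 M0 su uM z; have Iu := sqint_Itg1 mO fO su; have k1 := ckern_mol e0.
apply: le_trans (conv_box (C := K) k1 k1 Iu _) _; first by move=> w; have [] := hK _ e0 z w.
rewrite -[leRHS]mulrA; apply: ler_wpM2l; first exact: ltW.
apply: le_trans (_ : I2 (fun w => M * box e (e ^- 2) (z, w)) <= _).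
  apply: (ae_le_I mO); [exact: Itg_boxM|by apply: (ItgZ mO); exact: Itg_box|].
  apply: (@filterS _ _ Fae _ _ _ uM) => w + Ow => /(_ Ow) h; rewrite mulrC ler_wpM2r//.
  by rewrite /box; case: ifP => // _; rewrite invr_ge0 exprn_ge0// ltW.
rewrite (IZ mO); last exact: Itg_box.
by rewrite [leRHS]mulrC; apply: ler_wpM2l => //; exact: I_box.
Qed.

Definition lip_on (M : R) f := forall z w, Om z -> Om w ->
  `|f z - f w| <= M * (`|z.1 - w.1| + `|z.2 - w.2|).

(** In [inner L1 L2 d] the gradient of the mollification is the mollified gradient. The mean value
    theorem is applied along a horizontal and a vertical segment meeting at [(x', y)], which stay in
    this rectangle. *)
Lemma mo_lip : exists K : R, 0 < K /\ forall e d u ux uy (M : R), 0 < e -> 2 * e <= d -> 0 <= M -> sq u ->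
  wd false u ux -> wd true u uy ->
  {ae leb2, forall z, Om z -> `|ux z| <= M} -> {ae leb2, forall z, Om z -> `|uy z| <= M} ->
  forall z w, inner L1 L2 d z -> inner L1 L2 d w ->
  `|mo e u z - mo e u w| <= K * M * (`|z.1 - w.1| + `|z.2 - w.2|).
Proof.
have [K [K0 hK]] := mo_bounded; exists K; split => //.
move=> e d u ux uy M e0 ed M0 su wx wy bx by_ [x y] [x' y'] [/=].
rewrite !in_itv/= => hx hy [/=]; rewrite !in_itv/= => hx' hy'.
have sm := smooth2_mo e0 su.
have B (t lo L : R) : lo < t < L -> d <= lo -> 2 * e < t < L.
  by move=> /andP[h1 h2] h; rewrite h2 andbT (le_lt_trans _ h1)// (le_trans ed).
apply: le_trans (ler_distD (mo e u (x', y)) _ _) _; rewrite mulrDr; apply: lerD.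
  have H c : d < c < L1 -> `|derive1 (fun t => mo e u (t, y)) c| <= K * M.
    move=> hc; have E := dd_mo (i := false) (z := (c, y)) e0 su wx (B _ _ _ hc (lexx _)) (B _ _ _ hy (lexx _)).
    rewrite (etrans (esym (dxE (mo e u) (c, y))) E).
    exact: (hK e ux M e0 M0 wx.1 bx).
  exact: (smooth1_lip_itv (smooth2_slicex y sm) H hx hx').
have H c : d < c < L2 -> `|derive1 (fun t => mo e u (x', t)) c| <= K * M.
  move=> hc; have E := dd_mo (i := true) (z := (x', c)) e0 su wy (B _ _ _ hx' (lexx _)) (B _ _ _ hc (lexx _)).
  rewrite (etrans (esym (dyE (mo e u) (x', c))) E).
  exact: (hK e uy M e0 M0 wy.1 by_).
exact: (smooth1_lip_itv (smooth2_slicey x' sm) H hy hy').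
Qed.

Lemma average_dist (B : set RR) f (c eta : R) : measurable B -> sq f ->
  (forall w, B w -> `|f w - c| <= eta) ->
  `|I2 (fun z => f z * \1_B z) - c * I2 (\1_B : RR -> R)| <= eta * I2 (\1_B : RR -> R).
Proof.
move=> mB sf h; have sB : sq (\1_B) by exact: sq_indic.
have Ifb : Itg leb2 Om (fun z => f z * \1_B z) := sqintM mO sf sB.
have Ib : Itg leb2 Om (\1_B) := sqint_Itg1 mO fO sB.
have E1 := IZ mO c Ib; have E2 := IZ mO eta Ib; have E3 := IB mO Ifb (ItgZ mO c Ib).
rewrite -E1 -E2 -E3; apply: (norm_I_le mO (ItgB mO Ifb (ItgZ mO c Ib)) (ItgZ mO eta Ib)).
move=> w _; rewrite -mulrBl normrM indicE; case: (boolP (w \in B)) => [/set_mem wB|_].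
  by rewrite normr1 !mulr1; exact: h.
by rewrite normr0 !mulr0.
Qed.

(** The mollifications are equi-Lipschitz away from [Gamma], and their means over a fixed small
    square converge by weak convergence; together this gives convergence at every point. The limit
    inherits the Lipschitz bound and equals [u] almost everywhere because both are limits against
    test functions. *)
Lemma lip_rep u (ud : bool -> R * R -> R) (M0 M : R) : sq u -> 0 <= M0 -> 0 <= M ->
  {ae leb2, forall z, Om z -> `|u z| <= M0} ->
  (forall i, wd i u (ud i)) -> (forall i, {ae leb2, forall z, Om z -> `|ud i z| <= M}) ->
  exists K : R, 0 <= K /\ exists U, [/\ {ae leb2, forall z, Om z -> u z = U z}, lip_on K U,
    (forall z, Om z -> `|U z| <= K) & measurable_fun Om (U : RR -> R)].
Proof.
move=> su M00 M1 uM0 wu uM.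
have [K1 [K10 hK1]] := mo_lip; have [K2 [K20 hK2]] := mo_bounded.
pose f n := mo (en n) u.
have bf n z : `|f n z| <= K2 * M0 by apply: hK2 => //; exact: en_gt0.
pose K := K1 * M + K2 * M0.
have KK0 : 0 <= K by rewrite addr_ge0// mulr_ge0// ltW.
have lf n d z w : 2 * en n <= d -> inner L1 L2 d z -> inner L1 L2 d w ->
    `|f n z - f n w| <= K1 * M * (`|z.1 - w.1| + `|z.2 - w.2|).
  by move=> h; apply: (hK1 _ _ _ _ _ _ _ h M1 su (wu false) (wu true)) => //; exact: en_gt0.
have en2 (d : R) : 0 < d -> \forall n \near \oo, 2 * en n <= d.
  move=> dp; have h : 0 < d / 2 by rewrite divr_gt0.
  by apply: filterS (en_lt h) => n hx; rewrite -ler_pdivlMl// mulrC; exact: ltW.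
have sf n : sq (f n) by exact: sq_mo.
have cauchyf z : Om z -> cvgn (fun n => f n z).
  case: z => x y /OmE[/andP[x0 xL] /andP[y0 yL]]; apply: cauchy_cvg; apply: cauchy_exP => eps eps0.
  pose d := Num.min x y / 2.
  have dmin : 0 < Num.min x y by rewrite lt_min x0.
  have dx0 : d < x by rewrite /d ltr_pdivrMr// (le_lt_trans (_ : _ <= x))// ?ge_min ?lexx// ltr_pMr// ltr1n.
  have dy0 : d < y by rewrite /d ltr_pdivrMr// (le_lt_trans (_ : _ <= y))// ?ge_min ?lexx ?orbT// ltr_pMr// ltr1n.
  have d0 : 0 < d by rewrite divr_gt0.
  (* Keeps the square [B] of half-side [r] in [inner L1 L2 d] and, at small scales, every [f n] on
     it within [eps / 2] of its value at the centre. *)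
  pose r := Num.min (Num.min (x - d) (L1 - x)) (Num.min (Num.min (y - d) (L2 - y)) (eps / (4 * (K1 * M + 1)))).
  have k0 : 0 <= K1 * M by rewrite mulr_ge0// ltW.
  have r0 : 0 < r by rewrite !lt_min !subr_gt0 dx0 xL dy0 yL divr_gt0// mulr_gt0// ltr_wpDl.
  have [r1 r2 r3 r4 r5] : [/\ r <= x - d, r <= L1 - x, r <= y - d, r <= L2 - y & r <= eps / (4 * (K1 * M + 1))].
    by split; rewrite /r !ge_min lexx ?orbT.
  pose B : set RR := `]x - r, x + r[%classic `*` `]y - r, y + r[%classic.
  have mB : measurable B by exact: measurableX.
  have BQ : B `<=` inner L1 L2 d.
    move=> [s t] [/=]; rewrite !in_itv/= => hs ht.
    by split; rewrite /= in_itv/=; [exact: itv_in hs r1 r2|exact: itv_in ht r3 r4].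
  have sB : sq (\1_B) by exact: sq_indic.
  pose b := I2 (\1_B : RR -> R).
  have b0 : 0 < b.
    rewrite /b /Rintegral integral_indic// setIidl; last by move=> w /BQ; exact: inner_sub.
    have lt2 (t : R) : t - r < t + r by rewrite ltrBlDr -addrA ltrDl addr_gt0.
    rewrite leb2_rect// !lebesgue_measure_itv/= !lte_fin !lt2 -!EFinD -EFinM /=.
    by apply: mulr_gt0; rewrite subr_gt0.
  have kr : 2 * (K1 * M) * r <= eps / 2 by exact: half_small k0 r0 r5.
  (* The mean of [u] over [B] is the centre for the Cauchy criterion: it is the limit of the means
     of [f n], which are eventually within [eps / 2] of [f n (x, y)]. *)
  exists (I2 (fun z => u z * \1_B z) / b).
  have hw := weak_cvg sB su.
  have hbe : 0 < b * (eps / 2) by rewrite mulr_gt0// divr_gt0.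
  move/cvgrPdist_lt : hw => /(_ _ hbe) h1.
  suff H : \forall n \near \oo, `|I2 (fun z => u z * \1_B z) / b - f n (x, y)| < eps by exact: H.
  have {}h1 : \forall n \near \oo, `|I2 (fun z => u z * \1_B z) - I2 (fun z => f n z * \1_B z)| < b * (eps / 2).
    exact: h1.
  apply: filterS2 h1 (en2 _ d0) => n h1 h2.
  rewrite -(ltr_pM2r b0) -[X in _ * X < _](ger0_norm (ltW b0)) -normrM mulrBl divfK ?gt_eqF//.
  have h3 : `|I2 (fun z => f n z * \1_B z) - f n (x, y) * b| <= eps / 2 * b.
    apply: (average_dist mB (sf n)) => w wB.
    apply: le_trans (lf n d _ _ h2 (BQ _ wB) _) _.
      by split; rewrite /= in_itv/=; apply/andP; split.
    apply: le_trans kr; rewrite (double_mul (K1 * M) r); apply: ler_wpM2l => //.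
    case: w wB => s t [/=]; rewrite !in_itv/= => /andP[s1 s2] /andP[t1 t2].
    by apply: lerD; apply: ltW; rewrite /= ltr_distl; apply/andP.
  apply: le_lt_trans (ler_distD (I2 (fun z => f n z * \1_B z)) _ _) _.
  rewrite (_ : eps * b = b * (eps / 2) + eps / 2 * b); last by field.
  exact: ltr_leD h1 h3.
pose U z := lim (f n z @[n --> \oo]).
have cU z : Om z -> f n z @[n --> \oo] --> U z by exact: cauchyf.
have mU : measurable_fun Om (U : RR -> R).
  by apply: (measurable_fun_cvg (h := f)) => // n; exact: (sf n).1.
have UM z : Om z -> `|U z| <= K2 * M0.
  by move=> /cU h; apply: (lim_norm_le h); apply: nearW.
have sU : sq U by apply: (sqint_bnd mO fO (M := K2 * M0)).
exists K; split => //; exists U; split => //.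
- apply: test_orth2 => // phi tp; have sp := test_sq tp.
  have h1 := weak_cvg sp su.
  have h2 : I2 (fun z => f n z * phi z) @[n --> \oo] --> I2 (fun z => U z * phi z).
    apply: (Rdct mO (g := fun z => K2 * M0 * `|phi z|)).
    - by move=> n; exact: Itg_meas (sqintM mO (sf n) sp).
    - exact: Itg_meas (sqintM mO sU sp).
    - by apply: (ItgZ mO); apply: Itg_norm; exact: (sqint_Itg1 mO fO).
    - by move=> n z _; rewrite normrM ler_wpM2r.
    - by apply: aeW => z Oz; apply: cvgM; [exact: cU|exact: cvg_cst].
  exact: (cvg_unique (@Rhausdorff R) h1 h2).
- move=> z w Oz Ow; have h : f n z - f n w @[n --> \oo] --> U z - U w by apply: cvgB; exact: cU.
  apply: le_trans (_ : K1 * M * (`|z.1 - w.1| + `|z.2 - w.2|) <= _); last first.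
    by rewrite ler_wpM2r ?addr_ge0// lerDl mulr_ge0// ltW.
  apply: (lim_norm_le h).
  case: z Oz h => x y /OmE[/andP[x0 xL] /andP[y0 yL]]; case: w Ow => x' y' /OmE[/andP[x0' xL'] /andP[y0' yL']] _.
  pose d := Num.min (Num.min x y) (Num.min x' y') / 2.
  have m0 : 0 < Num.min (Num.min x y) (Num.min x' y') by rewrite !lt_min x0 y0 x0'.
  have dp : 0 < d by rewrite divr_gt0.
  have dlt t : Num.min (Num.min x y) (Num.min x' y') <= t -> d < t.
    by move=> h; apply: lt_le_trans h; rewrite ltr_pdivrMr// ltr_pMr// ltr1n.
  apply: filterS (en2 _ dp) => n hn; apply: lf hn _ _; split; rewrite /= in_itv/= ?xL ?yL ?xL' ?yL' andbT;
  by apply: dlt; rewrite !ge_min lexx ?orbT.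
- by move=> z Oz; apply: le_trans (UM z Oz) _; rewrite lerDr mulr_ge0// ltW.
Qed.

End Lipschitz.

Lemma marg_in (R : realType) (d t L x : R) : 0 < d -> t < d / 2 -> d <= x -> x <= L - d ->
  2 * t < x < L.
Proof. by move=> *; apply/andP; split; lra. Qed.

Lemma tw_lin1 (R : realType) (A B C F G H : R) :
  A = B - C -> F = - G -> A = - G -> F = - H -> H - C = - B.
Proof. lra. Qed.

Lemma tw_lin2 (R : realType) (A B C F G H : R) :
  A = B - C -> F = - G -> A = - G -> H = - B -> F = - (H + C).
Proof. lra. Qed.

Lemma tw_lin3 (R : realType) (a b t : R) : a + t = a + b + t - b.
Proof. ring. Qed.

Lemma le_twice (R : realType) (C t : R) : 0 <= C -> 0 <= t -> C <= 2 * (C + t).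
Proof. lra. Qed.

(** * Interchange of transport and differentiation *)

Section Transport.
Context {R : realType}.
Notation RR := (measurableTypeR R * measurableTypeR R)%type.
Implicit Types (f g h u v phi : R * R -> R) (k : nat).
Variables (L1 L2 : R).
Hypotheses (hL1 : 0 < L1) (hL2 : 0 < L2).
Notation Om := (Omega L1 L2).
Notation I2 f := (\int[leb2]_(z in Om) f z).
Notation sq := (sqint leb2 Om).
Notation sn := (sqn leb2 Om).
Notation wd := (wd L1 L2).
Notation Hs := (Hs L1 L2).
Notation mo := (mo L1 L2).
Notation test := (test2 Om).

Let mO : measurable (Om : set RR) := Om_meas L1 L2.
Let fO := Om_fin L1 L2.
Let Fae := ae_filter_ringOfSetsType (@leb2 R).

(** [p] stands for the Lipschitz representative of [lam] and [pd] for its weak gradient, one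
    constant serving all bounds. Constant coefficients are also instances, through which plain
    derivatives become transport operators. *)
Definition coef (K : R) (p : R * R -> R) (pd : bool -> R * R -> R) :=
  [/\ 0 <= K, measurable_fun Om (p : RR -> R), forall z, Om z -> `|p z| <= K, lip_on L1 L2 K p &
      forall i, wd i p (pd i) /\ {ae leb2, forall z, Om z -> `|pd i z| <= K}].

(* [f = p u_x + q u_y] in the sense of distributions, with [px = p_x] *)
Definition tw p px (q : R) u f := sq f /\ forall phi, test phi ->
  I2 (fun z => f z * phi z) = - I2 (fun z => u z * (p z * dx phi z + px z * phi z + q * dy phi z)).

Lemma I2D3 u a b c : sq u -> sq a -> sq b -> sq c ->
  I2 (fun z => u z * (a z + b z + c z)) =
  I2 (fun z => u z * a z) + I2 (fun z => u z * b z) + I2 (fun z => u z * c z).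
Proof.
move=> su sa sb sc; have i1 := sqintM mO su sa; have i2 := sqintM mO su sb; have i3 := sqintM mO su sc.
rewrite -(ID mO i1 i2) -(ID mO (ItgD mO i1 i2) i3).
by apply: eq_I => z _; rewrite -!mulrDr.
Qed.

Section Coefficient.
Variables (K : R) (p : R * R -> R) (pd : bool -> R * R -> R) (q : R).
Hypothesis hp : coef K p pd.
Notation tw := (tw p (pd false) q).

Lemma coef_sq : sq p.
Proof. by case: hp => K0 mp pK _ _; apply: (sqint_bnd mO fO mp pK). Qed.

Lemma coef_sqM u : sq u -> sq (fun z => p z * u z).
Proof. by case: hp => K0 mp pK _ _ su; have [h _] := sqint_bndM mO mp pK su. Qed.

Lemma coefd_sqM i u : sq u -> sq (fun z => pd i z * u z).
Proof.
by case: hp => K0 _ _ _ /(_ i)[[sp _] pK] su; have [h _] := ae_sqint_bndM mO sp.1 pK su.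
Qed.

Lemma coef_wdM i u ui : sq u -> wd i u ui ->
  wd i (fun z => p z * u z) (fun z => pd i z * u z + p z * ui z).
Proof.
move=> su ui_; case: (hp) => _ _ _ _ /(_ i)[wp _].
exact: (wdM coef_sq su wp ui_ (coefd_sqM i su) (coef_sqM ui_.1)).
Qed.

Lemma tw_test phi : test phi ->
  [/\ sq (fun z => p z * dx phi z), sq (fun z => pd false z * phi z) & sq (fun z => q * dy phi z)].
Proof.
move=> tp; split; [apply: coef_sqM; exact: test_sq (test_dx tp)|apply: coefd_sqM; exact: test_sq|].
by apply: (sqintZ mO); exact: test_sq (test_dy tp).
Qed.

Lemma tw_uniq u f g : tw u f -> tw u g -> {ae leb2, forall z, Om z -> f z = g z}.
Proof. by move=> [sf h1] [sg h2]; apply: test_orth2 => // phi tp; rewrite h1// h2. Qed.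

Lemma twD u v f g : sq u -> sq v -> tw u f -> tw v g ->
  tw (fun z => u z + v z) (fun z => f z + g z).
Proof.
move=> su sv [sf h1] [sg h2]; split; first exact: (sqintD mO).
move=> phi tp; have [s1 s2 s3] := tw_test tp; have s := sqintD mO (sqintD mO s1 s2) s3.
have E (a b r : R * R -> R) : sq a -> sq b -> sq r ->
    I2 (fun z => (a z + b z) * r z) = I2 (fun z => a z * r z) + I2 (fun z => b z * r z).
  move=> sa sb sr; rewrite -(ID mO (sqintM mO sa sr) (sqintM mO sb sr)).
  by apply: eq_I => z _; rewrite mulrDl.
by rewrite (E _ _ _ sf sg (test_sq tp)) (E _ _ _ su sv s) h1// h2// opprD.
Qed.

Lemma twZ (c : R) u f : sq u -> tw u f -> tw (fun z => c * u z) (fun z => c * f z).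
Proof.
move=> su [sf h1]; split; first exact: (sqintZ mO).
move=> phi tp; have [s1 s2 s3] := tw_test tp; have s := sqintD mO (sqintD mO s1 s2) s3.
have E (a r : R * R -> R) : sq a -> sq r ->
    I2 (fun z => (c * a z) * r z) = c * I2 (fun z => a z * r z).
  move=> sa sr; rewrite -(IZ mO _ (sqintM mO sa sr)).
  by apply: eq_I => z _; rewrite mulrA.
by rewrite (E _ _ sf (test_sq tp)) (E _ _ su s) h1// mulrN.
Qed.

Lemma tw_H1 u ux uy : sq u -> wd false u ux -> wd true u uy ->
  tw u (fun z => p z * ux z + q * uy z).
Proof.
move=> su wx wy.
have s : sq (fun z => p z * ux z + q * uy z).
  by apply: (sqintD mO); [exact: coef_sqM wx.1|exact: (sqintZ mO _ wy.1)].
split => // phi tp; have [s1 s2 s3] := tw_test tp; have sp := test_sq tp.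
rewrite (I2D3 su s1 s2 s3).
have [_ hx] := coef_wdM su wx; have := hx _ tp.
have i1 := sqintM mO (coefd_sqM false su) sp; have i2 := sqintM mO (coef_sqM wx.1) sp.
have -> : I2 (fun z => p z * u z * dd false phi z) = I2 (fun z => u z * (p z * dx phi z)).
  by apply: eq_I => z _; rewrite mulrCA mulrA.
have -> : I2 (fun z => (pd false z * u z + p z * ux z) * phi z) =
    I2 (fun z => u z * (pd false z * phi z)) + I2 (fun z => p z * ux z * phi z).
  have -> : I2 (fun z => u z * (pd false z * phi z)) = I2 (fun z => pd false z * u z * phi z).
    by apply: eq_I => z _; rewrite mulrCA mulrA.
  by rewrite -(ID mO i1 i2); apply: eq_I => z _; rewrite mulrDl.
move=> e1; have e2 := wy.2 _ tp.
have -> : I2 (fun z => u z * (q * dy phi z)) = q * I2 (fun z => u z * dd true phi z).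
  rewrite -(IZ mO _ (sqintM mO su (test_sq (test_dd true tp)))).
  by apply: eq_I => z _; rewrite mulrCA.
have -> : I2 (fun z => (p z * ux z + q * uy z) * phi z) =
    I2 (fun z => p z * ux z * phi z) + q * I2 (fun z => uy z * phi z).
  rewrite -(IZ mO _ (sqintM mO wy.1 sp)) -(ID mO i2 (ItgZ mO _ (sqintM mO wy.1 sp))).
  by apply: eq_I => z _; rewrite mulrDl mulrA.
by rewrite e1 e2; ring.
Qed.

Let cross_smooth i j U phi : smooth2 U -> test phi ->
  I2 (fun z => dd j U z * (p z * dd i phi z + pd i z * phi z)) =
  - I2 (fun z => p z * (dd i (dd j U) z * phi z)).
Proof.
move=> sU tp; have sjU := smooth2_dd j sU; have tjp := testM sjU tp.
have [_ h] : wd i p (pd i) by case: hp => _ _ _ _ /(_ i)[].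
have s1 := test_sq (testM (smooth2_dd i sjU) tp).
have s2 := test_sq (testM sjU (test_dd i tp)).
have e := h _ tjp.
have i1 := sqintM mO coef_sq s1; have i2 := sqintM mO coef_sq s2.
have i3 : Itg leb2 Om (fun z => pd i z * (dd j U z * phi z)).
  by case: hp => _ _ _ _ /(_ i)[[spi _] _]; exact: (sqintM mO spi (test_sq tjp)).
have E : I2 (fun z => p z * dd i (fun z => dd j U z * phi z) z) =
    I2 (fun z => p z * (dd i (dd j U) z * phi z)) + I2 (fun z => p z * (dd j U z * dd i phi z)).
  rewrite -(ID mO i1 i2); apply: eq_I => z _.
  by rewrite (ddM i z sjU (test_smooth tp)) mulrDr addrC [phi z * _]mulrC.
have -> : I2 (fun z => dd j U z * (p z * dd i phi z + pd i z * phi z)) =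
    I2 (fun z => p z * (dd j U z * dd i phi z)) + I2 (fun z => pd i z * (dd j U z * phi z)).
  by rewrite -(ID mO i2 i3); apply: eq_I => z _; rewrite mulrDr !(mulrCA (dd j U z)).
move: e; rewrite E => e; apply/eqP; rewrite -subr_eq0 opprK addrC addrA e addrC subrr.
by [].
Qed.

(** Formally both sides are minus the integral of [p phi] against the second derivative of index
    [i], [j]. As [u] has only first derivatives, this is checked on its mollifications, where
    derivatives commute, and passed to the weak limit. *)
Lemma cross i j u ui uj phi : sq u -> wd i u ui -> wd j u uj -> test phi ->
  I2 (fun z => uj z * (p z * dd i phi z + pd i z * phi z)) =
  I2 (fun z => ui z * (p z * dd j phi z + pd j z * phi z)).
Proof.
move=> su wi wj tp.
have sG l : sq (fun z => p z * dd l phi z + pd l z * phi z).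
  apply: (sqintD mO); [apply: coef_sqM; exact: test_sq (test_dd l tp)|apply: coefd_sqM; exact: test_sq].
have key (l : bool) ul (k : bool) : wd l u ul ->
    \forall n \near \oo, I2 (fun z => mo (en n) ul z * (p z * dd k phi z + pd k z * phi z)) =
      - I2 (fun z => p z * (dd k (dd l (mo (en n) u)) z * phi z)).
  move=> wl.
  have [_ [d d0 md]] := (test2P L1 L2 phi).1 tp.
  have [_ [d' d'0 md']] := (test2P L1 L2 (dd k phi)).1 (test_dd k tp).
  have hd2 : 0 < d / 2 by rewrite divr_gt0.
  have hd2' : 0 < d' / 2 by rewrite divr_gt0.
  apply: filterS2 (en_lt hd2) (en_lt hd2') => n hn hn'.
  have sm := smooth2_mo (en_gt0 n) su.
  rewrite -(cross_smooth k l sm tp); apply: eq_I => z Oz.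
  have [h|h] := eqVneq (phi z) 0; first (have [h'|h'] := eqVneq (dd k phi z) 0).
  - by rewrite h h' !mulr0 addr0 !mulr0.
  - have [/andP[a1 a2] /andP[b1 b2]] := md' _ h'.
    by rewrite (dd_mo (en_gt0 n) su wl (marg_in d'0 hn' a1 a2) (marg_in d'0 hn' b1 b2)).
  have [/andP[a1 a2] /andP[b1 b2]] := md _ h.
  by rewrite (dd_mo (en_gt0 n) su wl (marg_in d0 hn a1 a2) (marg_in d0 hn b1 b2)).
have c1 := weak_cvg (sG i) wj.1; have c2 := weak_cvg (sG j) wi.1.
apply: (cvg_unique (@Rhausdorff R) c1); apply: cvg_near_eq c2.
apply: filterS2 (key _ _ i wj) (key _ _ j wi) => n -> ->.
by rewrite (ddC i j (smooth2_mo (en_gt0 n) su)).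
Qed.

(** The commutator of transport with a derivative, in a weak form free of second derivatives of [u]:
    the [x]-part is [cross], the [y]-part has a constant coefficient and uses the definition of weak
    derivatives twice. *)
Lemma tw_swap i u ux uy ui phi : sq u -> wd false u ux -> wd true u uy -> wd i u ui -> test phi ->
  I2 (fun z => (p z * ux z + q * uy z) * dd i phi z) =
  I2 (fun z => ui z * (p z * dx phi z + pd false z * phi z + q * dy phi z)) -
  I2 (fun z => pd i z * ux z * phi z).
Proof.
move=> su wx wy wi tp; have [s1 s2 s3] := tw_test tp; have sp := test_sq tp.
have sdp := test_sq (test_dd i tp).
have c := cross su wi wx tp.
have i1 := sqintM mO wx.1 (coef_sqM sdp); have i2 := sqintM mO wx.1 (coefd_sqM i sp).
have e1 : I2 (fun z => ux z * (p z * dd i phi z + pd i z * phi z)) =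
    I2 (fun z => ux z * (p z * dd i phi z)) + I2 (fun z => ux z * (pd i z * phi z)).
  by rewrite -(ID mO i1 i2); apply: eq_I => z _; rewrite mulrDr.
have e2 : I2 (fun z => ui z * (p z * dd false phi z + pd false z * phi z)) =
    I2 (fun z => ui z * (p z * dx phi z)) + I2 (fun z => ui z * (pd false z * phi z)).
  by rewrite -(ID mO (sqintM mO wi.1 s1) (sqintM mO wi.1 s2)); apply: eq_I => z _; rewrite mulrDr.
rewrite (I2D3 wi.1 s1 s2 s3) -e2 -c e1.
have -> : I2 (fun z => pd i z * ux z * phi z) = I2 (fun z => ux z * (pd i z * phi z)).
  by apply: eq_I => z _; rewrite mulrCA mulrA.
have -> : I2 (fun z => ui z * (q * dy phi z)) = q * I2 (fun z => ui z * dy phi z).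
  rewrite -(IZ mO _ (sqintM mO wi.1 (test_sq (test_dy tp)))).
  by apply: eq_I => z _; rewrite mulrCA.
have -> : I2 (fun z => (p z * ux z + q * uy z) * dd i phi z) =
    I2 (fun z => ux z * (p z * dd i phi z)) + q * I2 (fun z => uy z * dd i phi z).
  have j2 := sqintM mO wy.1 sdp.
  rewrite -(IZ mO _ j2) -(ID mO i1 (ItgZ mO _ j2)); apply: eq_I => z _.
  by rewrite mulrDl -!mulrA [p z * _]mulrCA.
have -> : I2 (fun z => ui z * dy phi z) = I2 (fun z => uy z * dd i phi z).
  have h1 := wi.2 _ (test_dy tp); have h2 := wy.2 _ (test_dd i tp).
  apply: oppr_inj; rewrite -h1 -h2; have -> : dd i (dy phi) = dd true (dd i phi).
    exact: (ddC i true (test_smooth tp)).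
  by [].
exact: tw_lin3.
Qed.

(** The relation [T u_i = (T u)_i - p_i u_x], where existence of the right-hand side yields that of
    the left; [wd_tw] goes the other way. *)
Lemma tw_wd i u ux uy ui f fi : sq u -> wd false u ux -> wd true u uy -> wd i u ui ->
  tw u f -> wd i f fi -> tw ui (fun z => fi z - pd i z * ux z).
Proof.
move=> su wx wy wi uf wf; have sl := coefd_sqM i wx.1.
split; first exact: (sqintB mO wf.1 sl).
move=> phi tp; have sp := test_sq tp.
have e := tw_swap su wx wy wi tp.
have e1 := uf.2 _ (test_dd i tp); have e2 := (tw_H1 su wx wy).2 _ (test_dd i tp).
have e3 := wf.2 _ tp.
have -> : I2 (fun z => (fi z - pd i z * ux z) * phi z) =
    I2 (fun z => fi z * phi z) - I2 (fun z => pd i z * ux z * phi z).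
  rewrite -(IB mO (sqintM mO wf.1 sp) (sqintM mO sl sp)).
  by apply: eq_I => z _; rewrite mulrBl.
exact: (tw_lin1 e e1 e2 e3).
Qed.

Lemma wd_tw i u ux uy ui g h : sq u -> wd false u ux -> wd true u uy -> wd i u ui ->
  tw u g -> tw ui h -> wd i g (fun z => h z + pd i z * ux z).
Proof.
move=> su wx wy wi ug uh; have sl := coefd_sqM i wx.1.
split; first exact: (sqintD mO uh.1 sl).
move=> phi tp; have sp := test_sq tp.
have e := tw_swap su wx wy wi tp.
have e1 := ug.2 _ (test_dd i tp); have e2 := (tw_H1 su wx wy).2 _ (test_dd i tp).
have e3 := uh.2 _ tp.
have -> : I2 (fun z => (h z + pd i z * ux z) * phi z) =
    I2 (fun z => h z * phi z) + I2 (fun z => pd i z * ux z * phi z).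
  rewrite -(ID mO (sqintM mO uh.1 sp) (sqintM mO sl sp)).
  by apply: eq_I => z _; rewrite mulrDl.
exact: (tw_lin2 e e1 e2 e3).
Qed.

(* L^2 bounds on [T u_alpha] for all the derivatives [u_alpha] of order at most k *)
Fixpoint HT k (C : R) u : Prop := (exists g, tw u g /\ sn g <= C) /\
  if k is k'.+1 then forall i, exists v, wd i u v /\ HT k' C v else True.

Lemma HT_le k C C' u : C <= C' -> HT k C u -> HT k C' u.
Proof.
move=> CC'; elim: k u => [|k IH] u [[g [tg gC]] H]; split => //.
- by exists g; split => //; exact: le_trans gC CC'.
- by exists g; split => //; exact: le_trans gC CC'.
by move=> i; have [v [wv hv]] := H i; exists v; split => //; exact: IH.
Qed.

Definition mults k := forall j, (j < k)%N -> exists2 M : R, 0 <= M & forall i, mult L1 L2 j M (pd i).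

(** Mollification commutes with derivatives and so controls [T] of each derivative, whereas the norm
    contains the derivatives of [T u]. This lemma and [HT_Hs] translate between the two, each
    exchange costing one multiplier term [p_i u_x] of lower order. *)
Lemma Hs_HT k : mults k -> exists2 B : R, 0 <= B & forall C u f, Hs k C u -> Hs k C f -> tw u f -> HT k (B * C) u.
Proof.
elim: k => [|k IH] hm.
  by exists 1 => // C u f hu hf uf; split => //; exists f; rewrite mul1r; split => //; exact: Hs_sn hf.
have [B B0 hB] := IH (fun j jk => hm j (ltnW jk)); have [M M0 hM] := hm k (ltnSn k).
exists (1 + B * (2 * (1 + M))); first by rewrite addr_ge0// !mulr_ge0// addr_ge0.
move=> C u f hu hf uf; have C0 := Hs_ge0 hu.
case: (hu) => su _ H; have [ux [wx hux]] := H false; have [uy [wy _]] := H true.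
split.
  exists f; split => //; apply: le_trans (Hs_sn hf) _.
  by rewrite mulrDl mul1r lerDl mulr_ge0// !mulr_ge0// addr_ge0.
move=> i; have [ui [wi hui]] := H i; exists ui; split => //.
case: (hf) => _ _ /(_ i) [fi [wfi hfi]].
apply: (@HT_le _ (B * (2 * (1 + M) * C))).
  by rewrite [leRHS]mulrDl mul1r mulrA lerDr.
have E : 2 * (C + M * C) = 2 * (1 + M) * C by ring.
have MC0 : 0 <= M * C by exact: mulr_ge0.
apply: hB (tw_wd su wx wy wi uf wfi).
  by apply: Hs_le hui; rewrite -E; exact: le_twice.
by rewrite -E; exact: (HsB hfi (hM i C ux hux)).
Qed.

Lemma HT_Hs k : mults k -> exists2 B : R, 0 <= B & forall C u g, Hs k C u -> HT k C u -> tw u g -> Hs k (B * C) g.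
Proof.
have un C u g : HT 0 C u -> tw u g -> Hs 0 C g.
  move=> [[g' [ug' gC]] _] ug; have e := tw_uniq ug' ug.
  by split => //; [exact: ug.1|rewrite -(sqn_ae mO ug'.1.1 ug.1.1 e)].
have HT0 j C u : HT j C u -> HT 0 C u by case: j => [|j] [].
elim: k => [|k IH] hm.
  by exists 1 => // C u g hu ht ug; rewrite mul1r; exact: un ht ug.
have [B B0 hB] := IH (fun j jk => hm j (ltnW jk)); have [M M0 hM] := hm k (ltnSn k).
exists (1 + 2 * (B + M)); first by rewrite addr_ge0// mulr_ge0// addr_ge0.
move=> C u g hu ht ug; have C0 := Hs_ge0 hu.
case: (hu) => su _ H; have [ux [wx hux]] := H false; have [uy [wy _]] := H true.
have [sg gC _] := un _ _ _ (HT0 _ _ _ ht) ug.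
have le1 : 2 * (B * C + M * C) <= (1 + 2 * (B + M)) * C.
  have -> : (1 + 2 * (B + M)) * C = C + 2 * (B * C + M * C) by ring.
  by rewrite lerDr.
split => //.
  apply: le_trans gC _; rewrite mulrDl mul1r lerDl mulr_ge0// mulr_ge0// addr_ge0//.
move=> i; case: (ht) => _ /(_ i) [ui [wi hti]].
have hui := Hs_wd hu wi; have [h [uh _]] : exists h, tw ui h /\ sn h <= C by have [] := HT0 _ _ _ hti.
exists (fun z => h z + pd i z * ux z); split; first exact: (wd_tw su wx wy wi ug uh).
apply: Hs_le le1 _; apply: HsD; first exact: hB uh.
exact: (hM i C ux hux).
Qed.

End Coefficient.

End Transport.

(** * Traces and integration by parts *)

Section Cutoff.
Context {R : realType}.

Definition cut (e x : R) := step (e^-1 * x).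

Lemma smooth1_cut e : smooth1 (cut e).
Proof. exact: smooth1_scale smooth1_step. Qed.

Lemma cut_d1 e : derive1 (cut e) = mol e.
Proof. by apply: is_derive1_eq => x; exact: is_derive_scale smooth1_step. Qed.

Lemma cut0 e x : 0 < e -> x <= e -> cut e x = 0.
Proof. by move=> e0 xe; apply: step0; rewrite ler_pdivrMl// mulr1. Qed.

Lemma cut1 e x : 0 < e -> 2 * e <= x -> cut e x = 1.
Proof. by move=> e0 ex; apply: step1; rewrite ler_pdivlMl// mulrC. Qed.

Lemma cut_bnd e x : `|cut e x| <= 1.
Proof. by rewrite ger0_norm ?step_ge0// step_le1. Qed.

Lemma cut_bnd1 e x : `|1 - cut e x| <= 1.
Proof. by rewrite ger0_norm ?subr_ge0 ?step_le1// gerBl step_ge0. Qed.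

Lemma cut_cvg (x : R) : 0 < x -> cut (en n) x @[n --> \oo] --> (1 : R).
Proof.
move=> x0; apply: cvg_near_cst; have h : 0 < x / 2 by rewrite divr_gt0.
apply: filterS (en_lt h) => n hn; apply: cut1; first exact: en_gt0.
by rewrite -ler_pdivlMl// mulrC ltW.
Qed.

Lemma H1norm_le (L A : R) (eta : R -> R) : 0 < L -> 0 <= A -> smooth1 eta ->
  (forall s, 0 < s < L -> `|eta s| <= A /\ `|derive1 eta s| <= A) ->
  H1norm L eta <= A * Num.sqrt (2 * L).
Proof.
move=> L0 A0 se h.
have mD : measurable (`]0, L[%classic : set (measurableTypeR R)) by exact: measurable_itv.
have lebL : fine (@lebesgue_measure R (`]0, L[%classic : set R)) = L.
  by rewrite lebesgue_measure_itv/= lte_fin L0 -EFinD subr0.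
have ce := smooth1_cont se; have ce' := smooth1_cont (smooth1_d1 se).
have -> : A * Num.sqrt (2 * L) = Num.sqrt (2 * A ^+ 2 * L).
  by rewrite -mulrA mulrCA (sqrtrM (2 * L) (sqr_ge0 A)) sqrtr_sqr ger0_norm.
apply: ler_wsqrtr.
have -> : 2 * A ^+ 2 * L = \int[lebesgue_measure]_(s in `]0, L[) (2 * A ^+ 2).
  by rewrite (Rintegral_cst _ mD) lebL.
apply: (le_I mD).
- apply: Itg_cont => s; apply: cvgD; apply: cvgM; [exact: ce|exact: ce|exact: ce'|exact: ce'].
- by apply: Itg_cont => s; exact: cvg_cst.
move=> s; rewrite /= in_itv/= => /h[h1 h2].
by rewrite mulr_natl mulr2n; apply: lerD; rewrite -[leLHS]real_normK ?num_real// ler_sqr ?nnegrE.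
Qed.

Lemma test1_intro (L b0 b : R) (eta : R -> R) : 0 < b0 -> b < L -> smooth1 eta ->
  (forall s, s <= b0 \/ b <= s -> eta s = 0) -> test1 L eta.
Proof.
move=> b00 bL se e0; split; first exact: smooth1_derive1n.
exists `[b0, b]%classic; split; first exact: segment_compact.
  by move=> s; rewrite /= !in_itv/= => /andP[h1 h2]; rewrite (lt_le_trans b00 h1) (le_lt_trans h2 bL).
move=> s; rewrite /= in_itv/= => /negP; rewrite negb_and -!ltNge => /orP[h|h]; apply: e0.
  by left; exact: ltW.
by right; exact: ltW.
Qed.

(* the factor [m] is a value of the derivative of a cutoff function *)
Lemma slice_H1 (L b0 b A m D : R) (eta : R -> R) : 0 < L -> 0 < b0 -> b < L -> 0 <= A ->
  smooth1 eta -> (forall s, s <= b0 \/ b <= s -> eta s = 0) -> `|m| <= D ->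
  (m != 0 -> forall s, 0 < s < L -> `|eta s| <= A /\ `|derive1 eta s| <= A) ->
  test1 L (fun s => eta s * m) /\ H1norm L (fun s => eta s * m) <= A * D * Num.sqrt (2 * L).
Proof.
move=> L0 b00 bL A0 se e0 mD h.
have sm : smooth1 (fun s => eta s * m) by apply: smooth1M => //; exact: smooth1_cst.
have D0 : 0 <= D by apply: le_trans mD.
split; first by apply: (test1_intro b00 bL sm) => s /e0 ->; rewrite mul0r.
apply: (H1norm_le L0 _ sm); first exact: mulr_ge0.
move=> s hs.
have -> : derive1 (fun s => eta s * m) s = derive1 eta s * m.
  have -> : derive1 (fun s => eta s * m) = (fun s => derive1 eta s * m); last by [].
  apply: is_derive1_eq => x; have i := smooth1_is x se.
  have : is_derive x 1 (fun s => m * eta s) (m * derive1 eta x) by exact: is_deriveZ.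
  by rewrite mulrC; congr (is_derive _ _ _ _); apply/funext => t; rewrite mulrC.
have [->|m0] := eqVneq m 0; first by rewrite !mulr0 normr0 mulr_ge0.
have [h1 h2] := h m0 s hs; rewrite !normrM.
by split; exact: ler_pM.
Qed.

(** Near [t = 0] the slices of [psi] are small in H^-1 by continuity; the growth [C / d] of the H^1
    norm of [eta t] is compensated by the width [2 d] of the strip where [eta] lives. *)
Lemma trace_small (L L' C e : R) psi : 0 < L -> is_trace0 L L' psi (fun=> 0) -> 0 <= C -> 0 < e ->
  exists d0 : R, 0 < d0 /\ forall d, 0 < d < d0 -> forall eta : R -> R -> R,
  (forall t, 0 < t < L -> test1 L' (eta t) /\ H1norm L' (eta t) <= C / d) ->
  (forall t s, 2 * d < t -> eta t s = 0) ->
  Itg lebesgue_measure `]0, L[ (fun t => \int[lebesgue_measure]_(s in `]0, L'[) (psi t s * eta t s)) ->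
  `|\int[lebesgue_measure]_(t in `]0, L[) \int[lebesgue_measure]_(s in `]0, L'[) (psi t s * eta t s)| <= e.
Proof.
move=> L0 [G [[_ cG] aeG G0]] C0 e0.
have mD : measurable (`]0, L[%classic : set (measurableTypeR R)) by exact: measurable_itv.
(* The final bound is [e' * (C / d) * (2 * d) = 2 * C * e']; the added 1 covers [C = 0]. *)
pose e' := e / (2 * C + 1).
have C1 : 0 < 2 * C + 1 by rewrite ltr_wpDl// mulr_ge0.
have e'0 : 0 < e' by rewrite divr_gt0.
have h0 : (0 : R) \in `[0, L] by rewrite in_itv/= lexx ltW.
have /nbhs_ballP[d1 /= d10 hd1] := cG 0 h0 e' e'0.
exists (Num.min (d1 / 2) (L / 2)); split; first by rewrite lt_min !divr_gt0.
move=> d /andP[dp]; rewrite lt_min => /andP[dd1 dL] eta he eta0.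
move=> IF.
pose B : set R := `]0, 2 * d]%classic.
have mB : measurable (B : set (measurableTypeR R)) by exact: measurable_itv.
have c0 : 0 <= e' * (C / d) by rewrite mulr_ge0 ?divr_ge0// ltW.
have I1 : Itg lebesgue_measure `]0, L[ (\1_B : measurableTypeR R -> R).
  have fD : (@lebesgue_measure R (`]0%R, L[%classic : set R) < +oo)%E.
    by rewrite lebesgue_measure_itv/= lte_fin L0 -EFinD ltry.
  apply: (Itg_bnd mD fD (M := 1)); first by apply: measurable_funTS; exact: measurable_indic.
  by move=> t _; rewrite indicE; case: (t \in B); rewrite ?normr1 ?normr0.
apply: le_trans (norm_I mD IF) _.
apply: le_trans (_ : \int[lebesgue_measure]_(t in `]0, L[) (e' * (C / d) * \1_B t) <= _).
  apply: (ae_le_I mD (Itg_norm IF) (ItgZ mD _ I1)).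
  have Fae := ae_filter_ringOfSetsType (@lebesgue_measure R).
  apply: (@filterS _ _ Fae _ _ _ aeG) => t + Dt; rewrite inE => /(_ Dt) Gt.
  move: (Dt); rewrite /= in_itv/= => ht; have [te tn] := he t ht.
  rewrite indicE; case: (boolP (t \in B)) => tB.
    rewrite mulr1; have := hd1 t _ _ _ te.
    have h1 : ball (0 : R) d1 t.
      move: tB; rewrite inE /B /= in_itv/= => /andP[t0 t2]; rewrite /ball /= sub0r normrN gtr0_norm//.
      by apply: le_lt_trans t2 _; rewrite mulrC -ltr_pdivlMr.
    move=> /(_ h1); have h2 : t \in `[0, L] by case/andP: ht => t0 tL; rewrite in_itv/= !ltW.
    move=> /(_ h2); rewrite (G0 _ te) subr0 (Gt _ te) => h3.
    by apply: le_trans h3 _; apply: ler_wpM2l => //; exact: ltW.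
  rewrite mulr0 (_ : Rintegral _ _ _ = 0) ?normr0//.
  have mD' : measurable (`]0, L'[%classic : set (measurableTypeR R)) by exact: measurable_itv.
  transitivity (\int[lebesgue_measure]_(s in `]0, L'[) (0 : R)); last exact: (I0 lebesgue_measure mD').
  apply: eq_Rintegral => s _; rewrite eta0 ?mulr0//.
  move: tB; rewrite notin_setE /B /= in_itv/= => h; rewrite ltNge; apply/negP => h2; apply: h.
  by case/andP: ht => -> _.
rewrite (IZ mD _ I1).
have h : \int[lebesgue_measure]_(t in `]0, L[) \1_B t <= 2 * d.
  have BE : @lebesgue_measure R B = (2 * d)%:E.
    by rewrite lebesgue_measure_itv/= lte_fin mulr_gt0// -EFinD subr0.
  rewrite /Rintegral integral_indic// -[leRHS]/(fine (2 * d)%:E) -BE.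
  have hl : (@lebesgue_measure R (B `&` (`]0%R, L[%classic : set R)) <= @lebesgue_measure R B)%E.
    by apply: le_measure; rewrite ?inE//; apply: measurableI.
  apply: fine_le => //; last by rewrite BE.
  by rewrite ge0_fin_numE// (le_lt_trans hl)// BE ltry.
apply: le_trans (ler_wpM2l c0 h) _.
have -> : e' * (C / d) * (2 * d) = e' * (2 * C) by field; exact: lt0r_neq0.
rewrite /e' -mulrA ler_piMr ?(ltW e0)// mulrC ler_pdivrMr// mul1r lerDl//.
Qed.

End Cutoff.

(** * Integration by parts against functions that need not vanish near Gamma *)

Section ByParts.
Context {R : realType}.
Notation RR := (measurableTypeR R * measurableTypeR R)%type.
Implicit Types (f g h u v phi : R * R -> R) (k n : nat).
Variables (L1 L2 : R).
Hypotheses (hL1 : 0 < L1) (hL2 : 0 < L2).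
Notation Om := (Omega L1 L2).
Notation I2 f := (\int[leb2]_(z in Om) f z).
Notation sq := (sqint leb2 Om).
Notation sn := (sqn leb2 Om).
Notation wd := (wd L1 L2).
Notation mo := (mo L1 L2).
Notation test := (test2 Om).

Let mO : measurable (Om : set RR) := Om_meas L1 L2.
Let fO := Om_fin L1 L2.

(** Models the functions [w => rho_e(z - w)] with [z] in the rectangle: they vanish near the right
    and upper sides, while near [Gamma] nothing is prescribed. *)
Definition adm phi := smooth2 phi /\ exists a b : R,
  [/\ a < L1, b < L2 & forall z, a <= z.1 \/ b <= z.2 -> phi z = 0].

Let mI (p q : R) : measurable (`]p, q[%classic : set (measurableTypeR R)).
Proof. exact: measurable_itv. Qed.

Let cutx (e : R) (z : R * R) : R := cut e z.1 * (fun=> 1) z.2.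
Let cuty (e : R) (z : R * R) : R := (fun=> 1) z.1 * cut e z.2.

Let smooth2_cutx e : smooth2 (cutx e).
Proof. exact: smooth2_tensor (smooth1_cut e) (smooth1_cst 1). Qed.

Let smooth2_cuty e : smooth2 (cuty e).
Proof. exact: smooth2_tensor (smooth1_cst 1) (smooth1_cut e). Qed.

Let d1cst (c : R) : derive1 (fun _ : R => c) = (fun _ : R => 0 : R).
Proof. by apply: is_derive1_eq => x; exact: is_derive_cst. Qed.

Let dx_cutx e z : dx (cutx e) z = mol e z.1.
Proof. by rewrite (isdxE (isdx_tensor (fun=> 1) (smooth1_cut e))) mulr1 cut_d1. Qed.

Let dy_cutx e z : dy (cutx e) z = 0.
Proof. by rewrite (isdyE (isdy_tensor (cut e) (smooth1_cst 1))) d1cst mulr0. Qed.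

Let dx_cuty e z : dx (cuty e) z = 0.
Proof. by rewrite (isdxE (isdx_tensor (cut e) (smooth1_cst 1))) d1cst mul0r. Qed.

Let dy_cuty e z : dy (cuty e) z = mol e z.2.
Proof. by rewrite (isdyE (isdy_tensor (fun=> 1) (smooth1_cut e))) mul1r cut_d1. Qed.

Section Fixed.
Variables (K : R) (p : R * R -> R) (pd : bool -> R * R -> R) (q : R) (u g : R * R -> R).
Hypotheses (hp : coef L1 L2 K p pd) (su : sq u) (ug : tw L1 L2 p (pd false) q u g).

Let sg : sq g. Proof. by case: ug. Qed.

Let D phi z := p z * dx phi z + pd false z * phi z + q * dy phi z.

(** Its integral is the defect in the integration by parts formula, linear in [phi] and zero on test
    functions. [D phi] is the divergence of [phi] times the vector field [(p, q)]. *)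
Let F phi z := g z * phi z + u z * D phi z.

Let sD phi : smooth2 phi -> sq (D phi).
Proof.
move=> sp; apply: (sqintD mO); last exact: (sqintZ mO _ (sq_smooth L1 L2 (smooth2_dy sp))).
apply: (sqintD mO); first exact: (coef_sqM hp (sq_smooth L1 L2 (smooth2_dx sp))).
exact: (coefd_sqM hp false (sq_smooth L1 L2 sp)).
Qed.

Let IF phi : smooth2 phi -> Itg leb2 Om (F phi).
Proof.
move=> sp; apply: (ItgD mO); first exact: (sqintM mO sg (sq_smooth L1 L2 sp)).
exact: (sqintM mO su (sD sp)).
Qed.

Let F_E phi : smooth2 phi -> I2 (F phi) = I2 (fun z => g z * phi z) + I2 (fun z => u z * D phi z).
Proof.
move=> sp; exact: (ID mO (sqintM mO sg (sq_smooth L1 L2 sp)) (sqintM mO su (sD sp))).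
Qed.

Let F_test phi : test phi -> I2 (F phi) = 0.
Proof. by move=> tp; rewrite (F_E (test_smooth tp)) (ug.2 _ tp) addNr. Qed.

Let F_D phi psi : smooth2 phi -> smooth2 psi ->
  I2 (F (fun z => phi z + psi z)) = I2 (F phi) + I2 (F psi).
Proof.
move=> sp ss; rewrite -(ID mO (IF sp) (IF ss)); apply: eq_I => z _.
by rewrite /F /D dxD// dyD//; ring.
Qed.

Let F_M phi kap z : smooth2 phi -> smooth2 kap ->
  F (fun z => phi z * kap z) z = kap z * F phi z + u z * phi z * (p z * dx kap z + q * dy kap z).
Proof. by move=> sp sk; rewrite /F /D dxM// dyM//; ring. Qed.

(** Multiplying [phi] by a cutoff multiplies the defect density by the cutoff and adds the term
    where the derivative falls on it. If the formula holds for the cut functions, it survives in the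
    limit as soon as this term tends to zero. *)
Let cut_limit phi (kap : nat -> R * R -> R) (M : R) : smooth2 phi -> (forall n, smooth2 (kap n)) ->
  (forall n z, `|kap n z| <= M) -> (forall z, Om z -> kap n z @[n --> \oo] --> (1 : R)) ->
  (\forall n \near \oo, I2 (F (fun z => phi z * kap n z)) = 0) ->
  I2 (fun z => u z * phi z * (p z * dx (kap n) z + q * dy (kap n) z)) @[n --> \oo] --> (0 : R) ->
  I2 (F phi) = 0.
Proof.
move=> sp sk kM k1 k0 kl.
have mF := Itg_meas (IF sp).
have c1 : I2 (fun z => kap n z * F phi z) @[n --> \oo] --> I2 (F phi).
  apply: (Rdct mO (g := fun z => M * `|F phi z|)).
  - by move=> n; apply: measurable_funM => //; exact: (sq_smooth L1 L2 (sk n)).1.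
  - exact: mF.
  - by apply: (ItgZ mO); exact: Itg_norm (IF sp).
  - by move=> n z _; rewrite normrM ler_wpM2r.
  apply: aeW => z Oz; rewrite -[X in _ --> X]mul1r; apply: cvgM; first exact: k1.
  exact: cvg_cst.
have c2 : - I2 (fun z => u z * phi z * (p z * dx (kap n) z + q * dy (kap n) z)) @[n --> \oo] --> (0 : R).
  by rewrite -oppr0; exact: cvgN.
apply: (cvg_unique (@Rhausdorff R) c1); apply: cvg_near_eq c2.
apply: filterS k0 => n e.
have i1 : Itg leb2 Om (fun z => kap n z * F phi z).
  have mk := (sq_smooth L1 L2 (sk n)).1.
  apply: (Itg_le mO _ _ (ItgZ mO M (Itg_norm (IF sp)))).
    exact: measurable_funM mk mF.
  by move=> z _; rewrite normrM ler_wpM2r.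
have i2 : Itg leb2 Om (fun z => u z * phi z * (p z * dx (kap n) z + q * dy (kap n) z)).
  have s1 : sq (fun z => p z * dx (kap n) z + q * dy (kap n) z).
    apply: (sqintD mO); first exact: (coef_sqM hp (sq_smooth L1 L2 (smooth2_dx (sk n)))).
    exact: (sqintZ mO _ (sq_smooth L1 L2 (smooth2_dy (sk n)))).
  have s2 := sqint_contM (smooth2_cont sp) su.
  by apply: (Itg_eq mO _ (sqintM mO s2 s1)) => z _; rewrite [phi z * u z]mulrC.
apply/eqP; rewrite -addr_eq0 -(ID mO i1 i2) -e; apply/eqP; apply: eq_I => z _.
by rewrite F_M.
Qed.

Hypothesis (tu : trace_Gamma_eq0 L1 L2 u).

(** Only the side [x = 0] is in question. The cutoff term is the integral of [p u phi] against
    [mol e] in [x]; the slices of [phi] in [y] have compact support in the open side, so the trace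
    of [u] can be tested on them. *)
Let F_x phi (b0 : R) : adm phi -> 0 < b0 -> (forall z, z.2 <= b0 -> phi z = 0) -> I2 (F phi) = 0.
Proof.
move=> [sp [a [b [aL bL p0]]]] b00 pb0.
apply: (@cut_limit phi (fun n => cutx (en n)) 1 sp (fun n => smooth2_cutx (en n))).
- by move=> n z; rewrite /cutx mulr1; exact: cut_bnd.
- move=> [x y] /OmE[/andP[x0 _] _]; rewrite /cutx /=.
  by under eq_fun do rewrite mulr1; exact: cut_cvg.
- apply: nearW => n; apply: F_test; apply/test2P; split; first exact: smooth2M.
  have e0 := en_gt0 n.
  exists (Num.min (Num.min (en n) b0) (Num.min (L1 - a) (L2 - b))).
    by rewrite !lt_min !subr_gt0 en_gt0 b00 aL bL.
  move=> z h.
  have [h1 h2] : phi z != 0 /\ cutx (en n) z != 0 by apply/andP; move: h; rewrite mulf_eq0 negb_or.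
  have z1 : en n < z.1.
    by rewrite ltNge; apply: contra h2 => h2; rewrite /cutx cut0// mul0r.
  have z2 : b0 < z.2 by rewrite ltNge; apply: contra h1 => h1; rewrite pb0.
  have z1a : z.1 < a by rewrite ltNge; apply: contra h1 => h1; rewrite p0//; left.
  have z2b : z.2 < b by rewrite ltNge; apply: contra h1 => h1; rewrite p0//; right.
  split; apply/andP; split.
  + by apply: le_trans (ltW z1); rewrite !ge_min lexx.
  + by rewrite lerBrDr -lerBrDl (le_trans (_ : _ <= L1 - a)) ?ge_min ?lexx ?orbT// lerD2l lerN2 ltW.
  + by apply: le_trans (ltW z2); rewrite !ge_min lexx orbT.
  + by rewrite lerBrDr -lerBrDl (le_trans (_ : _ <= L2 - b)) ?ge_min ?lexx ?orbT// lerD2l lerN2 ltW.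
have [Kb [Kb0 hKb]] := mo_bounded L1 L2; have [Mm [Mm0 hMm]] := @mol_bnd R.
have [M1 hM1] := cont2_bnd L1 L2 (smooth2_cont sp).
have [M2 hM2] := cont2_bnd L1 L2 (smooth2_cont (smooth2_dy sp)).
pose M := Num.max 0 (Num.max M1 M2).
have M0 : 0 <= M by rewrite le_max lexx.
have hM z : Om z -> `|phi z| <= M /\ `|dy phi z| <= M.
  by move=> Oz; split; rewrite /M !le_max ?(hM1 z Oz) ?(hM2 z Oz) ?orbT.
have [K0 mp pK _ wp] := hp.
have [wpy pyK] := wp true.
have Fae := ae_filter_ringOfSetsType (@leb2 R).
have pK' : {ae leb2, forall z, Om z -> `|p z| <= K} by exact: aeW.
(* Bounds the slices and their [y]-derivatives; the factor 2 is for the two terms of the product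
   rule. *)
pose A := 2 * (Kb * K * M).
have A0 : 0 <= A by rewrite !mulr_ge0// ltW.
pose C := A * Mm * Num.sqrt (2 * L2).
have C0 : 0 <= C by rewrite mulr_ge0 ?sqrtr_ge0// mulr_ge0// ltW.
apply/cvgrPdist_le => eps eps0.
have [d0 [d00 hd0]] := trace_small hL1 tu.1 C0 eps0.
apply: filterS (en_lt d00) => n hn; rewrite sub0r normrN.
set e := en n in hn *; have e0 : 0 < e := en_gt0 n.
have smol := (ckern_mol e0).1.
pose v z := u z * (phi z * mol e z.1).
have cm : continuous (fun z : R * R => phi z * mol e z.1).
  by move=> z; apply: cvgM; [exact: (smooth2_cont sp)|exact: (cont_fst (smooth1_cont smol))].
have sv : sq v.
  by apply: (sqint_eq mO _ (sqint_contM cm su)) => z _; rewrite mulrC.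
have -> : I2 (fun z => u z * phi z * (p z * dx (cutx e) z + q * dy (cutx e) z)) = I2 (fun z => p z * v z).
  by apply: eq_I => z _; rewrite dx_cutx dy_cutx mulr0 addr0 /v; ring.
(* A slice has to be smooth to be paired with the trace, and [p] is only Lipschitz: it is replaced
   by its mollifications, with bounds uniform in [k]. *)
apply: (lim_norm_le (weak_cvg sv (coef_sq hp))).
have he2 : 0 < e / 2 by rewrite divr_gt0.
have hb2 : 0 < b0 / 2 by rewrite divr_gt0.
(* From here on the slices live further than [2 * en k] from [Gamma], where [dd_mo] bounds the
   [y]-derivative of the mollified [p]. *)
apply: filterS2 (en_lt he2) (en_lt hb2) => k hk hk'.
have ek : 0 < en k :> R := en_gt0 k; have smp := smooth2_mo ek (coef_sq hp).
have bm := hKb _ _ _ ek K0 (coef_sq hp) pK'.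
have bmy := hKb _ _ _ ek K0 wpy.1 pyK.
pose eta t s := (mo (en k) p (t, s) * phi (t, s)) * mol e t.
have se t : smooth1 (fun s => mo (en k) p (t, s) * phi (t, s)).
  exact: smooth1M (smooth2_slicey t smp) (smooth2_slicey t sp).
have sn0 t : mol e t != 0 -> e <= t.
  by move=> m0; rewrite leNgt; apply: contra m0 => te; rewrite (ckern_mol e0).2//; left.
have IW : Itg leb2 Om (fun z => u z * eta z.1 z.2).
  have ce : continuous (fun z : R * R => mo (en k) p z * (phi z * mol e z.1)).
    by move=> z; apply: cvgM; [exact: (smooth2_cont smp)|exact: cm].
  apply: (Itg_eq mO _ (sqint_Itg1 mO fO (sqint_contM ce su))) => -[x y] _.
  by rewrite /eta /= mulrA [RHS]mulrC.
have -> : I2 (fun z => mo (en k) p z * v z) = I2 (fun z => u z * eta z.1 z.2).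
  by apply: eq_I => -[x y] _; rewrite /v /eta /=; ring.
rewrite (fubini_I (mI 0 L1) (mI 0 L2) IW).
apply: (hd0 e _ eta); first by rewrite e0.
- move=> t ht.
  have -> : C / e = A * (Mm / e) * Num.sqrt (2 * L2) by rewrite /C; ring.
  apply: (@slice_H1 _ L2 b0 b A _ _ _ hL2 b00 bL A0 (se t)).
  + by move=> s [h|h]; [rewrite pb0 ?mulr0|rewrite p0 ?mulr0//; right].
  + by have [] := hMm e e0 t.
  move=> m0 s hs; have et := sn0 t m0.
  have Ots : Om (t, s) by apply/OmE.
  have [h1 h2] := hM _ Ots.
  have KM : Kb * K * M <= A by rewrite /A mulr_natl mulr2n lerDl !mulr_ge0// ltW.
  have b1 : `|mo (en k) p (t, s) * phi (t, s)| <= Kb * K * M by rewrite normrM ler_pM.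
  split; first exact: le_trans KM.
  have E : derive1 (fun s => mo (en k) p (t, s) * phi (t, s)) s =
      mo (en k) p (t, s) * dy phi (t, s) + phi (t, s) * dy (mo (en k) p) (t, s).
    by rewrite -dyM// dyE.
  rewrite E; apply: le_trans (ler_normD _ _) _.
  rewrite /A mulr_natl mulr2n; apply: lerD; first by rewrite normrM ler_pM.
  have [->|f0] := eqVneq (phi (t, s)) 0; first by rewrite mul0r normr0 !mulr_ge0// ltW.
  have bs : b0 < s by rewrite ltNge; apply: contra f0 => f0; rewrite pb0.
  have hdd : dy (mo (en k) p) (t, s) = mo (en k) (pd true) (t, s).
    apply: (dd_mo (i := true) ek (coef_sq hp) wpy) => /=.
      case/andP: ht => _ ->; rewrite andbT; apply: lt_le_trans et.
      by rewrite mulrC -ltr_pdivlMr.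
    case/andP: hs => _ ->; rewrite andbT; apply: lt_trans bs.
    by rewrite mulrC -ltr_pdivlMr.
  by rewrite hdd normrM mulrC ler_pM.
- move=> t s h; rewrite /eta (ckern_mol e0).2 ?mulr0//; by right.
exact: (fubini_Itg (mI 0 L1) (mI 0 L2) IW).
Qed.

(** The counterpart of [F_x] on the side [y = 0]. The coefficient met there is the constant [q], so
    the slices are smooth as they stand. *)
Let F_y phi (a0 : R) : adm phi -> 0 < a0 -> (forall z, z.1 <= a0 -> phi z = 0) -> I2 (F phi) = 0.
Proof.
move=> [sp [a [b [aL bL p0]]]] a00 pa0.
apply: (@cut_limit phi (fun n => cuty (en n)) 1 sp (fun n => smooth2_cuty (en n))).
- by move=> n z; rewrite /cuty mul1r; exact: cut_bnd.
- move=> [x y] /OmE[_ /andP[y0 _]]; rewrite /cuty /=.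
  by under eq_fun do rewrite mul1r; exact: cut_cvg.
- apply: nearW => n; apply: F_test; apply/test2P; split; first exact: smooth2M.
  have e0 := en_gt0 n.
  exists (Num.min (Num.min a0 (en n)) (Num.min (L1 - a) (L2 - b))).
    by rewrite !lt_min !subr_gt0 en_gt0 a00 aL bL.
  move=> z h.
  have [h1 h2] : phi z != 0 /\ cuty (en n) z != 0 by apply/andP; move: h; rewrite mulf_eq0 negb_or.
  have z1 : a0 < z.1 by rewrite ltNge; apply: contra h1 => h1; rewrite pa0.
  have z2 : en n < z.2.
    by rewrite ltNge; apply: contra h2 => h2; rewrite /cuty cut0// mulr0.
  have z1a : z.1 < a by rewrite ltNge; apply: contra h1 => h1; rewrite p0//; left.
  have z2b : z.2 < b by rewrite ltNge; apply: contra h1 => h1; rewrite p0//; right.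
  split; apply/andP; split.
  + by apply: le_trans (ltW z1); rewrite !ge_min lexx.
  + by rewrite lerBrDr -lerBrDl (le_trans (_ : _ <= L1 - a)) ?ge_min ?lexx ?orbT// lerD2l lerN2 ltW.
  + by apply: le_trans (ltW z2); rewrite !ge_min lexx orbT.
  + by rewrite lerBrDr -lerBrDl (le_trans (_ : _ <= L2 - b)) ?ge_min ?lexx ?orbT// lerD2l lerN2 ltW.
have [Mm [Mm0 hMm]] := @mol_bnd R.
have [M1 hM1] := cont2_bnd L1 L2 (smooth2_cont sp).
have [M2 hM2] := cont2_bnd L1 L2 (smooth2_cont (smooth2_dx sp)).
pose M := Num.max 0 (Num.max M1 M2).
have M0 : 0 <= M by rewrite le_max lexx.
have hM z : Om z -> `|phi z| <= M /\ `|dx phi z| <= M.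
  by move=> Oz; split; rewrite /M !le_max ?(hM1 z Oz) ?(hM2 z Oz) ?orbT.
pose A := `|q| * M.
have A0 : 0 <= A by rewrite mulr_ge0.
pose C := A * Mm * Num.sqrt (2 * L1).
have C0 : 0 <= C by rewrite mulr_ge0 ?sqrtr_ge0// mulr_ge0// ltW.
apply/cvgrPdist_le => eps eps0.
have [d0 [d00 hd0]] := trace_small hL2 tu.2 C0 eps0.
apply: filterS (en_lt d00) => n hn; rewrite sub0r normrN.
set e := en n in hn *; have e0 : 0 < e := en_gt0 n.
have smol := (ckern_mol e0).1.
pose eta t s := (q * phi (s, t)) * mol e t.
have se t : smooth1 (fun s => q * phi (s, t)).
  exact: smooth1M (smooth1_cst q) (smooth2_slicex t sp).
have IW : Itg leb2 Om (fun z => u z * eta z.2 z.1).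
  have ce : continuous (fun z : R * R => q * phi z * mol e z.2).
    move=> z; apply: cvgM; last exact: (cont_snd (smooth1_cont smol)).
    by apply: cvgM; [exact: cvg_cst|exact: (smooth2_cont sp)].
  apply: (Itg_eq mO _ (sqint_Itg1 mO fO (sqint_contM ce su))) => -[x y] _.
  by rewrite /eta /= mulrC.
have -> : I2 (fun z => u z * phi z * (p z * dx (cuty e) z + q * dy (cuty e) z)) = I2 (fun z => u z * eta z.2 z.1).
  by apply: eq_I => -[x y] _; rewrite dx_cuty dy_cuty mulr0 add0r /eta /=; ring.
rewrite (fubini_I2 (mI 0 L1) (mI 0 L2) IW).
apply: (hd0 e _ eta); first by rewrite e0.
- move=> t ht.
  have -> : C / e = A * (Mm / e) * Num.sqrt (2 * L1) by rewrite /C; ring.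
  apply: (@slice_H1 _ L1 a0 a A _ _ _ hL1 a00 aL A0 (se t)).
  + by move=> s [h|h]; [rewrite pa0 ?mulr0|rewrite p0 ?mulr0//; left].
  + by have [] := hMm e e0 t.
  move=> m0 s hs.
  have Ots : Om (s, t) by apply/OmE.
  have [h1 h2] := hM _ Ots.
  split; first by rewrite normrM ler_wpM2l.
  have E : derive1 (fun s => q * phi (s, t)) s = q * dx phi (s, t) + phi (s, t) * dx (fun=> q) (s, t).
    by rewrite -dxM// ?dxE//; exact: smooth2_cst.
  have E2 : dx (fun _ : R * R => q) (s, t) = 0 by rewrite dxE d1cst.
  by rewrite E E2 mulr0 addr0 normrM ler_wpM2l.
- move=> t s h; rewrite /eta (ckern_mol e0).2 ?mulr0//; by right.
exact: (fubini_Itg2 (mI 0 L1) (mI 0 L2) IW).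
Qed.

Let corner (e : R) : set RR := `]0, 2 * e]%classic `*` `]0, 2 * e]%classic.

Let meas_corner e : measurable (corner e : set RR).
Proof. by apply: measurableX; exact: measurable_itv. Qed.

Let sn_corner e : 0 < e -> sn (\1_(corner e)) <= (2 * e) ^+ 2.
Proof.
move=> e0; have -> : sn (\1_(corner e)) = \int[leb2]_(z in Om) \1_(corner e) z.
  by apply: eq_I => z _; rewrite indicE; case: (z \in _); rewrite ?expr1n ?expr0n.
have BE : leb2 (corner e) = ((2 * e) ^+ 2)%:E.
  by rewrite leb2_rect// !lebesgue_measure_itv/= !lte_fin mulr_gt0// -!EFinD subr0 -EFinM.
rewrite /Rintegral integral_indic// -[leRHS]/(fine ((2 * e) ^+ 2)%:E) -BE.
have hl : (leb2 (corner e `&` Om) <= leb2 (corner e))%E.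
  by apply: le_measure; rewrite ?inE//; apply: measurableI.
apply: fine_le => //; last by rewrite BE.
rewrite ge0_fin_numE; last exact: measure_ge0.
by apply: (le_lt_trans hl); rewrite BE; exact: ltry.
Qed.

Let corner_cvg : sn (fun z => \1_(corner (en n)) z * u z) @[n --> \oo] --> (0 : R).
Proof.
have mu2 : measurable_fun Om (fun z => u z ^+ 2) := Itg_meas su.2.
rewrite -(I0 leb2 mO); apply: (Rdct mO (g := fun z => u z ^+ 2)).
- move=> n; apply: measurable_funX; apply: measurable_funM su.1.
  by apply: measurable_funTS; apply: measurable_indic; exact: meas_corner.
- exact: measurable_cst.
- exact: su.2.
- move=> n z _; rewrite ger0_norm ?sqr_ge0// indicE; case: (z \in _).
    by rewrite mul1r.
  by rewrite mul0r expr0n sqr_ge0.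
apply: aeW => -[x y] /OmE[/andP[x0 _] _]; apply: cvg_near_cst.
have h : 0 < x / 2 by rewrite divr_gt0.
apply: filterS (en_lt h) => n hn; rewrite indicE memNset ?mul0r ?expr0n//.
move=> [/=]; rewrite in_itv/= => /andP[_ h1] _; move: h1; rewrite leNgt.
by rewrite -ltr_pdivlMl// mulrC hn.
Qed.

(** Equals [1 - (1 - cut e x) (1 - cut e y)], which vanishes near the corner only. It is written as
    a term vanishing near [y = 0] plus one vanishing near [x = 0], to which [F_x] and [F_y] apply
    respectively. *)
Let cutc (e : R) (z : R * R) : R := cuty e z + cut e z.1 * (1 - cut e z.2).

Let smooth1_1cut e : smooth1 (fun x : R => 1 - cut e x).
Proof. exact: smooth1D (smooth1_cst 1) (smooth1N (smooth1_cut e)). Qed.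

Let d1_1cut e : derive1 (fun x : R => 1 - cut e x) = (fun x : R => - mol e x).
Proof.
apply: is_derive1_eq => x; rewrite -[- _]add0r.
apply: is_deriveD; apply: is_deriveN.
by rewrite -cut_d1; exact: smooth1_is (smooth1_cut e).
Qed.

Let smooth2_cutr e : smooth2 (fun z : R * R => cut e z.1 * (1 - cut e z.2)).
Proof. exact: smooth2_tensor (smooth1_cut e) (smooth1_1cut e). Qed.

Let dx_cutc e z : dx (cutc e) z = mol e z.1 * (1 - cut e z.2).
Proof.
rewrite dxD// dx_cuty add0r.
by rewrite (isdxE (isdx_tensor (fun x : R => 1 - cut e x) (smooth1_cut e))) cut_d1.
Qed.

Let dy_cutc e z : dy (cutc e) z = mol e z.2 * (1 - cut e z.1).
Proof.
rewrite dyD// dy_cuty (isdyE (isdy_tensor (cut e) (smooth1_1cut e))) d1_1cut.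
by rewrite mulrN mulrBr mulr1 mulrC.
Qed.

Let cutc_corner e (M : R) z : 0 < e -> Om z -> (forall x, `|mol e x| <= M) ->
  `|mol e z.1 * (1 - cut e z.2)| <= M * \1_(corner e) z /\
  `|mol e z.2 * (1 - cut e z.1)| <= M * \1_(corner e) z.
Proof.
case: z => x y e0 /OmE[/andP[x0 _] /andP[y0 _]] hM.
have M0 : 0 <= M by apply: le_trans (hM 0).
have key s t : 0 < s -> 0 < t -> `|mol e s * (1 - cut e t)| <=
    M * (if (s <= 2 * e) && (t <= 2 * e) then 1 else 0).
  move=> s0 t0; case: ifPn => h.
    by rewrite mulr1 normrM -[leRHS]mulr1 ler_pM// cut_bnd1.
  move: h; rewrite negb_and -!ltNge => /orP[h|h].
    by rewrite (ckern_mol e0).2 ?mul0r ?normr0 ?mulr0//; right.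
  by rewrite cut1 ?subrr ?mulr0 ?normr0// ltW.
have -> : \1_(corner e) (x, y) = (if (x <= 2 * e) && (y <= 2 * e) then 1 else 0) :> R.
  rewrite indicE; case: ifPn => h.
    by rewrite mem_set//; case/andP: h => h1 h2; split; rewrite /= in_itv/= ?x0 ?y0.
  rewrite memNset// => -[/=]; rewrite !in_itv/= => /andP[_ h1] /andP[_ h2].
  by rewrite h1 h2 in h.
by split; last rewrite andbC; exact: key.
Qed.

(** The gradient of the corner cutoff is of size [1 / e] on a square of side [2 e], so its L^2 norm
    is bounded in [e]. By Cauchy-Schwarz the cutoff term is controlled by the L^2 norm of [u] on
    that square, which tends to zero. *)
Let F_adm phi : adm phi -> I2 (F phi) = 0.
Proof.
move=> ap; case: (ap) => [sp [a [b [aL bL p0]]]].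
have sc e : smooth2 (cutc e) by exact: smooth2D.
apply: (@cut_limit phi (fun n => cutc (en n)) 2 sp (fun n => sc (en n))).
- move=> n z.
  have -> : cutc (en n) z = cut (en n) z.2 + cut (en n) z.1 * (1 - cut (en n) z.2).
    by rewrite /cutc /cuty mul1r.
  have -> : (2 : R) = 1 + 1 * 1 by rewrite mulr1.
  apply: le_trans (ler_normD _ _) (lerD (cut_bnd _ _) _); rewrite normrM.
  exact: (ler_pM (normr_ge0 _) (normr_ge0 _) (cut_bnd _ _) (cut_bnd1 _ _)).
- move=> [x y] /OmE[/andP[x0 _] /andP[y0 _]]; rewrite /cutc /cuty /=.
  have cx := cut_cvg x0; have cy := cut_cvg y0.
  have c3 : cut (en n) x * (1 - cut (en n) y) @[n --> \oo] --> (1 * (1 - 1) : R).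
    by apply: cvgM => //; apply: cvgB => //; exact: cvg_cst.
  have c4 : cut (en n) y + cut (en n) x * (1 - cut (en n) y) @[n --> \oo] --> (1 + 1 * (1 - 1) : R).
    exact: cvgD.
  rewrite subrr mulr0 addr0 in c4.
  by apply: cvg_near_eq c4; apply: nearW => n; rewrite mul1r.
- apply: nearW => n; have e0 := en_gt0 n.
  have -> : (fun z => phi z * cutc (en n) z) =
     (fun z => phi z * cuty (en n) z + phi z * (cut (en n) z.1 * (1 - cut (en n) z.2))).
    by apply/funext => z; rewrite /cutc mulrDr.
  have s1 : smooth2 (fun z => phi z * cuty (en n) z) by exact: smooth2M.
  have s2 : smooth2 (fun z => phi z * (cut (en n) z.1 * (1 - cut (en n) z.2))) by exact: smooth2M.
  rewrite (F_D s1 s2) (F_x (b0 := en n))// ?add0r; first (rewrite (F_y (a0 := en n))//).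
  + by split => //; exists a, b; split => // z /p0 ->; rewrite mul0r.
  + by move=> z h; rewrite cut0// mul0r mulr0.
  + by split => //; exists a, b; split => // z /p0 ->; rewrite mul0r.
  + by move=> z h; rewrite /cuty cut0// !mulr0.
have [Mm [Mm0 hMm]] := @mol_bnd R.
have [M1 hM1] := cont2_bnd L1 L2 (smooth2_cont sp).
pose M := Num.max 0 M1.
have M0 : 0 <= M by rewrite le_max lexx.
have hM z : Om z -> `|phi z| <= M by move=> Oz; rewrite /M le_max (hM1 z Oz) orbT.
have [K0 mp pK _ wp] := hp.
pose B := M * (K + `|q|) * Mm.
have B0 : 0 <= B by rewrite mulr_ge0 ?(ltW Mm0)// mulr_ge0// addr_ge0.
pose x n := sn (fun z => \1_(corner (en n)) z * u z).
have x0 n : 0 <= x n by exact: sqn_ge0.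
have key n : `|I2 (fun z => u z * phi z * (p z * dx (cutc (en n)) z + q * dy (cutc (en n)) z))| ^+ 2 <=
    (2 * B) ^+ 2 * x n.
  have e0 : 0 < en n :> R := en_gt0 n.
  set e := en n in e0 *.
  have sI : sq (\1_(corner e)) by apply: sq_indic; exact: meas_corner.
  have sIu : sq (fun z => \1_(corner e) z * u z).
    have mI' : measurable_fun Om (\1_(corner e) : RR -> R) := sI.1.
    have b1 z : Om z -> `|\1_(corner e) z| <= (1 : R).
      by move=> _; rewrite indicE; case: (z \in _); rewrite ?normr1 ?normr0.
    by have [h _] := sqint_bndM mO mI' b1 su.
  have sa : sq (fun z => `|\1_(corner e) z * u z|).
    split; first exact: (measurableT_comp (@normr_measurable R setT) sIu.1).
    by apply: (Itg_eq mO _ sIu.2) => z _; rewrite real_normK ?num_real.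
  have Ia := sqintM mO sa sI.
  have h1 : `|I2 (fun z => u z * phi z * (p z * dx (cutc e) z + q * dy (cutc e) z))| <=
      B / e * I2 (fun z => `|\1_(corner e) z * u z| * \1_(corner e) z).
    rewrite -(IZ mO _ Ia); apply: (norm_I_le mO _ (ItgZ mO _ Ia)).
      have s1 : sq (fun z => p z * dx (cutc e) z + q * dy (cutc e) z).
        apply: (sqintD mO); first exact: (coef_sqM hp (sq_smooth L1 L2 (smooth2_dx (sc e)))).
        exact: (sqintZ mO _ (sq_smooth L1 L2 (smooth2_dy (sc e)))).
      have s2 := sqint_contM (smooth2_cont sp) su.
      by apply: (Itg_eq mO _ (sqintM mO s2 s1)) => z _; rewrite [phi z * u z]mulrC.
    move=> z Oz; rewrite dx_cutc dy_cutc.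
    have [c1 c2] := cutc_corner e0 Oz (fun x => (hMm e e0 x).1).
    rewrite !normrM; set i := (\1_(corner e) z : R) in c1 c2 *.
    have i0 : 0 <= i by rewrite /i indicE.
    have ii : `|i| * `|u z| * i = `|u z| * i.
      by rewrite /i indicE; case: (z \in _); rewrite ?normr1 ?mul1r ?mulr1 ?mulr0.
    have pz := pK z Oz; have fz := hM z Oz.
    have h2 : `|p z * (mol e z.1 * (1 - cut e z.2)) + q * (mol e z.2 * (1 - cut e z.1))| <=
        (K + `|q|) * (Mm / e * i).
      apply: le_trans (ler_normD _ _) _; rewrite mulrDl !(normrM (p z)) !(normrM q); apply: lerD.
        exact: ler_pM.
      exact: ler_wpM2l.
    have -> : B / e * (`|i| * `|u z| * i) = `|u z| * M * ((K + `|q|) * (Mm / e * i)).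
      by rewrite ii /B; ring.
    apply: (ler_pM _ (normr_ge0 _) _ h2); first exact: mulr_ge0 (normr_ge0 _) (normr_ge0 _).
    exact: (ler_wpM2l (normr_ge0 _) fz).
  have h3 := cauchy_schwarz mO sa sI.
  have xE : sn (fun z => `|\1_(corner e) z * u z|) = x n.
    by apply: eq_I => z _; rewrite real_normK ?num_real.
  rewrite xE in h3.
  have Be : 0 <= B / e by rewrite divr_ge0// ltW.
  have J0 : 0 <= I2 (fun z => `|\1_(corner e) z * u z| * \1_(corner e) z).
    by apply: Rintegral_ge0 => z _; rewrite mulr_ge0// indicE.
  apply: (@le_trans _ _ ((B / e * I2 (fun z => `|\1_(corner e) z * u z| * \1_(corner e) z)) ^+ 2)).
    by rewrite ler_sqr ?nnegrE// mulr_ge0.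
  rewrite exprMn; apply: le_trans (ler_wpM2l (sqr_ge0 _) h3) _.
  apply: le_trans (ler_wpM2l (sqr_ge0 _) (ler_wpM2l (x0 n) (sn_corner e0))) _.
  rewrite le_eqVlt; apply/orP; left; apply/eqP.
  by move: (x n) => t; field; exact: lt0r_neq0.
have cx : (2 * B) ^+ 2 * x n @[n --> \oo] --> (0 : R).
  by rewrite -(mulr0 ((2 * B) ^+ 2)); apply: cvgM; [exact: cvg_cst|exact: corner_cvg].
apply/cvgrPdist_le => eps eps0.
have eps2 : 0 < eps ^+ 2 by exact: exprn_gt0.
move/cvgrPdist_le : cx => /(_ _ eps2); apply: filterS => n; rewrite !sub0r !normrN => h.
rewrite -(ler_sqr (normr_ge0 _) (ltW eps0)); apply: le_trans (key n) _.
by apply: le_trans h; exact: ler_norm.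
Qed.

Lemma by_parts phi : adm phi ->
  I2 (fun z => g z * phi z) = - I2 (fun z => u z * (p z * dx phi z + pd false z * phi z + q * dy phi z)).
Proof.
move=> ap; have := F_adm ap; rewrite (F_E ap.1) => /eqP; rewrite addr_eq0 => /eqP e.
exact: e.
Qed.

End Fixed.

End ByParts.

(** * Mollification and transport *)

Lemma comm_lin (R : realType) (P q A B M N E i1 i2 i3 i4 : R) : A = - i1 -> B = - i2 ->
  M = - (i4 + i3 + E) -> E = q * i2 -> N = i3 -> P * A + q * B - M - N = i4 - P * i1.
Proof. by move=> -> -> -> -> ->; ring. Qed.

Lemma comm_sum (R : realType) (a b c u g r m n : R) : 0 <= a -> 0 <= b -> 0 <= c -> 0 <= u -> 0 <= g ->
  r <= a * u -> m <= b * g -> n <= b * (c * u) ->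
  4 * r + (4 * m + 4 * n) <= (4 * a + (4 * b + 4 * (b * c))) * (u + g).
Proof.
move=> a0 b0 c0 u0 g0 h1 h2 h3.
have := mulr_ge0 a0 g0; have := mulr_ge0 b0 u0; have := mulr_ge0 (mulr_ge0 b0 c0) g0; lra.
Qed.

Section Mollification.
Context {R : realType}.
Notation RR := (measurableTypeR R * measurableTypeR R)%type.
Implicit Types (f g h u v phi : R * R -> R) (k n : nat).
Variables (L1 L2 : R).
Hypotheses (hL1 : 0 < L1) (hL2 : 0 < L2).
Notation Om := (Omega L1 L2).
Notation I2 f := (\int[leb2]_(z in Om) f z).
Notation sq := (sqint leb2 Om).
Notation sn := (sqn leb2 Om).
Notation wd := (wd L1 L2).
Notation mo := (mo L1 L2).
Notation Hs := (Hs L1 L2).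
Notation trace0 := (trace_Gamma_eq0 L1 L2).

Let mO : measurable (Om : set RR) := Om_meas L1 L2.
Let fO := Om_fin L1 L2.

Lemma kern2_adm (e : R) a b z : 0 < e -> ckern e a -> ckern e b -> Om z -> adm L1 L2 (kern2 a b z).
Proof.
case: z => x y e0 [sa a0] [sb b0] /OmE[/andP[_ xL] /andP[_ yL]].
split; first exact: smooth2_kern2.
have e2 : 0 < e / 2 by rewrite divr_gt0.
have lt (s t L : R) : s < L -> s - e / 2 < L by move=> h; apply: le_lt_trans h; rewrite gerBl ltW.
exists (x - e / 2), (y - e / 2); split; [exact: lt|exact: lt|].
have le (s t : R) : s - e / 2 <= t -> s - t < e.
  by rewrite lerBlDr -lerBlDl => h; apply: le_lt_trans h _; rewrite ltr_pdivrMr// ltr_pMr// ltr1n.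
move=> w [h|h]; rewrite /kern2 /=; first by rewrite a0 ?mul0r//; left; exact: le.
by rewrite b0 ?mulr0//; left; exact: le.
Qed.

Let dd_cst (i : bool) (c : R) : dd i (fun _ : R * R => c) = (fun _ => 0).
Proof.
by case: i; [apply: isdyE|apply: isdxE] => z; exact: is_derive_cst.
Qed.

Let coef_cst (c : R) : `|c| <= 1 -> coef L1 L2 1 (fun=> c) (fun _ _ => 0).
Proof.
move=> c1; split => //.
- by move=> z w _ _; rewrite subrr normr0 mulr_ge0// addr_ge0.
move=> i; split; first by have := wd_smooth hL1 hL2 i (smooth2_cst c); rewrite dd_cst.
by apply: aeW => z _; rewrite normr0.
Qed.

(** A derivative is the transport operator with constant coefficients [(1, 0)] or [(0, 1)], so
    [by_parts] covers it. It is applied to the kernel seen from [z], which may reach across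
    [Gamma]. *)
Lemma mo_dd i e u v z : 0 < e -> sq u -> trace0 u -> wd i u v -> Om z ->
  dd i (mo e u) z = mo e v z.
Proof.
move=> e0 su tu [sv wuv] Oz; rewrite (dd_moE i z e0 su).
have ka := ckern_mol e0; have ak := kern2_adm e0 ka ka Oz.
apply/esym; case: i wuv => wuv.
  have c0 : `|0 : R| <= 1 by rewrite normr0.
  have t : tw L1 L2 (fun=> 0) (fun=> 0) 1 u v.
    split => // phi tp; rewrite -[LHS]opprK -wuv//; congr (- _); apply: eq_I => w _.
    by rewrite !mul0r !add0r mul1r.
  rewrite (_ : mo e v z = I2 (fun w => v w * kern2 (mol e) (mol e) z w))// (by_parts hL1 hL2 (coef_cst c0) su t tu ak); congr (- _).
  by apply: eq_I => w _; rewrite !mul0r !add0r mul1r.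
have c1 : `|1 : R| <= 1 by rewrite normr1.
have t : tw L1 L2 (fun=> 1) (fun=> 0) 0 u v.
  split => // phi tp; rewrite -[LHS]opprK -wuv//; congr (- _); apply: eq_I => w _.
  by rewrite !mul0r !addr0 mul1r.
rewrite (_ : mo e v z = I2 (fun w => v w * kern2 (mol e) (mol e) z w))// (by_parts hL1 hL2 (coef_cst c1) su t tu ak); congr (- _).
by apply: eq_I => w _; rewrite !mul0r !addr0 mul1r.
Qed.

Lemma mo_wd i e u v : 0 < e -> sq u -> trace0 u -> wd i u v -> wd i (mo e u) (mo e v).
Proof.
move=> e0 su tu uv; have sm := smooth2_mo e0 su.
apply: wd_ae (wd_smooth hL1 hL2 i sm); first exact: (sq_smooth L1 L2 (smooth2_mo e0 uv.1)).1.
by apply: aeW => z Oz; exact: mo_dd.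
Qed.

Section Coefficient.
Variables (K : R) (p : R * R -> R) (pd : bool -> R * R -> R) (q : R).
Hypothesis hp : coef L1 L2 K p pd.
Notation tw := (tw L1 L2 p (pd false) q).

Let sum3 (A B C : R) : 0 <= B -> 0 <= C -> 2 * (2 * (A + B) + C) <= 4 * A + (4 * B + 4 * C).
Proof. lra. Qed.

(* commutator estimate: [p] being Lipschitz, [p(z) - p(w)] compensates the
   factor [1/e] produced by the derivative of the mollifier *)
Lemma mo_tw : exists B : R, 0 <= B /\ forall e u g, 0 < e -> sq u -> trace0 u -> tw u g ->
  exists G, tw (mo e u) G /\ sn G <= B * (sn u + sn g).
Proof.
have [Ky [Ky0 hKy]] := mo_young L1 L2; have [Kb [Kb0 hKb]] := @kern_box R.
have [K0 mp pK pL wp] := hp.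
(* The variation of [p] over the reach of the kernel is at most [K * (2 * e + 2 * e)], and the
   differentiated kernel is bounded by [Kb / e] times [box]. *)
pose C := 4 * K * Kb; have C0 : 0 <= C by rewrite !mulr_ge0// ltW.
exists (4 * (16 * C) ^+ 2 + (4 * Ky ^+ 2 + 4 * (Ky ^+ 2 * K ^+ 2))); split.
  apply: addr_ge0; first by apply: mulr_ge0 => //; exact: sqr_ge0.
  apply: addr_ge0; first by apply: mulr_ge0 => //; exact: sqr_ge0.
  by apply: mulr_ge0 => //; apply: mulr_ge0; exact: sqr_ge0.
move=> e u g e0 su tu ug; have sg := ug.1.
have ka := ckern_mol e0; have sm := smooth2_mo e0 su.
pose px := pd false.
have spu : sq (fun z => px z * u z) := coefd_sqM hp false su.
have npu : sn (fun z => px z * u z) <= K ^+ 2 * sn u.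
  by have [[spx _] pxK] := wp false; have [_ h] := ae_sqint_bndM mO spx.1 pxK su.
pose G z := p z * dd false (mo e u) z + q * dd true (mo e u) z.
have tG : tw (mo e u) G.
  exact: (tw_H1 q hp (sq_smooth L1 L2 sm) (wd_smooth hL1 hL2 false sm) (wd_smooth hL1 hL2 true sm)).
exists G; split => //.
(* The commutator proper. The zero-order term [px u], which comes from differentiating the
   coefficient in the weak formula, is bounded separately by [mo_young]. *)
pose r z := G z - mo e g z - mo e (fun w => px w * u w) z.
have smg : sq (mo e g) := sq_smooth L1 L2 (smooth2_mo e0 sg).
have smp : sq (mo e (fun w => px w * u w)) := sq_smooth L1 L2 (smooth2_mo e0 spu).
have sr : sq r by apply: (sqintB mO _ smp); exact: (sqintB mO tG.1 smg).
have hr z : Om z -> `|r z| <= C * I2 (fun w => box e (e ^- 2) (z, w) * `|u w|).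
  move=> Oz; have ak := kern2_adm e0 ka ka Oz.
  set rho := kern2 (mol e) (mol e) z in ak.
  have sX := sq_smooth L1 L2 (smooth2_dx ak.1); have sY := sq_smooth L1 L2 (smooth2_dy ak.1).
  have srho := sq_smooth L1 L2 ak.1.
  have e1 : mo e g z = - I2 (fun w => u w * (p w * dx rho w + px w * rho w + q * dy rho w)).
    exact: (by_parts hL1 hL2 hp su ug tu ak).
  have spX := coef_sqM hp sX; have spr := coefd_sqM hp false srho.
  have sqY : sq (fun w => q * dy rho w) := sqintZ mO q sY.
  rewrite (I2D3 su spX spr sqY) in e1.
  have e2 : mo e (fun w => px w * u w) z = I2 (fun w => u w * (px w * rho w)).
    by apply: eq_I => w _; rewrite mulrAC mulrC.
  have e3 : I2 (fun w => u w * (q * dy rho w)) = q * I2 (fun w => u w * dy rho w).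
    rewrite -(IZ mO q (sqintM mO su sY)); apply: eq_I => w _; exact: mulrCA.
  have e4 : dd false (mo e u) z = - I2 (fun w => u w * dx rho w) by exact: (dd_moE false z e0 su).
  have e5 : dd true (mo e u) z = - I2 (fun w => u w * dy rho w) by exact: (dd_moE true z e0 su).
  have iX := sqintM mO su sX; have ipX := sqintM mO su spX.
  (* The [y]-derivatives cancel because their coefficient is constant, and the terms in [px] cancel
     by the choice of [r]; only the difference [p w - p z] is left. *)
  have e6 : r z = I2 (fun w => u w * (p w * dx rho w)) - p z * I2 (fun w => u w * dx rho w).
    exact: (comm_lin (p z) e4 e5 e1 e3 e2).
  have e7 : r z = I2 (fun w => u w * (p w * dx rho w) - p z * (u w * dx rho w)).
    by rewrite e6 (IB mO ipX (ItgZ mO (p z) iX)) (IZ mO (p z) iX).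
  have Ib := Itg_boxM e (e ^- 2) z (sqint_Itg1 mO fO su).
  rewrite e7 -(IZ mO C Ib); apply: (norm_I_le mO (ItgB mO ipX (ItgZ mO (p z) iX)) (ItgZ mO C Ib)).
  move=> w Ow; have -> : u w * (p w * dx rho w) - p z * (u w * dx rho w) = u w * (p w - p z) * dx rho w.
    ring.
  have bX : `|dx rho w| <= Kb / e * box e (e ^- 2) (z, w).
    by rewrite (dx_kern2 _ _ _ ka.1) normrN; have [_ h _] := hKb e e0 z w.
  rewrite !normrM [C * _]mulrA [leRHS]mulrC -mulrA; apply: ler_wpM2l => //.
  case: (boolP ((`|z.1 - w.1| <= 2 * e) && (`|z.2 - w.2| <= 2 * e))) => hb.
    have h1 : `|p w - p z| <= K * (2 * e + 2 * e).
      rewrite distrC; apply: le_trans (pL z w Oz Ow) _; apply: ler_wpM2l => //.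
      by case/andP: hb => b1 b2; exact: lerD.
    apply: le_trans (ler_pM (normr_ge0 _) (normr_ge0 _) h1 bX) _.
    move: (box _ _ _) => t; rewrite le_eqVlt; apply/orP; left; apply/eqP; rewrite /C.
    by field; exact: lt0r_neq0.
  have b0 : box e (e ^- 2) (z, w) = 0 by rewrite /box (negbTE hb).
  by move: bX; rewrite b0 !mulr0 normr_le0 => /eqP ->; rewrite normr0 mulr0.
have [_ nr] := young e0 C0 su sr.1 hr.
have [_ ng] := hKy e g e0 sg; have [_ np] := hKy e _ e0 spu.
have -> : sn G = sn (fun z => (r z + mo e g z) + mo e (fun w => px w * u w) z).
  by apply: sqn_eq => z _; rewrite /r; ring.
apply: le_trans (sqnD_le mO (sqintD mO sr smg) smp) _.
have h1 := sqnD_le mO sr smg.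
apply: (@le_trans _ _ (2 * (2 * (sn r + sn (mo e g)) + sn (mo e (fun w => px w * u w))))).
  by apply: ler_wpM2l => //; apply: lerD.
apply: le_trans (sum3 _ (sqn_ge0 _ _ _) (sqn_ge0 _ _ _)) _.
have np' : sn (mo e (fun w => px w * u w)) <= Ky ^+ 2 * (K ^+ 2 * sn u).
  by apply: le_trans np _; apply: ler_wpM2l => //; exact: sqr_ge0.
exact: (comm_sum (sqr_ge0 _) (sqr_ge0 _) (sqr_ge0 _) (sqn_ge0 _ _ _) (sqn_ge0 _ _ _) nr ng np').
Qed.

(* the space X^m_Gamma: [u], [T u] and their derivatives bounded in L^2, traces of [u] zero *)
Fixpoint HX k (C : R) u : Prop := [/\ sq u, sn u <= C, trace0 u & exists g, tw u g /\ sn g <= C] /\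
  if k is k'.+1 then forall i, exists v, wd i u v /\ HX k' C v else True.

(** [mo_wd] makes the mollified derivatives the derivatives of the mollification, so at each level
    [mo_young] and [mo_tw] are applied to a derivative of [u] with vanishing trace. Hence one
    constant serves all orders. *)
Lemma HX_mo : exists B : R, 0 <= B /\ forall k C u e, 0 < e -> HX k C u ->
  Hs k (B * C) (mo e u) /\ HT L1 L2 p pd q k (B * C) (mo e u).
Proof.
have [Ky [Ky0 hKy]] := mo_young L1 L2; have [B [B0 hB]] := mo_tw.
exists (Ky ^+ 2 + 2 * B); split; first by rewrite addr_ge0 ?sqr_ge0// mulr_ge0.
move=> k C u e e0; elim: k u => [|k IH] u [[su nu tu [g [ug ng]]] H].
  all: have C0 : 0 <= C by apply: le_trans nu; exact: sqn_ge0.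
  all: have [sm nm] := hKy e u e0 su.
  all: have nm' : sn (mo e u) <= (Ky ^+ 2 + 2 * B) * C by
    apply: le_trans nm _; rewrite mulrDl; apply: (le_trans (ler_wpM2l (sqr_ge0 _) nu)); rewrite lerDl mulr_ge0// mulr_ge0.
  all: have [G [tG nG]] := hB e u g e0 su tu ug.
  all: have nG' : sn G <= (Ky ^+ 2 + 2 * B) * C by
    apply: le_trans nG _; apply: (le_trans (ler_wpM2l B0 (lerD nu ng)));
    rewrite (_ : (Ky ^+ 2 + 2 * B) * C = Ky ^+ 2 * C + B * (C + C)); [rewrite lerDr mulr_ge0// sqr_ge0|ring].
  by split; [split|split => //; exists G].
split; [split => //|split; first by exists G] => i; have [v [uv hv]] := H i; have [h1 h2] := IH _ hv;
by exists (mo e v); split => //; exact: mo_wd.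
Qed.

End Coefficient.

End Mollification.

Section TraceH1.
Context {R : realType}.
Notation mu := (@lebesgue_measure R).

Lemma int_H1norm (L c : R) (f eta : R -> R) : 0 < L -> 0 <= c -> continuous f -> smooth1 eta ->
  (forall s, 0 < s < L -> `|f s| <= c) ->
  `|\int[mu]_(s in `]0, L[) (f s * eta s)| <= c * Num.sqrt L * H1norm L eta.
Proof.
move=> L0 c0 cf se fc.
have mD : measurable (`]0, L[%classic : set (measurableTypeR R)) by exact: measurable_itv.
have lebL : fine (@lebesgue_measure R (`]0, L[%classic : set R)) = L.
  by rewrite lebesgue_measure_itv/= lte_fin L0 -EFinD subr0.
have ce := smooth1_cont se; have ce' := smooth1_cont (smooth1_d1 se).
have c2 (h : R -> R) : continuous h -> Itg mu `]0, L[ (fun s => h s ^+ 2).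
  by move=> ch; apply: Itg_cont => s; apply: cvgM; exact: ch.
have sf : sqint mu `]0, L[ f by split; [exact: Itg_meas (Itg_cont _ _ cf)|exact: c2].
have se' : sqint mu (`]0, L[) eta by split; [exact: Itg_meas (Itg_cont _ _ ce)|exact: c2].
have I0' : 0 <= \int[mu]_(s in `]0, L[) (eta s ^+ 2 + derive1 eta s ^+ 2).
  by apply: Rintegral_ge0 => s _; rewrite addr_ge0// sqr_ge0.
apply: (cauchy_schwarz_le mD sf se'); first by rewrite mulr_ge0// sqrtr_ge0.
- exact: sqrtr_ge0.
- rewrite exprMn sqr_sqrtr ?(ltW L0)// /sqn.
  have -> : c ^+ 2 * L = \int[mu]_(s in `]0, L[) (c ^+ 2).
    by rewrite (Rintegral_cst _ mD) lebL.
  apply: (le_I mD (c2 _ cf)); first by apply: Itg_cont => s; exact: cvg_cst.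
  move=> s; rewrite /= in_itv/= => /fc h.
  by rewrite -[leLHS]real_normK ?num_real// ler_sqr ?nnegrE.
rewrite sqr_sqrtr//; apply: (le_I mD (c2 _ ce)).
  by apply: (ItgD mD); exact: c2.
by move=> s _; rewrite lerDl sqr_ge0.
Qed.

(** Integration against the slices is the representative in C([0, L]; H^-1): the Lipschitz bound in
    [t] gives its continuity, through the embedding of L^2 into H^-1. *)
Lemma trace0_cont (L L' M : R) (psi : R -> R -> R) : 0 < L -> 0 < L' -> 0 <= M ->
  (forall t, continuous (psi t)) ->
  (forall t s, 0 <= t <= L -> 0 < s < L' -> `|psi t s| <= M) ->
  (forall t t' s, 0 <= t <= L -> 0 <= t' <= L -> 0 < s < L' -> `|psi t s - psi t' s| <= M * `|t - t'|) ->
  (forall s, 0 < s < L' -> psi 0 s = 0) ->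
  is_trace0 L L' psi (fun=> 0).
Proof.
move=> L0 L'0 M0 cp pM pL p0.
have mD : measurable (`]0, L'[%classic : set (measurableTypeR R)) by exact: measurable_itv.
have sm eta : test1 L' eta -> smooth1 eta by move=> [h _]; exact: derive1n_smooth1.
have It t eta : smooth1 eta -> Itg mu `]0, L'[ (fun s => psi t s * eta s).
  by move=> se; apply: Itg_cont => s; apply: cvgM; [exact: cp|exact: (smooth1_cont se)].
exists (fun t eta => \int[mu]_(s in `]0, L'[) (psi t s * eta s)); split.
- split=> t; rewrite in_itv/= => ht.
    split=> [c eta zeta /sm se /sm sz|].
      rewrite -(IZ mD c (It t _ se)) -(ID mD (ItgZ mD c (It t _ se)) (It t _ sz)).
      by apply: eq_Rintegral => s _; rewrite mulrDr mulrCA.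
    exists (M * Num.sqrt L') => eta /sm se.
    by apply: int_H1norm => // s hs; exact: pM.
  move=> e e0; have D0 : 0 < M * Num.sqrt L' + 1 by rewrite ltr_wpDl// mulr_ge0// sqrtr_ge0.
  have d0 : 0 < e / (M * Num.sqrt L' + 1) by rewrite divr_gt0.
  near=> s; rewrite in_itv/= => hs eta /sm se.
  have hst : `|s - t| <= e / (M * Num.sqrt L' + 1).
    by near: s; apply/nbhs_ballP; exists (e / (M * Num.sqrt L' + 1)) => //= x; rewrite /ball /= distrC => /ltW.
  rewrite -(IB mD (It s _ se) (It t _ se)).
  have -> : \int[mu]_(x in `]0, L'[) (psi s x * eta x - psi t x * eta x) =
      \int[mu]_(x in `]0, L'[) ((psi s x - psi t x) * eta x).
    by apply: eq_Rintegral => x _; rewrite mulrBl.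
  have cst : continuous (fun x => psi s x - psi t x) by move=> x; apply: cvgB; exact: cp.
  have c0 : 0 <= M * `|s - t| by rewrite mulr_ge0.
  apply: le_trans (int_H1norm L'0 c0 cst se (fun x hx => pL s t x hs ht hx)) _.
  apply: ler_wpM2r; first exact: sqrtr_ge0.
  rewrite mulrAC; apply: le_trans (ler_wpM2l _ hst) _; first by rewrite mulr_ge0// sqrtr_ge0.
  by rewrite mulrCA ler_piMr ?(ltW e0)// ler_pdivrMr// mul1r lerDl.
- by apply: aeW.
move=> eta te; transitivity (\int[mu]_(s in `]0, L'[) (0 : R)); last exact: (I0 mu mD).
by apply: eq_Rintegral => s; rewrite inE/= in_itv/= => /p0 ->; rewrite mul0r.
Unshelve. all: by end_near. Qed.

End TraceH1.

(** * Traces of functions vanishing near Gamma *)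

Section Traces.
Context {R : realType}.
Notation RR := (measurableTypeR R * measurableTypeR R)%type.
Notation mu := (@lebesgue_measure R).
Implicit Types (f g h u v phi : R * R -> R) (k n : nat).
Variables (L1 L2 : R).
Hypotheses (hL1 : 0 < L1) (hL2 : 0 < L2).
Notation Om := (Omega L1 L2).
Notation I2 f := (\int[leb2]_(z in Om) f z).
Notation sq := (sqint leb2 Om).
Notation sn := (sqn leb2 Om).
Notation trace0 := (trace_Gamma_eq0 L1 L2).

Let mO : measurable (Om : set RR) := Om_meas L1 L2.
Let fO := Om_fin L1 L2.

Definition van phi := exists2 d : R, 0 < d & forall z, z.1 < d \/ z.2 < d -> phi z = 0.

Let open_van (d : R) : open [set z : R * R | z.1 < d \/ z.2 < d].
Proof.
have -> : [set z : R * R | z.1 < d \/ z.2 < d] =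
    ((fun z : R * R => id z.1) @^-1` [set t | t < d]) `|` ((fun z : R * R => id z.2) @^-1` [set t | t < d]).
  by [].
apply: openU; [have /continuousP c := @cont_fst R id (fun x => cvg_id)|
  have /continuousP c := @cont_snd R id (fun x => cvg_id)]; apply: c; exact: open_lt.
Qed.

Lemma van_dd i phi : van phi -> van (dd i phi).
Proof.
move=> [d d0 h]; exists d => // z hz; rewrite /dd; case: i.
  exact (near_dy0 (@open_van d) h hz).
exact (near_dx0 (@open_van d) h hz).
Qed.

Lemma van_Dxy a b phi : van phi -> van (Dxy a b phi).
Proof.
move=> v; have vb : van (iter b dy phi) by elim: b => // b IH; exact: (van_dd true IH).
by rewrite /Dxy; elim: a => // a IH; exact: (van_dd false IH).
Qed.

Lemma VGamma_van phi : smooth2 phi -> van phi -> VGamma L1 L2 phi.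
Proof.
move=> sp [d d0 h]; split; first by exists phi.
exists [set z : R * R | z.1 < d \/ z.2 < d]; split; [exact: open_van| |by move=> z /h].
by move=> [x y] [[/= -> _]|[_ /= ->]]; [left|right].
Qed.

Lemma trace_van phi : smooth2 phi -> van phi -> trace0 phi.
Proof.
move=> sp vp; have [d d0 h] := vp.
have [dx' dx0' hx] := van_dd false vp; have [dy' dy0' hy] := van_dd true vp.
(* [cont2_bnd] covers an open rectangle; enlarging it by 1 includes the sides [t = L] of the closed
   interval. *)
have B f : continuous f -> exists2 M : R, 0 <= M & forall x y, 0 < x < L1 + 1 -> 0 < y < L2 + 1 -> `|f (x, y)| <= M.
  move=> cf; have [M hM] := cont2_bnd (L1 + 1) (L2 + 1) cf.
  by exists (Num.max 0 M); [rewrite le_max lexx|move=> x y h1 h2; rewrite le_max hM ?orbT//; apply/OmE].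
have [M0 M00 h0] := B _ (smooth2_cont sp).
have [M1 M10 h1] := B _ (smooth2_cont (smooth2_dx sp)).
have [M2 M20 h2] := B _ (smooth2_cont (smooth2_dy sp)).
pose M := M0 + M1 + M2.
have [m0 m1 m2] : [/\ M0 <= M, M1 <= M & M2 <= M].
  split; rewrite /M; first by rewrite -addrA lerDl addr_ge0.
    by rewrite -addrA addrCA lerDl addr_ge0.
  by rewrite lerDr addr_ge0.
have MM : 0 <= M by exact: le_trans m0.
have ll (s L : R) : 0 < s < L -> 0 < s < L + 1.
  by move=> /andP[-> sL]; rewrite ltr_wpDr.
have ll' (s L : R) : 0 < s -> 0 <= s <= L -> 0 < s < L + 1.
  by move=> -> /andP[_ sL]; rewrite (le_lt_trans sL)// ltrDl.
have lm (s L : R) : 0 <= s <= L -> - 1 < s < L + 1.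
  by move=> /andP[s0 sL]; rewrite (lt_le_trans _ s0) ?oppr_lt0// (le_lt_trans sL)// ltrDl.
split.
  apply: (trace0_cont hL1 hL2 MM).
  - by move=> t; exact: smooth1_cont (smooth2_slicey t sp).
  - move=> t s ht hs; have [t0|t0] := leP t 0.
      by rewrite h ?normr0//=; left; exact: le_lt_trans d0.
    by apply: le_trans m0; apply: h0; [exact: ll'|exact: ll].
  - move=> t t' s ht ht' hs.
    apply: (smooth1_lip_itv (smooth2_slicex s sp) _ (lm _ _ ht) (lm _ _ ht')) => c /andP[_ hc].
    rewrite -[derive1 _ c](dxE phi (c, s)); have [c0|c0] := leP c 0.
      by rewrite [dx _ _]hx ?normr0//=; left; exact: le_lt_trans dx0'.
    by apply: le_trans m1; apply: h1; [rewrite c0|exact: ll].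
  - by move=> s _; apply: h; left.
apply: (trace0_cont hL2 hL1 MM).
- by move=> t; exact: smooth1_cont (smooth2_slicex t sp).
- move=> t s ht hs; have [t0|t0] := leP t 0.
    by rewrite h ?normr0//=; right; exact: le_lt_trans d0.
  by apply: le_trans m0; apply: h0; [exact: ll|exact: ll'].
- move=> t t' s ht ht' hs.
  apply: (smooth1_lip_itv (smooth2_slicey s sp) _ (lm _ _ ht) (lm _ _ ht')) => c /andP[_ hc].
  rewrite -[derive1 _ c](dyE phi (s, c)); have [c0|c0] := leP c 0.
    by rewrite [dy _ _]hy ?normr0//=; right; exact: le_lt_trans dy0'.
  by apply: le_trans m2; apply: h2; [exact: ll|rewrite c0].
- by move=> s _; apply: h; right.
Qed.

(** By Fubini almost every slice of [u] agrees almost everywhere with that of [v], so the same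
    continuous representative [G] serves both. *)
Lemma trace_ae u v : sq u -> sq v -> {ae leb2, forall z, Om z -> u z = v z} -> trace0 u -> trace0 v.
Proof.
move=> su sv uv [tx ty].
have mI (L : R) : measurable (`]0, L[%classic : set (measurableTypeR R)) by exact: measurable_itv.
have Iu := sqint_Itg1 mO fO su; have Iv := sqint_Itg1 mO fO sv.
pose W z := `|u z - v z|.
have IW : Itg leb2 Om W := Itg_norm (ItgB mO Iu Iv).
have W0 : I2 W = 0.
  rewrite -[RHS](I0 leb2 mO); apply: (ae_eq_I mO (Itg_meas IW)); first exact: measurable_cst.
  have Fae := ae_filter_ringOfSetsType (@leb2 R).
  by apply: (@filterS _ _ Fae _ _ _ uv) => z + Oz => /(_ Oz) e; rewrite /W e subrr normr0.
have Fae := ae_filter_ringOfSetsType (@lebesgue_measure R).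
split.
  have [G [cG aeG G0]] := tx; exists G; split => //.
  have a1 := fubini_ae (mI L1) (mI L2) Iu; have a2 := fubini_ae (mI L1) (mI L2) Iv.
  have a3 := fubini_ae (mI L1) (mI L2) IW.
  have i4 := fubini_Itg (mI L1) (mI L2) IW.
  have e4 := fubini_I (mI L1) (mI L2) IW.
  have a4 : {ae mu, forall x, `]0, L1[%classic x -> \int[mu]_(y in `]0, L2[) W (x, y) = 0}.
    apply: (Itg_I0 (mI L1) i4); last by rewrite -e4.
    by move=> x _; apply: Rintegral_ge0 => y _; exact: normr_ge0.
  have a12 := @filterI _ _ Fae _ _ a1 a2; have a34 := @filterI _ _ Fae _ _ a3 a4.
  have a := @filterI _ _ Fae _ _ a12 a34.
  apply: (@filterS2 _ _ Fae _ _ _ _ aeG a) => x hG [[b1 b2] [b3 b4]] Dx eta te.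
  have Dx' : `]0, L1[%classic x by rewrite inE in Dx.
  rewrite (hG Dx eta te); have se : smooth1 eta by exact: derive1n_smooth1 te.1.
  have me := Itg_meas (Itg_cont 0 L2 (smooth1_cont se)).
  have ae0 := Itg_I0 (mI L2) (b3 Dx') (fun y _ => normr_ge0 _) (b4 Dx').
  apply: (ae_eq_I (mI L2)).
  - exact: measurable_funM (Itg_meas (b1 Dx')) me.
  - exact: measurable_funM (Itg_meas (b2 Dx')) me.
  apply: (@filterS _ _ Fae _ _ _ ae0) => y + Dy => /(_ Dy) /eqP.
  by rewrite normr_eq0 subr_eq0 => /eqP ->.
have [G [cG aeG G0]] := ty; exists G; split => //.
have a1 := fubini_ae2 (mI L1) (mI L2) Iu; have a2 := fubini_ae2 (mI L1) (mI L2) Iv.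
have a3 := fubini_ae2 (mI L1) (mI L2) IW.
have i4 := fubini_Itg2 (mI L1) (mI L2) IW.
have e4 := fubini_I2 (mI L1) (mI L2) IW.
have a4 : {ae mu, forall y, `]0, L2[%classic y -> \int[mu]_(x in `]0, L1[) W (x, y) = 0}.
  apply: (Itg_I0 (mI L2) i4); last by rewrite -e4.
  by move=> y _; apply: Rintegral_ge0 => x _; exact: normr_ge0.
have a12 := @filterI _ _ Fae _ _ a1 a2; have a34 := @filterI _ _ Fae _ _ a3 a4.
have a := @filterI _ _ Fae _ _ a12 a34.
apply: (@filterS2 _ _ Fae _ _ _ _ aeG a) => x hG [[b1 b2] [b3 b4]] Dx eta te.
have Dx' : `]0, L2[%classic x by rewrite inE in Dx.
rewrite (hG Dx eta te); have se : smooth1 eta by exact: derive1n_smooth1 te.1.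
have me := Itg_meas (Itg_cont 0 L1 (smooth1_cont se)).
have ae0 := Itg_I0 (mI L1) (b3 Dx') (fun y _ => normr_ge0 _) (b4 Dx').
apply: (ae_eq_I (mI L1)).
- exact: measurable_funM (Itg_meas (b1 Dx')) me.
- exact: measurable_funM (Itg_meas (b2 Dx')) me.
apply: (@filterS _ _ Fae _ _ _ ae0) => y + Dy => /(_ Dy) /eqP.
by rewrite normr_eq0 subr_eq0 => /eqP ->.
Qed.

End Traces.

(** * Weak limits of bounded sequences *)

Lemma cvg_fsum (R : realType) (J : Type) (s : seq J) (x : nat -> J -> R) (l : J -> R) :
  (forall j, x n j @[n --> \oo] --> l j) ->
  \sum_(j <- s) x n j @[n --> \oo] --> \sum_(j <- s) l j.
Proof.
move=> xl; elim: s => [|j s IH].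
  by rewrite big_nil; under eq_fun do rewrite big_nil; exact: cvg_cst.
rewrite big_cons; under eq_fun do rewrite big_cons.
by apply: cvgD; [exact: xl|exact: IH].
Qed.

Lemma discriminant_le (R : realType) (a b c : R) : 0 <= c ->
  (forall t, 0 <= a + 2 * t * b + t ^+ 2 * c) -> b ^+ 2 <= a * c.
Proof.
move=> c0 h; have [c1|c1] := eqVneq c 0.
  have [->|b0] := eqVneq b 0; first by rewrite expr0n c1 mulr0.
  have := h (- (a + 1) / (2 * b)); rewrite c1 mulr0 addr0.
  have -> : a + 2 * (- (a + 1) / (2 * b)) * b = -1 by field.
  by rewrite oppr_ge0 ler10.
have cp : 0 < c by rewrite lt_def c1.
have := h (- b / c); have -> : a + 2 * (- b / c) * b + (- b / c) ^+ 2 * c = (a * c - b ^+ 2) / c by field.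
by rewrite pmulr_lge0 ?invr_gt0// subr_ge0.
Qed.

Section Density.
Context {R : realType}.
Notation RR := (measurableTypeR R * measurableTypeR R)%type.
Implicit Types (f g h u v w phi : R * R -> R) (k n : nat).
Variables (L1 L2 : R).
Hypotheses (hL1 : 0 < L1) (hL2 : 0 < L2).
Notation Om := (Omega L1 L2).
Notation I2 f := (\int[leb2]_(z in Om) f z).
Notation sq := (sqint leb2 Om).
Notation sn := (sqn leb2 Om).
Notation mo := (mo L1 L2).
Notation test := (test2 Om).

Let mO : measurable (Om : set RR) := Om_meas L1 L2.
Let fO := Om_fin L1 L2.

Lemma I2_lin (c : R) w u v : sq w -> sq u -> sq v ->
  I2 (fun z => w z * (u z + c * v z)) = I2 (fun z => w z * u z) + c * I2 (fun z => w z * v z).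
Proof.
move=> sw su sv; have i1 := sqintM mO sw su; have i2 := sqintM mO sw sv.
rewrite -(IZ mO c i2) -(ID mO i1 (ItgZ mO c i2)).
by apply: eq_I => z _; rewrite mulrDr mulrCA.
Qed.

Lemma sn_lin (c : R) u v : sq u -> sq v ->
  sn (fun z => u z + c * v z) = sn u + 2 * c * I2 (fun z => u z * v z) + c ^+ 2 * sn v.
Proof.
move=> su sv; rewrite (sqnD mO su (sqintZ mO c sv)) (sqnZ mO c sv); congr (_ + _ + _).
rewrite -mulrA -(IZ mO c (sqintM mO su sv)); congr (_ * _).
by apply: eq_I => z _; rewrite mulrCA.
Qed.

Section Jets.
Variables (J : finType) (P : (J -> R * R -> R) -> Prop).
Implicit Types (V W U : J -> R * R -> R).
Hypothesis (Psq : forall V, P V -> forall j, sq (V j)).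
Hypothesis (Plin : forall V W (c : R), P V -> P W -> P (fun j z => V j z + c * W j z)).

Let N V := \sum_j sn (V j).
Let B V W := \sum_j I2 (fun z => V j z * W j z).

Let N_ge0 V : 0 <= N V.
Proof. by apply: sumr_ge0 => j _; exact: sqn_ge0. Qed.

Let N_lin V W (c : R) : (forall j, sq (V j)) -> (forall j, sq (W j)) ->
  N (fun j z => V j z + c * W j z) = N V + 2 * c * B V W + c ^+ 2 * N W.
Proof.
move=> sV sW; rewrite /N /B !mulr_sumr -!big_split /=.
by apply: eq_bigr => j _; exact: sn_lin.
Qed.

Let N_le V W : (forall j, sq (V j)) -> (forall j, sq (W j)) ->
  N (fun j z => V j z + -1 * W j z) <= 2 * (N V + N W).
Proof.
move=> sV sW; rewrite /N -big_split mulr_sumr; apply: ler_sum => j _ /=.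
have e : sn (fun z => -1 * W j z) = sn (W j) by rewrite (sqnZ mO _ (sW j)) sqrrN expr1n mul1r.
by rewrite -[X in _ + X]e; exact: (sqnD_le mO (sV j) (sqintZ mO _ (sW j))).
Qed.

(* A subspace contains elements close to any weak limit of a bounded sequence of
   its elements: an almost minimizer [V] of the distance to [U] satisfies
   [B (U - V) S ^ 2 <= eta * N S] on the subspace, which is used with [S = Un - V]. *)
Lemma jet_dense U (Un : nat -> J -> R * R -> R) (C : R) :
  (forall j, sq (U j)) -> (forall n, P (Un n)) -> (forall n, N (Un n) <= C) ->
  (forall j w, sq w -> I2 (fun z => w z * Un n j z) @[n --> \oo] --> I2 (fun z => w z * U j z)) ->
  forall eps : R, 0 < eps -> exists V, P V /\ \sum_j sn (fun z => U j z - V j z) < eps.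
Proof.
move=> sU PU UC wU eps eps0.
have C0 : 0 <= C by apply: le_trans (UC 0%N); exact: N_ge0.
pose D V j z := U j z + -1 * V j z.
pose E := [set N (D V) | V in P].
have E0 : has_lbound E by exists 0 => _ [V _ <-]; exact: N_ge0.
have Ei : has_inf E by split => //; exists (N (D (Un 0%N))); exists (Un 0%N).
(* Bounds the squared norm of [Un n - V] for every [n], through [N_le] and the bound on [N V]
   below. *)
pose K := 2 * (C + 2 * (N U + inf E + 1)).
have E00 : 0 <= inf E by apply: lb_le_inf Ei.1 _ => _ [V _ <-]; exact: N_ge0.
have NU0 := N_ge0 U.
have K0 : 0 < K by rewrite /K mulr_gt0// ltr_wpDl// mulr_gt0// ltr_wpDl// addr_ge0.
(* The second term ensures [eta * K < eps ^+ 2]; the minimum with 1 keeps [N X] below [inf E + 1], a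
   bound that enters [K] itself. *)
pose eta := Num.min 1 (eps ^+ 2 / (2 * K)).
have eta0 : 0 < eta by rewrite lt_min ltr01 divr_gt0 ?exprn_gt0// mulr_gt0.
have eta1 : eta <= 1 by rewrite /eta ge_min lexx.
have etaK : eta * K < eps ^+ 2.
  apply: (@le_lt_trans _ _ (eps ^+ 2 / (2 * K) * K)).
    by apply: ler_wpM2r; [exact: ltW|rewrite /eta ge_min lexx orbT].
  have -> : eps ^+ 2 / (2 * K) * K = eps ^+ 2 / 2 by field; exact: lt0r_neq0.
  by rewrite ltr_pdivrMr// ltr_pMr ?exprn_gt0// ltr1n.
have [_ [V PV <-] hV] := inf_adherent eta0 Ei.
have sV := Psq PV.
pose X := D V.
have sX j : sq (X j) by apply: (sqintD mO); [exact: sU|exact: (sqintZ mO _ (sV j))].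
have XK : N X <= inf E + 1 by apply: le_trans (ltW hV) _; rewrite lerD2l.
have key S : P S -> B X S ^+ 2 <= eta * N S.
  move=> PS; apply: (discriminant_le (N_ge0 S)) => t.
  have h : inf E <= N (D (fun j z => V j z + - t * S j z)).
    by apply: (ge_inf E0); exists (fun j z => V j z + - t * S j z) => //; exact: Plin.
  have e : N (D (fun j z => V j z + - t * S j z)) = N (fun j z => X j z + t * S j z).
    by apply: eq_bigr => j _; apply: sqn_eq => z _; rewrite /X /D; ring.
  rewrite e (N_lin t sX (Psq PS)) in h.
  by move: hV h; rewrite -/X; move: (N X) (inf E) (B X S) (t ^+ 2 * _) => a b c d; lra.
have PUV n : P (fun j z => Un n j z + -1 * V j z) by exact: Plin.
(* In the weak limit [Un n - V] becomes [U - V = X], so the pairing tends to [N X], the quantity to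
   be bounded. *)
have cB : B X (fun j z => Un n j z + -1 * V j z) @[n --> \oo] --> B X X.
  apply: cvg_fsum => j.
  have -> : I2 (fun z => X j z * X j z) = I2 (fun z => X j z * U j z) + -1 * I2 (fun z => X j z * V j z).
    by rewrite -(I2_lin _ (sX j) (sU j) (sV j)).
  under eq_fun do rewrite (I2_lin _ (sX j) (Psq (PU _) j) (sV j)).
  by apply: cvgD; [exact: (wU j _ (sX j))|exact: cvg_cst].
have BX : B X X = N X by apply: eq_bigr => j _; apply: eq_I => z _; rewrite expr2.
have NV : N V <= 2 * (N U + (inf E + 1)).
  have -> : N V = N (fun j z => U j z + -1 * X j z).
    by apply: eq_bigr => j _; apply: sqn_eq => z _; rewrite /X /D; ring.
  by apply: le_trans (N_le sU sX) _; rewrite ler_pM2l// lerD2l.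
have NX2 : N X ^+ 2 <= eta * K.
  rewrite -BX; apply: (lim_sqr_le cB); apply: nearW => n.
  apply: le_trans (key _ (PUV n)) _; apply: ler_wpM2l; first exact: ltW.
  apply: le_trans (N_le (Psq (PU n)) sV) _; rewrite /K ler_pM2l//; apply: lerD => //.
  by rewrite -addrA.
exists V; split => //.
have -> : \sum_j sn (fun z => U j z - V j z) = N X.
  by apply: eq_bigr => j _; apply: sqn_eq => z _; rewrite /X /D mulN1r.
by rewrite -(ltr_sqr (N_ge0 X) (ltW eps0)); exact: le_lt_trans NX2 etaK.
Qed.

End Jets.

(** Cuts off near the right and upper sides. Mollifications vanish near [Gamma] by themselves, so
    their product with [kap e] is a test function. *)
Let kap (e : R) (z : R * R) : R := (fun x => cut e (L1 + -1 * x)) z.1 * (fun y => cut e (L2 + -1 * y)) z.2.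

Let smooth2_kap e : smooth2 (kap e).
Proof. by apply: smooth2_tensor; apply: smooth1_affine; exact: smooth1_cut. Qed.

Let kap_bnd e z : `|kap e z| <= 1.
Proof. by rewrite /kap normrM -[leRHS]mulr1; apply: ler_pM => //; exact: cut_bnd. Qed.

Let kap_cvg z : Om z -> kap (en n) z @[n --> \oo] --> (1 : R).
Proof.
case: z => x y /OmE[/andP[_ xL] /andP[_ yL]]; rewrite -[X in _ --> X](mulr1 (1 : R)).
by apply: cvgM; apply: cut_cvg; rewrite mulN1r subr_gt0.
Qed.

Let test_kap e v : 0 < e -> sq v -> test (fun z => kap e z * mo e v z).
Proof.
move=> e0 sv; apply/test2P; split; first by apply: smooth2M => //; exact: smooth2_mo.
exists e => // z; rewrite mulf_eq0 negb_or => /andP[h1 h2].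
have k1 : ckern e (mol e) := ckern_mol e0.
have [z1 z2] : e <= z.1 /\ e <= z.2.
  by split; rewrite leNgt; apply: contra h2 => h2; apply/eqP; apply: (conv0 _ _ _ k1 k1); [left|right].
have [z3 z4] : e <= L1 - z.1 /\ e <= L2 - z.2.
  split; rewrite leNgt; apply: contra h1 => h1; rewrite /kap !mulN1r.
    by rewrite cut0 ?mul0r// ltW.
  by rewrite [cut e (L2 - _)]cut0 ?mulr0// ltW.
by split; apply/andP; split => //; rewrite lerBrDr -lerBrDl.
Qed.

(** An instance of [jet_dense] with a single component: the cut mollifications are a bounded
    sequence of test functions converging weakly to [v]. *)
Lemma test_dense v (eps : R) : sq v -> 0 < eps -> exists2 phi, test phi & sn (fun z => v z - phi z) < eps.
Proof.
move=> sv eps0; have [K [K0 hK]] := mo_young L1 L2.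
have mk e : measurable_fun Om (kap e : RR -> R) := (sq_smooth L1 L2 (smooth2_kap e)).1.
pose P (V : 'I_1 -> R * R -> R) := test (V ord0).
have Psq V : P V -> forall j, sq (V j) by move=> t j; rewrite (ord1 j); exact: test_sq.
have Plin V W (c : R) : P V -> P W -> P (fun j z => V j z + c * W j z).
  by move=> tV tW; apply: testD => //; exact: testZ.
pose Un n (j : 'I_1) z := kap (en n) z * mo (en n) v z.
have PU n : P (Un n) by exact: (test_kap (en_gt0 n) sv).
have UC n : \sum_j sn (Un n j) <= K ^+ 2 * sn v.
  rewrite big_ord1; have [sm nm] := hK _ _ (en_gt0 n) sv.
  have [_ h] := sqint_bndM mO (mk (en n)) (fun z _ => kap_bnd (en n) z) sm.
  by apply: le_trans h _; rewrite expr1n mul1r.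
have wU (j : 'I_1) w : sq w -> I2 (fun z => w z * Un n j z) @[n --> \oo] --> I2 (fun z => w z * v z).
  move=> sw.
  have s1 n : sq (fun z => w z + -1 * (kap (en n) z * w z)).
    apply: (sqintD mO sw); apply: (sqintZ mO).
    by have [h _] := sqint_bndM mO (mk (en n)) (fun z _ => kap_bnd (en n) z) sw.
  have c1 : I2 (fun z => mo (en n) v z * w z) @[n --> \oo] --> I2 (fun z => w z * v z).
    have -> : I2 (fun z => w z * v z) = I2 (fun z => v z * w z).
      by apply: eq_I => z _; rewrite mulrC.
    exact: (weak_cvg sw sv).
  (* The cutoff is moved onto the fixed [w], where dominated convergence makes [w - kap w] tend to
     zero strongly; paired with a bounded sequence it disappears. *)
  have c2 : I2 (fun z => mo (en n) v z * (w z + -1 * (kap (en n) z * w z))) @[n --> \oo] --> (0 : R).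
    have cs : K ^+ 2 * sn v * sn (fun z => w z + -1 * (kap (en n) z * w z)) @[n --> \oo] --> (0 : R).
      rewrite -[X in _ --> X](mulr0 (K ^+ 2 * sn v)); apply: cvgM; first exact: cvg_cst.
      rewrite -[X in _ --> X](I0 leb2 mO); apply: (Rdct mO (g := fun z => 4 * w z ^+ 2)).
      - by move=> n; exact: Itg_meas (s1 n).2.
      - exact: measurable_cst.
      - exact: (ItgZ mO _ sw.2).
      - move=> n z _; rewrite ger0_norm ?sqr_ge0// -[leLHS]real_normK ?num_real//.
        have -> : 4 * w z ^+ 2 = (2 * `|w z|) ^+ 2 by rewrite exprMn real_normK ?num_real// -natrX.
        rewrite ler_sqr ?nnegrE ?mulr_ge0//; apply: le_trans (ler_normD _ _) _.
        rewrite mulr_natl mulr2n lerD2l mulN1r normrN normrM ler_piMl//.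
      apply: aeW => z Oz; have kz := kap_cvg Oz.
      have c3 : w z + -1 * (kap (en n) z * w z) @[n --> \oo] --> w z + -1 * (1 * w z).
        apply: cvgD; first exact: cvg_cst.
        by apply: cvgM; [exact: cvg_cst|apply: cvgM => //; exact: cvg_cst].
      rewrite mul1r mulN1r subrr in c3.
      have c4 : (w z + -1 * (kap (en n) z * w z)) ^+ 2 @[n --> \oo] --> (0 * 0 : R) by apply: cvgM; exact: c3.
      by rewrite mulr0 in c4.
    apply/cvgrPdist_le => e e0.
    have e2 : 0 < e ^+ 2 by exact: exprn_gt0.
    move/cvgrPdist_le : cs => /(_ _ e2); apply: filterS => n; rewrite !sub0r !normrN => h.
    rewrite -(ler_sqr (normr_ge0 _) (ltW e0)) real_normK ?num_real//.
    have [sm nm] := hK _ _ (en_gt0 n) sv.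
    apply: le_trans (cauchy_schwarz mO sm (s1 n)) _.
    apply: le_trans (ler_wpM2r (sqn_ge0 _ _ _) nm) _.
    by apply: le_trans h; exact: ler_norm.
  have c3 : (I2 (fun z => mo (en n) v z * w z) -
      I2 (fun z => mo (en n) v z * (w z + -1 * (kap (en n) z * w z)))) @[n --> \oo] -->
      (I2 (fun z => w z * v z) - 0 : R) by exact: cvgB.
  rewrite subr0 in c3.
  apply: cvg_near_eq c3; apply: nearW => n /=.
  have sm := sq_mo n sv.
  rewrite (I2_lin _ sm sw); last first.
    by have [h _] := sqint_bndM mO (mk (en n)) (fun z _ => kap_bnd (en n) z) sw.
  rewrite mulN1r opprB addrCA subrr addr0; apply: eq_I => z _.
  by rewrite /Un; move: (mo _ _ _) => t; ring.
have [V [PV hV]] := jet_dense Psq Plin (U := fun=> v) (fun=> sv) PU UC wU eps0.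
by exists (V ord0) => //; move: hV; rewrite big_ord1.
Qed.

(** Density of test functions in L^2 and the uniform bound: replacing [w] by a nearby test function
    costs at most [e / 3] on each side. *)
Lemma weak_of_dist (G : nat -> R * R -> R) g (C : R) : (forall n, sq (G n)) -> sq g ->
  (forall n, sn (G n) <= C) ->
  (forall phi, test phi -> I2 (fun z => G n z * phi z) @[n --> \oo] --> I2 (fun z => g z * phi z)) ->
  forall w, sq w -> I2 (fun z => w z * G n z) @[n --> \oo] --> I2 (fun z => w z * g z).
Proof.
move=> sG sg GC h w sw; apply/cvgrPdist_le => e e0.
have C0 : 0 <= C by apply: le_trans (GC 0%N); exact: sqn_ge0.
pose B := Num.sqrt (C + sn g).
have B0 : 0 <= B by exact: sqrtr_ge0.
have BE : B ^+ 2 = C + sn g by rewrite sqr_sqrtr// addr_ge0// sqn_ge0.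
pose A := e / (3 * (B + 1)).
have A0 : 0 < A by rewrite divr_gt0// mulr_gt0// ltr_wpDl.
have AB : A * B <= e / 3.
  have -> : A = e / 3 / (B + 1) by rewrite /A invfM mulrA.
  by rewrite mulrAC ler_pdivrMr ?ltr_wpDl// ler_wpM2l ?divr_ge0 ?(ltW e0)// lerDl.
have [phi tp hp] := test_dense sw (exprn_gt0 2 A0).
have sp := test_sq tp; have sd := sqintB mO sw sp.
have e3 : 0 < e / 3 by rewrite divr_gt0.
move/cvgrPdist_le : (h _ tp) => /(_ _ e3); apply: filterS => n hn.
have E u : sq u -> I2 (fun z => w z * u z) = I2 (fun z => (w z - phi z) * u z) + I2 (fun z => u z * phi z).
  move=> su; rewrite -(ID mO (sqintM mO sd su) (sqintM mO su sp)).
  by apply: eq_I => z _; rewrite mulrBl [u z * _]mulrC subrK.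
rewrite (E _ sg) (E _ (sG n)).
have b1 : `|I2 (fun z => (w z - phi z) * g z)| <= A * B.
  by apply: (cauchy_schwarz_le mO sd sg (ltW A0) B0 (ltW hp)); rewrite BE lerDr.
have b2 : `|I2 (fun z => (w z - phi z) * G n z)| <= A * B.
  apply: (cauchy_schwarz_le mO sd (sG n) (ltW A0) B0 (ltW hp)).
  by rewrite BE; apply: le_trans (GC n) _; rewrite lerDl sqn_ge0.
have fin (a b c d s : R) : `|a| <= s -> `|b| <= s -> s <= e / 3 -> `|c - d| <= e / 3 -> `|a + c - (b + d)| <= e.
  move=> h1 h2 h3 h4; have -> : a + c - (b + d) = a - b + (c - d) by ring.
  apply: le_trans (ler_normD _ _) _; have := ler_normB a b; lra.
exact: fin b1 b2 AB hn.
Qed.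

End Density.

(** * Approximation *)

Section Main.
Context {R : realType}.
Notation RR := (measurableTypeR R * measurableTypeR R)%type.
Implicit Types (f g h u v w phi theta lam : R * R -> R) (a b k n m : nat).
Variables (L1 L2 : R).
Hypotheses (hL1 : 0 < L1) (hL2 : 0 < L2).
Notation Om := (Omega L1 L2).
Notation I2 f := (\int[leb2]_(z in Om) f z).
Notation sq := (sqint leb2 Om).
Notation sn := (sqn leb2 Om).
Notation mo := (mo L1 L2).
Notation wd := (wd L1 L2).
Notation Hs := (Hs L1 L2).
Notation trace0 := (trace_Gamma_eq0 L1 L2).
Notation test := (test2 Om).

Let mO : measurable (Om : set RR) := Om_meas L1 L2.
Let fO := Om_fin L1 L2.
Let Fae := ae_filter_ringOfSetsType (@leb2 R).

Lemma test_Dxy a b phi : test phi -> test (Dxy a b phi).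
Proof.
move=> tp; have tb : test (iter b dy phi) by elim: b => // b IH; exact: test_dy.
by rewrite /Dxy; elim: a => // a IH; exact: test_dx.
Qed.

Lemma is_wderiv_sq a b u v : is_wderiv Om a b u v -> sq v.
Proof. by case=> /inLpP. Qed.

Lemma wderivP a b u v : is_wderiv Om a b u v -> is_wderiv Om a b u (wderiv Om a b u).
Proof. by move=> uv; exact: (xgetPex _ (ex_intro _ v uv)). Qed.

Lemma is_wderiv_lin a b (c : R) u u' v v' : sq u -> sq u' ->
  is_wderiv Om a b u v -> is_wderiv Om a b u' v' ->
  is_wderiv Om a b (fun z => u z + c * u' z) (fun z => v z + c * v' z).
Proof.
move=> su su' [/inLpP sv h] [/inLpP sv' h']; split.
  by apply/inLpP; apply: (sqintD mO sv); exact: (sqintZ mO).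
move=> phi tp; have sp := test_sq tp; have sd := test_sq (test_Dxy a b tp).
have E (p q r : R * R -> R) : sq p -> sq q -> sq r ->
    I2 (fun z => (p z + c * q z) * r z) = I2 (fun z => p z * r z) + c * I2 (fun z => q z * r z).
  move=> sp' sq' sr; have i1 := sqintM mO sp' sr; have i2 := sqintM mO sq' sr.
  rewrite -(IZ mO c i2) -(ID mO i1 (ItgZ mO c i2)).
  by apply: eq_I => z _; rewrite mulrDl mulrA.
by rewrite (E _ _ _ su su' sd) (E _ _ _ sv sv' sp) h// h'// mulrDr [c * (_ * _)]mulrCA.
Qed.

Lemma is_wderiv_ael a b u u' v : sq u -> sq u' -> {ae leb2, forall z, Om z -> u z = u' z} ->
  is_wderiv Om a b u v -> is_wderiv Om a b u' v.
Proof.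
move=> su su' uu' [sv h]; split => // phi tp; rewrite -h//.
have sd := test_sq (test_Dxy a b tp).
apply: (ae_eq_I mO (Itg_meas (sqintM mO su' sd)) (Itg_meas (sqintM mO su sd))).
by apply: (@filterS _ _ Fae _ _ _ uu') => z + Oz => /(_ Oz) ->.
Qed.

Lemma is_wderiv_smooth a b phi : smooth2 phi -> is_wderiv Om a b phi (Dxy a b phi).
Proof.
move=> sp; elim: a => [|a IH].
  elim: b => [|b IH]; first exact: is_wderiv00 (sq_smooth L1 L2 sp).
  exact: is_wderiv_dy IH (wd_smooth hL1 hL2 true (smooth2_Dxy 0 b sp)).
exact: is_wderiv_dx IH (wd_smooth hL1 hL2 false (smooth2_Dxy a b sp)).
Qed.

Lemma Hs_wderiv k C u a b : Hs k C u -> (a + b <= k)%N ->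
  is_wderiv Om a b u (wderiv Om a b u) /\ sn (wderiv Om a b u) <= C.
Proof.
move=> hu ab; have [v [uv hv]] := Hs_is_wderiv hu ab; have uw := wderivP uv; split => //.
have vw := is_wderiv_ae (Hs_sq hu) uv uw.
by rewrite -(sqn_ae mO (is_wderiv_sq uv).1 (is_wderiv_sq uw).1 vw) (Hs_sn hv).
Qed.

(** The definition of transport involves [lam] and its selected derivative; both are changed on a
    null set into the Lipschitz representative [p] and its companion [px]. *)
Lemma is_transport_tw lam p px u f : sq u -> measurable_fun Om (lam : RR -> R) ->
  sq p -> (forall phi, test phi -> sq (fun z => p z * dx phi z + px z * phi z + 1 * dy phi z)) ->
  sq lam -> {ae leb2, forall z, Om z -> lam z = p z} -> wd false lam px ->
  is_transport Om lam u f <-> tw L1 L2 p px 1 u f.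
Proof.
move=> su ml sp sD sl lp wl.
have w1 : is_wderiv Om 1 0 lam px by exact/is_wderiv10.
have w2 := wderivP w1; have e := is_wderiv_ae sl w2 w1.
have E phi : test phi ->
    I2 (fun z => u z * (lam z * dx phi z + wderiv Om 1 0 lam z * phi z + dy phi z)) =
    I2 (fun z => u z * (p z * dx phi z + px z * phi z + 1 * dy phi z)).
  move=> tp; have m3 := sD _ tp.
  apply: (ae_eq_I mO); [|exact: Itg_meas (sqintM mO su m3)|].
    apply: measurable_funM; first exact: su.1.
    apply: measurable_funD; last exact: (test_sq (test_dy tp)).1.
    apply: measurable_funD; apply: measurable_funM => //.
    - exact: (test_sq (test_dx tp)).1.
    - exact: (is_wderiv_sq w2).1.
    - exact: (test_sq tp).1.
  by apply: (@filterS2 _ _ Fae _ _ _ _ lp e) => z + + Oz => /(_ Oz) -> /(_ Oz) ->; rewrite mul1r.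
split=> -[sf h]; split; first exact/inLpP.
- by move=> phi tp; rewrite h// E.
- exact/inLpP.
by move=> phi tp; rewrite h// E.
Qed.

Lemma positive_coef m lam : positive_condition L1 L2 m lam ->
  sq lam /\ exists K p pd, [/\ coef L1 L2 K p pd, {ae leb2, forall z, Om z -> lam z = p z},
    wd false lam (pd false) & mults L1 L2 pd m].
Proof.
move=> hlam; have [sl [lamd [wl [M M0 [hM hm]]]]] := positive_mult hL1 hL2 hlam.
split => //; case: hlam => ml [c0 [c1 [c00 c10 hc]]] _.
have hb : {ae leb2, forall z, Om z -> `|lam z| <= c1}.
  apply: (@filterS _ _ Fae _ _ _ hc) => z + Oz => /(_ Oz)/andP[h1 h2].
  by rewrite ger0_norm// (le_trans (ltW c00)).
have [K [K0 [p [lp lip pK mp]]]] := lip_rep sl (ltW c10) M0 hb wl hM.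
have KM : K <= K + M by rewrite lerDl.
have sp : sq p := sqint_bnd mO fO mp pK.
exists (K + M), p, lamd; split => //; split => //.
- exact: addr_ge0.
- by move=> z Oz; exact: le_trans (pK z Oz) KM.
- by move=> z w Oz Ow; apply: le_trans (lip z w Oz Ow) _; rewrite ler_wpM2r// addr_ge0.
move=> i; split; first exact: wd_ael sl sp lp (wl i).
apply: (@filterS _ _ Fae _ _ _ (hM i)) => z + Oz => /(_ Oz) h.
by apply: le_trans h _; rewrite lerDr.
Qed.

Section Approximation.
Variables (m : nat) (K : R) (p : R * R -> R) (pd : bool -> R * R -> R).
Hypotheses (hp : coef L1 L2 K p pd) (hm : mults L1 L2 pd m).
Notation tw := (tw L1 L2 p (pd false) 1).
Notation HX := (HX L1 L2 p pd 1).
Notation HT := (HT L1 L2 p pd 1).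

(** The vanishing traces are given for the selected derivatives of [theta], so the recursion carries
    the multi-index of the current derivative, and [trace_ae] transfers the trace to it. *)
Lemma HX_of theta C k a b u : sq theta ->
  (forall a b, (a + b <= m)%N -> trace0 (wderiv Om a b theta)) ->
  is_wderiv Om a b theta u -> (a + b + k <= m)%N -> Hs k C u -> HT k C u -> HX k C u.
Proof.
move=> st tr; elim: k a b u => [|k IH] a b u wu abk hs ht.
  all: have ab : (a + b <= m)%N by apply: leq_trans abk; exact: leq_addr.
  all: have ww := wderivP wu.
  all: have su := is_wderiv_sq wu.
  all: have tu : trace0 u by apply: (trace_ae (is_wderiv_sq ww) su _ (tr a b ab)); exact: is_wderiv_ae ww wu.
  all: case: (ht) => hg H.
  by split => //; split => //; exact: (Hs_sn hs).
split; first by split => //; exact: (Hs_sn hs).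
move=> i; have [v [wv hv]] := H i; exists v; split => //.
have hsv := Hs_wd hs wv.
case: i wv => wv.
  by apply: (IH a b.+1) => //; [exact: is_wderiv_dy wu wv|rewrite addnS addSnnS].
by apply: (IH a.+1 b) => //; [exact: is_wderiv_dx wu wv|rewrite addSn addSnnS].
Qed.

(** Embeds the space into a finite power of L^2: the flag selects derivatives of [phi] or of [g].
    Entries of order above [m] are zero, which allows a plain product of finite types as index. *)
Definition jets phi g (V : 'I_m.+1 * 'I_m.+1 * bool -> R * R -> R) := forall (a b : 'I_m.+1) i,
  if (a + b <= m)%N then is_wderiv Om a b (if i then g else phi) (V (a, b, i))
  else V (a, b, i) = (fun=> 0).

Let J := ('I_m.+1 * 'I_m.+1 * bool)%type.

Definition smooth_jet (V : J -> R * R -> R) := exists phi g, [/\ smooth2 phi, van phi, tw phi g & jets phi g V].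

Definition wjet phi g (j : J) : R * R -> R :=
  if (j.1.1 + j.1.2 <= m)%N then wderiv Om j.1.1 j.1.2 (if j.2 then g else phi) else (fun=> 0).

Lemma jets_sq phi g V : jets phi g V -> forall j, sq (V j).
Proof.
move=> h [[a b] i]; have := h a b i; case: ifP => _; first exact: is_wderiv_sq.
move=> ->; exact: (sq_smooth L1 L2 (smooth2_cst 0)).
Qed.

Lemma smooth_jet_lin V W (c : R) : smooth_jet V -> smooth_jet W ->
  smooth_jet (fun j z => V j z + c * W j z).
Proof.
move=> [phi [g [s1 [d1 d10 v1] t1 j1]]] [psi [h [s2 [d2 d20 v2] t2 j2]]].
have sp := sq_smooth L1 L2 s1; have ss := sq_smooth L1 L2 s2.
exists (fun z => phi z + c * psi z), (fun z => g z + c * h z); split.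
- exact: smooth2D s1 (smooth2Z c s2).
- exists (Num.min d1 d2); first by rewrite lt_min d10.
  by move=> z; rewrite !lt_min => hz; rewrite v1 ?v2 ?mulr0 ?addr0//; case: hz => /andP[h1 h2]; by [left|right].
- exact: (twD hp sp (sqintZ mO c ss) t1 (twZ hp c ss t2)).
move=> a b i; have := j1 a b i; have := j2 a b i; case: ifP => _.
  by case: i => w2 w1; apply: is_wderiv_lin => //; [exact: t1.1|exact: t2.1].
by move=> -> ->; apply/funext => z; rewrite mulr0 addr0.
Qed.

Lemma Xjet_dense theta f : sq theta -> inHm Om m theta -> tw theta f -> inHm Om m f ->
  (forall a b, (a + b <= m)%N -> trace0 (wderiv Om a b theta)) ->
  forall eps : R, 0 < eps -> exists V, smooth_jet V /\ \sum_j sn (fun z => wjet theta f j z - V j z) < eps.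
Proof.
move=> st /inHm_Hs[C1 h1] tf /inHm_Hs[C2 h2] tr eps eps0.
have C10 := Hs_ge0 h1; have C20 := Hs_ge0 h2.
pose C := C1 + C2.
have hth : Hs m C theta by apply: Hs_le h1; rewrite lerDl.
have hf : Hs m C f by apply: Hs_le h2; rewrite lerDr.
have [B1 B10 hB1] := Hs_HT 1 hp hm; have [B2 B20 hB2] := HT_Hs 1 hp hm.
have [B3 [B30 hB3]] := HX_mo hL1 hL2 1 hp.
have C0 : 0 <= C by exact: addr_ge0.
(* Covers at once the H^m bound on [theta] and the bounds on [T] of its derivatives provided by
   [Hs_HT]. *)
pose C' := C + B1 * C.
have hX : HX m C' theta.
  apply: (HX_of (a := 0) (b := 0) st tr (is_wderiv00 st)) => //.
    by apply: Hs_le hth; rewrite lerDl mulr_ge0.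
  by apply: HT_le (hB1 _ _ _ hth hf tf); rewrite lerDr.
pose C3 := B3 * C'.
have C30 : 0 <= C3 by rewrite mulr_ge0// addr_ge0// mulr_ge0.
pose phi n := mo (en n) theta.
have sphi n : smooth2 (phi n) by apply: smooth2_mo => //; exact: en_gt0.
have vphi n : van (phi n).
  have e0 : 0 < en n :> R := en_gt0 n; have k1 := ckern_mol e0.
  by exists (en n) => // z hz; exact: (conv0 _ _ _ k1 k1 hz).
(* [T] of the mollifications, with an H^m bound uniform in [n]: [HX_mo] bounds [T] of the
   derivatives and [HT_Hs] returns to derivatives of [T]. *)
have [g hg] : {g : nat -> R * R -> R & forall n, tw (phi n) (g n) /\ Hs m (B2 * C3) (g n)}.
  apply: (boolp.choice (P := fun n g => tw (phi n) g /\ Hs m (B2 * C3) g)) => n.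
  have [hs ht] := hB3 m C' theta (en n) (en_gt0 n) hX.
  have [g0 tg0] : exists g0, tw (phi n) g0.
    by case: (m) ht => [|?] [[g0 [tg0 _]] _]; exists g0.
  by exists g0; split => //; exact: hB2 hs ht tg0.
pose CC := C3 + B2 * C3.
have hphi n : Hs m CC (phi n).
  have [hs _] := hB3 m C' theta (en n) (en_gt0 n) hX.
  by apply: Hs_le hs; rewrite lerDl mulr_ge0.
have hgn n : Hs m CC (g n) by apply: Hs_le (hg n).2; rewrite lerDr.
pose Un n (j : J) := wjet (phi n) (g n) j.
have CC0 : 0 <= CC by rewrite addr_ge0// mulr_ge0.
have jU n : jets (phi n) (g n) (Un n).
  move=> a b i; case: ifP => ab; rewrite /Un /wjet /= ab //.
  by case: i; [exact: (Hs_wderiv (hgn n) ab).1|exact: (Hs_wderiv (hphi n) ab).1].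
have jT : jets theta f (wjet theta f).
  move=> a b i; case: ifP => ab; rewrite /wjet /= ab //.
  by case: i; [exact: (Hs_wderiv hf ab).1|exact: (Hs_wderiv hth ab).1].
have UC n j : sn (Un n j) <= CC.
  case: j => [[a b] i]; rewrite /Un /wjet /=; case: ifP => ab.
    by case: i; [exact: (Hs_wderiv (hgn n) ab).2|exact: (Hs_wderiv (hphi n) ab).2].
  rewrite (_ : sn _ = 0)//; transitivity (I2 (fun=> 0 : R)); last exact: (I0 leb2 mO).
  by apply: eq_I => z _; rewrite expr0n.
apply: (@jet_dense R L1 L2 J smooth_jet _ smooth_jet_lin (wjet theta f) Un (\sum_(j : J) CC)) => //.
- by move=> V [? [? [_ _ _ /jets_sq]]].
- exact: jets_sq jT.
- by move=> n; exists (phi n), (g n); split => //; exact: (hg n).1.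
- by move=> n; apply: ler_sum => j _; exact: UC.
move=> j; apply: (weak_of_dist (G := fun n => Un n j) (g := wjet theta f j) (C := CC)) => //.
- by move=> n; exact: jets_sq (jU n) j.
- exact: jets_sq jT j.
move=> psi tpsi; case: j => [[a b] i].
(* Convergence is tested on smooth functions only: [T] and the derivatives are moved onto them,
   which leaves the weak convergence of the mollifications of [theta]. *)
have dist : forall chi, test chi -> I2 (fun z => (if i then g n else phi n) z * chi z) @[n --> \oo] -->
    I2 (fun z => (if i then f else theta) z * chi z).
  move=> chi tc; case: i.
    have [s1 s2 s3] := tw_test 1 hp tc; have sD := sqintD mO (sqintD mO s1 s2) s3.
    rewrite (tf.2 _ tc); under eq_fun do rewrite ((hg _).1.2 _ tc).
    by apply: cvgN; exact: (weak_cvg sD st).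
  exact: (weak_cvg (test_sq tc) st).
have := dist _ (test_Dxy a b tpsi); have := jT a b i; case: ifPn => ab wT c.
  have s2 : (-1) ^+ (a + b) * (-1) ^+ (a + b) = 1 :> R by rewrite -expr2 sqrr_sign.
  have E u v : is_wderiv Om a b u v -> I2 (fun z => v z * psi z) = (-1) ^+ (a + b) * I2 (fun z => u z * Dxy a b psi z).
    by move=> [_ h]; rewrite h// mulrA s2 mul1r.
  rewrite (E _ _ wT).
  have En n : I2 (fun z => Un n (a, b, i) z * psi z) =
      (-1) ^+ (a + b) * I2 (fun z => (if i then g n else phi n) z * Dxy a b psi z).
    by apply: E; have := jU n a b i; rewrite ab.
  under eq_fun do rewrite En.
  by apply: cvgM; [exact: cvg_cst|exact: c].
have En n : Un n (a, b, i) = (fun=> 0) by have := jU n a b i; rewrite (negbTE ab).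
by rewrite wT; under eq_fun do rewrite En; exact: cvg_cst.
Qed.

End Approximation.

Lemma Hmnorm_sqr m u (F : nat -> nat -> R) :
  (forall a b, (a + b <= m)%N -> L2norm Om (wderiv Om a b u) ^+ 2 = F a b) ->
  (forall a b, (m < a + b)%N -> F a b = 0) ->
  Hmnorm Om m u ^+ 2 = \sum_(a < m.+1) \sum_(b < m.+1) F a b.
Proof.
move=> h1 h2; rewrite /Hmnorm sqr_sqrtr; last first.
  by apply: sumr_ge0 => a _; apply: sumr_ge0 => b _; exact: sqr_ge0.
apply: eq_bigr => a _; rewrite big_mkcond; apply: eq_bigr => b _ /=.
by case: leqP => ab; [exact: h1|rewrite h2].
Qed.

End Main.

Theorem theorem2p2 (R : realType) (L1 L2 : R) (hL1 : 0 < L1) (hL2 : 0 < L2)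
    (m : nat) (lam : R * R -> R) (hlam : positive_condition L1 L2 m lam) :
  forall theta : R * R -> R, XGamma L1 L2 m lam theta ->
  forall eps : R, 0 < eps ->
  exists phi : R * R -> R,
    [/\ VGamma L1 L2 phi, XGamma L1 L2 m lam phi &
        Xnorm L1 L2 m lam (theta \- phi) < eps].
Proof.
move=> theta [hth [f [tf hf]] tr] eps eps0.
have mO := Om_meas L1 L2.
have [sl [K [p [pd [hp lp wl hm]]]]] := positive_coef hL1 hL2 hlam.
have st : sqint leb2 (Omega L1 L2) theta by case: hth => /inLpP.
have ml : measurable_fun (Omega L1 L2) lam by case: hlam.
have TE u g : sqint leb2 (Omega L1 L2) u ->
    is_transport (Omega L1 L2) lam u g <-> tw L1 L2 p (pd false) 1 u g.
  move=> su; apply: (is_transport_tw g su ml (coef_sq hp) _ sl lp wl) => phi tp.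
  by have [s1 s2 s3] := tw_test 1 hp tp; exact: (sqintD mO (sqintD mO s1 s2) s3).
move/(TE _ _ st) : tf => tf.
(* By uniqueness of weak derivatives the sum of the squared distances between the jets will be
   exactly the squared [Xnorm] of the difference, hence [eps ^+ 2]. *)
have [V [[phi [g [sp vp tg jV]]] hV]] := Xjet_dense hL1 hL2 hp hm st hth tf hf tr (exprn_gt0 2 eps0).
have spq := sq_smooth L1 L2 sp.
have wV a b i : (a + b <= m)%N -> exists v, is_wderiv (Omega L1 L2) a b (if i then g else phi) v.
  move=> ab; have a1 : (a < m.+1)%N by rewrite ltnS (leq_trans _ ab)// leq_addr.
  have b1 : (b < m.+1)%N by rewrite ltnS (leq_trans _ ab)// leq_addl.
  by have := jV (Ordinal a1) (Ordinal b1) i; rewrite /= ab => h; exists (V (Ordinal a1, Ordinal b1, i)).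
exists phi; split; first exact: VGamma_van.
  split.
  - by split; [exact/inLpP|move=> a b /(wV _ _ false)].
  - exists g; split; first exact/TE.
    by split; [exact/inLpP/tg.1|move=> a b /(wV _ _ true)].
  move=> a b ab; have ws := is_wderiv_smooth hL1 hL2 a b sp; have ww := wderivP ws.
  apply: (trace_ae (is_wderiv_sq ws) (is_wderiv_sq ww)).
    exact: (is_wderiv_ae spq ws ww).
  by apply: (trace_van hL1 hL2); [exact: smooth2_Dxy|exact: van_Dxy].
have E0 u v : (fun z => u z + -1 * v z) = u \- v :> (R * R -> R).
  by apply/funext => z; rewrite mulN1r.
have sd : sqint leb2 (Omega L1 L2) (theta \- phi) := sqintB mO st spq.
have td : tw L1 L2 p (pd false) 1 (theta \- phi) (f \- g).
  have := twD hp st (sqintZ mO (-1) spq) tf (twZ hp (-1) spq tg).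
  by rewrite !E0.
have sfg : sqint leb2 (Omega L1 L2) (f \- g) := td.1.
(* [transport] is a selection with a junk default; the existence of [f - g] makes it a genuine
   value, equal to [f - g] almost everywhere. *)
have th : is_transport (Omega L1 L2) lam (theta \- phi) (transport (Omega L1 L2) lam (theta \- phi)).
  by have /(TE _ _ sd) td' := td; exact: (xgetPex _ (ex_intro _ _ td')).
set h := transport _ _ _ in th *.
have [sh hfg] : sqint leb2 (Omega L1 L2) h /\ {ae leb2, forall z, Omega L1 L2 z -> (f \- g) z = h z}.
  have th' := (TE _ _ sd).1 th; split; first exact: th'.1.
  exact: (tw_uniq td th').
(* Indexed by natural numbers to fit [Hmnorm_sqr]; the default 0 out of range agrees with the zero
   entries of the jets beyond order [m]. *)
pose F (i : bool) (a b : nat) : R := if insub a is Some a' then if insub b is Some b' then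
  sqn leb2 (Omega L1 L2) (fun z => wjet L1 L2 theta f (a' : 'I_m.+1, b' : 'I_m.+1, i) z - V (a', b', i) z) else 0 else 0.
have FE i (a b : 'I_m.+1) : F i a b =
    sqn leb2 (Omega L1 L2) (fun z => wjet L1 L2 theta f (a, b, i) z - V (a, b, i) z).
  by rewrite /F !valK.
have F0 i a b : (m < a + b)%N -> F i a b = 0.
  move=> ab; rewrite /F; case: insubP => // a' _ ea; case: insubP => // b' _ eb.
  have := jV a' b' i; rewrite ea eb leqNgt ab /= => ->.
  rewrite /wjet /= ea eb leqNgt ab /=.
  transitivity (\int[leb2]_(z in Omega L1 L2) (0 : R)); last exact: (I0 leb2 mO).
  by apply: eq_I => z _; rewrite subrr expr0n.
have F1 i a b : (a + b <= m)%N -> L2norm (Omega L1 L2) (wderiv (Omega L1 L2) a b (if i then h else theta \- phi)) ^+ 2 = F i a b.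
  move=> ab; have a1 : (a < m.+1)%N by rewrite ltnS (leq_trans _ ab)// leq_addr.
  have b1 : (b < m.+1)%N by rewrite ltnS (leq_trans _ ab)// leq_addl.
  have := jV (Ordinal a1) (Ordinal b1) i; rewrite /= ab => w1.
  have -> : F i a b = F i (Ordinal a1) (Ordinal b1) by [].
  rewrite FE /wjet /= ab.
  have w2 : is_wderiv (Omega L1 L2) a b (if i then f else theta) (wderiv (Omega L1 L2) a b (if i then f else theta)).
    by case: (i); [have [v hv] := hf.2 a b ab; exact: wderivP hv|have [v hv] := hth.2 a b ab; exact: wderivP hv].
  have w3 : is_wderiv (Omega L1 L2) a b (if i then h else theta \- phi)
      (wderiv (Omega L1 L2) a b (if i then f else theta) \- V (Ordinal a1, Ordinal b1, i)).
    case: i w1 w2 => w1 w2.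
      have := is_wderiv_lin (-1) tf.1 tg.1 w2 w1; rewrite !E0; exact: is_wderiv_ael sfg sh hfg.
    by have := is_wderiv_lin (-1) st spq w2 w1; rewrite !E0.
  have su : sqint leb2 (Omega L1 L2) (if i then h else theta \- phi) by case: (i).
  have w4 := wderivP w3.
  rewrite (L2norm_sqr (is_wderiv_sq w4)).
  exact: (sqn_ae mO (is_wderiv_sq w4).1 (is_wderiv_sq w3).1 (is_wderiv_ae su w4 w3)).
rewrite /Xnorm -/h (Hmnorm_sqr (F1 false) (F0 false)) (Hmnorm_sqr (F1 true) (F0 true)).
rewrite -(ger0_norm (ltW eps0)) -sqrtr_sqr ltr_sqrt ?exprn_gt0//.
apply: le_lt_trans hV; rewrite le_eqVlt; apply/orP; left; apply/eqP.
pose G (j : 'I_m.+1 * 'I_m.+1 * bool) :=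
  sqn leb2 (Omega L1 L2) (fun z => wjet L1 L2 theta f j z - V j z).
have e1 : \sum_(ab : 'I_m.+1 * 'I_m.+1) \sum_(i : bool) G (ab, i) = \sum_j G j.
  by rewrite (pair_bigA _ (fun ab i => G (ab, i))); apply: eq_bigr => -[ab i] _.
have e2 : \sum_(a < m.+1) \sum_(b < m.+1) \sum_(i : bool) G (a, b, i) =
    \sum_(ab : 'I_m.+1 * 'I_m.+1) \sum_(i : bool) G (ab, i).
  rewrite (pair_bigA _ (fun a b => \sum_(i : bool) G (a, b, i))).
  by apply: eq_bigr => -[a b] _.
rewrite -[RHS]e1 -e2 -big_split; apply: eq_bigr => a _; rewrite -big_split; apply: eq_bigr => b _.
by rewrite big_bool /= !FE addrC.
Qed.
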